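(* Given $\delta>0$, let $\Omega$ be the bounded Lipschitz domain provided by $(V_2)$ for this $\delta$, and let $g$ be the associated truncated nonlinearity (see context). Then there exists $\bar\varepsilon_\delta>0$ such that for every $\varepsilon\in(0,\bar\varepsilon_\delta)$ the problem \[ M\Big(\iint_{\mathbb{R}^6}\frac{|u(x)-u(y)|^2}{|x-y|^{3+2s}}dxdy+\int_{\mathbb{R}^3}V(\varepsilon x)u^2dx\Big)\big[(-\Delta)^su+V(\varepsilon x)u\big]=g(\varepsilon x,u)\quad\text{in }\mathbb{R}^3 \] has at least $\mathrm{cat}_{\Lambda_\delta}(\Lambda)$ positive solutions.
   Context: $s\in(\frac34,1)$, $(-\Delta)^s$ the fractional Laplacian; solutions are weak solutions in $H^s(\mathbb{R}^3)$. $M:[0,\infty)\to[0,\infty)$ continuous with $(M_1)$ $M(t)\ge m_0>0$; $(M_2)$ $M$ increasing; $(M_3)$ $\frac{M(t_1)}{t_1}-\frac{M(t_2)}{t_2}\le m_0(\frac1{t_1}-\frac1{t_2})$ for $t_1\ge t_2>0$. $V\in C(\mathbb{R}^3,\mathbb{R})$ with $(V_1)$ $V_0:=\inf V>0$; $(V_2)$ for each $\delta>0$ there is a bounded Lipschitz domain $\Omega\subset\mathbb{R}^3$ with $V_0<\min_{\partial\Omega}V$, $\Lambda:=\{x\in\Omega:V(x)=V_0\}\ne\emptyset$ and $\Lambda_\delta:=\{x:\mathrm{dist}(x,\Lambda)\le\delta\}\subset\Omega$. $f:\mathbb{R}\to\mathbb{R}$ continuous, $f=0$ on $(-\infty,0)$,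 $F(t)=\int_0^tf$, with $(f_1)$ $f(t)/t^3\to0$ ($t\to0^+$); $(f_2)$ $f(t)/t^{q-1}\to0$ ($t\to\infty$), some $q\in(4,\frac6{3-2s})$; $(f_3)$ $0<\vartheta F(t)\le f(t)t$ for $t>0$, some $\vartheta\in(4,\frac6{3-2s})$; $(f_4)$ $f(t)/t^3$ nondecreasing on $(0,\infty)$. Truncation: fix $K>2/m_0$ and $a>0$ with $f(a)=V_0a/K$; $\tilde f(t)=f(t)$ for $t\le a$, $\tilde f(t)=V_0t/K$ for $t>a$; $g(x,t)=\chi_\Omega(x)f(t)+(1-\chi_\Omega(x))\tilde f(t)$. $\mathrm{cat}_X(Y)$ denotes the Ljusternik–Schnirelmann category of $Y$ in $X$ (least number of closed sets contractible in $X$ covering $Y$). *)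

(* Defs.v *)
From mathcomp Require Import all_boot all_order all_algebra.
From mathcomp Require Import all_classical all_reals all_analysis.
Import Order.TTheory GRing.Theory Num.Theory numFieldNormedType.Exports.
Local Open Scope classical_set_scope.
Local Open Scope ring_scope.

Set Implicit Arguments.
Unset Strict Implicit.
Unset Printing Implicit Defensive.

Section Defs.
Variable R : realType.

Definition pt := (R * R * R)%type.
Definition pzero : pt := (0, 0, 0).
Definition psub (x y : pt) : pt := (x.1.1 - y.1.1, x.1.2 - y.1.2, x.2 - y.2).
Definition pscale (e : R) (x : pt) : pt := (e * x.1.1, e * x.1.2, e * x.2).
Definition enorm (x : pt) : R := Num.sqrt (x.1.1 ^+ 2 + x.1.2 ^+ 2 + x.2 ^+ 2).

Definition leb3 := ((@lebesgue_measure R \x @lebesgue_measure R)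
                      \x @lebesgue_measure R)%E.

Definition boundary (O : set pt) : set pt := closure O `\` interior O.
Definition bounded_pset (O : set pt) : Prop :=
  exists r : R, forall x, O x -> enorm x <= r.

(* bounded Lipschitz domain: nonempty bounded open connected set whose boundary
   is locally (after a rigid motion) the graph of a Lipschitz function,
   with the domain lying above the graph. *)
Definition lipschitz_domain (O : set pt) : Prop :=
  open O /\ connected O /\ O !=set0 /\ bounded_pset O /\
  forall p, boundary O p ->
    exists r : R, 0 < r /\
    exists Q : pt -> pt,
      (forall x y, enorm (psub (Q x) (Q y)) = enorm (psub x y)) /\
      Q pzero = pzero /\
    exists (gam : R -> R -> R) (L : R),
      (forall a b c d, `|gam a b - gam c d| <= L * Num.sqrt ((a - c) ^+ 2 + (b - d) ^+ 2)) /\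
      forall x, enorm (psub x p) < r ->
        (O x <-> gam (Q (psub x p)).1.1 (Q (psub x p)).1.2 < (Q (psub x p)).2).

Definition Vinf (V : pt -> R) : R := inf (range V).
Definition Lam (V : pt -> R) (O : set pt) : set pt := [set x | O x /\ V x = Vinf V].
Definition dist_to (A : set pt) (x : pt) : R := inf [set enorm (psub x y) | y in A].
Definition Lam_delta (V : pt -> R) (O : set pt) (d : R) : set pt :=
  [set x | dist_to (Lam V O) x <= d].

Definition V2_domain (V : pt -> R) (d : R) (O : set pt) : Prop :=
  lipschitz_domain O /\ (forall x, boundary O x -> Vinf V < V x) /\
  Lam V O !=set0 /\ Lam_delta V O d `<=` O.

Definition contractible_in (X A : set pt) : Prop :=
  exists (H : R * pt -> pt) (x0 : pt),
    X x0 /\ {within `[0, 1]%classic `*` A, continuous H} /\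
    (forall a, A a -> H (0, a) = a /\ H (1, a) = x0) /\
    (forall t a, `[0, 1]%classic t -> A a -> X (H (t, a))).

Definition cat_ge (X Y : set pt) (n : nat) : Prop :=
  forall (k : nat) (C : 'I_k -> set pt),
    (forall i, closed (C i) /\ C i `<=` X /\ contractible_in X (C i)) ->
    Y `<=` [set x | exists i, C i x] -> (n <= k)%N.

Definition primitive (f : R -> R) (t : R) : R :=
  Rintegral (@lebesgue_measure R) `[0, t] f.
Definition ftilde (f : R -> R) (V0 K a : R) (t : R) : R :=
  if t <= a then f t else V0 * t / K.
Definition gtrunc (O : set pt) (f : R -> R) (V0 K a : R) (x : pt) (t : R) : R :=
  \1_O x * f t + (1 - \1_O x) * ftilde f V0 K a t.

Definition gag_kernel (s : R) (x y : pt) : R := (enorm (psub x y)) `^ (3 + 2 * s).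

Definition in_Heps (s eps : R) (V : pt -> R) (u : pt -> R) : Prop :=
  measurable_fun setT u /\
  (\int[leb3]_x ((u x) ^+ 2)%:E < +oo)%E /\
  (\int[leb3]_x \int[leb3]_y (((u x - u y) ^+ 2) / gag_kernel s x y)%:E < +oo)%E /\
  (\int[leb3]_x (V (pscale eps x) * (u x) ^+ 2)%:E < +oo)%E.

Definition energy (s eps : R) (V : pt -> R) (u : pt -> R) : R :=
  Rintegral leb3 setT (fun x => Rintegral leb3 setT
      (fun y => (u x - u y) ^+ 2 / gag_kernel s x y)) +
  Rintegral leb3 setT (fun x => V (pscale eps x) * (u x) ^+ 2).

Definition bilin (s eps : R) (V : pt -> R) (u phi : pt -> R) : R :=
  Rintegral leb3 setT (fun x => Rintegral leb3 setT
      (fun y => (u x - u y) * (phi x - phi y) / gag_kernel s x y)) +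
  Rintegral leb3 setT (fun x => V (pscale eps x) * u x * phi x).

(* weak solution in H_eps of
   M(energy u) [(-Delta)^s u + V(eps x) u] = g(eps x, u) in R^3 *)
Definition weak_solution (s eps : R) (M : R -> R) (V : pt -> R)
    (g : pt -> R -> R) (u : pt -> R) : Prop :=
  in_Heps s eps V u /\
  forall phi, in_Heps s eps V phi ->
    M (energy s eps V u) * bilin s eps V u phi =
    Rintegral leb3 setT (fun x => g (pscale eps x) (u x) * phi x).

End Defs.

(* Main.v *)
Require Import Defs.
From HB Require Import structures.
From mathcomp Require Import all_boot all_order all_algebra.
From mathcomp Require Import all_classical all_reals all_analysis.
From mathcomp Require Import measurable_realfun ring lra.
Import Order.TTheory GRing.Theory Num.Theory numFieldNormedType.Exports.
Local Open Scope classical_set_scope.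
Local Open Scope ring_scope.

Set Implicit Arguments.
Unset Strict Implicit.
Unset Printing Implicit Defensive.

(** Solutions are critical points of J(u) = Mhat(N(u)) / 2 - int G(eps x, u),
    where N is the squared norm and Mhat, G are primitives.  By (M_3), (f_4) and
    the truncation, the derivative of J along each ray divided by t^3 is
    quantitatively decreasing, so the Nehari set {u <> 0 : J'(u) u = 0} meets
    each ray at most once and J is descended on it by normalized gradient steps.
    A function on the Nehari set with energy close to the level c0 of the
    autonomous limit problem (V = V_0, no truncation) cannot split into two
    separated pieces, hence sits near one point, and its barycenter lies near
    Lambda when eps is small.  Conversely, translating a compactly supported
    near-minimizer of the limit problem maps Lambda continuously into a low
    sublevel, and the composition with the barycenter is homotopic to the
    identity in Lambda_delta.  If only k critical points lie below the level,
    deforming the image of Lambda downwards past each of them covers Lambda by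
    k closed sets contractible in Lambda_delta.  Nonzero critical points
    are positive almost everywhere because the fractional Laplacian is nonlocal. *)

(** * Integration of real-valued functions *)

(** [f] and [M] are only continuous, so the gradient of [J] is merely continuous and the Nehari set
    need not be a manifold. A flow is therefore replaced by discrete steps followed by a radial
    projection, whose existence and continuity come from the ray condition and the intermediate
    value theorem. The factor [M] sees the norm of the whole function: a weak limit of approximate
    solutions need not solve the equation with the same coefficient. Splitting is done with explicit
    cutoffs instead of limit profiles, and the superadditivity of [t M(t)] and of its primitive puts
    the interaction of the two pieces on the favourable side. The thresholds must not depend on the
    parameter eps, so the estimates are uniform over all weights bounded below by [V_0] and all
    measurable domains. The condition [s > 3/4] says that the critical exponent [6 / (3 - 2 s)]
    exceeds [4], the homogeneity at which the Kirchhoff term competes with [F]. The condition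
    [K > 2 / m0] lets [m0] times the squared norm absorb the truncated nonlinearity off the domain,
    which gives coercivity and compactness. *)

Section ProductSigmaFinite.
Context d1 d2 (T1 : measurableType d1) (T2 : measurableType d2) (R : realType).
Variable m1 : {sigma_finite_measure set T1 -> \bar R}.
Variable m2 : {sigma_finite_measure set T2 -> \bar R}.

Lemma product_sigma_finite : sigma_finite setT (m1 \x m2)%E.
Proof.
have /sigma_finiteP[F [TF ndF Foo]] := sigma_finiteT m1.
have /sigma_finiteP[G [TG ndG Goo]] := sigma_finiteT m2.
exists (fun n => F n `*` G n).
  rewrite -setXTT TF TG predeqE => -[x y]; split.
    move=> [/= [n _ Fnx] [k _ Gky]]; exists (maxn n k) => //; split.
      by move: x Fnx; exact/subsetPset/ndF/leq_maxl.
    by move: y Gky; exact/subsetPset/ndG/leq_maxr.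
  by move=> [n _ []/= ? ?]; split; exists n.
move=> k; have [? ?] := Foo k; have [? ?] := Goo k.
split; first exact: measurableX.
by rewrite product_measure1E// lte_mul_pinfty// ge0_fin_numE.
Qed.
End ProductSigmaFinite.

Section Leb.
Variable R : realType.
Notation RR := (measurableTypeR R).

(** The triple product is rebuilt in stages so that each stage carries the measure and
    sigma-finiteness structures that Tonelli's theorem asks for. [mu3] is convertible to [leb3]. *)
Definition mu2 : set (RR * RR)%type -> \bar R :=
  (@lebesgue_measure R \x @lebesgue_measure R)%E.
HB.instance Definition _ := Measure.on mu2.
HB.instance Definition _ := @Measure_isSigmaFinite.Build _ _ _ mu2
  (product_sigma_finite (@lebesgue_measure R) (@lebesgue_measure R)).

Definition mu3_fun : set (RR * RR * RR)%type -> \bar R := (mu2 \x @lebesgue_measure R)%E.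
HB.instance Definition _ := Measure.on mu3_fun.
HB.instance Definition _ := @Measure_isSigmaFinite.Build _ _ _ mu3_fun
  (product_sigma_finite mu2 (@lebesgue_measure R)).
Definition mu3 : {sigma_finite_measure set (RR * RR * RR)%type -> \bar R} := mu3_fun.

Lemma ae_leb3 P : {ae mu3, forall x, P x} -> {ae @leb3 R, forall x, P x}.
Proof. by []. Qed.
End Leb.

Section RealIntegral.
Context d (T : measurableType d) (R : realType) (mu : {measure set T -> \bar R}).
Implicit Types f g h : T -> R.

Definition L1 f := mu.-integrable setT (EFin \o f).
Definition Int f := Rintegral mu setT f.

Lemma L1_meas f : L1 f -> measurable_fun setT f.
Proof. by move=> /integrableP[/measurable_EFinP]. Qed.

Lemma mEFin f : measurable_fun setT f -> measurable_fun setT (fun x => (f x)%:E).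
Proof. by move=> mf; apply: measurableT_comp. Qed.

Lemma L1_EFin f : L1 f -> (\int[mu]_x (f x)%:E)%E = (Int f)%:E.
Proof. by move=> Lf; rewrite fineK//; exact: integrable_fin_num. Qed.

Lemma eq_Int f g : (forall x, f x = g x) -> Int f = Int g.
Proof. by move=> fg; congr Int; exact/funext. Qed.

Lemma L1_dom f g : measurable_fun setT f -> L1 g -> (forall x, `|f x| <= g x) -> L1 f.
Proof.
move=> mf Lg fg; apply: le_integrable Lg => //; first exact: mEFin.
by move=> x _ /=; rewrite lee_fin (le_trans (fg x))// ler_norm.
Qed.

Lemma L1_0 : L1 (fun=> 0). Proof. exact: integrable0. Qed.

Lemma L1D f g : L1 f -> L1 g -> L1 (fun x => f x + g x).
Proof. by move=> Lf Lg; have := integrableD measurableT Lf Lg. Qed.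

Lemma L1B f g : L1 f -> L1 g -> L1 (fun x => f x - g x).
Proof. by move=> Lf Lg; have := integrableB measurableT Lf Lg. Qed.

Lemma L1Z k f : L1 f -> L1 (fun x => k * f x).
Proof. by move=> Lf; have := integrableZl measurableT k Lf. Qed.

Lemma L1_abs f : L1 f -> L1 (fun x => `|f x|).
Proof. by move=> Lf; have := integrable_abse Lf. Qed.

Lemma eq_L1 f g : (forall x, f x = g x) -> L1 f -> L1 g.
Proof. by move=> fg; rewrite (_ : g = f)//; apply/funext => x; rewrite fg. Qed.

Lemma IntD f g : L1 f -> L1 g -> Int (fun x => f x + g x) = Int f + Int g.
Proof. exact: RintegralD. Qed.

Lemma IntB f g : L1 f -> L1 g -> Int (fun x => f x - g x) = Int f - Int g.
Proof. exact: RintegralB. Qed.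

Lemma IntZ k f : L1 f -> Int (fun x => k * f x) = k * Int f.
Proof. by move=> Lf; exact: RintegralZl. Qed.

Lemma Int0 : Int (fun=> 0) = 0.
Proof. by rewrite /Int /Rintegral integral0. Qed.

Lemma Int_ge0 f : (forall x, 0 <= f x) -> 0 <= Int f.
Proof. by move=> f0; exact: Rintegral_ge0. Qed.

Lemma Int_le f g : L1 f -> L1 g -> (forall x, f x <= g x) -> Int f <= Int g.
Proof. by move=> Lf Lg fg; apply: le_Rintegral. Qed.

Lemma Int_abs f : L1 f -> `|Int f| <= Int (fun x => `|f x|).
Proof. by move=> Lf; exact: le_normr_Rintegral. Qed.

Lemma Int_abs_le f g : L1 f -> L1 g -> (forall x, `|f x| <= g x) -> `|Int f| <= Int g.
Proof.
by move=> Lf Lg fg; apply: le_trans (Int_abs Lf) _; apply: Int_le => //; exact: L1_abs.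
Qed.

Lemma L1_sum (I : Type) (s : seq I) (F : I -> T -> R) :
  (forall i, L1 (F i)) -> L1 (fun x => \sum_(i <- s) F i x).
Proof.
move=> LF; elim: s => [|i s IH].
  by apply: eq_L1 L1_0 => x; rewrite big_nil.
by apply: eq_L1 (L1D (LF i) IH) => x; rewrite big_cons.
Qed.

Lemma Int_sum (I : Type) (s : seq I) (F : I -> T -> R) :
  (forall i, L1 (F i)) -> Int (fun x => \sum_(i <- s) F i x) = \sum_(i <- s) Int (F i).
Proof.
move=> LF; elim: s => [|i s IH].
  by rewrite big_nil -[RHS]Int0; apply: eq_Int => x; rewrite big_nil.
rewrite big_cons -IH -IntD//; last exact: L1_sum.
by apply: eq_Int => x; rewrite big_cons.
Qed.

Lemma L1_fin f : measurable_fun setT f -> (forall x, 0 <= f x) ->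
  (\int[mu]_x (f x)%:E < +oo)%E -> L1 f.
Proof.
move=> mf f0 fin; apply/integrableP; split; first exact: mEFin.
by under eq_integral => x _ do rewrite /= ger0_norm//.
Qed.

Lemma L1_finP f : (forall x, 0 <= f x) -> L1 f -> (\int[mu]_x (f x)%:E < +oo)%E.
Proof. by move=> f0 Lf; rewrite L1_EFin// ltry. Qed.

(** Bounds through the Gagliardo density hold only at points whose slice is integrable, so the
    comparison is almost everywhere and must deliver the integrability of [f] as well. *)
Lemma ae_Int_ge0 f g : (forall x, 0 <= f x) -> measurable_fun setT f -> L1 g ->
  {ae mu, forall x, f x <= g x} -> L1 f /\ Int f <= Int g.
Proof.
move=> f0 mf Lg fg.
have H : (\int[mu]_x (f x)%:E <= \int[mu]_x (`|g x|)%:E)%E.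
  apply: ae_ge0_le_integral => //.
  - by move=> *; rewrite lee_fin.
  - exact: mEFin.
  - by apply: mEFin; exact: L1_meas (L1_abs Lg).
  - by apply: filterS fg => x fgx _; rewrite lee_fin (le_trans fgx)// ler_norm.
have Lf : L1 f.
  by apply: L1_fin => //; apply: le_lt_trans H _; rewrite L1_EFin ?ltry//; exact: L1_abs.
split=> //; rewrite -lee_fin -!L1_EFin//.
have -> : (\int[mu]_x (g x)%:E = \int[mu]_x (`|g x|)%:E)%E.
  apply: ae_eq_integral => //.
  - by apply: mEFin; exact: L1_meas.
  - by apply: mEFin; exact: L1_meas (L1_abs Lg).
  - by apply: filterS fg => x fgx _; rewrite ger0_norm// (le_trans _ fgx).
by [].
Qed.

Lemma ae_Int_eq f g : L1 f -> measurable_fun setT g ->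
  {ae mu, forall x, f x = g x} -> L1 g /\ Int g = Int f.
Proof.
move=> Lf mg fg.
have Lg : L1 g.
  have [] : L1 (fun x => `|g x|) /\ Int (fun x => `|g x|) <= Int (fun x => `|f x|).
    apply: ae_Int_ge0 => //; [exact: measurableT_comp|exact: L1_abs|].
    by apply: filterS fg => x ->.
  by move=> Lg _; exact: (L1_dom mg Lg).
split=> //; apply: EFin_inj; rewrite -!L1_EFin//; apply: ae_eq_integral => //.
- exact: (measurable_int mu Lg).
- exact: (measurable_int mu Lf).
- by apply: filterS fg => x ->.
Qed.

Lemma Int_eq0 f : L1 f -> (forall x, 0 <= f x) -> Int f = 0 -> {ae mu, forall x, f x = 0}.
Proof.
move=> Lf f0 I0.
have : (\int[mu]_x `|(EFin \o f) x| = 0)%E.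
  under eq_integral => x _ do rewrite /= ger0_norm//.
  by rewrite L1_EFin// I0.
move/(ae_eq_integral_abs mu measurableT (mEFin (L1_meas Lf))).
by apply: filterS => x /(_ Logic.I) [].
Qed.

Lemma aeS (P Q : T -> Prop) : (forall x, P x -> Q x) ->
  {ae mu, forall x, P x} -> {ae mu, forall x, Q x}.
Proof. by move=> PQ; apply: filterS. Qed.

Lemma aeI (P Q : T -> Prop) : {ae mu, forall x, P x} -> {ae mu, forall x, Q x} ->
  {ae mu, forall x, P x /\ Q x}.
Proof. exact: filterI. Qed.

End RealIntegral.

(** * Semidefinite forms and weak limits *)

Section PreHilbert.
Variables (R : realType) (H : lmodType R) (B : H -> H -> R).

(** Only semidefinite: functions equal almost everywhere are not identified, so a nonzero vector may
    have norm [0]. Equality of vectors is accordingly replaced by [nm (u - v) = 0]. *)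
Record psd_form : Prop := PsdForm {
  psdC : forall u v, B u v = B v u;
  psdD : forall u v w, B (u + v) w = B u w + B v w;
  psdZ : forall a u w, B (a *: u) w = a * B u w;
  psd_ge0 : forall u, 0 <= B u u }.

Hypothesis BP : psd_form.

Definition nm u := Num.sqrt (B u u).

Lemma psdDr u v w : B w (u + v) = B w u + B w v.
Proof. by rewrite psdC// psdD// !(psdC BP w). Qed.
Lemma psdZr a u w : B w (a *: u) = a * B w u.
Proof. by rewrite psdC// psdZ// (psdC BP w). Qed.
Lemma psdN u w : B (- u) w = - B u w.
Proof. by rewrite -scaleN1r psdZ// mulN1r. Qed.
Lemma psdNr u w : B w (- u) = - B w u.
Proof. by rewrite -scaleN1r psdZr// mulN1r. Qed.
Lemma psdB u v w : B (u - v) w = B u w - B v w.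
Proof. by rewrite psdD// psdN. Qed.
Lemma psdBr u v w : B w (u - v) = B w u - B w v.
Proof. by rewrite psdDr// psdNr. Qed.
Lemma psd0 w : B 0 w = 0.
Proof. by rewrite -[X in B X _](scale0r 0) psdZ// mul0r. Qed.

Lemma nm_ge0 u : 0 <= nm u. Proof. exact: sqrtr_ge0. Qed.
Lemma nmE u : B u u = nm u ^+ 2. Proof. by rewrite sqr_sqrtr// psd_ge0. Qed.

Lemma nm_le u a : 0 <= a -> B u u <= a ^+ 2 -> nm u <= a.
Proof. by move=> a0 h; rewrite -(ger0_norm a0) -sqrtr_sqr ler_wsqrtr. Qed.

(** The degenerate case of Cauchy-Schwarz, where division by [B u u] is impossible: a nonzero
    [B u v] would make [B v v + t * B u v] negative for some [t]. *)
Lemma psd_eq0 u v : B u u = 0 -> B u v = 0.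
Proof.
move=> u0; have h t : 0 <= B v v + t * B u v.
  have := psd_ge0 BP (v + (t / 2) *: u).
  by rewrite psdD// !psdDr// psdZ// !psdZr// psdZ// u0 (psdC BP v u); lra.
have := h (- (B v v + 1) / B u v); have [->//|nz] := eqVneq (B u v) 0.
by rewrite divfK//; lra.
Qed.

Lemma psd_CS u v : `|B u v| <= nm u * nm v.
Proof.
have [u0|u0] := eqVneq (B u u) 0.
  by rewrite psd_eq0// normr0 mulr_ge0// nm_ge0.
have up : 0 < B u u by rewrite lt_neqAle eq_sym u0 psd_ge0.
have nu : 0 < nm u by rewrite sqrtr_gt0.
rewrite -[leRHS]ger0_norm ?mulr_ge0 ?nm_ge0// -ler_sqr ?nnegrE// !real_normK ?num_real//.
rewrite exprMn -!nmE.
have := psd_ge0 BP (v - (B u v / B u u) *: u).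
rewrite psdB// !psdBr// !psdZ// !psdZr// (psdC BP v u).
set a := B u v; set b := B u u; set c := B v v.
have -> : c - a / b * a - (a / b * a - a / b * (a / b * b)) = (b * c - a ^+ 2) / b.
  by field.
by rewrite pmulr_lge0 ?invr_gt0//; lra.
Qed.

Lemma psd_le u v : B u v <= nm u * nm v.
Proof. exact: le_trans (ler_norm _) (psd_CS _ _). Qed.

Lemma nmD u v : nm (u + v) <= nm u + nm v.
Proof.
apply: nm_le; first by rewrite addr_ge0 ?nm_ge0.
rewrite psdD// !psdDr// (psdC BP v u) !nmE; have := psd_le u v; lra.
Qed.

Lemma nmZ a u : nm (a *: u) = `|a| * nm u.
Proof. by rewrite /nm psdZ// psdZr// mulrA -expr2 sqrtrM ?sqr_ge0// sqrtr_sqr. Qed.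

Lemma nmN u : nm (- u) = nm u.
Proof. by rewrite -scaleN1r nmZ normrN1 mul1r. Qed.

Lemma nm0 : nm 0 = 0. Proof. by rewrite /nm psd0 sqrtr0. Qed.

Lemma nmBC u v : nm (u - v) = nm (v - u).
Proof. by rewrite -nmN opprB. Qed.

Lemma nmB u v : nm (u - v) <= nm u + nm v.
Proof. by rewrite -(nmN v) nmD. Qed.

Lemma nm_dist u v : nm u <= nm v + nm (u - v).
Proof. by rewrite -{1}(subrK v u) addrC nmD. Qed.

Lemma nm_tri u v w : nm (u - w) <= nm (u - v) + nm (v - w).
Proof. by rewrite -{1}(subrK v u) -addrA nmD. Qed.

Lemma nm_eq0 u v : nm u = 0 -> B u v = 0.
Proof. by move=> u0; apply: psd_eq0; rewrite nmE u0 expr0n. Qed.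

Definition complete_form := forall w : nat -> H,
  (forall e : R, 0 < e -> exists N, forall m n, (N <= m)%N -> (N <= n)%N -> nm (w m - w n) <= e) ->
  exists l, forall e : R, 0 < e -> exists N, forall n, (N <= n)%N -> nm (w n - l) <= e.

Hypothesis BK : complete_form.

Lemma small_inv (e : R) : 0 < e -> exists N, forall n, (N <= n)%N -> n.+1%:R^-1 <= e.
Proof.
move=> e0; exists (Num.bound e^-1) => n Nn.
rewrite -[leRHS]invrK lef_pV2 ?posrE ?invr_gt0//.
apply: le_trans (ltW (archi_boundP _)) _; first by rewrite invr_ge0 ltW.
by rewrite ler_nat (leq_trans Nn).
Qed.

(* The representing vector minimizes [B v v - 2 L v]. *)
Lemma riesz (L : H -> R) (C : R) :
  (forall u v, L (u + v) = L u + L v) -> (forall a u, L (a *: u) = a * L u) ->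
  (forall u, `|L u| <= C * nm u) -> exists w, forall v, L v = B w v.
Proof.
move=> LD LZ LC.
pose q v := B v v - 2 * L v.
have qb v : - C ^+ 2 <= q v.
  rewrite /q nmE; have := LC v; rewrite ler_norml => /andP[_ h].
  have := sqr_ge0 (nm v - C); rewrite sqrrB; lra.
have hi : has_inf (range q) by split; [exists (q 0), 0|exists (- C ^+ 2) => _ [v _ <-]].
pose m := inf (range q).
have mq v : m <= q v by apply: ge_inf; [case: hi|exists v].
have wE n : exists w, q w <= m + n.+1%:R^-1.
  have [_ [v _ <-] vm] := inf_adherent (ltac:(by rewrite invr_gt0) : 0 < n.+1%:R^-1) hi.
  by exists v; exact: ltW.
have [w wP] := choice wE.
(* Parallelogram law: the midpoint has value at least [m], so a minimizing sequence is Cauchy. *)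
have par u v : B (u - v) (u - v) = 2 * q u + 2 * q v - 4 * q (2^-1 *: (u + v)).
  rewrite /q LZ LD psdZ// psdZr// !psdD// !psdDr// !psdN// !psdNr// (psdC BP v u).
  by field.
have [l lP] : exists l, forall e : R, 0 < e -> exists N, forall n, (N <= n)%N -> nm (w n - l) <= e.
  apply: BK => e e0.
  have [N NP] := small_inv (divr_gt0 (exprn_gt0 2 e0) (ltr0n _ 4)); exists N => a b Na Nb.
  apply: nm_le; first exact: ltW.
  rewrite par; have := mq (2^-1 *: (w a + w b)).
  have wb n : (N <= n)%N -> q (w n) <= m + e ^+ 2 / 4.
    by move=> Nn; rewrite (le_trans (wP n))// lerD2l NP.
  by have := wb _ Na; have := wb _ Nb; lra.
exists l => v.
(* First variation at [l], tested on [w n + t *: v] for late [n], when [q (w n)] is close to the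
   infimum. *)
have key t : 0 <= 2 * t * (B l v - L v) + t ^+ 2 * B v v.
  rewrite leNgt; apply/negP => neg.
  set x := 2 * t * (B l v - L v) + t ^+ 2 * B v v in neg.
  pose K := 2 * `|t| * nm v + 1.
  have K0 : 0 < K by rewrite /K ltr_wpDl// !mulr_ge0// nm_ge0.
  have [N1 N1P] := lP (- x / 4 / K) ltac:(by rewrite !divr_gt0// oppr_gt0).
  have [N2 N2P] := small_inv (divr_gt0 (ltac:(by rewrite oppr_gt0) : 0 < - x) (ltr0n _ 4)).
  pose n := maxn N1 N2.
  have h1 := N1P n (leq_maxl _ _); have h2 := N2P n (leq_maxr _ _).
  have := mq (w n + t *: v).
  rewrite {1}/q LD LZ psdD// !psdDr// !psdZ// !psdZr// (psdC BP v (w n)).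
  have : q (w n) <= m - x / 4 by rewrite (le_trans (wP n))// -mulNr lerD2l.
  rewrite {1}/q.
  have hB : 2 * t * B (w n) v <= 2 * t * B l v - x / 4.
    rewrite -lerBlDl -mulrBr -psdB//.
    apply: le_trans (ler_norm _) _; rewrite !normrM (ger0_norm (_ : 0 <= 2))//.
    apply: (@le_trans _ _ (2 * `|t| * (nm (w n - l) * nm v))).
      by apply: ler_wpM2l; [rewrite mulr_ge0|exact: psd_CS].
    apply: (@le_trans _ _ (K * (- x / 4 / K))); last by rewrite mulrC divfK ?gt_eqF//; lra.
    apply: (@le_trans _ _ (K * nm (w n - l))); last by rewrite ler_wpM2l// ltW.
    by have := nm_ge0 (w n - l); rewrite /K; lra.
  move: hB neg; rewrite /x; lra.
apply/eqP; rewrite eq_sym -subr_eq0; apply/eqP.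
set a := B l v - L v in key *; set b := B v v in key.
have b0 : 0 <= b := psd_ge0 BP v.
(* The optimal [t] would be [- a / b]; the added [1] covers [b = 0], which a semidefinite form
   allows. *)
have := key (- a / (b + 1)).
have -> : 2 * (- a / (b + 1)) * a + (- a / (b + 1)) ^+ 2 * b
  = - (a ^+ 2 * (b + 2) / (b + 1) ^+ 2) by field; lra.
rewrite oppr_ge0 pmulr_lle0 ?invr_gt0 ?exprn_gt0 ?ltr_wpDl// pmulr_lle0; last lra.
by move=> a2; apply/eqP; rewrite -sqrf_eq0 eq_le a2 sqr_ge0.
Qed.

Section WeakLimit.
Variable U : set_system nat.
Hypothesis UF : UltraFilter U.

Lemma ultra_lim (x : nat -> R) (C : R) : (forall n, `|x n| <= C) ->
  exists l : R, x n @[n --> U] --> l.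
Proof.
move=> xC.
have [|l [_ lP]] := @segment_compact R (- C) C (x @ U) _.
  by apply: (@filterE _ U) => n; rewrite /= in_itv/= -ler_norml.
exists l; apply/cvgrPdist_le => e e0.
have [//|/= nU] := in_ultra_setVsetC [set n | `|l - x n| <= e] UF.
have xU : (x @ U) (x @` (~` [set n | `|l - x n| <= e])).
  by move: nU; apply: (@filterS _ U) => n nn; exists n.
have [_ [[n nn <-]]] := lP _ _ xU (nbhsx_ballx l e e0).
by rewrite -ball_normE /= => /ltW.
Qed.

(** Along an ultrafilter all the bounded scalar sequences [B (w n) v] converge at once, so no
    diagonal extraction is needed. The limit is a functional bounded by [C], which Riesz
    represents. *)
Lemma weak_lim (w : nat -> H) (C : R) : (forall n, nm (w n) <= C) ->
  exists l, forall v, B (w n) v @[n --> U] --> (B l v : R).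
Proof.
move=> wC.
have C0 : 0 <= C by apply: le_trans (wC 0%N); exact: nm_ge0.
have bd v n : `|B (w n) v| <= C * nm v.
  by apply: le_trans (psd_CS _ _) _; rewrite ler_wpM2r ?nm_ge0.
have [L LP] := choice (fun v => ultra_lim (bd v)).
have [l lP] : exists l, forall v, L v = B l v.
  apply: (@riesz L C).
  - move=> u v.
    have h : B (w n) (u + v) @[n --> U] --> L u + L v.
      by under eq_fun do rewrite psdDr; exact: cvgD.
    exact: (cvg_unique _ (LP (u + v)) h).
  - move=> a u.
    have h : B (w n) (a *: u) @[n --> U] --> a * L u.
      by under eq_fun do rewrite psdZr; exact: cvgMr.
    exact: (cvg_unique _ (LP (a *: u)) h).
  - move=> u; have h : `|B (w n) u| @[n --> U] --> `|L u| by apply: cvg_norm.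
    by apply: (cvgr_to_le h); apply: nearW.
by exists l => v; rewrite -lP.
Qed.
End WeakLimit.
End PreHilbert.

(** * Descent on the Nehari set *)

Section RayMax.
Variable R : realType.

(* [g' t / t^3] decreasing at a quadratic rate and [g' 1 = 0] force a quadratic
   drop of [g] away from its maximum at [1]. *)
Lemma ray_drop (g g' : R -> R) (e : R) :
  (forall t : R, 0 < t -> is_derive t 1 g (g' t)) ->
  (forall t1 t2 : R, 0 < t1 -> t1 < t2 ->
     g' t2 / t2 ^+ 3 <= g' t1 / t1 ^+ 3 - e * ((t1 ^+ 2)^-1 - (t2 ^+ 2)^-1)) ->
  g' 1 = 0 -> forall t : R, 0 < t -> g t <= g 1 - e / 4 * (t ^+ 2 - 1) ^+ 2.
Proof.
move=> dg ray g1 t t0.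
(* [h] is [g] plus the claimed drop; the monotonicity of [g' t / t^3] against [t = 1] says exactly
   that [(1 - x) * h' x] is nonnegative, so [h] is largest at [1]. *)
pose h x := g x + e / 4 * (x ^+ 2 - 1) ^+ 2.
pose h' x := g' x + e * (x * (x ^+ 2 - 1)).
have dh (x : R) : 0 < x -> is_derive x 1 h (h' x).
  move=> x0; have := dg x x0 => ?; apply: is_derive_eq; rewrite /h' /GRing.scale /=.
  by rewrite expr2; field.
have ch (a b : R) : 0 < a -> {within `[a, b], continuous h}.
  move=> a0; apply: continuous_in_subspaceT => x; rewrite inE/= in_itv/= => /andP[ax _].
  apply: differentiable_continuous; apply/derivable1_diffP.
  by have [] := dh x (lt_le_trans a0 ax).
rewrite lerBrDr -/(h t).
have -> : g 1 = h 1 by rewrite /h expr1n subrr expr0n mulr0 addr0.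
have hd (x : R) : 0 < x -> (1 - x) * h' x >= 0.
  move=> x0; rewrite /h'; have [x1|x1|->] := ltgtP x 1; last by rewrite subrr mul0r.
  - have := ray x 1 x0 x1; rewrite g1 mul0r expr1n invr1 => k.
    rewrite mulr_ge0//; first by rewrite subr_ge0 ltW.
    have -> : g' x + e * (x * (x ^+ 2 - 1)) = x ^+ 3 * (g' x / x ^+ 3 - e * ((x ^+ 2)^-1 - 1)).
      by field; rewrite gt_eqF.
    by rewrite mulr_ge0// exprn_ge0// ltW.
  - have := ray 1 x ltr01 x1; rewrite g1 mul0r expr1n invr1 => k.
    rewrite mulr_le0//; first by rewrite subr_le0 ltW.
    have -> : g' x + e * (x * (x ^+ 2 - 1)) = x ^+ 3 * (g' x / x ^+ 3 + e * (1 - (x ^+ 2)^-1)).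
      by field; rewrite gt_eqF.
    rewrite pmulr_rle0 ?exprn_gt0//; lra.
have [t1|t1|->//] := ltgtP t 1.
- have [||x] := @MVT _ h h' t 1 t1.
  + by move=> x; rewrite in_itv/= => /andP[tx _]; apply: dh; exact: lt_trans tx.
  + exact: ch.
  rewrite in_itv/= => /andP[tx x1] E; rewrite -subr_ge0 E.
  by have := hd x (lt_trans t0 tx); rewrite pmulr_rge0 ?subr_gt0// => hx; rewrite mulr_ge0// subr_ge0 ltW.
- have [||x] := @MVT _ h h' 1 t t1.
  + by move=> x; rewrite in_itv/= => /andP[tx _]; apply: dh; exact: lt_trans tx.
  + exact: ch.
  rewrite in_itv/= => /andP[tx x1] E; rewrite -subr_le0 E.
  have := hd x (lt_trans ltr01 tx); rewrite nmulr_rge0 ?subr_lt0// => hx.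
  by rewrite pmulr_lle0 ?subr_gt0.
Qed.

Lemma is_derive_eps (g : R -> R) (t l : R) :
  (forall e : R, 0 < e -> exists2 d : R, 0 < d & forall h, `|h| <= d ->
     `|g (t + h) - g t - l * h| <= e * `|h|) -> is_derive t 1 g l.
Proof.
move=> gP.
have cv : h^-1 *: ((g \o shift t) (h *: 1) - g t) @[h --> 0^'] --> l.
  apply/cvgrPdist_le => e e0; have [d d0 dP] := gP e e0.
  exists d => //= h /=; rewrite distrC subr0 => hd h0.
  rewrite /GRing.scale /= mulr1 (addrC h t) -[X in `|X|]mulr1 -(mulVf h0).
  have -> : (l - h^-1 * (g (t + h) - g t)) * (h^-1 * h) = h^-1 * - (g (t + h) - g t - l * h).
    by field.
  rewrite normrM normrN normfV ler_pdivrMl ?normr_gt0// [leRHS]mulrC; exact/dP/ltW.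
apply: DeriveDef; first by apply/cvg_ex; exists l.
exact: cvg_lim cv.
Qed.

End RayMax.

Section Nehari.
Variables (R : realType) (H : lmodType R) (B : H -> H -> R) (J : H -> R) (D : H -> H).
Hypothesis BP : psd_form B.
Notation nm := (nm B).

(** The remainder is uniform on bounded sets. This alone yields the uniform continuity of [D] on
    bounded sets in [unif_grad], without a second derivative. *)
Definition unif_diff := forall rho lam : R, 0 < lam -> exists2 tau : R, 0 < tau &
  forall u v, nm u <= rho -> nm v <= tau -> `|J (u + v) - J u - B (D u) v| <= lam * nm v.
(** The quotient by [t^3] reflects the homogeneity [4] of the competition between the Kirchhoff term
    and the nonlinearity; the last term makes the monotonicity strict with a constant common to all
    rays. *)
Definition ray_cond (c : R) := forall u (t1 t2 : R), 0 < t1 -> t1 < t2 ->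
  B (D (t2 *: u)) u / t2 ^+ 3 <=
  B (D (t1 *: u)) u / t1 ^+ 3 - c * B u u * ((t1 ^+ 2)^-1 - (t2 ^+ 2)^-1).
Definition nehari w := 0 < nm w /\ B (D w) w = 0.

Variables (c r : R).
Hypothesis dJ : unif_diff.
Hypothesis ray : ray_cond c.
Hypothesis c0 : 0 < c.
Hypothesis r0 : 0 < r.
Hypothesis Nr : forall w, nehari w -> r <= nm w.

Ltac lra_goal := clear -BP dJ ray c0 r0 Nr; lra.

(** Three expansions, at [u] with increments [w] and [w + v] and at [u + w] with increment [v],
    isolate [B (D (u + w) - D u) v]. Taking [v] along the difference of the gradients and of length
    [a] turns this into a bound on its norm. *)
Lemma unif_grad (rho lam : R) : 0 < lam -> exists2 tau : R, 0 < tau &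
  forall u w, nm u <= rho -> nm w <= tau -> nm (D (u + w) - D u) <= lam.
Proof.
move=> l0; have [t t0 tP] := dJ (rho + 1) (divr_gt0 l0 (ltr0n _ 4)).
pose a := Num.min t 1 / 2.
have a0 : 0 < a by rewrite divr_gt0// lt_min t0 ltr01.
have [at_ a1] : 2 * a <= t /\ a <= 1.
  by rewrite /a; case: (leP t 1) => h; split; lra.
exists a => // u w ur wa; set z := D (u + w) - D u.
have [->|z0] := eqVneq (nm z) 0; first exact: ltW.
have zp : 0 < nm z by rewrite lt_neqAle eq_sym z0 nm_ge0.
pose v := (a / nm z) *: z.
have va : nm v = a by rewrite /v nmZ// (gtr0_norm (divr_gt0 a0 zp)) -mulrA mulVf// mulr1.
have h1 := tP (u + w) v _ _; have h2 := tP u (w + v) _ _; have h3 := tP u w _ _.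
have : nm (w + v) <= 2 * a by rewrite (le_trans (nmD BP _ _))// va; lra.
move=> wva; have uw : nm (u + w) <= rho + 1 by rewrite (le_trans (nmD BP _ _))// lerD// (le_trans wa).
have {}h1 := h1 uw ltac:(by rewrite va; lra).
have {}h2 := h2 ltac:(move: ur; lra_goal) ltac:(move: wva at_; lra_goal).
have {}h3 := h3 ltac:(lra) ltac:(lra).
have E : B z v = a * nm z.
  by rewrite psdZr// nmE// expr2 mulrA divfK.
have : B z v <= lam * a.
  have -> : B z v = - (J (u + w + v) - J (u + w) - B (D (u + w)) v)
    + (J (u + (w + v)) - J u - B (D u) (w + v)) - (J (u + w) - J u - B (D u) w).
    by rewrite /z psdB// psdDr// -(addrA u w v); ring.
  move: h1 h2 h3; rewrite !ler_norml va => /andP[h1 _] /andP[_ h2] /andP[h3 _].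
  have h4 : lam / 4 * nm (w + v) <= lam / 4 * (2 * a) by rewrite ler_wpM2l// divr_ge0// ltW.
  have h5 : lam / 4 * nm w <= lam / 4 * a by rewrite ler_wpM2l// divr_ge0// ltW.
  lra.
by rewrite E mulrC ler_pM2r.
Qed.

(** The segment from [0] to [u] is cut into steps shorter than the modulus of [unif_grad]; each of
    them changes the gradient by at most [1]. *)
Lemma bdd_grad (rho : R) : exists2 C : R, 1 <= C & forall u, nm u <= rho -> nm (D u) <= C.
Proof.
have [t t0 tP] := unif_grad rho ltr01.
have [N NP] := small_inv (divr_gt0 t0 (ltac:(by rewrite ltr_wpDl) : 0 < `|rho| + 1)).
exists (nm (D 0) + N.+1%:R + 1); first by rewrite lerDr addr_ge0// nm_ge0.
move=> u ur; have r1 : rho <= `|rho| + 1 by rewrite (le_trans (ler_norm _))// lerDl.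
have st k : (k <= N.+1)%N -> nm (D ((k%:R / N.+1%:R) *: u)) <= nm (D 0) + k%:R.
  elim: k => [_|k IH kN]; first by rewrite mul0r scale0r addr0.
  rewrite -natr1 mulrDl mul1r scalerDl.
  apply: le_trans (nm_dist BP _ (D ((k%:R / N.+1%:R) *: u))) _.
  rewrite addrA lerD ?IH ?(ltnW kN)//; apply: tP.
    rewrite nmZ// ger0_norm ?divr_ge0//; apply: le_trans ur.
    by rewrite ler_piMl ?nm_ge0// ler_pdivrMr ?ltr0n// mul1r ler_nat ltnW.
  rewrite nmZ// ger0_norm ?invr_ge0//.
  apply: le_trans (ler_pM _ _ (NP N (leqnn _)) (le_trans ur r1)) _; rewrite ?nm_ge0 ?invr_ge0//.
  by rewrite divfK// gt_eqF// ltr_wpDl.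
have := st _ (leqnn _); rewrite divff ?pnatr_eq0// scale1r => h.
by rewrite (le_trans h)// lerDl.
Qed.

Lemma is_derive_line u (t : R) : is_derive t 1 (fun t => J (t *: u)) (B (D (t *: u)) u).
Proof.
apply: is_derive_eps => e e0.
have n1 : 0 < nm u + 1 by rewrite ltr_wpDl// nm_ge0.
have [d d0 dP] := dJ (nm (t *: u)) (divr_gt0 e0 n1).
exists (d / (nm u + 1)); first exact: divr_gt0.
move=> h hd.
have hs : nm (h *: u) <= `|h| * (nm u + 1) by rewrite nmZ// ler_wpM2l// lerDl.
have hh : nm (h *: u) <= d by rewrite (le_trans hs)// -ler_pdivlMr.
have := dP _ _ (lexx _) hh; rewrite -scalerDl (psdZr BP) [h * _]mulrC => /le_trans; apply.
by rewrite -mulrA ler_wpM2l ?(ltW e0)// ler_pdivrMl// mulrC.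
Qed.

Lemma nehari_ray w (t : R) : nehari w -> 0 < t ->
  J (t *: w) <= J w - c * B w w / 4 * (t ^+ 2 - 1) ^+ 2.
Proof.
move=> [w0 Dw] t0.
have := @ray_drop R (fun t => J (t *: w)) (fun t => B (D (t *: w)) w) (c * B w w).
rewrite scale1r; apply => //.
- by move=> x _; exact: is_derive_line.
- by move=> t1 t2 t10 t12; exact: ray.
Qed.

Lemma nehari_ray_le w (t : R) : nehari w -> 0 < t -> J (t *: w) <= J w.
Proof.
move=> Nw t0; apply: le_trans (nehari_ray Nw t0) _.
have h : 0 <= c * B w w by rewrite mulr_ge0 ?(ltW c0)// psd_ge0.
by rewrite lerBlDr lerDl mulr_ge0 ?sqr_ge0// divr_ge0.
Qed.

Lemma nehari_uniq u (t1 t2 : R) : 0 < t1 -> 0 < t2 ->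
  nehari (t1 *: u) -> nehari (t2 *: u) -> t1 = t2.
Proof.
wlog h : t1 t2 / t1 < t2.
  by move=> W t10 t20 N1 N2; have [h|h|//] := ltgtP t1 t2; [|symmetry]; exact: W.
move=> t10 t20 [u0 E1] [_ E2]; exfalso.
have := ray u t10 h; move: E1 E2; rewrite !(psdZr BP) => /eqP + /eqP.
rewrite !mulf_eq0 (gt_eqF t10) (gt_eqF t20) /= => /eqP -> /eqP ->; rewrite !mul0r sub0r.
rewrite oppr_ge0 leNgt mulr_gt0//; last first.
  by rewrite subr_gt0 ltf_pV2 ?posrE ?exprn_gt0// ltr_pXn2r ?nnegrE ?ltW.
rewrite mulr_gt0// (nmE BP) exprn_gt0//.
by move: u0; rewrite nmZ// pmulr_rgt0// normr_gt0 gt_eqF.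
Qed.

(** The ray condition makes the radial derivative at [w] at least [al] at time [1 - th] and at most
    [- al] at time [1 + th]. Passing from [w] to a nearby [u] costs at most [al / 2], so the sign
    change persists and the intermediate value theorem gives a root. *)
Lemma proj_exists (rho th : R) : 0 < th -> th <= 1 / 2 -> exists2 eta : R, 0 < eta &
  forall w u, nehari w -> nm w <= rho -> nm (u - w) <= eta ->
  exists2 t : R, `|t - 1| <= th & nehari (t *: u).
Proof.
move=> th0 th1; pose al := c * r ^+ 2 * th / 2.
have alE : al = c * (r ^+ 2 * (th / 2)) by rewrite /al !mulrA.
have al0 : 0 < al by rewrite divr_gt0// mulr_gt0// mulr_gt0// exprn_gt0.
pose rh : R := `|rho| + 1; have rh0 : 0 < rh by rewrite ltr_wpDl.
have rle : rho <= rh by rewrite (le_trans (ler_norm _))// lerDl.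
have [C C1 CP] := bdd_grad (2 * rh).
have C0 : 0 < C by exact: lt_le_trans C1.
have [ta ta0 taP] := unif_grad (2 * rh) (divr_gt0 al0 (ltac:(by rewrite mulr_gt0// addr_gt0) : 0 < 4 * (rh + 1))).
pose eta := Num.min (Num.min 1 (r / 2)) (Num.min (ta / 2) (al / (4 * C))).
have eta0 : 0 < eta by rewrite !lt_min ltr01 !divr_gt0 ?mulr_gt0.
exists eta => // w u Nw wr uw.
have [wn Dw] := Nw.
have [e1 e2 e3 e4] : [/\ nm (u - w) <= 1, nm (u - w) <= r / 2, nm (u - w) <= ta / 2 &
    nm (u - w) <= al / (4 * C)].
  by move: uw; rewrite /eta !le_min => /andP[/andP[? ?] /andP[? ?]].
have un : nm u <= rh + 1 by rewrite (le_trans (nm_dist BP _ w))// lerD// (le_trans wr).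
have up : 0 < nm u.
  by have := nm_dist BP w u; rewrite (nmBC BP w u); have := Nr Nw; move: r0; lra.
have pert (t : R) : `|t - 1| <= th -> `|B (D (t *: u)) u - B (D (t *: w)) w| <= al / 2.
  move=> /ler_normlP[t1 t2].
  have tb : `|t| <= 2 by rewrite ler_norml; lra.
  have -> : B (D (t *: u)) u - B (D (t *: w)) w =
     B (D (t *: w + t *: (u - w)) - D (t *: w)) u + B (D (t *: w)) (u - w).
    have -> : t *: w + t *: (u - w) = t *: u by rewrite -scalerDr addrC subrK.
    by rewrite (psdB BP) (psdBr BP); ring.
  apply: le_trans (ler_normD _ _) _.
  have tw : nm (t *: w) <= 2 * rh by rewrite nmZ// ler_pM ?nm_ge0// (le_trans wr).
  have -> : al / 2 = al / (4 * (rh + 1)) * (rh + 1) + C * (al / (4 * C)).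
    by field; rewrite !(gt_eqF C0, gt_eqF (addr_gt0 rh0 ltr01)).
  apply: lerD; apply: le_trans (psd_CS BP _ _) _; apply: ler_pM; rewrite ?nm_ge0//.
    apply: taP => //; rewrite nmZ//; apply: (@le_trans _ _ (2 * (ta / 2))); last lra.
    by rewrite ler_pM ?nm_ge0.
  exact: CP.
have Bw : r ^+ 2 <= B w w by rewrite (nmE BP) ler_pXn2r ?nnegrE ?nm_ge0 ?(ltW r0)//; exact: Nr.
have kp : al <= B (D ((1 - th) *: w)) w.
  have t0 : 0 < 1 - th by lra.
  have := ray w t0 (ltac:(lra) : 1 - th < 1); rewrite scale1r Dw mul0r expr1n invr1.
  set k := B _ w => h.
  have {h} : c * B w w * ((1 - th) - (1 - th) ^+ 3) <= k.
    have -> : k = (1 - th) ^+ 3 * (k / (1 - th) ^+ 3) by field; rewrite gt_eqF.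
    have -> : c * B w w * (1 - th - (1 - th) ^+ 3) = (1 - th) ^+ 3 * (c * B w w * (((1 - th) ^+ 2)^-1 - 1)).
      by field; rewrite gt_eqF.
    by rewrite ler_wpM2l ?exprn_ge0 ?(ltW t0)//; lra.
  move=> /(le_trans _); apply; rewrite alE -[leRHS]mulrA ler_wpM2l ?(ltW c0)//.
  apply: ler_pM => //; rewrite ?sqr_ge0// ?divr_ge0 ?(ltW th0)//.
  have -> : 1 - th - (1 - th) ^+ 3 = th * ((1 - th) * (2 - th)) by ring.
  rewrite ler_wpM2l ?(ltW th0)//; nra.
have kn : B (D ((1 + th) *: w)) w <= - al.
  have t0 : 0 < 1 + th by lra.
  have := ray w ltr01 (ltac:(lra) : 1 < 1 + th); rewrite scale1r Dw mul0r expr1n invr1 sub0r.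
  set k := B _ w => h.
  have {h} : k <= - (c * B w w * ((1 + th) ^+ 3 - (1 + th))).
    have -> : k = (1 + th) ^+ 3 * (k / (1 + th) ^+ 3) by field; rewrite gt_eqF.
    have -> : - (c * B w w * ((1 + th) ^+ 3 - (1 + th))) = (1 + th) ^+ 3 * (- (c * B w w * (1 - ((1 + th) ^+ 2)^-1))).
      by field; rewrite gt_eqF.
    by rewrite ler_wpM2l ?exprn_ge0 ?(ltW t0)//; lra.
  move=> /le_trans; apply; rewrite lerN2 alE -[leRHS]mulrA ler_wpM2l ?(ltW c0)//.
  apply: ler_pM => //; rewrite ?sqr_ge0// ?divr_ge0 ?(ltW th0)//.
  have -> : (1 + th) ^+ 3 - (1 + th) = th * ((1 + th) * (2 + th)) by ring.
  rewrite ler_wpM2l ?(ltW th0)//; nra.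
have ck : {within `[1 - th, 1 + th], continuous (fun t : R => B (D (t *: u)) u)}.
  apply: continuous_subspaceT => t; apply/cvgrPdist_le => e e0.
  have [d d0 dP] := unif_grad (nm (t *: u)) (divr_gt0 e0 up).
  exists (d / nm u); first exact: divr_gt0.
  move=> s /=; rewrite distrC => ts.
  rewrite distrC -(psdB BP); apply: le_trans (psd_CS BP _ _) _.
  rewrite -ler_pdivlMr//.
  have -> : s *: u = t *: u + (s - t) *: u by rewrite -scalerDl addrC subrK.
  by apply: dP => //; rewrite nmZ// -ler_pdivlMr// ltW.
have [||t] := @IVT _ _ (1 - th) (1 + th) 0 _ ck; first by lra.
  have /ler_normlP[hp _] := pert (1 - th) ltac:(by rewrite ler_norml; move: th0 th1; lra_goal).
  have /ler_normlP[_ hn] := pert (1 + th) ltac:(by rewrite ler_norml; move: th0 th1; lra_goal).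
  rewrite ge_min le_max; apply/andP; split; apply/orP; [right|left]; move: hp hn kp kn al0; lra_goal.
rewrite in_itv/= => /andP[ta1 ta2] Et; exists t; first by rewrite ler_norml; move: ta1 ta2; lra_goal.
split; last by rewrite (psdZr BP) Et mulr0.
by rewrite nmZ// mulr_gt0// normr_gt0 gt_eqF//; move: ta1 th1; lra_goal.
Qed.

(** The value [0] is taken when the ray misses the Nehari set; each use first exhibits a valid time,
    unique by [nehari_uniq]. *)
Definition nehari_time u : R := xget 0 [set t : R | 0 < t /\ nehari (t *: u)].
Definition nehari_proj u := nehari_time u *: u.

Lemma nehari_projE u (t : R) : 0 < t -> nehari (t *: u) -> nehari_proj u = t *: u.
Proof.
move=> t0 Nt; rewrite /nehari_proj; congr (_ *: u).
have [s0 Ns] : [set t : R | 0 < t /\ nehari (t *: u)] (nehari_time u).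
  by apply: xgetPex; exists t.
exact: (nehari_uniq s0 t0 Ns Nt).
Qed.

Lemma nehari_proj_id w : nehari w -> nehari_proj w = w.
Proof. by move=> Nw; rewrite (@nehari_projE w 1) ?scale1r. Qed.

Lemma nehari_proj_cont u0 (t0 e : R) : 0 < t0 -> nehari (t0 *: u0) -> 0 < e ->
  exists2 eta : R, 0 < eta & forall u, nm (u - u0) <= eta ->
    (exists2 t : R, 0 < t & nehari_proj u = t *: u) /\
    nehari (nehari_proj u) /\ nm (nehari_proj u - t0 *: u0) <= e.
Proof.
move=> tp Nw e0; set w := t0 *: u0 in Nw *.
have n1 : 0 < 2 * (nm w + 1) by rewrite mulr_gt0// ltr_wpDl// nm_ge0.
pose th := Num.min (1 / 2) (e / (2 * (nm w + 1))).
have th0 : 0 < th by rewrite lt_min !divr_gt0.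
have th1 : th <= 1 / 2 by rewrite /th ge_min lexx.
have th2 : th <= e / (2 * (nm w + 1)) by rewrite /th ge_min lexx orbT.
have [eta h0 hP] := proj_exists (nm w) th0 th1.
exists (Num.min (eta / t0) (e / (4 * t0))).
  by rewrite lt_min !divr_gt0// mulr_gt0.
move=> u; rewrite le_min => /andP[u1 u2].
have uE : nm (t0 *: u - w) = t0 * nm (u - u0) by rewrite -scalerBr nmZ// gtr0_norm.
have [|t t1 Nt] := hP w (t0 *: u) Nw (lexx _).
  by rewrite uE mulrC -ler_pdivlMr.
have tpos : 0 < t by move: t1; rewrite ler_norml => /andP[]; lra.
have E : nehari_proj u = t *: (t0 *: u).
  by rewrite scalerA; apply: nehari_projE; rewrite ?mulr_gt0// -scalerA.
split; first by exists (t * t0); rewrite ?mulr_gt0// E scalerA.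
rewrite E; split=> //.
have -> : t *: (t0 *: u) - w = t *: (t0 *: u - w) + (t - 1) *: w.
  by rewrite scalerBr scalerBl scale1r addrA subrK.
apply: le_trans (nmD BP _ _) _; rewrite (nmZ BP t) uE (gtr0_norm tpos) (nmZ BP (t - 1)).
have t2 : t <= 2 by move: t1; rewrite ler_norml => /andP[]; lra.
have a1 : t * (t0 * nm (u - u0)) <= 2 * (e / 4).
  rewrite ler_pM ?(ltW tpos)// ?mulr_ge0 ?nm_ge0 ?(ltW tp)//.
  by move: u2; rewrite ler_pdivlMr ?mulr_gt0//; lra.
have a2 : `|t - 1| * nm w <= e / 2.
  apply: (@le_trans _ _ (e / (2 * (nm w + 1)) * (nm w + 1))).
    by rewrite ler_pM ?nm_ge0 ?(le_trans t1)// lerDl.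
  by rewrite invfM mulrA mulfVK// gt_eqF// ltr_wpDl// nm_ge0.
lra.
Qed.

(** The factor switches the step off where the gradient is below [kap / 2]. Elsewhere the gain
    [nm (D w) * nm d] dominates first-order errors of total size [kap / 4 * nm d], so that [J] never
    increases, even near critical points. *)
Definition descent (kap : R) w := Num.max 0 (nm (D w) - kap / 2) *: D w.

Lemma max_lip (a b k : R) : `|Num.max 0 (a - k) - Num.max 0 (b - k)| <= `|a - b|.
Proof.
rewrite ler_norml; have h1 := ler_norm (a - b); have := ler_norm (b - a).
by rewrite distrC; case: (leP 0 (a - k)); case: (leP 0 (b - k)); lra.
Qed.

Lemma descent_lip (kap C : R) w w' : 0 < kap -> nm (D w) <= C -> nm (D w') <= C ->
  nm (descent kap w' - descent kap w) <= 2 * C * nm (D w' - D w).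
Proof.
move=> k0 wC w'C; rewrite /descent.
set x := nm (D w); set x' := nm (D w').
have -> : Num.max 0 (x' - kap / 2) *: D w' - Num.max 0 (x - kap / 2) *: D w =
  (Num.max 0 (x' - kap / 2) - Num.max 0 (x - kap / 2)) *: D w' +
  Num.max 0 (x - kap / 2) *: (D w' - D w).
  by rewrite scalerBl scalerBr addrA subrK.
apply: le_trans (nmD BP _ _) _; rewrite !nmZ//.
have xx : `|x' - x| <= nm (D w' - D w).
  by rewrite ler_norml; have := nm_dist BP (D w') (D w); have := nm_dist BP (D w) (D w');
     rewrite (nmBC BP (D w)) -/x -/x'; lra.
have xp : 0 <= x := nm_ge0 _ _; have xp' : 0 <= x' := nm_ge0 _ _.
have m1 : `|Num.max 0 (x' - kap / 2) - Num.max 0 (x - kap / 2)| <= nm (D w' - D w).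
  apply: le_trans (max_lip _ _ _) xx.
have m2 : `|Num.max 0 (x - kap / 2)| <= C.
  by rewrite ger0_norm ?le_max ?lexx// ge_max; apply/andP; split; move: xp wC; rewrite -/x; lra.
have -> : 2 * C * nm (D w' - D w) = nm (D w' - D w) * C + C * nm (D w' - D w) by ring.
by rewrite lerD// ler_pM ?nm_ge0.
Qed.

Variables (b rho : R).
Hypothesis Nb : forall w, nehari w -> J w <= b -> nm w <= rho.

Ltac lra_goal ::= clear -BP dJ ray c0 r0 Nr Nb; lra.
Definition nehari_le w := nehari w /\ J w <= b.

(* One projected gradient step, uniform over the whole sublevel. *)
Lemma descent_step (kap : R) : 0 < kap -> exists tau sig C : R, [/\ 0 < tau, 0 < sig, 0 < C,
  (forall w, nehari_le w -> nm (D w) <= C) &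
  forall w, nehari_le w ->
    (forall s : R, 0 <= s <= tau -> nehari_le (nehari_proj (w - s *: descent kap w)) /\
       (exists2 t : R, 0 < t & nehari_proj (w - s *: descent kap w) = t *: (w - s *: descent kap w)) /\
       J (nehari_proj (w - s *: descent kap w)) <= J w) /\
    (kap <= nm (D w) -> J (nehari_proj (w - tau *: descent kap w)) <= J w - sig)].
Proof.
move=> k0; pose rh : R := `|rho| + 1; have rh0 : 0 < rh by rewrite ltr_wpDl.
have rle w : nehari_le w -> nm w <= rh.
  by case=> Nw Jw; rewrite (le_trans (Nb Nw Jw))// (le_trans (ler_norm _))// lerDl.
have [C C1 CP] := bdd_grad rh.
have C0 : 0 < C by exact: lt_le_trans C1.
have l0 : 0 < kap / 8 by rewrite divr_gt0.
have [t1 t10 t1P] := unif_grad rh l0.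
have [t2 t20 t2P] := dJ (2 * rh) l0.
pose th := Num.min (1 / 2) (t1 / rh).
have th0 : 0 < th by rewrite lt_min !divr_gt0.
have th1 : th <= 1 / 2 by rewrite /th ge_min lexx.
have th2 : th * rh <= t1 by rewrite -ler_pdivlMr// /th ge_min lexx orbT.
have [eta eta0 etaP] := proj_exists rh th0 th1.
(* A step has length at most [tau * C ^+ 2], because [nm d <= C ^+ 2]. It has to fit the range of
   [proj_exists], and that of the expansion even after multiplication by [t <= 2]. *)
pose tau := Num.min eta (t2 / 2) / C ^+ 2.
have tau0 : 0 < tau by rewrite divr_gt0 ?exprn_gt0// lt_min eta0 divr_gt0.
have tau1 : tau * C ^+ 2 <= eta by rewrite /tau divfK ?gt_eqF ?exprn_gt0// ge_min lexx.
have tau2 : tau * C ^+ 2 <= t2 / 2 by rewrite /tau divfK ?gt_eqF ?exprn_gt0// ge_min lexx orbT.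
exists tau, (tau / 2 * (kap * (kap / 2) * (kap / 4))), C; split => //.
- apply: mulr_gt0; first exact: divr_gt0.
  by apply: mulr_gt0; [apply: mulr_gt0|]; rewrite ?divr_gt0.
- by move=> w /rle; exact: CP.
move=> w NLw; have [Nw Jw] := NLw; have wr := rle w NLw; have DC := CP w wr.
set x := nm (D w) in DC *; have x0 : 0 <= x := nm_ge0 _ _.
pose m := Num.max 0 (x - kap / 2).
have m0 : 0 <= m by rewrite le_max lexx.
have mx : m <= x by rewrite ge_max x0; lra.
set d := descent kap w; have dE : d = m *: D w by [].
have nd : nm d = m * x by rewrite dE nmZ// ger0_norm.
have ndC : nm d <= C ^+ 2 by rewrite nd expr2 ler_pM// (le_trans mx).
have key (s : R) : 0 <= s <= tau -> exists2 t : R, `|t - 1| <= th &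
    nehari (t *: (w - s *: d)) /\ J (t *: (w - s *: d)) <= J w - s / 2 * (nm d * (kap / 4)).
  move=> /andP[s0 st].
  have sd : s * nm d <= tau * C ^+ 2 by rewrite ler_pM ?nm_ge0.
  have [|t tt Nt] := etaP w (w - s *: d) Nw wr.
    by rewrite addrC addKr nmN// nmZ// ger0_norm// (le_trans sd).
  exists t => //; split=> //.
  have [ta tb] : - th <= t - 1 /\ t - 1 <= th by move: tt; rewrite ler_norml => /andP[].
  have tp : 0 < t by move: ta th1; lra_goal.
  have t32 : t <= 2 by move: tb th1; lra_goal.
  have twr : nm (t *: w) <= 2 * rh by rewrite nmZ// gtr0_norm// ler_pM ?nm_ge0 ?(ltW tp).
  have tsd : nm ((- (t * s)) *: d) <= t2.
    rewrite nmZ// normrN ger0_norm ?mulr_ge0 ?(ltW tp)// -mulrA.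
    by apply: (@le_trans _ _ (2 * (t2 / 2))); [rewrite ler_pM ?(ltW tp) ?mulr_ge0 ?nm_ge0// (le_trans sd)|move: t20; lra_goal].
  have := t2P _ _ twr tsd; rewrite ler_norml => /andP[_].
  have -> : t *: w + (- (t * s)) *: d = t *: (w - s *: d).
    by rewrite scalerBr scaleNr (scalerA t s d).
  rewrite psdZr// nmZ// normrN (ger0_norm (_ : 0 <= t * s)) ?mulr_ge0 ?(ltW tp)// => h.
  (* [w] maximizes [J] on its ray, so expanding at [t *: w] instead of [w] costs nothing, although
     [t - 1] may be large compared with [s]. *)
  have Jt := nehari_ray_le Nw tp.
  have gd : B (D w) d - kap / 8 * nm d <= B (D (t *: w)) d.
    rewrite lerBlDr -lerBlDl -psdB//; apply: le_trans (psd_le BP _ _) _.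
    rewrite ler_wpM2r ?nm_ge0// nmBC//.
    have -> : t *: w = w + (t - 1) *: w by rewrite scalerBl scale1r addrC subrK.
    apply: t1P => //; rewrite nmZ//; apply: le_trans th2.
    by rewrite ler_pM ?nm_ge0.
  have Bd : B (D w) d = x * nm d by rewrite {1}dE psdZr// nmE// nd -/x; ring.
  have xm : nm d * (kap / 4) <= nm d * (x - kap / 4).
    rewrite nd /m; case: (leP 0 (x - kap / 2)) => hx; last by rewrite !mul0r.
    by rewrite ler_wpM2l ?mulr_ge0//; move: hx; lra_goal.
  have ts0 : 0 <= t * s by rewrite mulr_ge0// ltW.
  have h2 : t * s * (B (D w) d - kap / 8 * nm d) <= t * s * B (D (t *: w)) d by rewrite ler_wpM2l.
  have h3 : t * s * (nm d * (kap / 4)) <= t * s * (nm d * (x - kap / 4)) by rewrite ler_wpM2l.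
  have h4 : s / 2 * (nm d * (kap / 4)) <= t * s * (nm d * (kap / 4)).
    by rewrite ler_wpM2r// ?mulr_ge0 ?nm_ge0 ?divr_ge0 ?(ltW k0)//; move: ta th1 s0; clear -BP dJ ray c0 r0 Nr Nb; nra.
  move: h h2 h3 h4 Jt; rewrite Bd; lra_goal.
have tpos (t : R) : `|t - 1| <= th -> 0 < t by rewrite ler_norml => /andP[]; move: th1; lra_goal.
split=> [s sP|kx].
- have [t tt [Nt Jt]] := key s sP; have t0 := tpos t tt.
  rewrite (nehari_projE t0 Nt).
  have Jw' : J (t *: (w - s *: d)) <= J w.
    rewrite (le_trans Jt)// lerBlDr lerDl mulr_ge0// ?mulr_ge0 ?nm_ge0 ?divr_ge0 ?(ltW k0)//.
    by case/andP: sP.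
  by split; [split=> //; exact: le_trans Jw|split=> //; exists t].
- have [t tt [Nt Jt]] := key tau ltac:(by rewrite lexx ltW); have t0 := tpos t tt.
  have mk : kap / 2 <= m by rewrite le_max; apply/orP; right; move: kx; lra_goal.
  rewrite (nehari_projE t0 Nt) (le_trans Jt)// lerD2l lerN2.
  apply: ler_wpM2l; first by move: (tau) tau0 => T0; lra_goal.
  apply: ler_wpM2r; first by move: k0; lra_goal.
  by rewrite nd [leRHS]mulrC; apply: ler_pM => //; move: k0; lra_goal.
Qed.

Definition cont_on (T : topologicalType) (A : set T) (phi : T -> H) :=
  forall y, A y -> forall e : R, 0 < e -> \forall z \near within A (nbhs y), nm (phi z - phi y) <= e.

Lemma closed_sublevel (T : topologicalType) (Y : set T) phi v (a : R) :
  closed Y -> cont_on Y phi -> closed [set y | Y y /\ nm (phi y - v) <= a].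
Proof.
move=> cY cphi y yC.
have Yy : Y y by apply: cY; apply: closure_subset yC => z [].
split=> //; rewrite leNgt; apply/negP => ay.
have e0 : 0 < (nm (phi y - v) - a) / 2 by rewrite divr_gt0// subr_gt0.
have [z [[Yz za] /(_ Yz)]] := yC _ (cphi y Yy _ e0).
have := nm_tri BP (phi y) (phi z) v; rewrite (nmBC BP (phi y) (phi z)); lra.
Qed.

Lemma closed_superlevel (T : topologicalType) (Y : set T) phi v (a : R) :
  closed Y -> cont_on Y phi -> closed [set y | Y y /\ a <= nm (phi y - v)].
Proof.
move=> cY cphi y yC.
have Yy : Y y by apply: cY; apply: closure_subset yC => z [].
split=> //; rewrite leNgt; apply/negP => ay.
have e0 : 0 < (a - nm (phi y - v)) / 2 by rewrite divr_gt0// subr_gt0.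
have [z [[Yz za] /(_ Yz)]] := yC _ (cphi y Yy _ e0).
have := nm_tri BP (phi z) (phi y) v; lra.
Qed.

Lemma cont_on_proj (T : topologicalType) (A : set T) (p : T -> H) :
  cont_on A p -> (forall y, A y -> nehari (nehari_proj (p y)) /\ exists2 t : R, 0 < t & nehari_proj (p y) = t *: p y) ->
  cont_on A (fun y => nehari_proj (p y)).
Proof.
move=> cp Np y Ay e e0; have [N1 [t t0 E]] := Np y Ay.
have Nt : nehari (t *: p y) by rewrite -E.
have [eta eta0 etaP] := nehari_proj_cont t0 Nt e0.
apply: filterS (cp y Ay _ eta0) => z h; rewrite E; exact: (etaP _ h).2.2.
Qed.
End Nehari.

(** * Lusternik-Schnirelmann theory *)

Section Homotopy.
Variable R : realType.
Notation E := (pt R).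
Notation I01 := (`[0, 1]%classic : set R).

Definition homotopic_in (X Y : set E) (f g : E -> E) := exists h : R * E -> E,
  [/\ {within I01 `*` Y, continuous h},
      forall y, Y y -> h (0, y) = f y /\ h (1, y) = g y &
      forall t y, I01 t -> Y y -> X (h (t, y))].

Lemma homotopic_in_sub (X Y Y' : set E) f g : Y' `<=` Y ->
  homotopic_in X Y f g -> homotopic_in X Y' f g.
Proof.
move=> YY [h [ch h01 hX]]; exists h; split.
- by apply: continuous_subspaceW ch => -[t y] [/= ? /YY].
- by move=> y /YY; exact: h01.
- by move=> t y It /YY; exact: hX.
Qed.

Lemma within_comp (T T' T'' : topologicalType) (A : set T) (A' : set T') (k : T -> T') (h : T' -> T'') :
  continuous k -> (forall x, A x -> A' (k x)) ->
  (forall x, A' x -> h @ within A' (nbhs x) --> h x) ->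
  forall x, A x -> (h \o k) @ within A (nbhs x) --> h (k x).
Proof.
move=> ck kA ch x Ax; apply: cvg_trans (ch _ (kA _ Ax)) => P /= hP.
have := ck x _ hP; rewrite /= /nbhs /= /within /=.
by apply: filterS => z Pz Az; apply: Pz; exact: kA.
Qed.

(* Concatenation without gluing: the two halves are added and the common middle
   map subtracted, so that one of them cancels at every time. *)
Lemma homotopic_in_trans (X Y : set E) f g k :
  homotopic_in X Y f g -> homotopic_in X Y g k -> homotopic_in X Y f k.
Proof.
move=> [h1 [/subspace_continuousP c1 e1 X1]] [h2 [/subspace_continuousP c2 e2 X2]].
pose a (t : R) := Num.min (2 * t) 1; pose b (t : R) : R := Num.max (2 * t - 1) 0.
have aI t : I01 t -> I01 (a t).
  rewrite /= !in_itv/= /a le_min ge_min lexx orbT ler01 !andbT => /andP[t0 _].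
  by rewrite mulr_ge0.
have bI t : I01 t -> I01 (b t).
  rewrite /= !in_itv/= /b le_max ge_max lexx orbT ler01 andbT => /andP[_ t1] /=; lra.
have ca : continuous a.
  move=> t; apply: continuous_min; last exact: cst_continuous.
  by apply: continuousM; [exact: cst_continuous|exact: (fun x => cvg_id)].
have cb : continuous b.
  move=> t; apply: (continuous_max (f := fun t : R => 2 * t - 1 : R^o) (g := fun=> 0)); last exact: cst_continuous.
  apply: continuousB; last exact: cst_continuous.
  by apply: continuousM; [exact: cst_continuous|exact: (fun x => cvg_id)].
have I1 : I01 1 by rewrite /= in_itv/= ler01 lexx.
have I0 : I01 0 by rewrite /= in_itv/= ler01 lexx.
have cp (u : R -> R) : continuous u -> continuous (fun z : R * E => (u z.1, z.2)).
  move=> cu z P [[P1 P2] [/= k1 k2] hP].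
  exists (u @^-1` P1, P2) => /=; first by split => //; exact: cu.
  by move=> [t y] [/= ? ?]; apply: hP.
have W (u : R -> R) (h : R * E -> E) : continuous u -> (forall t, I01 t -> I01 (u t)) ->
    (forall x, (I01 `*` Y) x -> h @ within (I01 `*` Y) (nbhs x) --> h x) ->
    forall x, (I01 `*` Y) x -> (fun z : R * E => h (u z.1, z.2)) @ within (I01 `*` Y) (nbhs x) --> h (u x.1, x.2).
  move=> cu uI ch; apply: (@within_comp _ _ _ (I01 `*` Y) (I01 `*` Y) (fun z : R * E => (u z.1, z.2)) h) => //.
    exact: cp.
  by move=> [t y] [/= It Yy]; split => //=; exact: uI.
exists (fun z => h1 (a z.1, z.2) + h2 (b z.1, z.2) - h1 (1, z.2)); split.
- apply/subspace_continuousP => x Ax; apply: cvgB; first apply: cvgD.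
  + exact: (W a h1).
  + exact: (W b h2).
  + by apply: (W (fun=> 1) h1) => //; exact: cst_continuous.
- move=> y Yy; have [e10 e11] := e1 y Yy; have [e20 e21] := e2 y Yy; rewrite /= /a /b.
  have -> : Num.min (2 * 0) 1 = 0 :> R by rewrite mulr0 minElt ltr01.
  have -> : Num.max (2 * 0 - 1) 0 = 0 :> R by rewrite mulr0 sub0r maxElt ltrN10.
  have -> : Num.min (2 * 1) 1 = 1 :> R by rewrite minElt mulr1 ltNge ler1n.
  have -> : Num.max (2 * 1 - 1) 0 = 1 :> R.
    by rewrite mulr1 (_ : 2 - 1 = 1) ?maxElt ?ltNge ?ler01//=; lra.
  by rewrite e10 e11 e20 e21 addrK addrC addKr.
- move=> t y It Yy /=; have [e10 e11] := e1 y Yy; have [e20 e21] := e2 y Yy.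
  have [t2|t2] := leP (2 * t) 1.
    have -> : b t = 0 by rewrite /b maxEle subr_le0 t2.
    by rewrite e20 e11 addrK; apply: X1 => //; exact: aI.
  have -> : a t = 1 by rewrite /a minElt ltNge (ltW t2).
  by rewrite addrC addKr; apply: X2 => //; exact: bI.
Qed.

(** Peeling off one closed contractible set at a time matches the deformation, where each critical
    point accounts for one set. [coverable_cat] compares this with the indexed families of
    [cat_ge]. *)
Fixpoint coverable (X Y : set E) (k : nat) : Prop :=
  if k is k'.+1 then
    exists C, [/\ closed C, C `<=` X, contractible_in X C & coverable X (Y `\` C) k']
  else Y `<=` set0.

Lemma coverable_sub X Y Y' k : Y' `<=` Y -> coverable X Y k -> coverable X Y' k.
Proof.
elim: k Y Y' => [|k IH] Y Y' YY /=; first exact: subset_trans.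
by move=> [C [? ? ? cY]]; exists C; split => //; apply: IH cY => y [/YY ? ?]; split.
Qed.

Lemma coverable_leq X Y k k' : X !=set0 -> (k <= k')%N -> coverable X Y k -> coverable X Y k'.
Proof.
move=> [x0 Xx0]; elim: k' k Y => [|k' IH] [|k] Y //= kk; last first.
  by move=> [C [? ? ? cY]]; exists C; split => //; exact: IH cY.
(* Padding uses the empty set, which is contractible in [X] as soon as [X] has a point to contract
   to. *)
move=> Y0; exists set0; split; [exact: closed0|by []| |by apply: (IH 0%N) => //= y [/Y0]].
exists (fun=> x0), x0; split => //; split; last by split => // ? ? ? [].
by apply/subspace_continuousP => x [_ []].
Qed.

Lemma coverable_seq X Y k : coverable X Y k -> exists s : seq (set E), [/\ size s = k,
  (forall i, (i < k)%N -> [/\ closed (nth set0 s i), nth set0 s i `<=` X & contractible_in X (nth set0 s i)]) &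
  forall y, Y y -> exists2 i, (i < k)%N & nth set0 s i y].
Proof.
elim: k Y => [|k IH] Y /=; first by move=> Y0; exists [::]; split => // y /Y0.
move=> [C [cC CX kC /IH[s [ss sP sY]]]]; exists (C :: s); split => /=; first by rewrite ss.
  by case=> [|i] //= ik; exact: sP.
move=> y Yy; have [Cy|Cy] := pselect (C y); first by exists 0%N.
by have [i ik iy] := sY y (conj Yy Cy); exists i.+1.
Qed.

Lemma coverable_cat X Y k n : coverable X Y k -> cat_ge X Y n -> (n <= k)%N.
Proof.
move=> /coverable_seq[s [ss sP sY]] /(_ k (fun i => nth set0 s i)); apply.
  by move=> i; have [? ? ?] := sP i (ltn_ord i).
by move=> y /sY[i ik iy]; exists (Ordinal ik).
Qed.

Section LSCategory.
Variables (H : lmodType R) (B : H -> H -> R) (J : H -> R) (D : H -> H).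
Hypothesis BP : psd_form B.
Notation nm := (nm B).
Variables (c r b rho : R).
Hypothesis dJ : unif_diff B J D.
Hypothesis ray : ray_cond B D c.
Hypothesis c0 : 0 < c.
Hypothesis r0 : 0 < r.
Hypothesis Nr : forall w, nehari B D w -> r <= nm w.
Hypothesis Nb : forall w, nehari B D w -> J w <= b -> nm w <= rho.
Notation neh := (nehari B D).
Notation NL := (nehari_le B J D b).
Notation proj := (nehari_proj B D).
Hypothesis Jpos : forall w, neh w -> 0 < J w.
Hypothesis PS : forall w : nat -> H, (forall n, NL (w n)) ->
  (forall n, nm (D (w n)) <= n.+1%:R^-1) ->
  exists l, [/\ neh l, nm (D l) = 0 &
    forall e : R, 0 < e -> forall N, exists2 n, (N <= n)%N & nm (w n - l) <= e].

Variables (X : set E) (beta : H -> E).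
Hypothesis betaX : forall w, NL w -> X (beta w).
Hypothesis beta_cont : forall w, NL w -> forall e : R, 0 < e -> exists2 eta : R, 0 < eta &
  forall w', NL w' -> nm (w' - w) <= eta -> `|beta w' - beta w| <= e.

(** Homotopies in [X] come from paths of functions: as long as the path stays in the sublevel,
    [beta] keeps its image inside [X]. *)
Lemma homotopic_in_path (Y : set E) (p : R * E -> H) (f g : E -> E) :
  cont_on B (I01 `*` Y) p -> (forall t y, I01 t -> Y y -> NL (p (t, y))) ->
  (forall y, Y y -> f y = beta (p (0, y)) /\ g y = beta (p (1, y))) -> homotopic_in X Y f g.
Proof.
move=> cp Np fg; exists (beta \o p); split.
- apply/subspace_continuousP => -[t y] [/= It Yy]; apply/cvgrPdist_le => e e0.
  have [eta eta0 etaP] := beta_cont (Np t y It Yy) e0.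
  have h := cp (t, y) (conj It Yy) eta eta0.
  apply: (@filterS _ (nbhs (t, y)) _ (fun z => (I01 `*` Y) z -> nm (p z - p (t, y)) <= eta)) h.
  move=> -[t' y'] hz It'; rewrite distrC.
  by apply: etaP; [apply: Np; case: It'|exact: hz].
- by move=> y Yy; have [-> ->] := fg y Yy.
- by move=> t y It Yy; apply: betaX; exact: Np.
Qed.

Variable vs : seq H.
Hypothesis vsP : forall v, v \in vs -> NL v /\ nm (D v) = 0.
Hypothesis vs_crit : forall w, NL w -> nm (D w) = 0 -> exists2 v, v \in vs & nm (w - v) = 0.

Lemma J_crit_cont v (e : R) : nm (D v) = 0 -> 0 < e -> exists2 eta : R, 0 < eta &
  forall w, nm (w - v) <= eta -> `|J w - J v| <= e.
Proof.
move=> Dv e0; have [t t0 tP] := dJ (nm v) ltr01.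
exists (Num.min t e); first by rewrite lt_min t0.
move=> w; rewrite le_min => /andP[wt we].
have := tP v (w - v) (lexx _) wt.
have -> : v + (w - v) = w by rewrite addrC subrK.
by rewrite (nm_eq0 BP _ Dv) subr0 mul1r => /le_trans; apply.
Qed.

Lemma J_eq w v : nm (D v) = 0 -> nm (w - v) = 0 -> J w = J v.
Proof.
move=> Dv wv; apply/eqP; rewrite -subr_eq0 -normr_le0; apply/ler_addgt0Pl => e e0; rewrite addr0.
by have [eta eta0] := J_crit_cont Dv e0; apply; rewrite wv ltW.
Qed.

Lemma crit_ball v (lev : R) : v \in vs -> J v <= lev -> lev < b -> exists2 eta : R, 0 < eta &
  forall u, nm (u - v) <= eta -> NL (proj u) /\ exists2 t : R, 0 < t & proj u = t *: u.
Proof.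
move=> /vsP[[Nv Jv] Dv] vl lb.
have e0 : 0 < b - J v by rewrite subr_gt0 (le_lt_trans vl).
have [e1 e10 e1P] := J_crit_cont Dv e0.
have N1 : neh (1 *: v) by rewrite scale1r.
have [eta eta0 etaP] := nehari_proj_cont BP dJ ray c0 r0 Nr ltr01 N1 e10.
exists eta => // u /etaP[ut [Np]]; rewrite scale1r => /e1P.
by rewrite ler_norml => /andP[_ h]; split => //; split => //; rewrite -(lerD2r (- J v)).
Qed.

(** Otherwise there is a Palais-Smale sequence with levels tending to [lev]. Its limit point is
    critical at level [lev], hence equivalent to some [v] in [vs], while the sequence stays at
    distance [rr] from [v]. *)
Lemma crit_gap (lev rr : R) : 0 < rr -> exists e0 kap : R, [/\ 0 < e0, 0 < kap &
  forall w, NL w -> `|J w - lev| <= e0 ->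
    (forall v, v \in vs -> J v = lev -> rr <= nm (w - v)) -> kap <= nm (D w)].
Proof.
move=> rr0; apply: contrapT => h.
have wE n : exists w, [/\ NL w, `|J w - lev| <= n.+1%:R^-1,
    (forall v, v \in vs -> J v = lev -> rr <= nm (w - v)) & nm (D w) <= n.+1%:R^-1].
  apply: contrapT => hn; apply: h; exists n.+1%:R^-1, n.+1%:R^-1; split; rewrite ?invr_gt0//.
  move=> w Nw Jw wv; rewrite leNgt; apply/negP => Dw; apply: hn; exists w; split => //.
  exact: ltW.
have [w wP] := choice wE.
have [||l [Nl Dl lP]] := PS (w := w); first by move=> n; have [] := wP n.
  by move=> n; have [] := wP n.
have Jl : J l = lev.
  apply/eqP; rewrite -subr_eq0 -normr_le0; apply/ler_addgt0Pl => e e0; rewrite addr0.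
  have e2 : 0 < e / 2 by rewrite divr_gt0.
  have [eta eta0 etaP] := J_crit_cont Dl e2.
  have [N NP] := small_inv e2; have [n Nn wn] := lP _ eta0 N.
  have := etaP _ wn; have [_ + _ _] := wP n; have := NP n Nn.
  rewrite (distrC (J (w n)) (J l)) => h1 h2 h3.
  have := ler_normD (J l - J (w n)) (J (w n) - lev); rewrite addrA subrK.
  by move=> /le_trans; apply; rewrite [leRHS]splitr; apply: lerD => //; exact: le_trans h1.
have Jlb : J l <= b.
  apply/ler_addgt0Pl => e e0; have [eta eta0 etaP] := J_crit_cont Dl e0.
  have [n _ wn] := lP _ eta0 0%N; have [[_ Jwn] _ _ _] := wP n.
  have := etaP _ wn; rewrite ler_norml => /andP[h1 _]; move: h1 Jwn; lra.
have [v vv lv] := vs_crit (conj Nl Jlb) Dl.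
have [_ Dv] := vsP vv.
have Jv : J v = lev by rewrite -(J_eq Dv lv).
have [n _ wn] := lP _ (divr_gt0 rr0 (ltr0n R 2)) 0%N.
have [_ _ /(_ v vv Jv) wv _] := wP n.
have := nm_tri BP (w n) l v; rewrite lv addr0.
by move=> h1; move: wv wn rr0 h1; lra.
Qed.

Lemma cont_on_line (Y : set E) (phi psi : E -> H) (a : R) :
  cont_on B Y phi -> cont_on B Y psi ->
  cont_on B (I01 `*` Y) (fun z => phi z.2 + (a * z.1) *: psi z.2).
Proof.
move=> cphi cpsi [t0 y0] [/= It Yy] e e0.
pose K : R := `|a| + 1; pose L := nm (psi y0) + 1.
have K0 : 0 < K by rewrite /K ltr_wpDl.
have L0 : 0 < L by rewrite ltr_wpDl// nm_ge0.
have e3 : 0 < e / 3 by rewrite divr_gt0.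
have e4 : 0 < e / 3 / K by rewrite divr_gt0.
have e5 : 0 < e / 3 / K / L by rewrite divr_gt0.
have hphi : nbhs y0 (fun z => Y z -> nm (phi z - phi y0) <= e / 3) := cphi y0 Yy _ e3.
have hpsi : nbhs y0 (fun z => Y z -> nm (psi z - psi y0) <= e / 3 / K) := cpsi y0 Yy _ e4.
exists ([set t | `|t0 - t| < e / 3 / K / L],
  [set z | (Y z -> nm (phi z - phi y0) <= e / 3) /\ (Y z -> nm (psi z - psi y0) <= e / 3 / K)]).
  split=> /=; last exact: filterI.
  exact: (nbhsx_ballx t0 _ e5).
move=> [t y] [/= tt [h1 h2]] [/= It' Yy'].
have -> : phi y + (a * t) *: psi y - (phi y0 + (a * t0) *: psi y0) =
  (phi y - phi y0) + ((a * t) *: (psi y - psi y0) + (a * (t - t0)) *: psi y0).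
  by rewrite opprD addrACA; congr (_ + _); rewrite mulrBr scalerBl scalerBr addrA subrK.
apply: le_trans (nmD BP _ _) _; apply: le_trans (lerD (h1 Yy') (nmD BP _ _)) _.
rewrite !nmZ// !normrM.
have t1 : `|t| <= 1.
  by move: It'; rewrite in_itv/= => /andP[? ?]; rewrite ger0_norm.
have a1 : `|a| * `|t| * nm (psi y - psi y0) <= e / 3.
  apply: (@le_trans _ _ (K * (e / 3 / K))); last by rewrite mulrC divfK// gt_eqF.
  apply: ler_pM; rewrite ?mulr_ge0 ?nm_ge0//; last exact: h2.
  by apply: (@le_trans _ _ (`|a| * 1)); [rewrite ler_wpM2l|rewrite mulr1 /K lerDl].
have a2 : `|a| * `|t - t0| * nm (psi y0) <= e / 3.
  apply: (@le_trans _ _ (K * (e / 3 / K / L) * L)); last first.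
    by rewrite mulrA -mulrA mulVf ?gt_eqF// mulr1 mulrC divfK// gt_eqF.
  apply: ler_pM; rewrite ?mulr_ge0 ?nm_ge0//; last by rewrite /L lerDl.
  by apply: ler_pM => //; [rewrite /K lerDl|rewrite distrC ltW].
by move: a1 a2; lra.
Qed.

(* Proved for all levels [lev < b] by real induction. *)
Definition cover_prop (lev : R) := forall (Y : set E) (phi : E -> H), closed Y -> Y `<=` X ->
  cont_on B Y phi -> (forall y, Y y -> NL (phi y) /\ J (phi y) <= lev) ->
  homotopic_in X Y id (beta \o phi) -> coverable X Y (count (fun v => J v <= lev) vs).

Lemma cont_on_sub (Y Y' : set E) (phi : E -> H) : Y' `<=` Y -> cont_on B Y phi -> cont_on B Y' phi.
Proof.
move=> YY cphi y Yy e e0.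
have h : nbhs y (fun z => Y z -> nm (phi z - phi y) <= e) := cphi y (YY _ Yy) e e0.
by apply: filterS h => z hz /YY.
Qed.

Lemma cont_on_cst (Y : set E) v : cont_on B Y (fun=> v).
Proof. by move=> y Yy e e0; apply: filterE => z; rewrite subrr nm0// ltW. Qed.

Lemma cont_onB (Y : set E) (phi psi : E -> H) : cont_on B Y phi -> cont_on B Y psi ->
  cont_on B Y (fun y => phi y - psi y).
Proof.
move=> c1 c2 y Yy e e0; have e2 : 0 < e / 2 by rewrite divr_gt0.
have h1 : nbhs y (fun z => Y z -> nm (phi z - phi y) <= e / 2) := c1 y Yy _ e2.
have h2 : nbhs y (fun z => Y z -> nm (psi z - psi y) <= e / 2) := c2 y Yy _ e2.
apply: filterS (filterI h1 h2) => z [k1 k2] Yz.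
have -> : phi z - psi z - (phi y - psi y) = (phi z - phi y) - (psi z - psi y).
  by rewrite !opprB [psi y - phi y]addrC addrACA [- psi z + _]addrC.
by rewrite (le_trans (nmB BP _ _))// [leRHS]splitr lerD ?k1 ?k2.
Qed.

(** Each [v] contributes the closed set of points sent by [phi] into its ball. The segments towards
    [v], projected to the Nehari set and mapped by [beta], contract that set in [X], once the
    identity has been replaced by [beta \o phi]. *)
Lemma cover_balls (rr : R) (l : seq H) (Y : set E) (phi : E -> H) k : closed Y -> Y `<=` X ->
  cont_on B Y phi -> (forall y, Y y -> NL (phi y)) -> homotopic_in X Y id (beta \o phi) ->
  {in l, forall v, NL v /\ forall u, nm (u - v) <= rr -> NL (proj u) /\ exists2 t : R, 0 < t & proj u = t *: u} ->
  coverable X [set y | Y y /\ {in l, forall v, rr <= nm (phi y - v)}] k ->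
  coverable X Y (size l + k).
Proof.
elim: l Y => [|v l IH] Y cY YX cphi Nphi hphi lP; first by apply: coverable_sub => y Yy; split.
move=> cov; have [Nv vP] := lP v (mem_head _ _).
pose C := [set y | Y y /\ nm (phi y - v) <= rr].
have CY : C `<=` Y by move=> y [].
exists C; split.
- exact: closed_sublevel.
- exact: subset_trans YX.
- have [h [ch h01 hX]] : homotopic_in X C id (fun=> beta v).
    apply: homotopic_in_trans (homotopic_in_sub CY hphi) _.
    have ball t y : I01 t -> C y -> nm (phi y + (1 * t) *: (v - phi y) - v) <= rr.
      rewrite /= in_itv/= => /andP[t0 t1] [_ yv]; apply: le_trans yv.
      have -> : phi y + (1 * t) *: (v - phi y) - v = (1 - t) *: (phi y - v).
        by rewrite mul1r -(opprB (phi y)) scalerN scalerBl scale1r addrAC.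
      by rewrite nmZ// ger0_norm ?subr_ge0// ler_piMl ?nm_ge0// lerBlDr lerDl.
    apply: (@homotopic_in_path _ (fun z => proj (phi z.2 + (1 * z.1) *: (v - phi z.2)))).
    + apply: (cont_on_proj BP dJ ray c0 r0 Nr).
        apply: (@cont_on_line C phi (fun y => v - phi y) 1); first exact: cont_on_sub cphi.
        by apply: cont_onB; [exact: cont_on_cst|exact: cont_on_sub cphi].
      by move=> [t y] [It Cy]; have [[? _] ?] := vP _ (ball _ _ It Cy).
    + by move=> t y It Cy; have [] := vP _ (ball _ _ It Cy).
    + move=> y [Yy _] /=; rewrite mulr0 scale0r addr0 mulr1 scale1r addrC subrK.
      by rewrite !(nehari_proj_id BP ray c0)//; [case: Nv|case: (Nphi _ Yy)].
  exists h, (beta v); split; first exact: betaX.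
  by split => //; split => // y /h01.
- have IH' := IH [set y | Y y /\ rr <= nm (phi y - v)].
  apply: (@coverable_sub _ [set y | Y y /\ rr <= nm (phi y - v)]).
    by move=> y [Yy nC]; split => //; rewrite leNgt; apply/negP => /ltW h; apply: nC.
  apply: IH'.
  + exact: closed_superlevel.
  + by move=> y [/YX].
  + by apply: cont_on_sub cphi => y [].
  + by move=> y [/Nphi].
  + by apply: homotopic_in_sub hphi => y [].
  + by move=> u ul; apply: lP; rewrite inE ul orbT.
  + apply: coverable_sub cov => y [[Yy yv] yl]; split => // u; rewrite inE => /orP[/eqP->//|].
    exact: yl.
Qed.

Lemma cont_on_descent (kap C : R) (Y : set E) (phi : E -> H) : 0 < kap -> 0 < C ->
  (forall w, NL w -> nm (D w) <= C) -> (forall y, Y y -> NL (phi y)) ->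
  cont_on B Y phi -> cont_on B Y (fun y => - descent B D kap (phi y)).
Proof.
move=> k0 C0 DC Nphi cphi y Yy e e0.
have e1 : 0 < e / (2 * C) by rewrite divr_gt0// mulr_gt0.
have [t t0 tP] := unif_grad BP dJ rho e1.
have h : nbhs y (fun z => Y z -> nm (phi z - phi y) <= t) := cphi y Yy _ t0.
apply: filterS h => z hz Yz.
rewrite -opprD nmN//; apply: le_trans (descent_lip BP k0 (DC _ (Nphi _ Yy)) (DC _ (Nphi _ Yz))) _.
rewrite mulrC -ler_pdivlMr ?mulr_gt0//.
have -> : phi z = phi y + (phi z - phi y) by rewrite addrC subrK.
by apply: tP; [case: (Nphi _ Yy) => N1 J1; exact: Nb|exact: hz].
Qed.

(** Points sent near a critical point of level [lev] are treated by [cover_balls]. On the remaining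
    closed set one descent step leads below [lev - e], where the induction hypothesis applies and
    counts only critical points of lower level. *)
Lemma cover_step (lev : R) : lev < b -> X !=set0 -> (forall l', l' < lev -> cover_prop l') ->
  exists2 e : R, 0 < e & forall l', l' <= lev + e -> cover_prop l'.
Proof.
move=> levb X0 IH.
pose l := [seq v <- vs | J v == lev].
have [rr rr0 rrP] : exists2 rr : R, 0 < rr & {in l, forall v, forall u, nm (u - v) <= rr ->
    NL (proj u) /\ exists2 t : R, 0 < t & proj u = t *: u}.
  have : {subset l <= l} by [].
  elim: {1 3}l => [_|v l' IHl vl]; first by exists 1.
  have [|rr rr0 rrP] := IHl; first by move=> u ul; apply: vl; rewrite inE ul orbT.
  have := vl v (mem_head _ _); rewrite mem_filter => /andP[/eqP Jv vv].
  have [eta eta0 etaP] := crit_ball vv (ltac:(by rewrite Jv) : J v <= lev) levb.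
  exists (Num.min rr eta); first by rewrite lt_min rr0.
  move=> u; rewrite inE => /orP[/eqP->|ul] z; rewrite le_min => /andP[z1 z2]; first exact: etaP.
  exact: (rrP u ul).
have [e0 [kap [e00 k0 gap]]] := crit_gap lev rr0.
have [tau [sig [C [tau0 sig0 C0 DC step]]]] := descent_step BP dJ ray c0 r0 Nr Nb k0.
(* [e <= e0] keeps the band around [lev] in the range of [crit_gap]; [2 * e <= sig] lets a single
   step cross it. *)
pose e := Num.min e0 (sig / 2).
have ep : 0 < e by rewrite lt_min e00 divr_gt0.
have ee0 : e <= e0 by rewrite /e ge_min lexx.
have es : e <= sig / 2 by rewrite /e ge_min lexx orbT.
exists e => // l' l'e; have [ll|ll] := ltP l' lev; first exact: IH.
move=> Y phi cY YX cphi Nphi hphi.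
have NLphi y : Y y -> NL (phi y) by case/Nphi.
apply: (@coverable_leq _ _ (size l + count (fun v => J v <= lev - e) vs)) => //.
  rewrite size_filter -count_predUI.
  have -> : count (predI (fun v => J v == lev) (fun v => J v <= lev - e)) vs = 0%N.
    apply/eqP; rewrite -leqn0 leqNgt -has_count; apply/negP => /hasP[v _ /= /andP[/eqP ->]].
    by rewrite lerBrDr gerDl leNgt ep.
  rewrite addn0; apply: sub_count => v /= /orP[/eqP->//|h].
  by apply: le_trans h _; move: ll ep; lra.
pose Y' := [set y | Y y /\ {in l, forall v, rr <= nm (phi y - v)}].
have Y'Y : Y' `<=` Y by move=> y [].
apply: (@cover_balls rr l Y phi) => //.
  move=> v vl; split; last exact: rrP.
  by move: vl; rewrite mem_filter => /andP[_ /vsP[]].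
have cY' : closed Y'.
  have -> : Y' = Y `&` \bigcap_(v in [set v | v \in l]) [set y | Y y /\ rr <= nm (phi y - v)].
    apply/seteqP; split => [y [Yy yl]|y [Yy yl]]; split => // v vl; first by split => //; exact: yl.
    by have [] := yl v vl.
  apply: closedI => //; apply: closed_bigI => v _; exact: closed_superlevel.
pose step_map (t : R) (y : E) := phi y + (tau * t) *: - descent B D kap (phi y).
have stepE t y : step_map t y = phi y - (tau * t) *: descent B D kap (phi y).
  by rewrite /step_map scalerN.
have tt (t : R) : I01 t -> 0 <= tau * t <= tau.
  by rewrite /= in_itv/= => /andP[h0 h1]; rewrite mulr_ge0 ?(ltW tau0)//= ler_piMr ?(ltW tau0).
have stepP t y : I01 t -> Y y -> NL (proj (step_map t y)) /\
    (exists2 s : R, 0 < s & proj (step_map t y) = s *: step_map t y) /\ J (proj (step_map t y)) <= J (phi y).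
  by move=> It Yy; rewrite stepE; have [h _] := step _ (NLphi y Yy); exact: h (tt t It).
have cline : cont_on B (I01 `*` Y) (fun z => proj (step_map z.1 z.2)).
  apply: (cont_on_proj BP dJ ray c0 r0 Nr).
    apply: (@cont_on_line Y phi (fun y => - descent B D kap (phi y)) tau) => //.
    exact: (cont_on_descent k0 C0).
  by move=> [t y] [It Yy]; have [[N1 _] [s1 _]] := stepP t y It Yy.
have I1 : I01 (1 : R) by rewrite /= in_itv/= ler01 lexx.
have I0 : I01 (0 : R) by rewrite /= in_itv/= ler01 lexx.
apply: (IH (lev - e) _ Y' (fun y => proj (step_map 1 y))) => //.
- by rewrite ltrBlDr ltrDl.
- exact: subset_trans YX.
- move=> y Yy d d0.
  have [[A1 A2] [/= a1 a2] h] : nbhs ((1 : R), y) (fun z => (I01 `*` Y) z -> nm (proj (step_map z.1 z.2) - proj (step_map 1 y)) <= d).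
    by apply: (cline (1, y)) => //; split => //; exact: Y'Y.
  by apply: filterS a2 => z Az Y'z; apply: (h (1, z)); split => //=; [exact: nbhs_singleton|exact: Y'Y].
- move=> y Y'y; have Yy := Y'Y y Y'y; have [N1 [_ J1]] := stepP 1 y I1 Yy; split => //.
  have [Jlow|Jhigh] := leP (J (phi y)) (lev - e); first exact: le_trans J1 Jlow.
  have [_ Jl'] := Nphi y Yy.
  have kD : kap <= nm (D (phi y)).
    apply: gap; [exact: NLphi| |].
      by rewrite ler_norml; apply/andP; split; move: Jhigh Jl' l'e ee0; lra.
    by move=> v vv Jv; have [_] := Y'y; apply; rewrite mem_filter vv Jv eqxx.
  have [_ /(_ kD)] := step _ (NLphi y Yy); rewrite stepE mulr1.
  by move: Jl' l'e es; lra.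
- apply: homotopic_in_trans (homotopic_in_sub Y'Y hphi) _.
  apply: (homotopic_in_sub Y'Y).
  apply: (@homotopic_in_path _ (fun z => proj (step_map z.1 z.2))) => //.
    by move=> t y It Yy; have [] := stepP t y It Yy.
  move=> y Yy; split => //=; congr beta.
  by rewrite stepE mulr0 scale0r subr0 (nehari_proj_id BP ray c0)//; case: (NLphi y Yy).
Qed.

Theorem ls_cover (lev : R) : lev < b -> X !=set0 -> cover_prop lev.
Proof.
move=> levb X0.
(* The induction starts at level [0], below which no function of the Nehari set lies because [J] is
   positive there. *)
pose A := [set l : R | l <= lev /\ forall l', l' <= l -> cover_prop l'].
have cov0 l' : l' <= 0 -> cover_prop l'.
  move=> l0 Y phi _ _ _ Nphi _.
  apply: (@coverable_leq _ _ 0) => //= y /Nphi[[Ny _] Jy].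
  by have := lt_le_trans (Jpos Ny) (le_trans Jy l0); rewrite ltxx.
have [lev0|lev0] := leP lev 0; first exact: cov0.
have A0 : A 0 by split; [exact: ltW|exact: cov0].
have supA : has_sup A by split; [exists 0|exists lev => l []].
pose s := sup A.
have slev : s <= lev by apply: ge_sup; [exists 0|move=> l []].
have IHs l' : l' < s -> cover_prop l'.
  move=> l's; have ls0 : 0 < s - l' by rewrite subr_gt0.
  have [l [_ lP]] := sup_adherent ls0 supA; rewrite opprB addrC subrK => /ltW; exact: lP.
have [e e0 eP] := cover_step (le_lt_trans slev levb) X0 IHs.
have [sl|sl] := leP lev (s + e); first exact: eP.
have : A (s + e) by split; [exact: ltW|exact: eP].
by move=> /(ub_le_sup (proj2 supA)); rewrite -/s leNgt ltrDl e0.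
Qed.
End LSCategory.
End Homotopy.

(** * Fubini, Tonelli and products of square integrable functions *)

Section FubiniReal.
Context d1 d2 (T1 : measurableType d1) (T2 : measurableType d2) (R : realType).
Variables (m1 : {sigma_finite_measure set T1 -> \bar R}) (m2 : {sigma_finite_measure set T2 -> \bar R}).
Local Notation m12 := (m1 \x m2)%E.
Implicit Types F : T1 * T2 -> R.

Lemma L1_tonelli F : measurable_fun setT F -> (forall z, 0 <= F z) ->
  (\int[m1]_x \int[m2]_y (F (x, y))%:E < +oo)%E -> L1 m12 F.
Proof.
move=> mF F0 fin; apply: L1_fin => //.
rewrite fubini_tonelli1//; exact: mEFin.
Qed.

(** In an iterated real integral a divergent inner integral counts as [0]. For integrable [F] such
    slices form a null set, so the iterated integrals used in [energy] and [bilin] agree with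
    integrals over pairs of points. *)
Lemma L1_fubini F : L1 m12 F ->
  [/\ L1 m1 (fun x => Int m2 (fun y => F (x, y))),
      Int m1 (fun x => Int m2 (fun y => F (x, y))) = Int m12 F &
      {ae m1, forall x, L1 m2 (fun y => F (x, y))}].
Proof.
move=> LF; pose f := EFin \o F.
have iF : m1.-integrable setT (fubini_F m2 f) by exact: integrable_fubini_F.
have ae1 : {ae m1, forall x, L1 m2 (fun y => F (x, y))} by exact: ae_integrable1 LF.
have E x : Int m2 (fun y => F (x, y)) = fine (fubini_F m2 f x) by [].
have mfine : measurable_fun setT (fun x => fine (fubini_F m2 f x)).
  by apply: measurableT_comp => //; exact: (measurable_int m1 iF).
have L : L1 m1 (fun x => fine (fubini_F m2 f x)).
  apply: le_integrable iF => //; first exact: mEFin.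
  by move=> x _ /=; case: (fubini_F m2 f x) => [r||] //=; rewrite normr0 leey.
split => //.
apply: EFin_inj; rewrite -!L1_EFin// -(integral12_prod_meas1 LF).
apply: ae_eq_integral => //; [exact: mEFin|exact: (measurable_int m1 iF)|].
apply: filterS ae1 => x Lx _; rewrite E fineK//.
exact: (integrable_fin_num measurableT Lx).
Qed.

End FubiniReal.

Section Swap.
Context d (T : measurableType d) (R : realType) (m : {sigma_finite_measure set T -> \bar R}).

Lemma L1_swap (F : T * T -> R) : (forall z, 0 <= F z) -> L1 (m \x m)%E F ->
  L1 (m \x m)%E (fun z => F (z.2, z.1)) /\
  Int (m \x m)%E (fun z => F (z.2, z.1)) = Int (m \x m)%E F.
Proof.
move=> F0 LF; have mF := L1_meas LF.
have mF' : measurable_fun setT (fun z : T * T => F (z.2, z.1)).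
  apply: (measurableT_comp mF); apply: measurable_fun_pair; [exact: measurable_snd|exact: measurable_fst].
have E : (\int[m \x m]_z (F (z.2, z.1))%:E = \int[m \x m]_z (F z)%:E)%E.
  rewrite (@fubini_tonelli1 _ _ _ _ _ m m (fun z => (F (z.2, z.1))%:E) (mEFin mF')); last by move=> z; rewrite lee_fin.
  by rewrite (@fubini_tonelli2 _ _ _ _ _ m m (fun z => (F z)%:E) (mEFin mF)); last by move=> z; rewrite lee_fin.
split; last by rewrite /Int /Rintegral E.
by apply: L1_fin => //; rewrite E; exact: L1_finP.
Qed.
End Swap.

Section L2.
Context d (T : measurableType d) (R : realType) (mu : {measure set T -> \bar R}).

Lemma L1_mul (f g : T -> R) : measurable_fun setT f -> measurable_fun setT g ->
  L1 mu (fun x => f x ^+ 2) -> L1 mu (fun x => g x ^+ 2) -> L1 mu (fun x => f x * g x).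
Proof.
move=> mf mg Lf Lg; apply: (@L1_dom _ _ _ _ _ (fun x => f x ^+ 2 + g x ^+ 2)).
- exact: measurable_funM.
- exact: L1D.
- move=> x; rewrite normrM -(real_normK (num_real (f x))) -(real_normK (num_real (g x))).
  have := sqr_ge0 (`|f x| - `|g x|); rewrite sqrrB.
  have := sqr_ge0 `|f x|; have := sqr_ge0 `|g x|; lra.
Qed.

Lemma L1_wmul (w f g : T -> R) : (forall x, 0 <= w x) ->
  measurable_fun setT w -> measurable_fun setT f -> measurable_fun setT g ->
  L1 mu (fun x => w x * f x ^+ 2) -> L1 mu (fun x => w x * g x ^+ 2) ->
  L1 mu (fun x => w x * f x * g x).
Proof.
move=> w0 mw mf mg Lf Lg; apply: (@L1_dom _ _ _ _ _ (fun x => w x * f x ^+ 2 + w x * g x ^+ 2)).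
- by apply: measurable_funM => //; exact: measurable_funM.
- exact: L1D.
- move=> x; rewrite -mulrA normrM ger0_norm// -mulrDr ler_wpM2l//.
  rewrite normrM -(real_normK (num_real (f x))) -(real_normK (num_real (g x))).
  have := sqr_ge0 (`|f x| - `|g x|); rewrite sqrrB.
  have := sqr_ge0 `|f x|; have := sqr_ge0 `|g x|; lra.
Qed.
End L2.

(** * Measurability and norms in three dimensions *)

Section R3.
Variable R : realType.
Notation RR := (measurableTypeR R).
Notation T3 := (RR * RR * RR)%type.

Lemma mR d (T : measurableType d) (f : T -> RR) : measurable_fun setT f -> measurable_fun setT (f : T -> R).
Proof. by []. Qed.

Lemma m_c1 : measurable_fun setT (fun x : T3 => x.1.1 : R).
Proof. by apply: mR; apply: (measurableT_comp measurable_fst); exact: measurable_fst. Qed.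
Lemma m_c2 : measurable_fun setT (fun x : T3 => x.1.2 : R).
Proof. by apply: mR; apply: (measurableT_comp measurable_snd); exact: measurable_fst. Qed.
Lemma m_c3 : measurable_fun setT (fun x : T3 => x.2 : R).
Proof. by apply: mR; exact: measurable_snd. Qed.

Lemma m_fst (u : T3 -> R) : measurable_fun setT u -> measurable_fun setT (fun z : T3 * T3 => u z.1).
Proof. by move=> mu; apply: (measurableT_comp mu); exact: measurable_fst. Qed.
Lemma m_snd (u : T3 -> R) : measurable_fun setT u -> measurable_fun setT (fun z : T3 * T3 => u z.2).
Proof. by move=> mu; apply: (measurableT_comp mu); exact: measurable_snd. Qed.

Lemma m_enorm d (T : measurableType d) (f : T -> pt R) :
  measurable_fun setT (fun t => (f t).1.1) -> measurable_fun setT (fun t => (f t).1.2) ->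
  measurable_fun setT (fun t => (f t).2) -> measurable_fun setT (fun t => enorm (f t)).
Proof.
move=> m1 m2 m3; rewrite /enorm.
apply: (measurableT_comp (f := @Num.sqrt R)).
  by apply: continuous_measurable_fun; exact: sqrt_continuous.
by apply: measurable_funD; [apply: measurable_funD|]; exact: measurable_funX.
Qed.

Lemma m_gag (s : R) : measurable_fun setT (fun z : T3 * T3 => gag_kernel s z.1 z.2).
Proof.
have h : measurable_fun setT (fun z : T3 * T3 => enorm (psub z.1 z.2 : pt R)).
  apply: m_enorm => /=; apply: measurable_funB.
  - exact: (m_fst m_c1). - exact: (m_snd m_c1). - exact: (m_fst m_c2).
  - exact: (m_snd m_c2). - exact: (m_fst m_c3). - exact: (m_snd m_c3).
rewrite /gag_kernel; exact: (measurableT_comp (measurable_powR (3 + 2 * s)) h).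
Qed.

Lemma m_gagV (s : R) : measurable_fun setT (fun z : T3 * T3 => (gag_kernel s z.1 z.2)^-1).
Proof.
have -> : (fun z : T3 * T3 => (gag_kernel s z.1 z.2)^-1) = (fun z => (gag_kernel s z.1 z.2) `^ (-1)).
  by apply/funext => z; rewrite powR_inv1 ?powR_ge0.
exact: (measurableT_comp (measurable_powR (-1)) (m_gag s)).
Qed.

Lemma enorm_ge0 (x : pt R) : 0 <= enorm x. Proof. exact: sqrtr_ge0. Qed.
Lemma enorm_sq (x : pt R) : enorm x ^+ 2 = x.1.1 ^+ 2 + x.1.2 ^+ 2 + x.2 ^+ 2.
Proof. by rewrite sqr_sqrtr// !addr_ge0// sqr_ge0. Qed.

Lemma psubE (x y : pt R) : psub x y = x - y.
Proof. by case: x => [[? ?] ?]; case: y => [[? ?] ?]. Qed.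

Lemma norm_ptE (x : pt R) : `|x| = Num.max (Num.max `|x.1.1| `|x.1.2|) `|x.2|.
Proof. by []. Qed.

Lemma norm_pt_le (x : pt R) (r : R) : (`|x| <= r) = [&& `|x.1.1| <= r, `|x.1.2| <= r & `|x.2| <= r].
Proof. by rewrite norm_ptE !ge_max andbA. Qed.

Lemma norm_pt_c (x : pt R) : [/\ `|x.1.1| <= `|x|, `|x.1.2| <= `|x| & `|x.2| <= `|x|].
Proof. by have := lexx `|x|; rewrite {1}norm_pt_le => /and3P. Qed.

Lemma enorm_le (x : pt R) : enorm x <= 2 * `|x|.
Proof.
rewrite -ler_sqr ?nnegrE ?enorm_ge0 ?mulr_ge0// enorm_sq.
have [h1 h2 h3] := norm_pt_c x.
rewrite -(real_normK (num_real x.1.1)) -(real_normK (num_real x.1.2)) -(real_normK (num_real x.2)).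
have k (a : R) : 0 <= a -> a <= `|x| -> a ^+ 2 <= `|x| ^+ 2 by move=> a0 ax; rewrite ler_sqr ?nnegrE.
have := k _ (normr_ge0 _) h1; have := k _ (normr_ge0 _) h2; have := k _ (normr_ge0 _) h3.
have := sqr_ge0 `|x|; rewrite exprMn; lra.
Qed.

Lemma le_enorm (x : pt R) : `|x| <= enorm x.
Proof.
have k (a b : R) : 0 <= b -> `|a| <= Num.sqrt (a ^+ 2 + b).
  by move=> b0; rewrite -sqrtr_sqr ler_wsqrtr// lerDl.
rewrite norm_pt_le; apply/and3P; split; rewrite /enorm.
- by rewrite -addrA k// addr_ge0// sqr_ge0.
- by rewrite (addrC (x.1.1 ^+ 2)) -addrA k// addr_ge0// sqr_ge0.
- by rewrite addrC k// addr_ge0// sqr_ge0.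
Qed.

Lemma gagC (s : R) (x y : pt R) : gag_kernel s x y = gag_kernel s y x.
Proof.
rewrite /gag_kernel; congr (_ `^ _); rewrite /enorm /psub /=; congr Num.sqrt.
by rewrite -!(sqrrN (y.1.1 - _)) -!(sqrrN (y.1.2 - _)) -!(sqrrN (y.2 - _)) !opprB.
Qed.

Lemma gag_ge0 (s : R) (x y : pt R) : 0 <= gag_kernel s x y. Proof. exact: powR_ge0. Qed.

(** The sigma-algebra of [T3] is a product, defined without the topology of [pt R]. An open set is
    the union of the countably many rational cubes it contains. *)
Lemma open_m3 (O : set (pt R)) : open O -> measurable (O : set T3).
Proof.
pose box (z : rat * rat * rat * rat) : set T3 :=
  [set x | [/\ `|x.1.1 - ratr z.1.1.1| < ratr z.2, `|x.1.2 - ratr z.1.1.2| < ratr z.2 & `|x.2 - ratr z.1.2| < ratr z.2]].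
have mbox z : measurable (box z).
  have m (g : T3 -> R) (q : R) : measurable_fun setT g -> measurable [set x | `|g x - q| < ratr z.2].
    move=> mg; have mh : measurable_fun setT (fun x => `|g x - q|).
      by apply: measurableT_comp => //; exact: measurable_funB.
    have -> : [set x | `|g x - q| < ratr z.2] = setT `&` (fun x => `|g x - q|) @^-1` `]-oo, (ratr z.2)[.
      by rewrite setTI; apply/seteqP; split => x /=; rewrite in_itv.
    by apply: mh => //; exact: measurable_itv.
  have -> : box z = [set x | `|x.1.1 - ratr z.1.1.1| < ratr z.2] `&` [set x | `|x.1.2 - ratr z.1.1.2| < ratr z.2]
     `&` [set x | `|x.2 - ratr z.1.2| < ratr z.2].
    by apply/seteqP; split => x /=; [case|case => [[]]].
  by apply: measurableI; [apply: measurableI|]; apply: m; [exact: m_c1|exact: m_c2|exact: m_c3].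
move=> oO; have -> : (O : set T3) = \bigcup_(z in [set z | box z `<=` O]) box z.
  apply/seteqP; split => [x Ox|x [z zO] /zO//].
  have /nbhs_ballP[e /= e0 eO] : nbhs x O by exact: open_nbhs_nbhs.
  have [r] := rat_in_itvoo (divr_gt0 e0 (ltr0n R 2)); rewrite in_itv/= => /andP[r0 re].
  have q (a : R) : exists q : rat, `|a - ratr q| < ratr r.
    have [q] := @rat_in_itvoo R (a - ratr r) (a + ratr r) ltac:(by lra).
    by rewrite in_itv/= => /andP[? ?]; exists q; rewrite ltr_norml; apply/andP; split; lra.
  have [q1 h1] := q x.1.1; have [q2 h2] := q x.1.2; have [q3 h3] := q x.2.
  exists (q1, q2, q3, r) => //= y [/= k1 k2 k3]; apply: eO.
  have tri (a b c : R) : `|a - c| < ratr r -> `|b - c| < ratr r -> `|a - b| < e.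
    by move=> ac bc; rewrite (le_lt_trans (ler_distD c _ _))// (distrC c) (lt_le_trans (ltrD ac bc))// [leRHS]splitr lerD// ltW.
  by split => /=; [split => /=|]; rewrite -ball_normE /=; [exact: tri k1|exact: tri k2|exact: tri k3].
rewrite bigcup_mkcond; apply: countable_bigcupT_measurable => [|z]; first exact: countableP.
by case: ifP => // _; exact: measurable0.
Qed.

Lemma m_continuous (f : pt R -> R) : continuous f -> measurable_fun setT (f : T3 -> R).
Proof.
move=> cf; apply: (measurability _ (RGenOpens.measurableE R)) => _ [_ [a [b ->] <-]].
rewrite setTI; apply: open_m3; move/continuousP: cf; apply; exact: interval_open.
Qed.
End R3.

(** * The energy space *)

Section Space.
Variables (R : realType) (s : R).
Notation RR := (measurableTypeR R).
Notation T3 := (RR * RR * RR)%type.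
Notation m3 := (mu3 R).
Notation m6 := (mu3 R \x mu3 R)%E.
Implicit Types (u v w : pt R -> R) (W : pt R -> R).

(** The polarized Gagliardo integrand. On the diagonal it is [0] whatever the kernel is there. *)
Definition gq u v (z : T3 * T3) : R := (u z.1 - u z.2) * (v z.1 - v z.2) / gag_kernel s z.1 z.2.

Record inH W u : Prop := InH {
  inH_m : measurable_fun setT (u : T3 -> R);
  inH_2 : L1 m3 (fun x => u x ^+ 2);
  inH_g : L1 m6 (gq u u);
  inH_W : L1 m3 (fun x => W x * u x ^+ 2) }.

Lemma gq_ge0 u z : 0 <= gq u u z.
Proof. by rewrite /gq -expr2 divr_ge0 ?sqr_ge0 ?gag_ge0. Qed.

Lemma gqE u z : gq u u z = (u z.1 - u z.2) ^+ 2 / gag_kernel s z.1 z.2.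
Proof. by rewrite /gq expr2. Qed.

Lemma m_gq u v : measurable_fun setT (u : T3 -> R) -> measurable_fun setT (v : T3 -> R) ->
  measurable_fun setT (gq u v).
Proof.
move=> mu mv; apply: measurable_funM; last exact: m_gagV.
by apply: measurable_funM; apply: measurable_funB; [exact: m_fst|exact: m_snd|exact: m_fst|exact: m_snd].
Qed.

Definition hform W u v : R := Int m6 (gq u v) + Int m3 (fun x => W x * u x * v x).

(** Covers both [V (eps x)] and the constant [V_0] of the limit problem. The lower bound [V0] lets
    the form control the [L^2] norm with a constant common to all weights. *)
Record weight (V0 : R) := Weight {
  wt :> pt R -> R;
  wt_m : measurable_fun setT (wt : T3 -> R);
  wt_V0 : 0 < V0;
  wt_ge : forall x, V0 <= wt x }.

Section Weight.
Variables (V0 : R) (W : weight V0).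
Let mW : measurable_fun setT (W : T3 -> R). Proof. exact: wt_m. Qed.

Lemma wt_ge0 x : 0 <= W x.
Proof. exact: le_trans (ltW (wt_V0 W)) (wt_ge W x). Qed.
Let W0 := wt_ge0.

Lemma L1_gq u v : inH W u -> inH W v -> L1 m6 (gq u v).
Proof.
move=> Hu Hv; apply: (@L1_dom _ _ _ _ _ (fun z => gq u u z + gq v v z)).
- exact: m_gq (inH_m Hu) (inH_m Hv).
- exact: L1D (inH_g Hu) (inH_g Hv).
- move=> z; rewrite /gq -mulrDl normrM [X in _ * X]ger0_norm ?invr_ge0 ?gag_ge0//.
  rewrite ler_wpM2r ?invr_ge0 ?gag_ge0// normrM.
  set a := u z.1 - u z.2; set b := v z.1 - v z.2.
  rewrite -!expr2 -(real_normK (num_real a)) -(real_normK (num_real b)).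
  have := sqr_ge0 (`|a| - `|b|); rewrite sqrrB.
  have := sqr_ge0 `|a|; have := sqr_ge0 `|b|; lra.
Qed.

Lemma L1_W u v : inH W u -> inH W v -> L1 m3 (fun x => W x * u x * v x).
Proof. by move=> Hu Hv; apply: L1_wmul;
  [exact: W0|exact: mW|exact: inH_m Hu|exact: inH_m Hv|exact: inH_W Hu|exact: inH_W Hv]. Qed.

(** Membership of sums, multiples and truncations all reduces to a pointwise comparison of squares
    of values and of increments. *)
Lemma inH_dom u v w (C : R) : measurable_fun setT (w : T3 -> R) -> inH W u -> inH W v ->
  (forall x, w x ^+ 2 <= C * (u x ^+ 2 + v x ^+ 2)) ->
  (forall x y, (w x - w y) ^+ 2 <= C * ((u x - u y) ^+ 2 + (v x - v y) ^+ 2)) -> inH W w.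
Proof.
move=> mw Hu Hv w2 wg; split => //.
- apply: (@L1_dom _ _ _ _ _ (fun x : T3 => C * (u x ^+ 2 + v x ^+ 2))).
  + exact: measurable_funX.
  + exact: L1Z (L1D (inH_2 Hu) (inH_2 Hv)).
  + by move=> x; rewrite ger0_norm ?sqr_ge0.
- apply: (@L1_dom _ _ _ _ _ (fun z => C * (gq u u z + gq v v z))).
  + exact: m_gq.
  + exact: L1Z (L1D (inH_g Hu) (inH_g Hv)).
  + move=> z; rewrite ger0_norm ?gq_ge0// !gqE -mulrDl mulrA.
    by rewrite ler_wpM2r ?invr_ge0 ?gag_ge0.
- apply: (@L1_dom _ _ _ _ _ (fun x : T3 => C * (W x * u x ^+ 2 + W x * v x ^+ 2))).
  + by apply: measurable_funM => //; exact: measurable_funX.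
  + exact: L1Z (L1D (inH_W Hu) (inH_W Hv)).
  + move=> x; rewrite ger0_norm; last by apply: mulr_ge0 => //; exact: sqr_ge0.
    have -> : C * (W x * u x ^+ 2 + W x * v x ^+ 2) = W x * (C * (u x ^+ 2 + v x ^+ 2)) by ring.
    by rewrite ler_wpM2l.
Qed.

Lemma inH_cst0 : inH W (fun=> 0).
Proof.
split; first exact: measurable_cst.
- by apply: eq_L1 (L1_0 _) => x; rewrite expr0n.
- by apply: eq_L1 (L1_0 _) => x; rewrite /gq subrr !mul0r.
- by apply: eq_L1 (L1_0 _) => x; rewrite expr0n mulr0.
Qed.

Lemma eq_inH u v : (forall x, u x = v x) -> inH W u -> inH W v.
Proof. by move=> uv; rewrite (_ : v = u)//; apply/funext => x; rewrite uv. Qed.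

Lemma inHD u v : inH W u -> inH W v -> inH W (fun x => u x + v x).
Proof.
have sq (a b : R) : (a + b) ^+ 2 <= 2 * (a ^+ 2 + b ^+ 2).
  by have := sqr_ge0 (a - b); rewrite sqrrB sqrrD; lra.
move=> Hu Hv; apply: (inH_dom (C := 2) _ Hu Hv).
- exact: measurable_funD (inH_m Hu) (inH_m Hv).
- by move=> x; exact: sq.
- by move=> x y; rewrite opprD addrACA; exact: sq.
Qed.

Lemma inHZ a u : inH W u -> inH W (fun x => a * u x).
Proof.
move=> Hu; apply: (inH_dom (C := a ^+ 2) _ Hu inH_cst0).
- exact: measurable_funM (measurable_cst _) (inH_m Hu).
- by move=> x; rewrite expr0n addr0 exprMn.
- by move=> x y; rewrite subrr expr0n addr0 -mulrBr exprMn.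
Qed.

Lemma inHB u v : inH W u -> inH W v -> inH W (fun x => u x - v x).
Proof.
move=> Hu Hv; have := inHD Hu (inHZ (-1) Hv).
by apply: eq_inH => x; rewrite mulN1r.
Qed.

Lemma hformC u v : hform W u v = hform W v u.
Proof.
by congr (_ + _); apply: eq_Int => x; rewrite /gq ?(mulrC (u _ - _))// mulrAC.
Qed.

Lemma hformD u v w : inH W u -> inH W v -> inH W w ->
  hform W (fun x => u x + v x) w = hform W u w + hform W v w.
Proof.
move=> Hu Hv Hw; rewrite /hform addrACA -!IntD; do ?[exact: L1_gq|exact: L1_W].
by congr (_ + _); apply: eq_Int => x; rewrite /gq; ring.
Qed.

Lemma hformZ a u w : inH W u -> inH W w -> hform W (fun x => a * u x) w = a * hform W u w.
Proof.
move=> Hu Hw; rewrite /hform mulrDr -!IntZ; do ?[exact: L1_gq|exact: L1_W].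
by congr (_ + _); apply: eq_Int => x; rewrite /gq; ring.
Qed.

Lemma hform_ge0 u : 0 <= hform W u u.
Proof.
rewrite addr_ge0//; first by apply: Int_ge0 => z; exact: gq_ge0.
by apply: Int_ge0 => x; rewrite -mulrA mulr_ge0// -expr2 sqr_ge0.
Qed.

Lemma hformE u : hform W u u = Int m6 (gq u u) + Int m3 (fun x => W x * u x ^+ 2).
Proof. by congr (_ + _); apply: eq_Int => x; rewrite expr2 mulrA. Qed.

Definition inHp : {pred (pt R -> R)} := fun u => `[< inH W u >].

Lemma inHp_closed : submod_closed inHp.
Proof.
split; first by apply/asboolP; exact: inH_cst0.
move=> a u v /asboolP Hu /asboolP Hv; apply/asboolP.
exact: (inHD (inHZ a Hu) Hv).
Qed.
HB.instance Definition _ := GRing.isSubmodClosed.Build R (pt R -> R) inHp inHp_closed.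
Definition Hsp := {u : pt R -> R | u \in inHp}.
HB.instance Definition _ := SubType.on Hsp.
HB.instance Definition _ := [Choice of Hsp by <:].
HB.instance Definition _ := [SubChoice_isSubLmodule of Hsp by <:].
Definition Hform (u v : Hsp) : R := hform W (val u) (val v).
Lemma HspP (u : Hsp) : inH W (val u). Proof. by have /asboolP := valP u. Qed.
Definition toH u (Hu : inH W u) : Hsp := exist _ u (asboolT Hu).

Lemma Hform_psd : psd_form Hform.
Proof.
split.
- by move=> u v; exact: hformC.
- by move=> u v w; rewrite /Hform raddfD/=; apply: hformD; exact: HspP.
- by move=> a u w; rewrite /Hform linearZ/=; apply: hformZ; exact: HspP.
- by move=> u; exact: hform_ge0.
Qed.
End Weight.

End Space.

Lemma cvgEFin (R : realType) (u : nat -> R) (l : R) : u n @[n --> \oo] --> l ->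
  (u n)%:E @[n --> \oo] --> l%:E.
Proof.
move=> ul; apply: cvg_EFin => //; by apply: nearW.
Qed.

Lemma cvg_sqr (R : realType) (u : nat -> R) (l : R) : u n @[n --> \oo] --> l ->
  u n ^+ 2 @[n --> \oo] --> l ^+ 2.
Proof. by move=> ul; rewrite expr2; under eq_fun do rewrite expr2; exact: cvgM. Qed.

(** * Fatou's lemma and completeness of the energy space *)

Section Fatou.
Context d (T : measurableType d) (R : realType) (mu : {measure set T -> \bar R}).

Lemma measurable_limn_einf (f : nat -> T -> \bar R) : (forall n, measurable_fun setT (f n)) ->
  measurable_fun setT (fun x => limn_einf (f^~ x)).
Proof.
move=> mf; have -> : (fun x => limn_einf (f^~ x)) = (fun x => - limn_esup (fun n => - f n x))%E.
  by apply/funext => x; rewrite -[RHS]oppeK oppeK -[X in limn_einf X](_ : -%E \o (fun n => - f n x)%E = _)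
    ?limn_einfN//; apply/funext => n /=; rewrite oppeK.
apply: measurableT_comp => //; apply: measurable_fun_limn_esup => n.
exact: measurableT_comp.
Qed.

Lemma fatou_bound (f_ : nat -> T -> R) (f : T -> R) (C : R) :
  (forall n, L1 mu (f_ n)) -> (forall n x, 0 <= f_ n x) -> (forall n, Int mu (f_ n) <= C) ->
  measurable_fun setT f -> {ae mu, forall x, f_ n x @[n --> \oo] --> f x} ->
  (forall x, 0 <= f x) -> L1 mu f /\ Int mu f <= C.
Proof.
move=> Lf f0 fC mf fcv fp.
have mfn n : measurable_fun setT (fun x => (f_ n x)%:E) by apply: mEFin; exact: L1_meas.
have E : (\int[mu]_x (f x)%:E = \int[mu]_x limn_einf (fun n => (f_ n x)%:E))%E.
  apply: ae_eq_integral => //; first exact: mEFin.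
    exact: measurable_limn_einf.
  apply: filterS fcv => x cx _; rewrite is_cvg_limn_einfE.
    by apply/esym/cvg_lim => //; exact: cvgEFin.
  by apply/cvg_ex; exists (f x)%:E; exact: cvgEFin.
have H : (\int[mu]_x (f x)%:E <= C%:E)%E.
  rewrite E; apply: le_trans (fatou mu measurableT mfn _) _; first by move=> n x _; rewrite lee_fin.
  apply: le_trans (limn_einf_sup _) _.
  rewrite limn_esup_lim; apply: lime_le; first exact: is_cvg_esups.
  apply: nearW => n; apply: ge_ereal_sup => _ [k _ <-] /=.
  by rewrite L1_EFin// lee_fin.
have L : L1 mu f by apply: L1_fin => //; apply: le_lt_trans H _; rewrite ltry.
by split => //; rewrite -lee_fin -L1_EFin.
Qed.

(** The partial sums increase to a function whose integral Fatou bounds by [C], so that it is finite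
    almost everywhere and bounds every term. *)
Lemma summable_ae (f : nat -> T -> R) (C : R) : (forall n, L1 mu (f n)) -> (forall n x, 0 <= f n x) ->
  (forall n, \sum_(i < n) Int mu (f i) <= C) -> {ae mu, forall x, exists M : R, forall i, f i x <= M}.
Proof.
move=> Lf f0 fC; pose S n x := \sum_(0 <= i < n) f i x.
have LS n : L1 mu (S n) by exact: L1_sum.
have SC n : Int mu (S n) <= C by rewrite Int_sum// big_mkord.
have S0 n x : 0 <= S n x by apply: sumr_ge0.
have mS n : measurable_fun setT (fun x => (S n x)%:E) by apply: mEFin; exact: L1_meas.
pose g x := limn_einf (fun n => (S n x)%:E).
have mg : measurable_fun setT g by exact: measurable_limn_einf.
have H : (\int[mu]_x g x <= C%:E)%E.
  apply: le_trans (fatou mu measurableT mS _) _; first by move=> n x _; rewrite lee_fin.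
  apply: le_trans (limn_einf_sup _) _.
  rewrite limn_esup_lim; apply: lime_le; first exact: is_cvg_esups.
  apply: nearW => n; apply: ge_ereal_sup => _ [k _ <-] /=.
  by rewrite L1_EFin// lee_fin.
have nd x : {homo (fun n => (S n x)%:E) : n m / (n <= m)%N >-> (n <= m)%E}.
  have h : nondecreasing_seq (S^~ x) by apply/nondecreasing_seqP => n; rewrite /S big_nat_recr//= lerDl.
  by move=> n m nm; rewrite lee_fin; exact: h.
have Sg n x : ((S n x)%:E <= g x)%E.
  rewrite /g is_cvg_limn_einfE; last exact: ereal_nondecreasing_is_cvgn.
  by rewrite (cvg_lim _ (ereal_nondecreasing_cvgn (nd x)))//; apply: ereal_sup_ubound; exists n.
have ig : mu.-integrable setT g.
  apply/integrableP; split => //; apply: le_lt_trans (ltry C).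
  apply: le_trans H; rewrite (eq_integral (fun x => g x))// => x _.
  by rewrite gee0_abs// (le_trans _ (Sg 0%N x))// lee_fin.
apply: filterS (integrable_ae measurableT ig) => x /(_ Logic.I) gx.
exists (fine (g x)) => i; rewrite -lee_fin fineK//.
apply: le_trans (Sg i.+1 x); rewrite lee_fin /S big_nat_recr//= lerDr.
by apply: sumr_ge0.
Qed.

Lemma geom_cauchy (z : nat -> R) (M : R) : (forall i, `|z i.+1 - z i| <= M * (1 / 2) ^+ i) -> cvgn z.
Proof.
move=> zM.
have c1 : cvgn (series (fun i => `|z i.+1 - z i|)).
  apply: (@series_le_cvg _ _ (geometric M (1 / 2))) => //.
  - by move=> n; rewrite /geometric /= (le_trans _ (zM n)).
  - by apply: is_cvg_geometric_series; rewrite ger0_norm// ltr_pdivrMr// mul1r ltr1n.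
have c2 : cvgn (series (telescope z)) by exact: normed_cvg.
have -> : z = (fun n => series (telescope z) n + z 0%N).
  by apply/funext => n; rewrite telescopeK addrC subrKC.
by apply: is_cvgD => //; exact: is_cvg_cst.
Qed.

(** The rate [8^-i] leaves room for the weight [4^i]: the weighted squares are still summable, so
    almost everywhere the increments are [O(2^-i)] and the sequence converges pointwise. *)
Lemma L2_subseq (z : nat -> T -> R) : (forall n, measurable_fun setT (z n)) ->
  (forall i, L1 mu (fun x => (z i.+1 x - z i x) ^+ 2) /\
     Int mu (fun x => (z i.+1 x - z i x) ^+ 2) <= (1 / 8) ^+ i) ->
  exists2 u : T -> R, measurable_fun setT u & {ae mu, forall x, z n x @[n --> \oo] --> u x}.
Proof.
move=> mz zP.
exists (fun x => fine (limn_esup (fun n => (z n x)%:E))).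
  apply: measurableT_comp => //; apply: measurable_fun_limn_esup => n; exact: mEFin.
have h : {ae mu, forall x, exists M : R, forall i, 4 ^+ i * (z i.+1 x - z i x) ^+ 2 <= M}.
  apply: (summable_ae (C := 2)).
  - by move=> n; apply: L1Z; case: (zP n).
  - by move=> n x; apply: mulr_ge0; [exact: exprn_ge0|exact: sqr_ge0].
  - move=> n; have : \sum_(i < n) Int mu (fun x => 4 ^+ i * (z i.+1 x - z i x) ^+ 2) <= 2 - 2 * (1 / 2) ^+ n.
      elim: n => [|n IH]; first by rewrite big_ord0 expr0 mulr1 subrr.
      rewrite big_ord_recr /= IntZ; last by case: (zP n).
      have : 4 ^+ n * Int mu (fun x => (z n.+1 x - z n x) ^+ 2) <= 4 ^+ n * (1 / 8) ^+ n.
        by rewrite ler_wpM2l ?exprn_ge0//; case: (zP n).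
      rewrite -exprMn (_ : 4 * (1 / 8) = 1 / 2 :> R); last by field.
      rewrite exprS; lra.
    by move=> /le_trans; apply; rewrite lerBlDr lerDl mulr_ge0// exprn_ge0.
apply: filterS h => x [M hM].
have cz : cvgn (fun n => z n x).
  apply: (@geom_cauchy _ (Num.sqrt M)) => i.
  have -> : (1 / 2) ^+ i = Num.sqrt ((1 / 4) ^+ i) :> R.
    have -> : (1 / 4) ^+ i = ((1 / 2) ^+ i) ^+ 2 :> R.
      by rewrite -exprM mulnC exprM; congr (_ ^+ i); field.
    by rewrite sqrtr_sqr ger0_norm ?exprn_ge0.
  have M0 : 0 <= M by apply: le_trans (hM 0%N); rewrite mulr_ge0 ?sqr_ge0// exprn_ge0.
  rewrite -sqrtrM// -sqrtr_sqr ler_wsqrtr//.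
  have := hM i; rewrite -ler_pdivlMl ?exprn_gt0// mulrC expr_div_n expr1n mul1r => //.
rewrite is_cvg_limn_esupE; last by apply/cvg_ex; exists (limn (fun n => z n x))%:E; exact: cvgEFin.
rewrite EFin_lim//=.
Qed.
End Fatou.

Section AeProd.
Context d (T : measurableType d) (R : realType) (m : {sigma_finite_measure set T -> \bar R}).

Lemma ae_prod (P : T -> Prop) : {ae m, forall x, P x} -> {ae (m \x m)%E, forall z, P z.1 /\ P z.2}.
Proof.
move=> [N [mN N0 NP]]; exists ((N `*` setT) `|` (setT `*` N)); split.
- by apply: measurableU; apply: measurableX.
- apply/eqP; rewrite eq_le measure_ge0 andbT.
  apply: le_trans (measureU2 _ _ _) _; [exact: measurableX|exact: measurableX|].
  change ((m \x m) (N `*` setT) + (m \x m) (setT `*` N) <= 0)%E.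
  rewrite (product_measure1E m m mN measurableT) (product_measure1E m m measurableT mN).
  have -> : (m N * m setT = 0)%E by rewrite N0 mul0e.
  have -> : (m setT * m N = 0)%E by rewrite N0 mule0.
  by rewrite adde0.
- move=> [x y] /=; apply: contra_notP => /not_orP[h1 h2]; split.
  + by apply: contrapT => Px; apply: h1; split => //; exact: NP.
  + by apply: contrapT => Px; apply: h2; split => //; exact: NP.
Qed.
End AeProd.

Section Complete.
Variables (R : realType) (s V0 : R) (W : weight V0).
Notation RR := (measurableTypeR R).
Notation T3 := (RR * RR * RR)%type.
Notation m3 := (mu3 R).
Notation m6 := (mu3 R \x mu3 R)%E.
Let mW : measurable_fun setT (W : T3 -> R). Proof. exact: wt_m. Qed.
Let V00 : 0 < V0. Proof. exact: wt_V0 W. Qed.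
Let WV x : V0 <= W x. Proof. exact: wt_ge. Qed.
Let W0 x : 0 <= W x. Proof. exact: wt_ge0. Qed.
Implicit Types u v w : pt R -> R.

Lemma L2_le_form u : inH s W u -> V0 * Int m3 (fun x => u x ^+ 2) <= hform s W u u.
Proof.
move=> Hu; rewrite hformE -IntZ; last exact: inH_2 Hu.
apply: (@le_trans _ _ (Int m3 (fun x : T3 => W x * u x ^+ 2))).
  apply: Int_le; [exact: L1Z (inH_2 Hu)|exact: inH_W Hu|].
  by move=> x; rewrite ler_wpM2r ?sqr_ge0.
by rewrite lerDr; apply: Int_ge0 => z; exact: gq_ge0.
Qed.

Lemma gag_le_form u : inH s W u -> Int m6 (gq s u u) <= hform s W u u.
Proof.
move=> Hu; rewrite hformE lerDl; apply: Int_ge0 => x.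
by apply: mulr_ge0 => //; exact: sqr_ge0.
Qed.

Lemma W_le_form u : inH s W u -> Int m3 (fun x : T3 => W x * u x ^+ 2) <= hform s W u u.
Proof. by move=> Hu; rewrite hformE lerDr; apply: Int_ge0 => z; exact: gq_ge0. Qed.

Lemma form_eq0_ae u : inH s W u -> hform s W u u = 0 -> {ae m3, forall x, u x = 0}.
Proof.
move=> Hu u0.
have I0 : Int m3 (fun x => u x ^+ 2) = 0.
  apply/eqP; rewrite eq_le Int_ge0 ?andbT; last by move=> x; exact: sqr_ge0.
  by have := L2_le_form Hu; rewrite u0 pmulr_rle0.
have := Int_eq0 (inH_2 Hu) (fun x => sqr_ge0 _) I0.
by apply: aeS => x /eqP; rewrite sqrf_eq0 => /eqP.
Qed.

(** Fatou is applied separately to the Gagliardo part and to the weighted part, each bounded by [e];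
    hence the factor [2]. *)
Lemma inH_limit (z : nat -> pt R -> R) u (e : R) (v : pt R -> R) : 0 <= e ->
  (forall n, inH s W (fun x => z n x - v x)) -> inH s W v ->
  (forall n, hform s W (fun x => z n x - v x) (fun x => z n x - v x) <= e) ->
  measurable_fun setT (u : T3 -> R) -> {ae m3, forall x : T3, z n x @[n --> \oo] --> u x} ->
  inH s W (fun x => u x - v x) /\ hform s W (fun x => u x - v x) (fun x => u x - v x) <= 2 * e.
Proof.
move=> e0 Hz Hv ze mu zu.
have mv := inH_m Hv.
have muv : measurable_fun setT (fun x : T3 => u x - v x) by exact: measurable_funB.
have [L1u _] : L1 m3 (fun x : T3 => (u x - v x) ^+ 2) /\ Int m3 (fun x : T3 => (u x - v x) ^+ 2) <= e / V0.
  apply: (@fatou_bound _ _ _ _ (fun n (x : T3) => (z n x - v x) ^+ 2)).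
  - by move=> n; exact: inH_2 (Hz n).
  - by move=> n x; exact: sqr_ge0.
  - by move=> n; rewrite ler_pdivlMr// mulrC (le_trans (L2_le_form (Hz n))).
  - exact: measurable_funX.
  - apply: (aeS _ zu) => x zx; apply: cvg_sqr.
    by apply: cvgB => //; exact: cvg_cst.
  - by move=> x; exact: sqr_ge0.
have [Lg Ig] : L1 m6 (gq s (fun x => u x - v x) (fun x => u x - v x)) /\
    Int m6 (gq s (fun x => u x - v x) (fun x => u x - v x)) <= e.
  apply: (@fatou_bound _ _ _ _ (fun n => gq s (fun x => z n x - v x) (fun x => z n x - v x))).
  - by move=> n; exact: inH_g (Hz n).
  - by move=> n x; exact: gq_ge0.
  - by move=> n; rewrite (le_trans (gag_le_form (Hz n))).
  - exact: m_gq.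
  - apply: (aeS _ (ae_prod zu)) => x [z1 z2]; rewrite /gq.
    apply: cvgM; last exact: cvg_cst.
    by apply: cvgM; apply: cvgB; apply: cvgB => //; exact: cvg_cst.
  - by move=> x; exact: gq_ge0.
have [LW IW] : L1 m3 (fun x : T3 => W x * (u x - v x) ^+ 2) /\ Int m3 (fun x : T3 => W x * (u x - v x) ^+ 2) <= e.
  apply: (@fatou_bound _ _ _ _ (fun n (x : T3) => W x * (z n x - v x) ^+ 2)).
  - by move=> n; exact: inH_W (Hz n).
  - by move=> n x; apply: mulr_ge0 => //; exact: sqr_ge0.
  - by move=> n; rewrite (le_trans (W_le_form (Hz n))).
  - by apply: measurable_funM => //; exact: measurable_funX.
  - apply: (aeS _ zu) => x zx; apply: cvgM; first exact: cvg_cst.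
    by apply: cvg_sqr; apply: cvgB => //; exact: cvg_cst.
  - by move=> x; apply: mulr_ge0 => //; exact: sqr_ge0.
split; first by split.
by rewrite hformE mulr_natl mulr2n lerD.
Qed.

Lemma Hform_complete : complete_form (@Hform R s V0 W).
Proof.
move=> w cw; pose B := @Hform R s V0 W.
have BP : psd_form B := Hform_psd s W.
have kE i : exists n, forall a b, (n <= a)%N -> (n <= b)%N -> B (w a - w b) (w a - w b) <= V0 * (1 / 8) ^+ i.
  have p0 : 0 < Num.sqrt (V0 * (1 / 8) ^+ i) by rewrite sqrtr_gt0 mulr_gt0 ?exprn_gt0// divr_gt0.
  have [N NP] := cw _ p0; exists N => a b Na Nb; rewrite (nmE BP).
  rewrite -[leRHS]sqr_sqrtr; last by rewrite mulr_ge0 ?exprn_ge0 ?(ltW V00)// divr_ge0.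
  by rewrite ler_sqr ?nnegrE ?nm_ge0 ?sqrtr_ge0// NP.
have [k0 k0P] := choice kE.
(* Partial sums make the extracted indices increasing and unbounded while keeping them above
   [k0 i]. *)
pose k i := (\sum_(j < i.+1) (k0 j).+1)%N.
have kk i : (k0 i <= k i)%N by rewrite /k big_ord_recr /= addnS ltnW// ltnS leq_addl.
have kS i : (k i <= k i.+1)%N by rewrite /k [leqRHS]big_ord_recr /= leq_addr.
pose z i := val (w (k i)).
have valB (a b : Hsp s W) : val (a - b) = (fun x => val a x - val b x) by rewrite raddfB.
have HB a b : inH s W (fun x => val (w a) x - val (w b) x).
  by apply: inHB => //; exact: HspP.
have [u mu zu] : exists2 u : T3 -> R, measurable_fun setT u & {ae m3, forall x : T3, z n x @[n --> \oo] --> u x}.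
  apply: L2_subseq => [n|i]; first exact: inH_m (HspP _).
  have Hi := HB (k i.+1) (k i); split; first exact: inH_2 Hi.
  rewrite -(ler_pM2l V00); apply: le_trans (L2_le_form Hi) _.
  have := k0P i (k i.+1) (k i) (leq_trans (kk i) (kS i)) (kk i).
  by rewrite /B /Hform valB.
have klim n : exists i, (n <= k i)%N.
  have h i : (i <= k i)%N.
    elim: i => [//|i IH]; apply: leq_ltn_trans IH _.
    by rewrite /k [ltnRHS]big_ord_recr /= addnS ltnS leq_addr.
  by exists n.
have lim (e : R) : 0 < e -> exists N, forall n, (N <= n)%N ->
    inH s W (fun x => u x - val (w n) x) /\ hform s W (fun x => u x - val (w n) x) (fun x => u x - val (w n) x) <= 2 * e ^+ 2.
  move=> e0; have [N NP] := cw e e0; exists N => n Nn.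
  have [i Ni] := klim N.
  apply: (@inH_limit (fun j => z (i + j)%N)).
  - exact: sqr_ge0.
  - by move=> j; exact: HB.
  - exact: HspP.
  - move=> j.
    have kij : (N <= k (i + j))%N.
      by apply: leq_trans Ni _; elim: j => [|j IH]; rewrite ?addn0// addnS (leq_trans IH).
    have := NP _ _ kij Nn; rewrite -(ler_pXn2r (n := 2))// ?nnegrE ?nm_ge0 ?(ltW e0)//.
    by rewrite -(nmE BP) /B /Hform valB.
  - exact: mu.
  - apply: (aeS _ zu) => x zx.
    have -> : (fun j => z (i + j)%N x) = (fun j => z (j + i)%N x) by apply/funext => j; rewrite addnC.
    by rewrite (cvg_shiftn i (fun n => z n x)).
have [N1 /(_ N1 (leqnn _))[H1 _]] := lim 1 ltr01.
have Hu : inH s W u.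
  by apply: eq_inH (inHD H1 (HspP (w N1))) => x; rewrite subrK.
exists (toH Hu) => e e0.
have e2 : 0 < e / 2 by rewrite divr_gt0.
have [N NP] := lim _ e2; exists N => n Nn; have [_ h] := NP n Nn.
rewrite (nmBC BP); apply: nm_le; first exact: ltW.
rewrite /B /Hform valB /=; apply: le_trans h _.
have := sqr_ge0 e; rewrite expr_div_n; lra.
Qed.
End Complete.

(** * Fractional Sobolev inequalities *)

Section Preserve.
Context d (T : measurableType d) (R : realType).

Definition preserves (m : set T -> \bar R) (phi : T -> T) :=
  measurable_fun setT phi /\ forall A, measurable A -> m (phi @^-1` A) = m A.

Lemma preserves_L1 (m : {measure set T -> \bar R}) phi (f : T -> R) : preserves m phi -> L1 m f ->
  L1 m (fun x => f (phi x)) /\ Int m (fun x => f (phi x)) = Int m f.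
Proof.
move=> [mp mE] Lf; have mf := L1_meas Lf.
pose ph : {mfun T >-> T} := HB.pack phi (isMeasurableFun.Build _ _ _ _ _ mp).
have E (g : T -> \bar R) : (\int[pushforward m ph]_x g x = \int[m]_x g x)%E.
  by apply: eq_measure_integral => A mA _; exact: mE.
have L : L1 m (fun x => f (phi x)).
  apply/integrableP; split; first by apply: mEFin; exact: measurableT_comp.
  have /integrableP[_] := Lf; rewrite -E ge0_integral_pushforward//.
  by apply: measurableT_comp => //; exact: mEFin.
split => //; congr fine.
rewrite -[RHS]E integral_pushforward//; exact: mEFin.
Qed.
End Preserve.

Section PreserveProd.
Context d1 d2 (T1 : measurableType d1) (T2 : measurableType d2) (R : realType).
Variables (m1 : {sigma_finite_measure set T1 -> \bar R}) (m2 : {sigma_finite_measure set T2 -> \bar R}).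

(** By uniqueness of the product measure only rectangles have to be checked. Iterated, this gives
    translation invariance on the space and on pairs of points. *)
Lemma preserves_prod phi1 phi2 : preserves m1 phi1 -> preserves m2 phi2 ->
  preserves (m1 \x m2)%E (fun z => (phi1 z.1, phi2 z.2)).
Proof.
move=> [mp1 E1] [mp2 E2].
have mp : measurable_fun setT (fun z : T1 * T2 => (phi1 z.1, phi2 z.2)).
  by apply: measurable_fun_pair; apply: measurableT_comp.
split => // A mA.
pose ph : {mfun (T1 * T2)%type >-> (T1 * T2)%type} := HB.pack (fun z : T1 * T2 => (phi1 z.1, phi2 z.2)) (isMeasurableFun.Build _ _ _ _ _ mp).
apply/esym; apply: (@product_measure_unique _ _ _ _ _ m1 m2 (pushforward (m1 \x m2)%E ph)) => // B C mB mC.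
transitivity ((m1 \x m2)%E ((phi1 @^-1` B) `*` (phi2 @^-1` C))); first by [].
have mB' : measurable (phi1 @^-1` B) by rewrite -[X in measurable X]setTI; exact: mp1.
have mC' : measurable (phi2 @^-1` C) by rewrite -[X in measurable X]setTI; exact: mp2.
rewrite (product_measure1E m1 m2 mB' mC'); congr (_ * _)%E; [exact: E1|exact: E2].
Qed.
End PreserveProd.

Section Cube.
Variables (R : realType).
Notation RR := (measurableTypeR R).
Notation T3 := (RR * RR * RR)%type.
Notation m3 := (mu3 R).
Notation m6 := (mu3 R \x mu3 R)%E.

Lemma preserves_shift1 (c : R) : preserves (@lebesgue_measure R) (fun x : RR => x + c : RR).
Proof.
have mp : measurable_fun setT (fun x : RR => x + c : RR).
  by apply: mR; apply: measurable_funD; [exact: measurable_id|exact: measurable_cst].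
split => // A mA.
pose ph : {mfun RR >-> RR} := HB.pack (fun x : RR => x + c : RR) (isMeasurableFun.Build _ _ _ _ _ mp).
apply/esym; apply: (@lebesgue_measure_unique _ (pushforward (@lebesgue_measure R) ph)) => // _ [[a b]] _ <-.
have E : (ph @^-1` `]a, b]%classic : set R) = `]a - c, b - c]%classic.
  by apply/seteqP; split => x /=; rewrite !in_itv/= ltrBlDr lerBrDr.
transitivity (lebesgue_measure `]a - c, b - c]%classic); last by rewrite -E.
by rewrite !lebesgue_measure_itv/= !lte_fin ltrD2r; case: ifP => // _; rewrite -!EFinB opprB addrA subrK.
Qed.

Lemma preserves_shift (c : pt R) : preserves m3 (fun x : T3 => (x : pt R) + c).
Proof.
have h2 : preserves (@mu2 R) (fun z : RR * RR => (z.1 + c.1.1 : RR, z.2 + c.1.2 : RR)).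
  exact: preserves_prod (preserves_shift1 c.1.1) (preserves_shift1 c.1.2).
exact: (@preserves_prod _ _ _ _ _ (@mu2 R) (@lebesgue_measure R) _ _ h2 (preserves_shift1 c.2)).
Qed.

Lemma preserves_shift6 (c : pt R) :
  preserves m6 (fun z : T3 * T3 => ((z.1 : pt R) + c, (z.2 : pt R) + c)).
Proof. exact: preserves_prod (preserves_shift c) (preserves_shift c). Qed.

(** Half-open and given by a corner, so that translates tile a larger cube exactly, as used in
    [grid_sum]. *)
Definition QB (x : pt R) (r : R) : set T3 :=
  (`[x.1.1, x.1.1 + r[ `*` `[x.1.2, x.1.2 + r[) `*` `[x.2, x.2 + r[.

Lemma mQB x r : measurable (QB x r).
Proof. by apply: measurableX; [apply: measurableX|]; exact: measurable_itv. Qed.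

Lemma mu3_QB x r : 0 <= r -> m3 (QB x r) = (r ^+ 3)%:E.
Proof.
move=> r0; have itvE (a : R) : lebesgue_measure `[a, a + r[ = r%:E.
  rewrite lebesgue_measure_itv/= lte_fin ltrDl; case: ltP => h.
    by rewrite -EFinB addrC addKr.
  by congr _%:E; apply/le_anti; rewrite r0 h.
pose A1 : set RR := `[x.1.1, x.1.1 + r[%classic; pose A2 : set RR := `[x.1.2, x.1.2 + r[%classic.
pose A3 : set RR := `[x.2, x.2 + r[%classic.
transitivity (@mu2 R (A1 `*` A2) * lebesgue_measure A3)%E.
  by apply: product_measure1E; [apply: measurableX|]; exact: measurable_itv.
have -> : (@mu2 R (A1 `*` A2) = lebesgue_measure A1 * lebesgue_measure A2)%E.
  by apply: product_measure1E; exact: measurable_itv.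
by rewrite !itvE -!EFinM !exprS expr0 mulr1 mulrA.
Qed.

Lemma L1_indic (A : set T3) (C : R) : measurable A -> (m3 A <= C%:E)%E ->
  L1 m3 (\1_A : T3 -> R) /\ Int m3 (\1_A : T3 -> R) <= C.
Proof.
move=> mA AC; have E : (\int[m3]_x (\1_A x)%:E = m3 A)%E by rewrite integral_indic// setIT.
have L : L1 m3 (\1_A : T3 -> R).
  by apply: L1_fin => //; rewrite E; exact: le_lt_trans AC (ltry _).
by split => //; rewrite -lee_fin -L1_EFin// E.
Qed.

Lemma L1_QB x r : 0 <= r -> L1 m3 (\1_(QB x r) : T3 -> R) /\ Int m3 (\1_(QB x r) : T3 -> R) = r ^+ 3.
Proof.
move=> r0; have [L _] := @L1_indic (QB x r) (r ^+ 3) (mQB x r) (eq_ind_r (fun y => (y <= _)%E) (lexx _) (mu3_QB x r0)).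
split => //; apply: EFin_inj; rewrite -L1_EFin// integral_indic//; last exact: mQB.
by rewrite setIT; exact: mu3_QB.
Qed.

Lemma QB_enorm x r y : QB x r y -> enorm (psub x y) <= 2 * r.
Proof.
case => -[] /=; rewrite !in_itv/= => /andP[? ?] /andP[? ?] /andP[? ?].
apply: le_trans (enorm_le _) _; rewrite ler_pM2l// norm_pt_le /=; apply/and3P.
by split; rewrite ler_norml; apply/andP; split; lra.
Qed.

Lemma QB_gag (s : R) x r y : 0 <= 3 + 2 * s -> QB x r y -> gag_kernel s x y <= (2 * r) `^ (3 + 2 * s).
Proof.
move=> s0 /QB_enorm h; apply: ge0_ler_powR => //; rewrite nnegrE ?enorm_ge0//.
exact: le_trans (enorm_ge0 _) h.
Qed.

Lemma gag_gt0 (s : R) (x y : pt R) : x <> y -> 0 < gag_kernel s x y.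
Proof.
move=> xy; apply: powR_gt0; apply: lt_le_trans (le_enorm _).
by rewrite psubE normr_gt0 subr_eq0; apply/eqP.
Qed.

(** [|u x|] is compared with [|u y|] for [y] in a cube: a jump larger than [tau] is paid by the
    Gagliardo density at [x], and a value [|u y|] larger than [rho] by the [L^p] mass in the
    cube. *)
Lemma cube_mean (s : R) (u : pt R -> R) (x : pt R) (r tau rho A D p : R) : 0 < r -> 0 < tau -> 0 < rho ->
  0 <= 3 + 2 * s -> 1 <= p -> measurable_fun setT (u : T3 -> R) ->
  L1 m3 (fun y => gq s u u (x, y)) -> Int m3 (fun y => gq s u u (x, y)) <= D ->
  L1 m3 (fun y => \1_(QB x r) y * `|u y| `^ p) -> Int m3 (fun y => \1_(QB x r) y * `|u y| `^ p) <= A ->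
  r ^+ 3 * `|u x| <= r ^+ 3 * (tau + rho) + (2 * r) `^ (3 + 2 * s) / tau * D + rho `^ (1 - p) * A.
Proof.
move=> r0 tau0 rho0 s0 p1 mu LD ID LA IA.
have [LQ IQ] := L1_QB x (ltW r0).
have pt_ y : \1_(QB x r) y * `|u x| <= \1_(QB x r) y * (tau + rho) + (2 * r) `^ (3 + 2 * s) / tau * gq s u u (x, y)
   + rho `^ (1 - p) * (\1_(QB x r) y * `|u y| `^ p).
  have g0 : 0 <= (2 * r) `^ (3 + 2 * s) / tau * gq s u u (x, y).
    by rewrite mulr_ge0 ?gq_ge0// divr_ge0 ?powR_ge0// ltW.
  rewrite indicE; have [Qy|Qy] := boolP (y \in QB x r); last by rewrite !mul0r mulr0 add0r addr0.
  rewrite !mul1r.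
  have h1 : `|u x - u y| <= tau + (2 * r) `^ (3 + 2 * s) / tau * gq s u u (x, y).
    have [h|h] := leP `|u x - u y| tau; first by move: h g0; clear; lra.
    apply: (@le_trans _ _ ((2 * r) `^ (3 + 2 * s) / tau * gq s u u (x, y))); last by rewrite lerDr ltW.
    have xy : x <> y by move=> E; move: h; rewrite E subrr normr0; lra.
    have k0 := gag_gt0 s xy.
    rewrite gqE /= -(real_normK (num_real (u x - u y))) mulrA ler_pdivlMr// -mulrA mulrCA mulrC.
    rewrite mulrCA; apply: ler_pM => //; [exact: ltW| |].
      by move: Qy; rewrite inE => /(QB_gag s0).
    by rewrite expr2 ler_pdivlMl// ler_wpM2r// ltW.
  have h2 : `|u y| <= rho + rho `^ (1 - p) * `|u y| `^ p.
    have [h|h] := leP `|u y| rho; first by rewrite ler_wpDr// mulr_ge0// powR_ge0.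
    apply: (@le_trans _ _ (rho `^ (1 - p) * `|u y| `^ p)); last by rewrite lerDr ltW.
    have y0 : 0 < `|u y| by exact: lt_trans h.
    rewrite -[leLHS](powRr1 (ltW y0)).
    have -> : `|u y| `^ 1 = `|u y| `^ (1 - p) * `|u y| `^ p.
      by rewrite -powRD ?subrK// gt_eqF ?implybT.
    rewrite ler_wpM2r ?powR_ge0// -[1 - p]opprB !powRN lef_pV2 ?posrE ?powR_gt0//.
    by apply: ge0_ler_powR => //; rewrite ?subr_ge0 ?nnegrE// ltW.
  have h3 : `|u x| <= `|u x - u y| + `|u y| by rewrite -{1}(subrK (u y) (u x)) ler_normD.
  move: h1 h2 h3; clear; lra.
have I : Int m3 (fun y : T3 => \1_(QB x r) y * `|u x|) <= Int m3 (fun y => (tau + rho) * \1_(QB x r) y + (2 * r) `^ (3 + 2 * s) / tau * gq s u u (x, y)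
   + rho `^ (1 - p) * (\1_(QB x r) y * `|u y| `^ p)).
  apply: Int_le.
  - by apply: eq_L1 (L1Z `|u x| LQ) => y; rewrite mulrC.
  - by apply: L1D; [apply: L1D|]; exact: L1Z.
  - by move=> y; rewrite (mulrC (tau + rho)); exact: pt_.
have E1 : Int m3 (fun y : T3 => \1_(QB x r) y * `|u x|) = r ^+ 3 * `|u x|.
  by rewrite -IQ mulrC -IntZ//; apply: eq_Int => y; rewrite mulrC.
have C1 : 0 <= (2 * r) `^ (3 + 2 * s) / tau by rewrite divr_ge0 ?powR_ge0// ltW.
rewrite E1 IntD ?IntD ?IntZ ?IQ in I; do ?[exact: L1Z|exact: LQ|by apply: L1D; exact: L1Z|assumption].
apply: le_trans I _; rewrite (mulrC (r ^+ 3) (tau + rho)).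
by apply: lerD; [rewrite lerD2l|]; apply: ler_wpM2l => //; exact: powR_ge0.
Qed.

(** [tau] and [rho] are both [l = |u x| / 4], and [r] is chosen with [r^3 l^p = A], so that the mass
    term of [cube_mean] equals [r^3 l]. Three of the four units [r^3 l] on the left are then
    absorbed, and the last one is bounded by the density at [x] alone. *)
Lemma cube_sobolev (s : R) (u : pt R -> R) (x : pt R) (A D p : R) : 0 < s -> 1 <= p -> 0 < A ->
  measurable_fun setT (u : T3 -> R) -> u x != 0 ->
  L1 m3 (fun y => gq s u u (x, y)) -> Int m3 (fun y => gq s u u (x, y)) <= D ->
  let r := (A / (`|u x| / 4) `^ p) `^ (1 / 3) in
  L1 m3 (fun y => \1_(QB x r) y * `|u y| `^ p) -> Int m3 (fun y => \1_(QB x r) y * `|u y| `^ p) <= A ->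
  (`|u x| / 4) `^ (2 + 2 * s * p / 3) <= 2 `^ (3 + 2 * s) * A `^ (2 * s / 3) * D.
Proof.
move=> s0 p1 A0 mu ux LD ID r LA IA.
pose l := `|u x| / 4; have l0 : 0 < l by rewrite divr_gt0// normr_gt0.
have lp0 : 0 < l `^ p by exact: powR_gt0.
have r0 : 0 < r by rewrite powR_gt0// divr_gt0.
have s3 : 0 <= 3 + 2 * s by clear -s0; lra.
have := cube_mean r0 l0 l0 s3 p1 mu LD ID LA IA.
have -> : `|u x| = 4 * l by rewrite /l mulrC divfK.
have r3 : r ^+ 3 = A / l `^ p.
  by rewrite /r -powR_mulrn ?powR_ge0// -powRrM mul1r mulVf// powRr1// divr_ge0// ?(ltW A0)// ltW.
have Al : l `^ (1 - p) * A = r ^+ 3 * l.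
  have -> : l `^ (1 - p) = l / l `^ p.
    by rewrite powRB; [rewrite powRr1 ?(ltW l0)|rewrite (gt_eqF l0) implybT].
  by rewrite r3; ring.
rewrite Al => h.
have h2 : r ^+ 3 * l <= (2 * r) `^ (3 + 2 * s) / l * D by move: h; clear; lra.
have D0 : 0 <= D by apply: le_trans ID; apply: Int_ge0 => y; exact: gq_ge0.
have {}h2 : l ^+ 2 <= 2 `^ (3 + 2 * s) * r `^ (2 * s) * D.
  have E : (2 * r) `^ (3 + 2 * s) = 2 `^ (3 + 2 * s) * r `^ (2 * s) * r ^+ 3.
    rewrite powRM ?(ltW r0)// -[X in _ = X]mulrA; congr (_ * _).
    by rewrite addrC powRD; [rewrite -[3]/(3%:R) powR_mulrn ?(ltW r0)|rewrite (gt_eqF r0) implybT].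
  have r30 : 0 < r ^+ 3 by exact: exprn_gt0.
  rewrite -(ler_pM2l r30) expr2 mulrA -ler_pdivlMr//.
  by apply: le_trans h2 _; rewrite E le_eqVlt; apply/orP; left; apply/eqP; ring.
have rs : r `^ (2 * s) = A `^ (2 * s / 3) / l `^ (2 * s * p / 3).
  rewrite /r -powRrM -/l powRM ?invr_ge0 ?(ltW lp0) ?(ltW A0)//.
  have -> : 1 / 3 * (2 * s) = 2 * s / 3 by ring.
  congr (_ * _); rewrite -powR_inv1 ?(ltW lp0)// -!powRrM -powRN; congr (_ `^ _); ring.
have q0 : 0 < l `^ (2 * s * p / 3) by exact: powR_gt0.
have -> : 4 * l / 4 = l by field.
rewrite powRD ?(gt_eqF l0) ?implybT// -[X in l `^ X * _]/(2%:R) powR_mulrn ?(ltW l0)//.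
rewrite -ler_pdivlMr//; apply: le_trans h2 _.
by rewrite rs le_eqVlt; apply/orP; left; apply/eqP; ring.
Qed.

End Cube.

Section Sobolev.
Variables (R : realType) (s : R).
Notation RR := (measurableTypeR R).
Notation T3 := (RR * RR * RR)%type.
Notation m3 := (mu3 R).
Notation m6 := (mu3 R \x mu3 R)%E.
Hypotheses (s0 : 0 < s) (s1 : s <= 1).

Definition dens (u : pt R -> R) (x : T3) : R := Int m3 (fun y : T3 => gq s u u (x, y)).

Lemma dens_ge0 u x : 0 <= dens u x.
Proof. by apply: Int_ge0 => y; exact: gq_ge0. Qed.

Lemma dens_L1 W u : inH s W u -> [/\ L1 m3 (dens u), Int m3 (dens u) = Int m6 (gq s u u) &
  {ae m3, forall x : T3, L1 m3 (fun y : T3 => gq s u u (x, y))}].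
Proof. by move=> Hu; exact: L1_fubini (inH_g Hu). Qed.

Lemma pow2s : 2 `^ (3 + 2 * s) <= 32 :> R.
Proof.
have hs0 := s0; have hs1 := s1.
have -> : 32 = 2 `^ 5%:R :> R by rewrite powR_mulrn// !exprS expr0; lra.
by apply: ler_powR; [rewrite ler1n|lra].
Qed.

Lemma m_absp (u : T3 -> R) p : measurable_fun setT u -> measurable_fun setT (fun x => `|u x| `^ p).
Proof.
move=> mu; apply: (measurableT_comp (measurable_powR p)).
exact: measurableT_comp.
Qed.

(** Quantified over all weights above [V0], so that the constant does not depend on the scaling
    parameter. *)
Definition Lp_bound (V0 p A : R) := forall (W : weight V0) u, inH s W u -> hform s W u u <= 1 ->
  L1 m3 (fun x : T3 => `|u x| `^ p) /\ Int m3 (fun x : T3 => `|u x| `^ p) <= A.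

Lemma L1_indicM (A : set T3) (f : T3 -> R) : measurable A -> L1 m3 f ->
  L1 m3 (fun x => \1_A x * f x).
Proof.
move=> mA Lf; apply: L1_dom (L1_abs Lf) _.
  by apply: measurable_funM; [exact: measurable_indic|exact: L1_meas Lf].
move=> x; rewrite normrM ger0_norm// ?indicE; case: (x \in A); rewrite ?mul1r ?mul0r//.
Qed.

Lemma Int_indicM (A : set T3) (f : T3 -> R) : measurable A -> L1 m3 f -> (forall x, 0 <= f x) ->
  Int m3 (fun x => \1_A x * f x) <= Int m3 f.
Proof.
move=> mA Lf f0; apply: Int_le => //; first exact: L1_indicM.
by move=> x; rewrite indicE; case: (x \in A); rewrite ?mul1r ?mul0r.
Qed.

(** [cube_sobolev] is integrated in [x]: its right side is a multiple of the Gagliardo density,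
    whose integral is at most the form. *)
Lemma Lp_step V0 p A : 0 < V0 -> 1 <= p -> Lp_bound V0 p A ->
  exists A', Lp_bound V0 (2 + 2 * s * p / 3) A'.
Proof.
have hs0 := s0; have hs1 := s1.
move=> V00 p1 hA; pose A1 := `|A| + 1; have A10 : 0 < A1 by rewrite /A1 ltr_wpDl.
pose p' := 2 + 2 * s * p / 3.
have p'0 : 0 < p'.
  have sp : 0 <= s * p by apply: mulr_ge0; lra.
  by rewrite /p'; lra.
pose c : R := 2 `^ (3 + 2 * s) * A1 `^ (2 * s / 3).
have c0 : 0 <= c by rewrite mulr_ge0 ?powR_ge0.
exists (4 `^ p' * c) => W u Hu u1.
have [Lu Iu] := hA W u Hu u1; have [LD ID aeD] := dens_L1 Hu.
have IA (Q : set T3) : measurable Q -> L1 m3 (fun y : T3 => \1_Q y * `|u y| `^ p) /\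
    Int m3 (fun y : T3 => \1_Q y * `|u y| `^ p) <= A1.
  move=> mQ; split; first exact: L1_indicM.
  apply: le_trans (Int_indicM mQ Lu _) _; first by move=> x; exact: powR_ge0.
  by apply: le_trans Iu _; rewrite /A1 (le_trans (ler_norm _))// lerDl.
have [L I] : L1 m3 (fun x : T3 => (`|u x| / 4) `^ p') /\
    Int m3 (fun x : T3 => (`|u x| / 4) `^ p') <= Int m3 (fun x => c * dens u x).
  apply: ae_Int_ge0.
  - by move=> x; exact: powR_ge0.
  - apply: (measurableT_comp (measurable_powR p')).
    apply: measurable_funM; last exact: measurable_cst.
    by apply: measurableT_comp => //; exact: inH_m Hu.
  - exact: L1Z.
  - apply: (aeS _ aeD) => x Lx.
    have [ux|ux] := eqVneq (u x) 0.
      by rewrite ux normr0 mul0r powR0 ?gt_eqF// mulr_ge0// dens_ge0.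
    have [LQ IQ] := IA _ (mQB x ((A1 / (`|u x| / 4) `^ p) `^ (1 / 3))).
    exact: (cube_sobolev s0 p1 A10 (inH_m Hu) ux Lx (lexx _) LQ IQ).
have E (x : T3) : `|u x| `^ p' = 4 `^ p' * (`|u x| / 4) `^ p'.
  by rewrite -powRM ?divr_ge0// mulrC divfK.
split; first by apply: eq_L1 (L1Z (4 `^ p') L) => x; rewrite E.
rewrite (eq_Int m3 E) IntZ// ler_wpM2l ?powR_ge0//.
apply: le_trans I _; rewrite IntZ// -[leRHS]mulr1 ler_wpM2l// ID.
exact: le_trans (gag_le_form Hu) u1.
Qed.

Lemma Lp_two V0 : 0 < V0 -> Lp_bound V0 2 V0^-1.
Proof.
move=> V00 W u Hu u1.
have E (x : T3) : `|u x| `^ 2 = u x ^+ 2.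
  by rewrite -[2]/(2%:R) powR_mulrn// real_normK// num_real.
split; first by apply: eq_L1 (inH_2 Hu) => x; rewrite E.
rewrite (eq_Int m3 E) -[leRHS]mulr1 ler_pdivlMl//.
exact: le_trans (L2_le_form Hu) u1.
Qed.

(* Bootstrap: a bound in L^p gives one in L^(2 + 2 s p / 3).  The fixed point of
   this iteration is the critical exponent, so finitely many steps pass q. *)
Lemma sobolev_exponent V0 q : 0 < V0 -> s < 1 -> q < 6 / (3 - 2 * s) ->
  exists p A : R, q <= p /\ Lp_bound V0 p A.
Proof.
have hs0 := s0; have hs1 := s1.
move=> V00 slt1 qs; pose ps : R := 6 / (3 - 2 * s).
have psE : ps = 2 + 2 * s / 3 * ps by rewrite /ps; field; lra.
pose t : R := 2 * s / 3; have t0 : 0 <= t by rewrite /t; lra.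
have t1 : t < 1 by rewrite /t; lra.
pose pn := fix pn n := if n is n'.+1 then 2 + 2 * s * pn n' / 3 else 2.
have pnE n : ps - pn n = t ^+ n * (ps - 2).
  elim: n => [|n IH]; first by rewrite expr0 mul1r.
  by rewrite exprS -mulrA -IH [LHS]/= {1}psE /t; field.
have pn1 n : 1 <= pn n.
  elim: n => [|n IH] /=; first by lra.
  have sp : 0 <= s * pn n by apply: mulr_ge0; lra.
  by lra.
have bound n : exists A, Lp_bound V0 (pn n) A.
  elim: n => [|n [A hA]]; first by exists V0^-1; exact: Lp_two.
  exact: Lp_step hA.
have tn0 : t ^+ n * (ps - 2) @[n --> \oo] --> 0.
  rewrite -(mul0r (ps - 2)); apply: cvgM; last exact: cvg_cst.
  by apply: cvg_expr; rewrite ger0_norm.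
have d0 : 0 < ps - q by rewrite subr_gt0.
have [n _ /(_ n (leqnn _))] := cvgr_lt 0 tn0 _ d0.
rewrite /= -pnE => h; have [A hA] := bound n.
by exists (pn n), A; split => //; lra.
Qed.

Lemma Lp_scaled V0 p A : Lp_bound V0 p A -> forall (W : weight V0) u (nu : R), 0 < nu ->
  inH s W u -> hform s W u u <= nu ^+ 2 ->
  L1 m3 (fun x : T3 => `|u x| `^ p) /\ Int m3 (fun x : T3 => `|u x| `^ p) <= A * nu `^ p.
Proof.
move=> hA W u nu nu0 Hu u1.
have Hv := inHZ nu^-1 Hu.
have [|Lv Iv] := hA W _ Hv.
  rewrite hformZ// hformC hformZ// mulrA -invfM ler_pdivrMl ?mulr1 -?expr2//.
  by rewrite exprn_gt0.
have E (x : T3) : `|u x| `^ p = nu `^ p * `|nu^-1 * u x| `^ p.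
  by rewrite -powRM ?(ltW nu0)// normrM ger0_norm ?invr_ge0 ?(ltW nu0)// mulrA divff ?gt_eqF// mul1r.
split; first by apply: eq_L1 (L1Z (nu `^ p) Lv) => x; rewrite E.
by rewrite (eq_Int m3 E) IntZ// mulrC ler_wpM2r ?powR_ge0.
Qed.

(** If the cube of [cube_sobolev] has side at most [1], it lies in the unit cube and carries mass at
    most [sig]. Otherwise [(|u x| / 4)^2 <= sig], and the excess power of [|u x|] is bounded by a
    power of [sig]; this case produces the term [u x ^+ 2]. *)
Lemma lions_pt u (x : pt R) (sig : R) : 0 < sig -> measurable_fun setT (u : T3 -> R) ->
  L1 m3 (fun y : T3 => u y ^+ 2) -> L1 m3 (fun y : T3 => gq s u u (x, y)) ->
  Int m3 (fun y : T3 => \1_(QB x 1) y * u y ^+ 2) <= sig ->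
  (`|u x| / 4) `^ (2 + 2 * s * 2 / 3) <= 32 * sig `^ (2 * s / 3) * (dens u x + u x ^+ 2).
Proof.
have hs0 := s0; have hs1 := s1.
move=> sig0 mu L2 LD Iu.
have d0 := dens_ge0 u x; have u20 := sqr_ge0 (u x).
have [ux|ux] := eqVneq (u x) 0.
  rewrite ux normr0 mul0r powR0; first by rewrite !mulr_ge0 ?powR_ge0// addr_ge0.
  by rewrite gt_eqF//; lra.
pose l := `|u x| / 4; have l0 : 0 < l by rewrite divr_gt0 ?normr_gt0.
pose r := (sig / l `^ 2) `^ (1 / 3).
have l2 : l `^ 2 = l ^+ 2 by rewrite -[2]/(2%:R) powR_mulrn ?(ltW l0).
have E2 (y : T3) : `|u y| `^ 2 = u y ^+ 2.
  by rewrite -[2]/(2%:R) powR_mulrn// real_normK// num_real.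
have [r1|r1] := leP r 1.
  have h : L1 m3 (fun y : T3 => \1_(QB x r) y * `|u y| `^ 2) -> Int m3 (fun y : T3 => \1_(QB x r) y * `|u y| `^ 2) <= sig ->
      (`|u x| / 4) `^ (2 + 2 * s * 2 / 3) <= 2 `^ (3 + 2 * s) * sig `^ (2 * s / 3) * dens u x.
    exact: (cube_sobolev s0 (ler1n R 2) sig0 mu ux LD (lexx _)).
  have {}h := h _ _; apply: (le_trans (h _ _)).
  - by apply: eq_L1 (L1_indicM (mQB x r) L2) => y; rewrite E2.
  - apply: le_trans Iu; apply: Int_le.
    + by apply: eq_L1 (L1_indicM (mQB x r) L2) => y; rewrite E2.
    + exact: L1_indicM (mQB x 1) L2.
    + move=> y; rewrite E2 ler_wpM2r ?sqr_ge0// !indicE ler_nat.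
      case: (boolP (y \in QB x r)) => //=; rewrite !inE => -[[h1 h2] h3].
      rewrite (_ : y \in _ = true)//; apply/mem_set; move: h1 h2 h3; rewrite /QB /= !in_itv /=.
      by move=> /andP[-> h1] /andP[-> h2] /andP[-> h3]; do !split => /=; apply: lt_le_trans (lerD (lexx _) r1).
  apply: (@le_trans _ _ (32 * sig `^ (2 * s / 3) * dens u x)).
    by apply: ler_wpM2r => //; apply: ler_wpM2r; [exact: powR_ge0|exact: pow2s].
  by apply: ler_wpM2l; [rewrite mulr_ge0 ?powR_ge0|rewrite lerDl].
have ls : l `^ 2 <= sig.
  rewrite leNgt; apply/negP => h; move: r1; rewrite ltNge => /negP; apply.
  have -> : 1 = (1 : R) `^ (1 / 3) by rewrite powR1.
  apply: ge0_ler_powR; rewrite ?nnegrE ?divr_ge0 ?powR_ge0 ?(ltW sig0)//.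
  by rewrite ler_pdivrMr ?powR_gt0// mul1r ltW.
rewrite -/l powRD; last by rewrite (gt_eqF l0) implybT.
have h1 : l `^ (2 * s * 2 / 3) <= sig `^ (2 * s / 3).
  have -> : 2 * s * 2 / 3 = 2 * (2 * s / 3) by ring.
  by rewrite powRrM; apply: ge0_ler_powR; rewrite ?nnegrE ?powR_ge0 ?(ltW sig0)//; lra.
rewrite [leRHS]mulrC; apply: ler_pM; rewrite ?powR_ge0//.
  rewrite l2 /l expr_div_n real_normK ?num_real//; lra.
by apply: le_trans h1 _; rewrite ler_peMl ?powR_ge0// ler1n.
Qed.

(** A quantitative form of the vanishing lemma of Lions: if no unit cube with corner in [O] carries
    much [L^2] mass, a higher power of [u] has a small integral over [O]. *)
Lemma lions V0 (W : weight V0) u (O : set T3) (sig : R) : 0 < sig -> measurable O -> inH s W u ->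
  (forall x, O x -> Int m3 (fun y : T3 => \1_(QB x 1) y * u y ^+ 2) <= sig) ->
  let p0 := 2 + 2 * s * 2 / 3 in
  L1 m3 (fun x : T3 => \1_O x * `|u x| `^ p0) /\
  Int m3 (fun x : T3 => \1_O x * `|u x| `^ p0) <=
    4 `^ p0 * 32 * sig `^ (2 * s / 3) * (1 + V0^-1) * hform s W u u.
Proof.
move=> sig0 mO Hu hO p0.
have V00 := wt_V0 W.
have [LD ID aeD] := dens_L1 Hu.
pose c := 4 `^ p0 * 32 * sig `^ (2 * s / 3).
have c0 : 0 <= c by rewrite !mulr_ge0 ?powR_ge0.
have Ls := L1D LD (inH_2 Hu).
have [L I] : L1 m3 (fun x : T3 => \1_O x * `|u x| `^ p0) /\
   Int m3 (fun x : T3 => \1_O x * `|u x| `^ p0) <= Int m3 (fun x : T3 => c * (dens u x + u x ^+ 2)).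
  apply: ae_Int_ge0.
  - by move=> x; rewrite mulr_ge0 ?powR_ge0.
  - apply: measurable_funM; first exact: measurable_indic.
    exact: m_absp (inH_m Hu).
  - exact: L1Z.
  - apply: (aeS _ aeD) => x Lx.
    have P0 : 0 <= c * (dens u x + u x ^+ 2) by rewrite mulr_ge0// addr_ge0 ?sqr_ge0 ?dens_ge0.
    rewrite indicE; have [|] := boolP (x \in O); last by rewrite mul0r.
    rewrite inE mul1r => /hO Ix.
    have -> : `|u x| `^ p0 = 4 `^ p0 * (`|u x| / 4) `^ p0.
      by rewrite -powRM ?divr_ge0// mulrC divfK.
    have := lions_pt sig0 (inH_m Hu) (inH_2 Hu) Lx Ix.
    have -> : c * (dens u x + u x ^+ 2) = 4 `^ p0 * (32 * sig `^ (2 * s / 3) * (dens u x + u x ^+ 2)) by rewrite /c; ring.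
    by apply: ler_wpM2l; exact: powR_ge0.
split => //; apply: le_trans I _; rewrite IntZ// -/c -mulrA ler_wpM2l//.
rewrite (IntD LD (inH_2 Hu)) ID mulrDl mul1r lerD ?gag_le_form//.
by rewrite ler_pdivlMl// L2_le_form.
Qed.

Lemma QB_gag2 c (r : R) x y : QB c r x -> QB c r y -> gag_kernel s x y <= (2 * r) `^ (3 + 2 * s).
Proof.
have hs0 := s0; have hs1 := s1.
move=> [[]] /=; rewrite !in_itv/= => /andP[? ?] /andP[? ?] /andP[? ?].
move=> [[]] /=; rewrite !in_itv/= => /andP[? ?] /andP[? ?] /andP[? ?].
have h : enorm (psub x y) <= 2 * r.
  apply: le_trans (enorm_le _) _; rewrite ler_pM2l// norm_pt_le /=; apply/and3P.
  by split; rewrite ler_norml; apply/andP; split; lra.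
apply: ge0_ler_powR => //; rewrite ?nnegrE ?enorm_ge0//; first by lra.
exact: le_trans (enorm_ge0 _) h.
Qed.

Lemma gq_cube u c (r : R) x y : 0 < r -> QB c r x -> QB c r y ->
  (u x - u y) ^+ 2 <= (2 * r) `^ (3 + 2 * s) * gq s u u (x, y).
Proof.
move=> r0 Qx Qy; rewrite gqE /=; have [->|xy] := eqVneq x y.
  by rewrite subrr expr0n/= mul0r mulr0.
have k0 := gag_gt0 s (elimN eqP xy).
by rewrite mulrA ler_pdivlMr// mulrC ler_wpM2r ?sqr_ge0// (QB_gag2 Qx Qy).
Qed.

Lemma pow_split (r : R) : 0 < r -> (2 * r) `^ (3 + 2 * s) <= 32 * r `^ (2 * s) * r ^+ 3.
Proof.
move=> r0; rewrite powRM ?(ltW r0)// addrC [r `^ _]powRD; last by rewrite (gt_eqF r0) implybT.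
have -> : r `^ 3 = r ^+ 3 by rewrite -[3]/(3%:R) powR_mulrn// ltW.
rewrite mulrA.
rewrite ler_wpM2r ?exprn_ge0 ?(ltW r0)// ler_wpM2r ?powR_ge0// addrC; exact: pow2s.
Qed.

(** Poincare inequality on a cube: the double integral of [(w x - w y)^2] over the cube equals twice
    [h^3] times the mass of [w], minus twice the square of its integral, and the kernel is at most
    [(2 h)^(3 + 2 s)] there. *)
Lemma QB_L2 V0 (W : weight V0) (w : pt R -> R) c (h : R) : 0 < h -> inH s W w ->
  L1 m6 (fun z => \1_(QB c h) z.1 * \1_(QB c h) z.2 * gq s w w z) /\
  h ^+ 3 * Int m3 (fun x : T3 => \1_(QB c h) x * w x ^+ 2) <=
    (Int m3 (fun x : T3 => \1_(QB c h) x * w x)) ^+ 2 +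
    (2 * h) `^ (3 + 2 * s) / 2 * Int m6 (fun z => \1_(QB c h) z.1 * \1_(QB c h) z.2 * gq s w w z).
Proof.
move=> h0 Hw; pose Q := QB c h; have mQ := mQB c h.
pose e (x : T3) : R := \1_Q x.
have me : measurable_fun setT e by exact: measurable_indic.
have e01 x : e x = 0 \/ e x = 1.
  by rewrite /e indicE; case: (x \in Q); [right|left].
have ee x : e x ^+ 2 = e x by case: (e01 x) => ->; rewrite ?expr0n ?expr1n.
have [Le Ie] := L1_QB c (ltW h0); rewrite -/Q in Le Ie.
have LeW : L1 m3 (fun x : T3 => e x * w x ^+ 2) by exact: L1_indicM mQ (inH_2 Hw).
have Lew : L1 m3 (fun x : T3 => e x * w x).
  apply: L1_mul => //; first exact: inH_m Hw.
    by apply: eq_L1 Le => x; rewrite ee.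
  exact: inH_2 Hw.
have mee : measurable_fun setT (fun z : T3 * T3 => e z.1 * e z.2).
  by apply: measurable_funM; [exact: m_fst|exact: m_snd].
have mw := inH_m Hw.
have Lg : L1 m6 (fun z => e z.1 * e z.2 * gq s w w z).
  apply: L1_dom (inH_g Hw) _; first by apply: measurable_funM => //; exact: m_gq.
  move=> z; rewrite normrM (ger0_norm (gq_ge0 _ _ _)).
  by case: (e01 z.1) => ->; case: (e01 z.2) => ->; rewrite ?(mul0r, mulr0, normr0, mul1r, normr1) ?gq_ge0.
split; first exact: Lg.
pose F (z : T3 * T3) : R := e z.1 * e z.2 * (w z.1 - w z.2) ^+ 2.
have FG z : 0 <= F z <= (2 * h) `^ (3 + 2 * s) * (e z.1 * e z.2 * gq s w w z).
  rewrite /F; have p0 := powR_ge0 (2 * h) (3 + 2 * s); have g0 := gq_ge0 s w z; have q0 := sqr_ge0 (w z.1 - w z.2).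
  rewrite /e !indicE; have [z1|_] := boolP (z.1 \in Q); last by rewrite !mul0r mulr0 lexx.
  have [z2|_] := boolP (z.2 \in Q); last by rewrite !mulr0 !mul0r mulr0 lexx.
  rewrite !mul1r q0 /=; have := @gq_cube w c h z.1 z.2 h0; rewrite -surjective_pairing; apply; exact: set_mem.
have mF : measurable_fun setT F.
  apply: measurable_funM => //; apply: measurable_funX.
  by apply: measurable_funB; [exact: m_fst|exact: m_snd].
have LF : L1 m6 F.
  apply: L1_dom (L1Z ((2 * h) `^ (3 + 2 * s)) Lg) _ => // z.
  by have /andP[F0 F1] := FG z; rewrite ger0_norm.
pose S := Int m3 (fun x : T3 => e x * w x ^+ 2); pose m := Int m3 (fun x : T3 => e x * w x).
have inner x : Int m3 (fun y : T3 => F (x, y)) = e x * w x ^+ 2 * h ^+ 3 - 2 * m * (e x * w x) + e x * S.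
  have -> : Int m3 (fun y : T3 => F (x, y)) =
     Int m3 (fun y => (e x * w x ^+ 2 * e y + (- 2 * e x * w x) * (e y * w y)) + e x * (e y * w y ^+ 2)).
    by apply: eq_Int => y; rewrite /F /=; ring.
  rewrite IntD ?IntD ?IntZ//; do ?[exact: L1Z|by apply: L1D; exact: L1Z].
  by rewrite Ie /S /m; ring.
have [_ EF _] := L1_fubini LF.
have E : Int m6 F = 2 * (h ^+ 3 * S) - 2 * m ^+ 2.
  rewrite -EF (eq_Int m3 inner).
  have -> : Int m3 (fun x => e x * w x ^+ 2 * h ^+ 3 - 2 * m * (e x * w x) + e x * S) =
     Int m3 (fun x => (h ^+ 3 * (e x * w x ^+ 2) + (- 2 * m) * (e x * w x)) + S * e x).
    by apply: eq_Int => x; ring.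
  rewrite IntD ?IntD ?IntZ//; do ?[exact: L1Z|by apply: L1D; exact: L1Z].
  by rewrite Ie -/S -/m; ring.
have : Int m6 F <= (2 * h) `^ (3 + 2 * s) * Int m6 (fun z => e z.1 * e z.2 * gq s w w z).
  rewrite -IntZ//; apply: Int_le => //; first exact: L1Z.
  by move=> z; have /andP[] := FG z.
rewrite E /m /S /e /Q; clear -h0; set A := Int _ _; set B := Int _ _; set C := Int _ _; lra.
Qed.

Definition gcell (a h : R) (t : R) (i : nat) : R := \1_(`[a + i%:R * h, a + i%:R * h + h[%classic : set R) t.

Lemma gcell_sum a h t n : 0 < h -> \sum_(i < n) gcell a h t i = \1_(`[a, a + n%:R * h[%classic : set R) t.
Proof.
move=> h0; elim: n => [|n IH].
  rewrite big_ord0 mul0r addr0 indicE set_itv_ge ?in_set0//.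
  by rewrite bnd_simp ltxx.
rewrite big_ord_recr /= IH /gcell !indicE -natrD.
congr (_%:R).
have nh : 0 <= n%:R * h by rewrite mulr_ge0// ltW.
have -> : a + n.+1%:R * h = a + n%:R * h + h by rewrite -natr1; ring.
set b := a + n%:R * h; have ab : a <= b by rewrite lerDl.
have [tb|tb] := ltP t b.
  rewrite [X in (_ + nat_of_bool X)%N](_ : _ = false); last first.
    by apply/negbTE/negP; rewrite inE/= in_itv/= leNgt tb.
  rewrite addn0; congr (nat_of_bool _); apply/idP/idP; rewrite !inE/= !in_itv/= => /andP[-> _] //=.
  by rewrite (lt_trans tb)// ltrDl.
rewrite [X in (nat_of_bool X + _)%N](_ : _ = false); last first.
  by apply/negbTE/negP; rewrite inE/= in_itv/= ltNge tb andbF.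
rewrite add0n; congr (nat_of_bool _); apply/idP/idP; rewrite !inE/= !in_itv/= => /andP[h1 h2].
  by rewrite (le_trans ab tb).
by rewrite tb.
Qed.

Definition corner (c : pt R) (h : R) (n : nat) (i : 'I_n * 'I_n * 'I_n) : pt R :=
  (c.1.1 + i.1.1%:R * h, c.1.2 + i.1.2%:R * h, c.2 + i.2%:R * h).

Lemma QB_gcell c h n i (y : T3) : \1_(QB (@corner c h n i) h) y =
  gcell c.1.1 h y.1.1 i.1.1 * gcell c.1.2 h y.1.2 i.1.2 * gcell c.2 h y.2 i.2 :> R.
Proof.
rewrite /gcell !indicE -!natrM; congr (_%:R); rewrite !mulnb; congr (nat_of_bool _).
apply/idP/idP; first by rewrite inE => -[[/= h1 h2] h3]; apply/andP; split; [apply/andP; split|]; apply/mem_set.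
by rewrite inE => /andP[/andP[/set_mem h1 /set_mem h2] /set_mem h3]; split.
Qed.

Lemma grid_prod n (F1 F2 F3 : nat -> R) :
  \sum_(i : 'I_n * 'I_n * 'I_n) F1 i.1.1 * F2 i.1.2 * F3 i.2 =
  (\sum_(i < n) F1 i) * (\sum_(i < n) F2 i) * (\sum_(i < n) F3 i).
Proof.
rewrite !mulr_suml.
under [RHS]eq_bigr => i _ do rewrite [F1 i * _]mulr_sumr mulr_suml.
under [RHS]eq_bigr => i _ do under eq_bigr => j _ do rewrite mulr_sumr.
by rewrite pair_big/= pair_big/=; apply: eq_bigr => -[[i j] k] _.
Qed.

Lemma grid_sum c (h : R) n (y : T3) : 0 < h ->
  \sum_i \1_(QB (@corner c h n i) h) y = \1_(QB c (n%:R * h)) y :> R.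
Proof.
move=> h0; under eq_bigr do rewrite QB_gcell.
rewrite (grid_prod n (gcell c.1.1 h y.1.1) (gcell c.1.2 h y.1.2) (gcell c.2 h y.2)) !gcell_sum//.
rewrite !indicE -!natrM; congr (_%:R); rewrite !mulnb; congr (nat_of_bool _).
apply/idP/idP; last by rewrite inE => -[[/= h1 h2] h3]; apply/andP; split; [apply/andP; split|]; apply/mem_set.
by rewrite inE => /andP[/andP[/set_mem h1 /set_mem h2] /set_mem h3]; split.
Qed.

Lemma grid_sum2 c (h : R) n (x y : T3) : 0 < h ->
  0 <= \sum_i (\1_(QB (@corner c h n i) h) x * \1_(QB (corner c h i) h) y : R) <= 1.
Proof.
move=> h0; apply/andP; split; first by apply: sumr_ge0 => i _; rewrite mulr_ge0.
apply: (@le_trans _ _ (\sum_i (\1_(QB (@corner c h n i) h) x : R))).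
  apply: ler_sum => i _; rewrite ler_piMr// indicE; by case: (_ \in _).
by rewrite grid_sum// indicE; case: (_ \in _).
Qed.

(** The quantitative core of a local Rellich theorem: weak convergence will make the finitely many
    cell integrals small, and the remainder is small with the mesh [h]. *)
Lemma grid_L2 V0 (W : weight V0) (w : pt R -> R) c (h : R) n : 0 < h -> inH s W w ->
  Int m3 (fun x : T3 => \1_(QB c (n%:R * h)) x * w x ^+ 2) <=
    (h ^+ 3)^-1 * \sum_(i : 'I_n * 'I_n * 'I_n) (Int m3 (fun x : T3 => \1_(QB (corner c h i) h) x * w x)) ^+ 2 +
    16 * h `^ (2 * s) * hform s W w w.
Proof.
move=> h0 Hw; have h30 : 0 < h ^+ 3 by exact: exprn_gt0.
pose q i := QB (@corner c h n i) h.
have LI i : L1 m3 (fun x : T3 => \1_(q i) x * w x ^+ 2) by exact: L1_indicM (mQB _ _) (inH_2 Hw).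
have -> : Int m3 (fun x : T3 => \1_(QB c (n%:R * h)) x * w x ^+ 2) = \sum_i Int m3 (fun x : T3 => \1_(q i) x * w x ^+ 2).
  by rewrite -Int_sum//; apply: eq_Int => x; rewrite -mulr_suml grid_sum.
have LG i : L1 m6 (fun z => \1_(q i) z.1 * \1_(q i) z.2 * gq s w w z) by exact: (QB_L2 _ h0 Hw).1.
have SG : \sum_i Int m6 (fun z => \1_(q i) z.1 * \1_(q i) z.2 * gq s w w z) <= hform s W w w.
  rewrite -Int_sum; last exact: LG.
  apply: le_trans (gag_le_form Hw); apply: Int_le; [exact: L1_sum|exact: inH_g Hw|].
  move=> z; rewrite -mulr_suml ler_piMl ?gq_ge0//.
  by have /andP[] := grid_sum2 c n z.1 z.2 h0.
have c0 : 0 <= 16 * h `^ (2 * s) by rewrite mulr_ge0// powR_ge0.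
apply: (@le_trans _ _ (\sum_i ((h ^+ 3)^-1 * (Int m3 (fun x : T3 => \1_(q i) x * w x)) ^+ 2 +
    16 * h `^ (2 * s) * Int m6 (fun z => \1_(q i) z.1 * \1_(q i) z.2 * gq s w w z)))); last first.
  by rewrite big_split /= -!mulr_sumr lerD2l; apply: ler_wpM2l.
apply: ler_sum => i _; have [_] := QB_L2 (corner c h i) h0 Hw.
rewrite -/(q i); set I := Int m3 _; set J := Int m3 _; set G := Int m6 _ => k.
have G0 : 0 <= G by apply: Int_ge0 => z; apply: mulr_ge0; [exact: mulr_ge0|exact: gq_ge0].
rewrite -(ler_pM2l h30) mulrDr mulrA divff ?gt_eqF// mul1r.
apply: le_trans k _; rewrite lerD2l.
have := ler_wpM2r G0 (pow_split h0).
set P := (2 * h) `^ _; clear; lra.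
Qed.

Lemma sqr_tri (a b c : R) : (a - b) ^+ 2 <= 2 * ((a - c) ^+ 2 + (b - c) ^+ 2).
Proof.
rewrite -subr_ge0; have -> : 2 * ((a - c) ^+ 2 + (b - c) ^+ 2) - (a - b) ^+ 2 = (a - c + (b - c)) ^+ 2 by ring.
exact: sqr_ge0.
Qed.

Lemma cube_shift (x a : pt R) (r : R) : 0 < r -> 3 * `|a| <= r ->
  exists2 c : pt R, QB c r x & QB c r (x + a).
Proof.
move=> r0 ar; exists (x.1.1 - `|a|, x.1.2 - `|a|, x.2 - `|a|).
  have an := normr_ge0 a.
  by do !split => /=; rewrite in_itv/=; apply/andP; split; lra.
have [] := norm_pt_c a; rewrite !ler_norml => /andP[b1 b2] /andP[b3 b4] /andP[b5 b6].
by do !split => /=; rewrite in_itv/=; apply/andP; split; lra.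
Qed.

Lemma cube_diff (u : pt R -> R) (c x x' : pt R) (r : R) : 0 < r -> QB c r x -> QB c r x' ->
  L1 m3 (fun y : T3 => gq s u u (x, y)) -> L1 m3 (fun y : T3 => gq s u u (x', y)) ->
  (u x' - u x) ^+ 2 <= 64 * r `^ (2 * s) * (dens u x' + dens u x).
Proof.
move=> r0 Qx Qx' L1x L1x'; pose P := (2 * r) `^ (3 + 2 * s).
have P0 : 0 <= P by exact: powR_ge0.
have [LQ IQ] := L1_QB c (ltW r0).
have ptw (y : T3) : (u x' - u x) ^+ 2 * \1_(QB c r) y <= 2 * P * (gq s u u (x', y) + gq s u u (x, y)).
  have g1 := gq_ge0 s u ((x', y) : T3 * T3); have g2 := gq_ge0 s u ((x, y) : T3 * T3).
  rewrite indicE; have [/set_mem Qy|_] := boolP (y \in QB c r); last first.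
    by rewrite mulr0; exact: (mulr_ge0 (mulr_ge0 (ler0n R 2) P0) (addr_ge0 g1 g2)).
  rewrite mulr1; have h1 := gq_cube u r0 Qx' Qy; have h2 := gq_cube u r0 Qx Qy.
  apply: le_trans (sqr_tri _ _ (u y)) _.
  by have := ler_wpM2l (ler0n R 2) (lerD h1 h2); rewrite -/P -(mulrDr P) (mulrA 2 P); apply.
have LS := L1D L1x' L1x.
have h : (u x' - u x) ^+ 2 * r ^+ 3 <= 2 * P * (dens u x' + dens u x).
  rewrite -IQ -(IntZ _ LQ) /dens -(IntD L1x' L1x) -(IntZ _ LS).
  apply: Int_le; [exact: L1Z LQ|exact: L1Z LS|exact: ptw].
have r30 : 0 < r ^+ 3 by exact: exprn_gt0.
rewrite -(ler_pM2r r30); apply: le_trans h _.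
have D0 : 0 <= dens u x' + dens u x by apply: addr_ge0; exact: dens_ge0.
have := ler_wpM2r D0 (pow_split r0); rewrite -/P; set D := _ + _; clear; lra.
Qed.

(** [x] and [x + a] lie in a common cube of side [r]. Comparing both values with [u y] and averaging
    over [y] in the cube bounds the difference by the densities at the two points. *)
Lemma shift_L2 V0 (W : weight V0) (u : pt R -> R) (a : pt R) (r : R) : 0 < r -> 3 * `|a| <= r ->
  inH s W u -> L1 m3 (fun x : T3 => (u ((x : pt R) + a) - u x) ^+ 2) /\
  Int m3 (fun x : T3 => (u ((x : pt R) + a) - u x) ^+ 2) <= 128 * r `^ (2 * s) * Int m6 (gq s u u).
Proof.
move=> r0 ar Hu; have [LD ID aeD] := dens_L1 Hu.
have Pa := preserves_shift a; have mP := Pa.1.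
have [LDa IDa] := preserves_L1 Pa LD.
have mua := measurableT_comp (inH_m Hu) mP.
have aeDa : {ae m3, forall x : T3, L1 m3 (fun y : T3 => gq s u u ((x : pt R) + a, y))}.
  case: aeD => N [mN N0 NP]; exists ((fun x : T3 => (x : pt R) + a) @^-1` N); split.
  - by rewrite -[X in measurable X]setTI; exact: mP.
  - by case: Pa => _ ->.
  - by move=> x /= nx; exact: NP.
have [L I] : L1 m3 (fun x : T3 => (u ((x : pt R) + a) - u x) ^+ 2) /\
    Int m3 (fun x : T3 => (u ((x : pt R) + a) - u x) ^+ 2) <= Int m3 (fun x : T3 => 64 * r `^ (2 * s) * (dens u ((x : pt R) + a) + dens u x)).
  apply: ae_Int_ge0.
  - by move=> x; exact: sqr_ge0.
  - by apply: measurable_funX; apply: measurable_funB; [exact: mua|exact: inH_m Hu].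
  - exact: L1Z (L1D LDa LD).
  - apply: (aeS _ (aeI aeD aeDa)) => x [L1x L1a].
    have [c Qx Qxa] := cube_shift x r0 ar.
    exact: cube_diff r0 Qx Qxa L1x L1a.
split; first exact: L.
have E2 := etrans (IntD LDa LD) (f_equal2 +%R (etrans IDa ID) ID).
have E := etrans (IntZ (64 * r `^ (2 * s)) (L1D LDa LD)) (f_equal ( *%R _) E2).
apply: (le_trans I); rewrite [leLHS]E; clear.
by set I6 := Int _ _; rewrite le_eqVlt; apply/orP; left; apply/eqP; ring.
Qed.
End Sobolev.

(** * Cutoff functions *)

Section Kernel.
Variables (R : realType) (s : R).
Notation RR := (measurableTypeR R).
Notation T3 := (RR * RR * RR)%type.
Notation m3 := (mu3 R).
Notation m6 := (mu3 R \x mu3 R)%E.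
Hypotheses (s0 : 0 < s) (s1 : s < 1).

(** Majorizes, up to a constant, the Gagliardo kernel weighted by the squared increment of a cutoff
    at scale [r]: that increment is bounded and is Lipschitz with constant of order [1 / r]. *)
Definition kf (r : R) (x y : pt R) : R := Num.min 1 (`|x - y| ^+ 2 / r ^+ 2) / gag_kernel s x y.

Lemma kfC r x y : kf r x y = kf r y x.
Proof. by rewrite /kf gagC distrC. Qed.

Lemma kf_ge0 r x y : 0 <= kf r x y.
Proof. by rewrite divr_ge0 ?gag_ge0// le_min ler01 divr_ge0// sqr_ge0. Qed.

Lemma kf_shift r x y : kf r x y = kf r 0 (y - x).
Proof.
rewrite kfC /kf sub0r normrN /gag_kernel; congr (_ / (_ `^ _)).
rewrite /enorm /psub /=; congr Num.sqrt.
by congr (_ + _ + _); rewrite /= sub0r sqrrN.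
Qed.

Lemma m_norm (f : T3 * T3 -> pt R) :
  measurable_fun setT (fun t => (f t).1.1) -> measurable_fun setT (fun t => (f t).1.2) ->
  measurable_fun setT (fun t => (f t).2) -> measurable_fun setT (fun t => `|f t|).
Proof.
move=> m1 m2 m3; under eq_fun do rewrite norm_ptE.
by apply: measurable_maxr; [apply: measurable_maxr|]; apply: measurableT_comp.
Qed.

Lemma m_kf r : measurable_fun setT (fun z : T3 * T3 => kf r z.1 z.2).
Proof.
apply: measurable_funM; last exact: m_gagV.
apply: measurable_minr; first exact: measurable_cst.
apply: measurable_funM; last exact: measurable_cst.
apply: measurable_funX; apply: m_norm; rewrite /=; apply: measurable_funB.
- exact: (m_fst (@m_c1 R)). - exact: (m_snd (@m_c1 R)). - exact: (m_fst (@m_c2 R)).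
- exact: (m_snd (@m_c2 R)). - exact: (m_fst (@m_c3 R)). - exact: (m_snd (@m_c3 R)).
Qed.

Lemma m_kf0 r : measurable_fun setT (kf r 0 : T3 -> R).
Proof.
have h : measurable_fun setT (fun y : T3 => ((0, 0, 0), y) : T3 * T3).
  by apply: measurable_fun_pair; [exact: measurable_cst|exact: measurable_id].
exact: (measurableT_comp (m_kf r) h).
Qed.

Lemma kf_far r (z : pt R) (t : R) : 0 < t -> t <= `|z| -> kf r 0 z <= t `^ (- (3 + 2 * s)).
Proof.
move=> t0 tz; have hs := s0.
have z0 : 0 < `|z| by exact: lt_le_trans t0 tz.
have g0 : t `^ (3 + 2 * s) <= gag_kernel s 0 z.
  apply: ge0_ler_powR; rewrite ?nnegrE ?enorm_ge0 ?(ltW t0)//; first by lra.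
  by apply: le_trans tz _; apply: le_trans (le_enorm _); rewrite psubE sub0r normrN.
have p0 : 0 < t `^ (3 + 2 * s) by exact: powR_gt0.
rewrite powRN -[leRHS]mul1r; apply: ler_pM.
- by rewrite le_min ler01 divr_ge0// sqr_ge0.
- by rewrite invr_ge0 gag_ge0.
- by rewrite ge_min lexx.
- by rewrite lef_pV2// posrE (lt_le_trans p0).
Qed.

Lemma kf_near r (z : pt R) (t a : R) : 0 < r -> 0 < t -> t <= `|z| -> `|z| <= a ->
  kf r 0 z <= a ^+ 2 / r ^+ 2 * t `^ (- (3 + 2 * s)).
Proof.
move=> r0 t0 tz za; have hs := s0.
have z0 : 0 < `|z| by exact: lt_le_trans t0 tz.
have g0 : t `^ (3 + 2 * s) <= gag_kernel s 0 z.
  apply: ge0_ler_powR; rewrite ?nnegrE ?enorm_ge0 ?(ltW t0)//; first by lra.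
  by apply: le_trans tz _; apply: le_trans (le_enorm _); rewrite psubE sub0r normrN.
have p0 : 0 < t `^ (3 + 2 * s) by exact: powR_gt0.
rewrite powRN; apply: ler_pM.
- by rewrite le_min ler01 divr_ge0// sqr_ge0.
- by rewrite invr_ge0 gag_ge0.
- rewrite ge_min; apply/orP; right; rewrite sub0r normrN ler_wpM2r ?invr_ge0 ?sqr_ge0//.
  by rewrite ler_pXn2r// nnegrE// (le_trans _ za).
- by rewrite lef_pV2// posrE (lt_le_trans p0).
Qed.

Definition cb (t : R) : set T3 := QB (- t, - t, - t) (2 * t).

Lemma cb_norm t (z : pt R) : `|z| < t -> cb t z.
Proof.
move=> zt; have [] := norm_pt_c z => h1 h2 h3.
have k (a : R) : `|a| <= `|z| -> - t <= a < - t + 2 * t.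
  by move=> /le_lt_trans /(_ zt); rewrite ltr_norml => /andP[? ?]; apply/andP; split; lra.
by split; [split|]; rewrite /= in_itv/=; exact: k.
Qed.

Lemma dyadic_shell (t : R) n : 1 <= t -> t < 2 ^+ n -> exists2 j : 'I_n, 2 ^+ j <= t & t < 2 ^+ j.+1.
Proof.
move=> t1; elim: n => [|n IH]; first by rewrite expr0 ltNge t1.
have [/IH[j h1 h2] _|h h'] := ltP t (2 ^+ n); first by exists (widen_ord (leqnSn n) j).
by exists ord_max.
Qed.

Lemma geom_sum_le (x : R) n : 0 <= x < 1 -> \sum_(j < n) x ^+ j <= (1 - x)^-1.
Proof.
move=> /andP[x0 x1]; have d : 0 < 1 - x by rewrite subr_gt0.
rewrite -[leRHS]mulr1 ler_pdivlMl//.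
have -> : (1 - x) * \sum_(j < n) x ^+ j = 1 - x ^+ n.
  elim: n => [|n IH]; first by rewrite big_ord0 mulr0 expr0 subrr.
  by rewrite big_ord_recr /= mulrDr IH exprS; ring.
by rewrite gerBl exprn_ge0.
Qed.

Lemma powR_exp (a x : R) (j : nat) : 0 <= a -> (a ^+ j) `^ x = (a `^ x) ^+ j.
Proof. by move=> a0; rewrite -(powR_mulrn j a0) -(powR_mulrn j (powR_ge0 a x)) powRAC. Qed.

Lemma pow2_lt (x y : R) : x < y -> 2 `^ x < 2 `^ y.
Proof.
move=> xy; rewrite /powR pnatr_eq0 /= ltr_expR ltr_pM2r// ln_gt0// ltr1n//.
Qed.

Definition kfar (r : R) (j : nat) : R := (r * 2 ^+ j) `^ (- (3 + 2 * s)).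
Definition knear (r : R) (j : nat) : R := (r / 2 ^+ j) ^+ 2 / r ^+ 2 * (r / 2 ^+ j.+1) `^ (- (3 + 2 * s)).

Lemma kf_shells (r : R) (z : pt R) n : 0 < r -> r / 2 ^+ n < `|z| -> `|z| < r * 2 ^+ n ->
  kf r 0 z <= \sum_(j < n) (kfar r j * \1_(cb (r * 2 ^+ j.+1)) z) +
              \sum_(j < n) (knear r j * \1_(cb (2 * r / 2 ^+ j)) z).
Proof.
move=> r0 zl zu.
have p2 k : 0 < (2 : R) ^+ k by exact: exprn_gt0.
have F0 : 0 <= \sum_(j < n) (kfar r j * \1_(cb (r * 2 ^+ j.+1)) z).
  by apply: sumr_ge0 => j _; rewrite mulr_ge0// powR_ge0.
have knear0 j : 0 <= knear r j by rewrite mulr_ge0 ?powR_ge0// divr_ge0// sqr_ge0.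
have N0 : 0 <= \sum_(j < n) (knear r j * \1_(cb (2 * r / 2 ^+ j)) z).
  by apply: sumr_ge0 => j _; rewrite mulr_ge0.
have z0 : 0 < `|z| by apply: le_lt_trans zl; rewrite divr_ge0 ?(ltW r0)// ltW.
have [rz|zr] := leP r `|z|.
  have [j] : exists2 j : 'I_n, 2 ^+ j <= `|z| / r & `|z| / r < 2 ^+ j.+1.
    by apply: dyadic_shell; [rewrite ler_pdivlMr// mul1r|rewrite ltr_pdivrMr// mulrC].
  rewrite ler_pdivlMr// ltr_pdivrMr// => h1 h2; rewrite mulrC in h1; rewrite mulrC in h2.
  rewrite -[leLHS]addr0; apply: lerD => //; rewrite (bigD1 j)//= -[leLHS]addr0; apply: lerD.
    have -> : \1_(cb (r * 2 ^+ j.+1)) z = 1 :> R by rewrite indicE mem_set//; exact: cb_norm.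
    by rewrite mulr1; apply: kf_far => //; rewrite mulr_gt0.
  by apply: sumr_ge0 => i _; rewrite mulr_ge0// powR_ge0.
have [j] : exists2 j : 'I_n, 2 ^+ j <= r / `|z| & r / `|z| < 2 ^+ j.+1.
  apply: dyadic_shell; first by rewrite ler_pdivlMr// mul1r ltW.
  by rewrite ltr_pdivrMr// mulrC -ltr_pdivrMr.
rewrite ler_pdivlMr// ltr_pdivrMr// => h1 h2.
rewrite -[leLHS]add0r; apply: lerD => //; rewrite (bigD1 j)//= -[leLHS]addr0; apply: lerD.
  have -> : \1_(cb (2 * r / 2 ^+ j)) z = 1 :> R.
    rewrite indicE mem_set//; apply: cb_norm; rewrite ltr_pdivlMr// mulrC.
    by apply: le_lt_trans h1 _; rewrite ltr_pMl// ltr1n.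
  rewrite mulr1; apply: kf_near => //; first by rewrite divr_gt0.
    by rewrite ler_pdivrMr// mulrC ltW.
  by rewrite ler_pdivlMr// mulrC.
by apply: sumr_ge0 => i _; rewrite mulr_ge0.
Qed.

Lemma L1_cb t : 0 <= t -> L1 m3 (\1_(cb t) : T3 -> R) /\ Int m3 (\1_(cb t) : T3 -> R) = 8 * t ^+ 3.
Proof.
move=> t0; have [|L ->] := L1_QB (- t, - t, - t) (r := 2 * t); first by rewrite mulr_ge0.
by split => //; ring.
Qed.

Definition kap (r : R) : R := Int m3 (kf r 0 : T3 -> R).
(** The sums of two geometric series over dyadic shells: the far shells have ratio [2^(- 2 s)],
    below [1] because [s > 0], and the near ones [2^(2 s) / 4], below [1] because [s < 1]. The
    constant [2048] is [512 * 4], since [2^(2 s) < 4]. *)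
Definition Ckap : R := 64 * (1 - 2 `^ (- (2 * s)))^-1 + 2048 * (1 - 2 `^ (2 * s) / 4)^-1.

Lemma kap_bound (r : R) : 0 < r -> L1 m3 (kf r 0 : T3 -> R) /\ kap r <= Ckap * r `^ (- (2 * s)).
Proof.
move=> r0; have hs := s0; have hs1 := s1.
have p2 k : 0 < (2 : R) ^+ k by exact: exprn_gt0.
pose G n (z : T3) : R := \sum_(j < n) (kfar r j * \1_(cb (r * 2 ^+ j.+1)) z) +
              \sum_(j < n) (knear r j * \1_(cb (2 * r / 2 ^+ j)) z).
have cbr j : 0 <= r * 2 ^+ j by rewrite mulr_ge0 ?(ltW r0)// ltW.
have cbr2 j : 0 <= 2 * r / 2 ^+ j by rewrite divr_ge0 ?mulr_ge0 ?(ltW r0)// ltW.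
have L1f j : L1 m3 (fun z : T3 => kfar r j * \1_(cb (r * 2 ^+ j.+1)) z) by apply: L1Z; have [] := L1_cb (cbr j.+1).
have L1n j : L1 m3 (fun z : T3 => knear r j * \1_(cb (2 * r / 2 ^+ j)) z) by apply: L1Z; have [] := L1_cb (cbr2 j).
have LG n : L1 m3 (G n) by apply: L1D; apply: L1_sum.
have powE (c : R) : 0 < c -> c ^+ 3 * c `^ (- (3 + 2 * s)) = c `^ (- (2 * s)).
  move=> c0; have -> : c ^+ 3 = c `^ 3 by rewrite -[3]/(3%:R) powR_mulrn// ltW.
  rewrite -powRD; last by rewrite (gt_eqF c0) implybT.
  by congr (_ `^ _); ring.
pose q1 : R := 2 `^ (- (2 * s)); pose q2 : R := 2 `^ (2 * s) / 4.
have q10 : 0 <= q1 < 1.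
  rewrite powR_ge0 /= -[ltRHS](powRr0 2); apply: pow2_lt; lra.
have E4 : 4 = 2 `^ 2 :> R by rewrite -[X in 2 `^ X]/(2%:R) powR_mulrn//; ring.
have q24 : 2 `^ (2 * s) < 4 :> R by rewrite E4; apply: pow2_lt; lra.
have q20 : 0 <= q2 < 1.
  by rewrite divr_ge0 ?powR_ge0//= ltr_pdivrMr// mul1r.
have If j : Int m3 (fun z : T3 => kfar r j * \1_(cb (r * 2 ^+ j.+1)) z) = 64 * r `^ (- (2 * s)) * q1 ^+ j.
  have [L I] := L1_cb (cbr j.+1); rewrite IntZ// I /kfar.
  have -> : 8 * (r * 2 ^+ j.+1) ^+ 3 = 64 * (r * 2 ^+ j) ^+ 3 by rewrite [2 ^+ j.+1]exprS; move: (2 ^+ j) => P; ring.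
  have -> (a b : R) : a * (64 * b) = 64 * (b * a) by ring.
  rewrite powE ?mulr_gt0// powRM ?(ltW r0) ?(ltW (p2 _))// mulrA; congr (_ * _).
  exact: powR_exp.
have In j : Int m3 (fun z : T3 => knear r j * \1_(cb (2 * r / 2 ^+ j)) z) = 512 * r `^ (- (2 * s)) * 2 `^ (2 * s) * q2 ^+ j.
  have [L I] := L1_cb (cbr2 j); rewrite IntZ// I /knear.
  pose c : R := r / 2 ^+ j.+1; have c0 : 0 < c by rewrite divr_gt0.
  have E1 : (2 * r / 2 ^+ j) ^+ 3 = 64 * c ^+ 3.
    rewrite /c [2 ^+ j.+1]exprS; have := p2 j; move: (2 ^+ j) => P P0; field; rewrite gt_eqF//.
  have E2 : (r / 2 ^+ j) ^+ 2 / r ^+ 2 = 4^-1 ^+ j.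
    have -> : 4^-1 ^+ j = (2 ^+ j) ^- 2 :> R.
      by rewrite -exprM mulnC exprM exprVn; congr (_ ^- j); ring.
    have := p2 j; move: (2 ^+ j) => P P0; field; rewrite !gt_eqF//.
  rewrite E1 E2 -/c.
  have -> : 4^-1 ^+ j * c `^ (- (3 + 2 * s)) * (8 * (64 * c ^+ 3)) = 512 * 4^-1 ^+ j * (c ^+ 3 * c `^ (- (3 + 2 * s))) by ring.
  rewrite powE// /c powRM ?(ltW r0) ?invr_ge0 ?(ltW (p2 _))//.
  have -> : (2 ^+ j.+1)^-1 `^ (- (2 * s)) = 2 `^ (2 * s) * (2 `^ (2 * s)) ^+ j :> R.
    by rewrite -exprS -powR_exp// -powR_inv1 ?(ltW (p2 _))// -powRrM mulrNN mul1r.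
  by rewrite /q2 expr_div_n exprVn; ring.
have rs0 : 0 <= r `^ (- (2 * s)) by exact: powR_ge0.
have IG n : Int m3 (G n) <= Ckap * r `^ (- (2 * s)).
  rewrite IntD; [|exact: L1_sum|exact: L1_sum]; rewrite !Int_sum//.
  rewrite (eq_bigr _ (fun (j : 'I_n) _ => If j)) (eq_bigr _ (fun (j : 'I_n) _ => In j)) -!mulr_sumr.
  have g0 : 0 <= 512 * r `^ (- (2 * s)) by exact: (mulr_ge0 (ler0n R 512) rs0).
  have S0 : 0 <= \sum_(j < n) q2 ^+ j by apply: sumr_ge0 => j _; rewrite exprn_ge0//; case/andP: q20.
  have h0 := ler_wpM2l rs0 (geom_sum_le n q10).
  have h1 := ler_wpM2l rs0 (geom_sum_le n q20).
  have h2 := ler_wpM2l (mulr_ge0 g0 S0) (ltW q24).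
  rewrite /Ckap -/q1 -/q2; move: h0 h1 h2.
  set S1 := \sum_(_ < _) q1 ^+ _; set S2 := \sum_(_ < _) q2 ^+ _; set T1 := (1 - q1)^-1; set T2 := (1 - q2)^-1.
  set P := r `^ _; set Q := 2 `^ _; clear; lra.
(* Truncation to finitely many shells, where [G n] dominates; Fatou removes it. *)
pose f n (z : T3) : R := \1_[set z : T3 | r / 2 ^+ n < `|z : pt R| < r * 2 ^+ n] z * kf r 0 z.
have fG n z : 0 <= f n z <= G n z.
  rewrite /f indicE; have [/set_mem /= /andP[h1 h2]|_] := boolP (z \in _).
    by rewrite mul1r kf_ge0 /=; exact: kf_shells.
  rewrite mul0r lexx /=; apply: addr_ge0; apply: sumr_ge0 => j _; rewrite mulr_ge0 ?powR_ge0//.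
  by rewrite mulr_ge0 ?powR_ge0// divr_ge0// sqr_ge0.
have mnorm : measurable_fun setT (fun z : T3 => `|z : pt R|).
  by apply: m_continuous; exact: norm_continuous.
have mf n : measurable_fun setT (f n).
  apply: measurable_funM; last exact: m_kf0.
  apply: measurable_indic.
  have -> : [set z : T3 | r / 2 ^+ n < `|z : pt R| < r * 2 ^+ n] = setT `&` (fun z : T3 => `|z : pt R|) @^-1` `]r / 2 ^+ n, r * 2 ^+ n[.
    by rewrite setTI; apply/seteqP; split => z /=; rewrite in_itv.
  by apply: mnorm => //; exact: measurable_itv.
have Lf n : L1 m3 (f n).
  by apply: L1_dom (LG n) _ => // z; have /andP[h1 h2] := fG n z; rewrite ger0_norm.
apply: (@fatou_bound _ _ _ m3 f) => //.
- by move=> n z; have /andP[] := fG n z.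
- move=> n; apply: le_trans (IG n); apply: Int_le => // z; by have /andP[] := fG n z.
- exact: m_kf0.
- apply: aeW => z.
  have [->|z0] := eqVneq (z : pt R) 0.
    have E : kf r 0 0 = 0 by rewrite /kf subrr normr0 expr0n/= mul0r min_r// mul0r.
    by rewrite /f E; under eq_fun do rewrite mulr0; exact: cvg_cst.
  have nz : 0 < `|z : pt R| by rewrite normr_gt0.
  have cvg2 : (2 : R)^-1 ^+ n @[n --> \oo] --> 0.
    by apply: cvg_expr; rewrite ger0_norm ?invr_ge0// invf_lt1// ltr1n.
  have d0 : 0 < Num.min (`|z : pt R| / r) (r / `|z : pt R|) by rewrite lt_min !divr_gt0.
  have [N _ NP] := cvgr_lt 0 cvg2 _ d0.
  apply: (@cvg_near_cst); exists N => // n /NP /=; rewrite lt_min exprVn => /andP[h1 h2].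
  rewrite /f indicE mem_set ?mul1r//=; apply/andP; split.
    by rewrite mulrC -ltr_pdivlMr.
  by move: h2; rewrite ltr_pdivlMr// mulrC ltr_pdivrMr// mulrC.
- by move=> z; exact: kf_ge0.
Qed.

Lemma L1_kf (r : R) (h : T3 -> R) : 0 < r -> (forall x, 0 <= h x) -> L1 m3 h ->
  [/\ L1 m6 (fun z => h z.1 * kf r z.1 z.2), Int m6 (fun z => h z.1 * kf r z.1 z.2) = kap r * Int m3 h,
      L1 m6 (fun z => h z.2 * kf r z.1 z.2) & Int m6 (fun z => h z.2 * kf r z.1 z.2) = kap r * Int m3 h].
Proof.
move=> r0 h0 Lh; have [Lk _] := kap_bound r0.
have mF : measurable_fun setT (fun z : T3 * T3 => h z.1 * kf r z.1 z.2).
  by apply: measurable_funM; [exact: m_fst (L1_meas Lh)|exact: m_kf].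
have F0 (z : T3 * T3) : 0 <= h z.1 * kf r z.1 z.2 by apply: mulr_ge0 => //; exact: kf_ge0.
have inner (x : T3) : L1 m3 (fun y : T3 => kf r x y) /\ Int m3 (fun y : T3 => kf r x y) = kap r.
  have [L I] := preserves_L1 (preserves_shift (- (x : pt R))) Lk.
  split; first by apply: eq_L1 L => y; exact: esym (kf_shift r x y).
  by rewrite (eq_Int m3 (fun y => kf_shift r x y)).
have L6 : L1 m6 (fun z => h z.1 * kf r z.1 z.2).
  apply: L1_tonelli => //.
  have -> : (fun x : T3 => (\int[m3]_y (h x * kf r x y)%:E)%E) = (fun x => (kap r * h x)%:E).
    apply/funext => x; have [L I] := inner x.
    by rewrite (L1_EFin (L1Z (h x) L)) (IntZ _ L) I mulrC.
  by rewrite L1_EFin ?ltry//; exact: L1Z.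
have I6 : Int m6 (fun z => h z.1 * kf r z.1 z.2) = kap r * Int m3 h.
  have [_ <- _] := L1_fubini L6; rewrite -IntZ//; apply: eq_Int => x /=.
  by have [L I] := inner x; rewrite (IntZ _ L) I mulrC.
have [L7 I7] := L1_swap F0 L6.
have E (z : T3 * T3) : h z.2 * kf r z.2 z.1 = h z.2 * kf r z.1 z.2 by rewrite kfC.
split; [exact: L6|exact: I6|exact: eq_L1 E L7|].
by rewrite -(eq_Int m6 E) -I6; exact: I7.
Qed.

Lemma inH_bump V0 (W : weight V0) (phi : pt R -> R) (A : set T3) (C r : R) : 0 < r ->
  measurable_fun setT (phi : T3 -> R) -> L1 m3 (\1_A : T3 -> R) -> measurable A -> 0 <= C ->
  (forall x y, (phi x - phi y) ^+ 2 <= C * (\1_A x + \1_A y) * Num.min 1 (`|x - y| ^+ 2 / r ^+ 2)) ->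
  (forall x, phi x ^+ 2 <= C * \1_A x) -> (forall x, A x -> W x <= C) -> inH s W phi.
Proof.
move=> r0 mp LA mA C0 pg p2 WC.
have W0 x : 0 <= W x := wt_ge0 W x.
have [L1a _ L1b _] := L1_kf r0 (fun x : T3 => ler0n R (x \in A)) LA.
split => //.
- apply: L1_dom (L1Z C LA) _; first exact: measurable_funX.
  by move=> x; rewrite ger0_norm ?sqr_ge0.
- apply: L1_dom (L1Z C (L1D L1a L1b)) _; first exact: m_gq.
  move=> z; rewrite ger0_norm ?gq_ge0// gqE /kf -mulrDl mulrA mulrA ler_wpM2r ?invr_ge0 ?gag_ge0//.
- apply: L1_dom (L1Z (C * C) LA) _.
    by apply: measurable_funM; [exact: wt_m|exact: measurable_funX].
  move=> x; rewrite ger0_norm; last by apply: mulr_ge0; [exact: W0|exact: sqr_ge0].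
  have := p2 x; rewrite indicE; have [/set_mem Ax|_] := boolP (x \in A).
    by rewrite !mulr1 => h; apply: ler_pM => //; [exact: sqr_ge0|exact: WC].
  rewrite !mulr0 => h; have -> : phi x ^+ 2 = 0 by apply/le_anti; rewrite h sqr_ge0.
  by rewrite mulr0.
Qed.

Definition clamp01 (t : R) : R := Num.max 0 (Num.min 1 t).

Lemma clamp01P t : 0 <= clamp01 t <= 1.
Proof. by rewrite /clamp01 le_max lexx /= ge_max ler01 ge_min lexx. Qed.

Lemma clamp01_lip t t' : `|clamp01 t - clamp01 t'| <= `|t - t'|.
Proof.
have k1 (x y : R) : `|Num.min 1 x - Num.min 1 y| <= `|x - y|.
  have := ler_norm (x - y); have := ler_norm (y - x); rewrite (distrC y x).
  by have [h1|h1] := leP 1 x; have [h2|h2] := leP 1 y; rewrite ler_norml => *; apply/andP; split; lra.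
have k2 (x y : R) : `|Num.max 0 x - Num.max 0 y| <= `|x - y|.
  have := ler_norm (x - y); have := ler_norm (y - x); rewrite (distrC y x).
  by have [h1|h1] := leP 0 x; have [h2|h2] := leP 0 y; rewrite ler_norml => *; apply/andP; split; lra.
exact: le_trans (k2 _ _) (k1 _ _).
Qed.

Lemma clamp01_0 t : t <= 0 -> clamp01 t = 0.
Proof. by move=> t0; rewrite /clamp01 max_l// ge_min t0 orbT. Qed.

Lemma clamp01_1 t : 1 <= t -> clamp01 t = 1.
Proof. by move=> t1; rewrite /clamp01 min_l// max_r. Qed.

Section Cutoff.
Variables (c : pt R) (r : R).
Hypothesis r0 : 0 < r.

Definition zeta (x : pt R) : R := clamp01 ((`|x - c| - r) / r).
(* Rational functions of [zeta] with [xic ^ 2 + etac ^ 2 = 1]. *)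
Definition xic (x : pt R) : R := (1 - zeta x ^+ 2) / (1 + zeta x ^+ 2).
Definition etac (x : pt R) : R := 2 * zeta x / (1 + zeta x ^+ 2).

Let d0 (x : pt R) : 1 + zeta x ^+ 2 != 0.
Proof. by rewrite gt_eqF// ltr_wpDr// sqr_ge0. Qed.

Lemma xic_etac x : xic x ^+ 2 + etac x ^+ 2 = 1.
Proof. by rewrite /xic /etac; field; exact: d0. Qed.

Lemma xic_in x : `|x - c| <= r -> xic x = 1 /\ etac x = 0.
Proof.
move=> h; have z0 : zeta x = 0 by apply: clamp01_0; rewrite pmulr_lle0 ?invr_gt0// subr_le0.
by rewrite /xic /etac z0 expr0n/= subr0 addr0 divr1 mulr0 mul0r.
Qed.

Lemma xic_out x : 2 * r <= `|x - c| -> xic x = 0 /\ etac x = 1.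
Proof.
move=> h; have z0 : zeta x = 1 by apply: clamp01_1; rewrite ler_pdivlMr//; lra.
by rewrite /xic /etac z0 expr1n subrr mul0r; split => //; field.
Qed.

Lemma xic_le x : 0 <= xic x <= 1.
Proof.
have /andP[h1 h2] := clamp01P ((`|x - c| - r) / r); rewrite -/(zeta x) in h1 h2.
have h3 : zeta x ^+ 2 <= 1 by rewrite expr_le1.
have h4 := sqr_ge0 (zeta x).
rewrite /xic divr_ge0 ?subr_ge0 ?addr_ge0//= ler_pdivrMr ?ltr_wpDr//; lra.
Qed.

Lemma etac_le x : 0 <= etac x <= 1.
Proof.
have /andP[h1 h2] := clamp01P ((`|x - c| - r) / r); rewrite -/(zeta x) in h1 h2.
have h4 := sqr_ge0 (zeta x); have h5 := sqr_ge0 (1 - zeta x); rewrite sqrrB expr1n mul1r in h5.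
by rewrite /etac divr_ge0 ?mulr_ge0 ?addr_ge0//= ler_pdivrMr ?ltr_wpDr//; lra.
Qed.

Lemma zeta_lip x y : (zeta x - zeta y) ^+ 2 <= Num.min 1 (`|x - y| ^+ 2 / r ^+ 2).
Proof.
have /andP[h1 h2] := clamp01P ((`|x - c| - r) / r); rewrite -/(zeta x) in h1 h2.
have /andP[h3 h4] := clamp01P ((`|y - c| - r) / r); rewrite -/(zeta y) in h3 h4.
rewrite le_min; apply/andP; split.
  by rewrite -(real_normK (num_real _)) expr_le1// ler_norml; apply/andP; split; lra.
rewrite -expr_div_n -(real_normK (num_real (zeta x - zeta y))) ler_pXn2r ?nnegrE ?divr_ge0 ?(ltW r0)//.
apply: le_trans (clamp01_lip _ _) _.
rewrite -mulrBl normrM [X in _ * X]ger0_norm ?invr_ge0 ?(ltW r0)// ler_wpM2r ?invr_ge0 ?(ltW r0)//.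
have -> : `|x - c| - r - (`|y - c| - r) = `|x - c| - `|y - c| by ring.
apply: le_trans (ler_dist_dist _ _) _.
by rewrite opprB addrA subrK.
Qed.

Definition ldef (x y : pt R) : R := (xic x - xic y) ^+ 2 + (etac x - etac y) ^+ 2.

Lemma ldef_le x y : 0 <= ldef x y <= 4 * Num.min 1 (`|x - y| ^+ 2 / r ^+ 2).
Proof.
rewrite /ldef addr_ge0 ?sqr_ge0//=.
(* [(xic, etac)] runs on the unit circle, and its rational parametrization makes the squared chord
   an explicit multiple of [(zeta x - zeta y)^2]. *)
have E : ldef x y = 4 * (zeta x - zeta y) ^+ 2 / ((1 + zeta x ^+ 2) * (1 + zeta y ^+ 2)).
  by rewrite /ldef /xic /etac; field; rewrite !d0.
rewrite -/(ldef x y) E; have h := zeta_lip x y.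
have z0 := sqr_ge0 (zeta x - zeta y).
have q0 : 1 <= (1 + zeta x ^+ 2) * (1 + zeta y ^+ 2).
  have a := sqr_ge0 (zeta x); have b := sqr_ge0 (zeta y); have := mulr_ge0 a b; lra.
rewrite ler_pdivrMr; last by apply: lt_le_trans q0.
apply: (@le_trans _ _ (4 * Num.min 1 (`|x - y| ^+ 2 / r ^+ 2) * 1)); first by rewrite mulr1 ler_wpM2l.
by apply: ler_wpM2l => //; rewrite mulr_ge0//; apply: le_trans h.
Qed.

Lemma m_zeta : measurable_fun setT (zeta : T3 -> R).
Proof.
have h : measurable_fun setT (fun x : T3 => (`|(x : pt R) - c| - r) / r).
  apply: measurable_funM; last exact: measurable_cst.
  apply: measurable_funB; last exact: measurable_cst.
  apply: (@m_continuous R (fun x : pt R => `|x - c|)) => x.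
  by apply: cvg_norm; apply: cvgB; [exact: cvg_id|exact: cvg_cst].
by apply: measurable_maxr; [exact: measurable_cst|apply: measurable_minr => //; exact: measurable_cst].
Qed.

Let mV : measurable_fun setT (fun x : T3 => (1 + zeta x ^+ 2)^-1).
Proof.
have -> : (fun x : T3 => (1 + zeta x ^+ 2)^-1) = (fun x => (1 + zeta x ^+ 2) `^ (-1)).
  by apply/funext => z; rewrite powR_inv1 ?addr_ge0 ?sqr_ge0.
apply: (measurableT_comp (measurable_powR (-1))).
by apply: measurable_funD; [exact: measurable_cst|apply: measurable_funX; exact: m_zeta].
Qed.

Lemma m_xic : measurable_fun setT (xic : T3 -> R).
Proof.
apply: measurable_funM; last exact: mV.
by apply: measurable_funB; [exact: measurable_cst|apply: measurable_funX; exact: m_zeta].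
Qed.

Lemma m_etac : measurable_fun setT (etac : T3 -> R).
Proof.
apply: measurable_funM; last exact: mV.
by apply: measurable_funM; [exact: measurable_cst|exact: m_zeta].
Qed.

Section IMS.
Variables (V0 : R) (W : weight V0) (u : pt R -> R).
Hypothesis Hu : inH s W u.
Let u1 (x : pt R) := xic x * u x.
Let u2 (x : pt R) := etac x * u x.

Lemma ims_gq (z : T3 * T3) : gq s u1 u1 z + gq s u2 u2 z =
  gq s u u z + u z.1 * u z.2 * ldef z.1 z.2 / gag_kernel s z.1 z.2.
Proof.
rewrite !gqE -!mulrDl; congr (_ / _); rewrite /u1 /u2 /ldef.
have := xic_etac z.1; have := xic_etac z.2.
set a := xic z.1; set b := etac z.1; set a' := xic z.2; set b' := etac z.2; set U := u z.1; set U' := u z.2.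
move=> E2 E1.
have -> : (a * U - a' * U') ^+ 2 + (b * U - b' * U') ^+ 2 =
  (a ^+ 2 + b ^+ 2) * U ^+ 2 + (a' ^+ 2 + b' ^+ 2) * U' ^+ 2 - 2 * U * U' * (a * a' + b * b') by ring.
have -> : (U - U') ^+ 2 + U * U' * ((a - a') ^+ 2 + (b - b') ^+ 2) =
  U ^+ 2 + U' ^+ 2 - 2 * U * U' * (a * a' + b * b') + U * U' * ((a ^+ 2 + b ^+ 2) + (a' ^+ 2 + b' ^+ 2) - 2) by ring.
by rewrite E1 E2; ring.
Qed.

Let err (z : T3 * T3) : R := u z.1 * u z.2 * ldef z.1 z.2 / gag_kernel s z.1 z.2.
Let dom (z : T3 * T3) : R := 2 * (u z.1 ^+ 2 * kf r z.1 z.2 + u z.2 ^+ 2 * kf r z.1 z.2).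

Lemma err_dom z : `|err z| <= dom z.
Proof.
have /andP[l0 l1] := ldef_le z.1 z.2.
have k0 : 0 <= (gag_kernel s z.1 z.2)^-1 by rewrite invr_ge0 gag_ge0.
rewrite /err /dom normrM (ger0_norm k0) /kf -mulrDl mulrA mulrA ler_wpM2r//.
rewrite normrM (ger0_norm l0) normrM.
set m := Num.min _ _ in l1 *.
have n0 : 0 <= `|u z.1| * `|u z.2| by rewrite mulr_ge0.
apply: (@le_trans _ _ (`|u z.1| * `|u z.2| * (4 * m))); first by rewrite ler_wpM2l.
have m0 : 0 <= m by lra.
rewrite -(real_normK (num_real (u z.1))) -(real_normK (num_real (u z.2))).
have := mulr_ge0 m0 (sqr_ge0 (`|u z.1| - `|u z.2|)); lra.
Qed.

Let mu1 : measurable_fun setT (u1 : T3 -> R).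
Proof. exact: measurable_funM m_xic (inH_m Hu). Qed.
Let mu2' : measurable_fun setT (u2 : T3 -> R).
Proof. exact: measurable_funM m_etac (inH_m Hu). Qed.

Let Ldom : L1 m6 dom /\ Int m6 dom = 4 * kap r * Int m3 (fun x : T3 => u x ^+ 2).
Proof.
have [La Ia Lb Ib] := L1_kf r0 (fun x : T3 => sqr_ge0 (u x)) (inH_2 Hu).
split; first exact: L1Z (L1D La Lb).
by rewrite IntZ ?IntD ?Ia ?Ib//; [ring|exact: L1D].
Qed.

Let cut_le x : 0 <= u1 x ^+ 2 <= u x ^+ 2 /\ 0 <= u2 x ^+ 2 <= u x ^+ 2.
Proof.
have k (a U : R) : 0 <= a <= 1 -> 0 <= (a * U) ^+ 2 <= U ^+ 2.
  move=> /andP[a0 a1]; rewrite sqr_ge0 exprMn /= ler_piMl ?sqr_ge0// expr_le1//.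
by split; apply: k; [exact: xic_le|exact: etac_le].
Qed.

Let cut_inH (v : pt R -> R) : measurable_fun setT (v : T3 -> R) ->
  (forall x, 0 <= v x ^+ 2 <= u x ^+ 2) -> (forall z, gq s v v z <= gq s u1 u1 z + gq s u2 u2 z) -> inH s W v.
Proof.
move=> mv vu gv; split => //.
- apply: L1_dom (inH_2 Hu) _; first exact: measurable_funX.
  by move=> x; have /andP[h1 h2] := vu x; rewrite ger0_norm.
- apply: L1_dom (L1D (inH_g Hu) Ldom.1) _; first exact: m_gq.
  move=> z; rewrite ger0_norm ?gq_ge0//; apply: le_trans (gv z) _; rewrite ims_gq lerD2l.
  exact: le_trans (ler_norm _) (err_dom z).
- apply: L1_dom (inH_W Hu) _.
    by apply: measurable_funM; [exact: wt_m|exact: measurable_funX].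
  move=> x; have /andP[h1 h2] := vu x; have W0 := wt_ge0 W x.
  by rewrite ger0_norm; [exact: ler_wpM2l|exact: mulr_ge0].
Qed.

(* The fractional analogue of the IMS localization formula. *)
Lemma ims : [/\ inH s W (fun x => xic x * u x), inH s W (fun x => etac x * u x) &
  `|hform s W (fun x => xic x * u x) (fun x => xic x * u x) +
    hform s W (fun x => etac x * u x) (fun x => etac x * u x) - hform s W u u| <=
  4 * kap r * Int m3 (fun x : T3 => u x ^+ 2)].
Proof.
have H1 : inH s W u1.
  apply: cut_inH => // x; first by have [] := cut_le x.
  by rewrite lerDl gq_ge0.
have H2 : inH s W u2.
  apply: cut_inH => // x; first by have [] := cut_le x.
  by rewrite lerDr gq_ge0.
split => //.
have Lerr : L1 m6 err.
  apply: eq_L1 (L1B (L1D (inH_g H1) (inH_g H2)) (inH_g Hu)) => z.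
  by rewrite ims_gq addrC addKr.
have E : hform s W u1 u1 + hform s W u2 u2 - hform s W u u = Int m6 err.
  rewrite !hformE.
  have EW : Int m3 (fun x : T3 => W x * u1 x ^+ 2) + Int m3 (fun x : T3 => W x * u2 x ^+ 2) = Int m3 (fun x : T3 => W x * u x ^+ 2).
    rewrite -IntD; [|exact: inH_W H1|exact: inH_W H2]; apply: eq_Int => x.
    rewrite /u1 /u2; move: (xic x) (etac x) (xic_etac x) => a b E.
    by rewrite -[u x ^+ 2]mul1r -E; ring.
  have EG : Int m6 (gq s u1 u1) + Int m6 (gq s u2 u2) = Int m6 (gq s u u) + Int m6 err.
    rewrite -IntD; [|exact: inH_g H1|exact: inH_g H2]; rewrite -IntD//; last exact: inH_g Hu.
    by apply: eq_Int => z; rewrite ims_gq.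
  by move: EW EG; lra.
rewrite -/u1 -/u2 E -Ldom.2; apply: Int_abs_le => //; first exact: Ldom.1.
exact: err_dom.
Qed.
End IMS.
End Cutoff.
End Kernel.

(** * The energy functional *)

Section Scalar.
Variable R : realType.

Lemma unif_cont_compact (E : normedModType R) (A : set E) (h : E -> R) (e : R) : continuous h -> compact A -> 0 < e ->
  exists2 d : R, 0 < d & forall x y, A x -> `|y - x| <= d -> `|h y - h x| <= e.
Proof.
move=> ch /compact_near_coveringP cA e0.
pose P (d : R) (x : E) := forall y, `|y - x| <= d -> `|h y - h x| <= e.
have : \forall d \near (0 : R)^'+, A `<=` P d.
  apply: cA => x Ax; have e2 : 0 < e / 2 by rewrite divr_gt0.
  have /cvgrPdist_le /(_ _ e2) /nbhs_ballP[r /= r0 hr] := ch x.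
  have r2 : 0 < r / 2 by rewrite divr_gt0.
  exists (ball x (r / 2), [set d : R | d < r / 2]).
    split => /=; first by apply/nbhs_ballP; exists (r / 2).
    exact: nbhs_right_lt.
  move=> [x' d] /= [xx' dr] y yx'.
  have h1 : `|h x - h x'| <= e / 2.
    by apply: hr; apply: le_ball xx'; lra.
  have h2 : `|h x - h y| <= e / 2.
    apply: hr; rewrite -ball_normE /=; rewrite -ball_normE /= in xx'.
    have -> : x - y = (x - x') - (y - x') by rewrite opprB addrA subrK.
    apply: le_lt_trans (ler_normB _ _) _; lra.
  have -> : h y - h x' = (h x - h x') - (h x - h y) by ring.
  by apply: le_trans (ler_normB _ _) _; lra.
move=> [r /= r0 hr]; exists (r / 2); first by rewrite divr_gt0.
move=> x y Ax xy; apply: (hr (r / 2)) => //; last by rewrite divr_gt0.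
by rewrite /= sub0r normrN gtr0_norm ?divr_gt0//; lra.
Qed.

Lemma seg_compact (T : R) : compact [set t : R | `|t| <= T].
Proof.
have -> : [set t : R | `|t| <= T] = `[- T, T]%classic by apply/seteqP; split => t /=; rewrite in_itv/= ler_norml.
exact: segment_compact.
Qed.

Lemma bounded_seg (h : R -> R) (T : R) : continuous h -> exists2 S : R, 0 < S & forall t, `|t| <= T -> `|h t| <= S.
Proof.
move=> ch; have [T0|T0] := ltP T 0; first by exists 1 => // t; have := normr_ge0 t; lra.
have cabs : {within `[- T, T], continuous (fun t => `|h t|)}.
  by apply: continuous_subspaceT => t; apply: cvg_norm; exact: ch.
have [|c _ hc] := EVT_max _ cabs; first by lra.
exists (`|h c| + 1); first by rewrite ltr_wpDl.
move=> t tT; apply: (@le_trans _ _ `|h c|); last by rewrite lerDl.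
by apply: hc; rewrite in_itv/= -ler_norml.
Qed.

Lemma mean_value (H h : R -> R) : (forall t : R, is_derive t 1 H (h t)) -> forall a b : R,
  exists c : R, [/\ `|c - a| <= `|b - a|, Num.min a b <= c, c <= Num.max a b & H b - H a = h c * (b - a)].
Proof.
move=> dH; have cH : continuous H.
  by move=> t; apply: differentiable_continuous; apply/derivable1_diffP; have [] := dH t.
have main (a b : R) : a <= b -> exists2 c : R, a <= c <= b & H b - H a = h c * (b - a).
  move=> ab; have [|c] := MVT_segment ab (fun x _ => dH x); first exact: continuous_subspaceT.
  by rewrite in_itv/= => cab E; exists c.
move=> a b; have [ab|ba] := leP a b.
  have [c /andP[h1 h2] E] := main a b ab; exists c; split => //.
  by rewrite !ger0_norm ?subr_ge0// lerD2r.
have [c /andP[h1 h2] E] := main b a (ltW ba); exists c; split => //.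
  by rewrite !ler0_norm ?subr_le0 ?(ltW ba)// lerN2 lerD2r.
by rewrite -opprB E -mulrN opprB.
Qed.

Record scal (p : R) (h H : R -> R) : Prop := Scal {
  sc_c : continuous h;
  sc_0 : forall l : R, 0 < l -> exists2 d : R, 0 < d & forall t, `|t| <= d -> `|h t| <= l * `|t|;
  sc_oo : forall l : R, 0 < l -> exists2 T : R, 0 < T & forall t, T <= `|t| -> `|h t| <= l * `|t| `^ (p - 1);
  sc_neg : forall t, t <= 0 -> h t = 0;
  sc_pos : forall t, 0 <= h t;
  sc_H : forall t : R, is_derive t 1 H (h t);
  sc_H0 : forall t, t <= 0 -> H t = 0 }.

Section ScalLemmas.
Variables (p : R) (h H : R -> R).
Hypotheses (p2 : 2 < p) (hs : scal p h H).

(** Replaces a Lipschitz bound for a merely continuous [h]. When [|a - b| >= e], the term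
    [C * |a - b|] absorbs the bounded part of [h]. When it is smaller, the smallness at [0] and at
    infinity is used, or in between uniform continuity with error [l * d], where
    [d <= |a| + |b|]. *)
Lemma scal_lip (l : R) : 0 < l -> exists2 C : R, 0 < C & forall a b,
  `|h a - h b| <= l * (`|a| + `|b| + `|a| `^ (p - 1) + `|b| `^ (p - 1)) + C * `|a - b|.
Proof.
move=> l0; have [d d0 hd] := sc_0 hs l0; have [T T0 hT] := sc_oo hs l0.
have [S S0 hS] := bounded_seg T (sc_c hs).
have bnd t : `|h t| <= l * `|t| `^ (p - 1) + S.
  have [tT|tT] := leP `|t| T; first by rewrite (le_trans (hS _ tT))// lerDr mulr_ge0 ?powR_ge0// ltW.
  by rewrite (le_trans (hT _ (ltW tT)))// lerDl ltW.
have [e0 e00 he0] := unif_cont_compact (sc_c hs) (@seg_compact (T + 1)) (mulr_gt0 l0 d0).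
pose e := Num.min e0 1; have ep : 0 < e by rewrite lt_min e00 ltr01.
have [ee0 e1] : e <= e0 /\ e <= 1 by rewrite !ge_min !lexx ?orbT.
exists (2 * S / e); first by rewrite divr_gt0 ?mulr_gt0.
move=> a b.
have pa := powR_ge0 `|a| (p - 1); have pb := powR_ge0 `|b| (p - 1).
have na := normr_ge0 a; have nb := normr_ge0 b.
have lpa := mulr_ge0 (ltW l0) pa; have lpb := mulr_ge0 (ltW l0) pb.
have lna := mulr_ge0 (ltW l0) na; have lnb := mulr_ge0 (ltW l0) nb.
have [eab|eab] := leP e `|a - b|.
  have : 2 * S <= 2 * S / e * `|a - b|.
    by rewrite -mulrA -[leLHS]mulr1 ler_wpM2l ?mulr_ge0 ?(ltW S0)// mulrC ler_pdivlMr// mul1r.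
  have := ler_normB (h a) (h b); have := bnd a; have := bnd b; lra.
have C0 : 0 <= 2 * S / e * `|a - b|.
  by apply: mulr_ge0 => //; apply: divr_ge0; [apply: mulr_ge0 => //; exact: ltW|exact: ltW].
suff : `|h a - h b| <= l * (`|a| + `|b| + `|a| `^ (p - 1) + `|b| `^ (p - 1)) by lra.
have [h1|h1] := leP (Num.max `|a| `|b|) d.
  move: h1; rewrite ge_max => /andP[/hd h1 /hd h2].
  have := ler_normB (h a) (h b); lra.
have h2 : d <= `|a| + `|b| by move: h1; rewrite lt_max => /orP[] /ltW ?; [rewrite ler_wpDr|rewrite ler_wpDl].
have {}h2 := ler_wpM2l (ltW l0) h2.
have [aT|aT] := leP `|a| (T + 1).
  have : `|h b - h a| <= l * d by apply: he0 => //; rewrite distrC; lra.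
  rewrite distrC; lra.
have bT : T <= `|b|.
  have := ler_normD (a - b) b; rewrite subrK; lra.
have := ler_normB (h a) (h b); have := hT _ bT; have := hT a; lra.
Qed.

Lemma scal_bound : exists2 C : R, 0 < C & forall t, `|h t| <= C * (`|t| + `|t| `^ (p - 1)).
Proof.
have [C C0 hC] := scal_lip ltr01; exists (C + 1); first by rewrite ltr_wpDl// ltW.
move=> t; have := hC t 0; have p1 : p - 1 != 0 by rewrite gt_eqF//; have := p2; lra.
rewrite (sc_neg hs (lexx 0)) !subr0 normr0 powR0// !addr0.
have pt := powR_ge0 `|t| (p - 1); have := mulr_ge0 (ltW C0) pt; lra.
Qed.

(** Only the range between [d] and [T] needs the last term, and there any positive power dominates a
    constant. The free exponent [r] is later the one of [lions], or [dp d] itself. *)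
Lemma scal_pow (r l : R) : 0 < r -> 0 < l -> exists2 C : R, 0 < C & forall t,
  h t * t <= l * (t ^+ 2 + `|t| `^ p) + C * `|t| `^ r.
Proof.
move=> r0 l0; have [d d0 hd] := sc_0 hs l0; have [T T0 hT] := sc_oo hs l0.
have [S S0 hS] := bounded_seg T (sc_c hs).
have dr := powR_gt0 r d0.
have C0 : 0 < S * T / d `^ r by rewrite divr_gt0// mulr_gt0.
exists (S * T / d `^ r) => // t.
have t2 := sqr_ge0 t; have tp := powR_ge0 `|t| p; have tr := powR_ge0 `|t| r.
have l2 := mulr_ge0 (ltW l0) t2; have lp := mulr_ge0 (ltW l0) tp; have lr := mulr_ge0 (ltW C0) tr.
have : h t * t <= `|h t| * `|t| by rewrite -normrM ler_norm.
have [td|td] := leP `|t| d.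
  have := ler_wpM2r (normr_ge0 t) (hd t td); rewrite -(mulrA l) -[`|t| * `|t|]expr2 real_normK ?num_real//; lra.
have [tT|tT] := leP T `|t|.
  have := ler_wpM2r (normr_ge0 t) (hT t tT).
  have -> : l * `|t| `^ (p - 1) * `|t| = l * `|t| `^ p.
    by rewrite -(mulrA l) (mulrC (`|t| `^ _)) mulr_powRB1//; have := p2; lra.
  lra.
have : S * T <= S * T / d `^ r * `|t| `^ r.
  rewrite -(mulrA (S * T)) ler_peMr; [by []|by rewrite mulr_ge0 ?(ltW S0) ?(ltW T0)|].
  rewrite mulrC ler_pdivlMr// mul1r.
  by apply: ge0_ler_powR; rewrite ?nnegrE ?(ltW r0) ?(ltW d0) ?(ltW td).
have := ler_pM (normr_ge0 (h t)) (normr_ge0 t) (hS t (ltW tT)) (ltW tT); lra.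
Qed.
End ScalLemmas.
End Scalar.

(* [dV], [dm], [dk], [dp] stand for V_0, m_0, V_0 / K and an exponent p >= q with
   a Sobolev inequality of constant [dA]; [dft] is the truncated nonlinearity and
   [dMh], [dF], [dFt] are the primitives of [dM], [df], [dft].  [dM] is extended
   to negative arguments as a constant. *)
Record pdata (R : realType) := Pdata {
  ds : R; dV : R; dm : R; dk : R; dp : R; dA : R;
  dM : R -> R; dMh : R -> R; df : R -> R; dF : R -> R; dft : R -> R; dFt : R -> R;
  ds0 : 0 < ds; ds1 : ds < 1; ds2 : 1 <= 2 * ds;
  dV0 : 0 < dV; dk0 : 0 < dk; dkm : 2 * dk < dm * dV;
  dp2 : 2 < dp; dLp : Lp_bound ds dV dp dA;
  dM_c : continuous dM; dM_ge : forall t : R, dm <= dM t;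
  dM_le : forall t1 t2 : R, 0 <= t1 -> t1 <= t2 -> dM t1 <= dM t2;
  dM_3 : forall t1 t2 : R, 0 < t2 -> t2 <= t1 -> dM t1 / t1 - dM t2 / t2 <= dm * (1 / t1 - 1 / t2);
  dMh0 : dMh 0 = 0; dMh_d : forall t : R, is_derive t 1 dMh (dM t);
  df_s : scal dp df dF; dft_s : scal dp dft dFt;
  df_4 : forall t1 t2 : R, 0 < t1 -> t1 <= t2 -> df t1 / t1 ^+ 3 <= df t2 / t2 ^+ 3;
  df_oo : forall C : R, exists2 T : R, 0 < T & forall t, T <= t -> C * t ^+ 3 <= df t;
  dft_4 : forall t1 t2 : R, 0 < t1 -> t1 <= t2 ->
    dft t1 / t1 ^+ 3 - dk * ((t1 ^+ 2)^-1 - (t2 ^+ 2)^-1) <= dft t2 / t2 ^+ 3;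
  dft_k : forall t : R, 0 <= t -> dft t <= dk * t;
  dft_f : forall t : R, dft t <= df t;
  dFt_F : forall t : R, dFt t <= dF t;
  dF_4 : forall t : R, 4 * dF t <= df t * t;
  dFt_4 : forall t : R, 4 * dFt t <= dft t * t + dk * t ^+ 2 }.

Section Functional.
Variables (R : realType) (d : pdata R).
Notation RR := (measurableTypeR R).
Notation T3 := (RR * RR * RR)%type.
Notation m3 := (mu3 R).
Notation m6 := (mu3 R \x mu3 R)%E.
Notation s := (ds d).
Notation p := (dp d).
Notation inH := (inH (ds d)).
Notation hform := (hform (ds d)).

(* [O] stands for [Om / eps], or for the whole space in the limit problem. *)
Definition gO (O : set T3) (x : T3) (t : R) : R := \1_O x * df d t + (1 - \1_O x) * dft d t.
Definition GO (O : set T3) (x : T3) (t : R) : R := \1_O x * dF d t + (1 - \1_O x) * dFt d t.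

Lemma gO_case (O : set T3) x : (O x /\ gO O x = df d /\ GO O x = dF d) \/
   (~ O x /\ gO O x = dft d /\ GO O x = dFt d).
Proof.
have [Ox|Ox] := pselect (O x); [left|right]; split => //; split; apply/funext => t; rewrite /gO /GO indicE.
- by rewrite mem_set// mul1r subrr mul0r addr0.
- by rewrite mem_set// mul1r subrr mul0r addr0.
- by rewrite memNset// mul0r subr0 mul1r add0r.
- by rewrite memNset// mul0r subr0 mul1r add0r.
Qed.

Lemma gO_scal O x : scal p (gO O x) (GO O x).
Proof. by have [[_ [-> ->]]|[_ [-> ->]]] := gO_case O x; [exact: df_s|exact: dft_s]. Qed.

Lemma gO_lip (l : R) : 0 < l -> exists2 C : R, 0 < C & forall O x a b,
  `|gO O x a - gO O x b| <= l * (`|a| + `|b| + `|a| `^ (p - 1) + `|b| `^ (p - 1)) + C * `|a - b|.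
Proof.
move=> l0; have [C1 C10 h1] := scal_lip (df_s d) l0; have [C2 C20 h2] := scal_lip (dft_s d) l0.
exists (C1 + C2) => [|O x a b]; first by rewrite addr_gt0.
have a0 := normr_ge0 (a - b); have q1 := mulr_ge0 (ltW C10) a0; have q2 := mulr_ge0 (ltW C20) a0.
by have [[_ [-> _]]|[_ [-> _]]] := gO_case O x; [have := h1 a b|have := h2 a b]; lra.
Qed.

Lemma gO_bound : exists2 C : R, 0 < C & forall O x t, `|gO O x t| <= C * (`|t| + `|t| `^ (p - 1)).
Proof.
have [C1 C10 h1] := scal_bound (dp2 d) (df_s d); have [C2 C20 h2] := scal_bound (dp2 d) (dft_s d).
exists (C1 + C2) => [|O x t]; first by rewrite addr_gt0.
have t0 : 0 <= `|t| + `|t| `^ (p - 1) by rewrite addr_ge0 ?powR_ge0.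
have q1 := mulr_ge0 (ltW C10) t0; have q2 := mulr_ge0 (ltW C20) t0.
by have [[_ [-> _]]|[_ [-> _]]] := gO_case O x; [have := h1 t|have := h2 t]; lra.
Qed.

Lemma gO_pow (r l : R) : 0 < r -> 0 < l -> exists2 C : R, 0 < C & forall O x t,
  gO O x t * t <= l * (t ^+ 2 + `|t| `^ p) + C * `|t| `^ r.
Proof.
move=> r0 l0; have [C1 C10 h1] := scal_pow (dp2 d) (df_s d) r0 l0; have [C2 C20 h2] := scal_pow (dp2 d) (dft_s d) r0 l0.
exists (C1 + C2) => [|O x t]; first by rewrite addr_gt0.
have t0 := powR_ge0 `|t| r; have q1 := mulr_ge0 (ltW C10) t0; have q2 := mulr_ge0 (ltW C20) t0.
by have [[_ [-> _]]|[_ [-> _]]] := gO_case O x; [have := h1 t|have := h2 t]; lra.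
Qed.

Lemma GO_0 O x : GO O x 0 = 0. Proof. exact: sc_H0 (gO_scal O x) _ (lexx 0). Qed.
Lemma gO_0 O x : gO O x 0 = 0. Proof. exact: sc_neg (gO_scal O x) _ (lexx 0). Qed.

Lemma GO_mv O x (a b : R) : exists c : R, [/\ `|c - a| <= `|b - a|, Num.min a b <= c, c <= Num.max a b &
  GO O x b - GO O x a = gO O x c * (b - a)].
Proof. exact: mean_value (sc_H (gO_scal O x)) a b. Qed.

Lemma GO_ge0 O x t : 0 <= GO O x t.
Proof.
have [t0|t0] := leP t 0; first by rewrite (sc_H0 (gO_scal O x)).
have [c [_ _ _]] := GO_mv O x 0 t; rewrite GO_0 !subr0 => ->.
by rewrite mulr_ge0 ?(ltW t0)// (sc_pos (gO_scal O x)).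
Qed.

Lemma GO_le O x t : GO O x t <= gO O x t * t + dk d * t ^+ 2.
Proof.
have t2 := mulr_ge0 (ltW (dk0 d)) (sqr_ge0 t); have := GO_ge0 O x t.
have [[_ [-> ->]]|[_ [-> ->]]] := gO_case O x; [have := dF_4 d t|have := dFt_4 d t]; lra.
Qed.

Lemma gO_f O x t : gO O x t <= df d t.
Proof. by have [[_ [-> _]]|[_ [-> _]]] := gO_case O x => //; exact: dft_f. Qed.

Lemma GO_F O x t : GO O x t <= dF d t.
Proof. by have [[_ [_ ->]]|[_ [_ ->]]] := gO_case O x => //; exact: dFt_F. Qed.

Lemma GO_4 O x t : 4 * GO O x t <= gO O x t * t + dk d * t ^+ 2.
Proof.
have t2 := mulr_ge0 (ltW (dk0 d)) (sqr_ge0 t).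
have [[_ [-> ->]]|[_ [-> ->]]] := gO_case O x; [have := dF_4 d t|have := dFt_4 d t]; lra.
Qed.

Lemma gO_ray O x (u t1 t2 : R) : 0 < t1 -> t1 < t2 ->
  gO O x (t1 * u) * u / t1 ^+ 3 - dk d * u ^+ 2 * ((t1 ^+ 2)^-1 - (t2 ^+ 2)^-1) <= gO O x (t2 * u) * u / t2 ^+ 3.
Proof.
move=> t10 t12; have t20 := lt_trans t10 t12.
have tt : 0 <= (t1 ^+ 2)^-1 - (t2 ^+ 2)^-1.
  by rewrite subr_ge0 lef_pV2 ?posrE ?exprn_gt0// ler_pXn2r ?nnegrE ?ltW.
have [u0|u0] := leP u 0.
  rewrite !(sc_neg (gO_scal O x)) ?pmulr_rle0// !mul0r sub0r oppr_le0.
  by apply: mulr_ge0 => //; apply: mulr_ge0; [exact: ltW (dk0 d)|exact: sqr_ge0].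
have a10 : 0 < t1 * u by exact: mulr_gt0.
have a12 : t1 * u <= t2 * u by rewrite ler_pM2r// ltW.
have E (t b : R) : 0 < t -> b * u / t ^+ 3 = u ^+ 4 * (b / (t * u) ^+ 3).
  by move=> t0; field; rewrite !gt_eqF.
have E2 : dk d * u ^+ 2 * ((t1 ^+ 2)^-1 - (t2 ^+ 2)^-1) = u ^+ 4 * (dk d * (((t1 * u) ^+ 2)^-1 - ((t2 * u) ^+ 2)^-1)).
  by field; rewrite !gt_eqF.
rewrite !E// E2 -mulrBr ler_wpM2l ?exprn_ge0 ?(ltW u0)//.
have [[_ [-> _]]|[_ [-> _]]] := gO_case O x; last exact: dft_4.
apply: le_trans (df_4 d a10 a12); rewrite lerBlDr lerDl mulr_ge0 ?(ltW (dk0 d))//.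
by rewrite subr_ge0 lef_pV2 ?posrE ?exprn_gt0// ?(lt_le_trans a10 a12)// ler_pXn2r ?nnegrE ?(ltW a10)// (le_trans (ltW a10)).
Qed.

Section Meas.
Variables (O : set T3).
Hypothesis mO : measurable O.

Lemma m_gO (u : T3 -> R) : measurable_fun setT u -> measurable_fun setT (fun x => gO O x (u x)).
Proof.
move=> mu; have mi : measurable_fun setT (\1_O : T3 -> R) by exact: measurable_indic.
have k (h : R -> R) : continuous h -> measurable_fun setT (fun x => h (u x)).
  by move=> ch; apply: measurableT_comp => //; exact: continuous_measurable_fun.
apply: measurable_funD; apply: measurable_funM => //.
- exact: k (sc_c (df_s d)).
- by apply: measurable_funB => //; exact: measurable_cst.
- exact: k (sc_c (dft_s d)).
Qed.

Lemma m_GO (u : T3 -> R) : measurable_fun setT u -> measurable_fun setT (fun x => GO O x (u x)).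
Proof.
move=> mu; have mi : measurable_fun setT (\1_O : T3 -> R) by exact: measurable_indic.
have k (h H : R -> R) : (forall t : R, is_derive t 1 H (h t)) -> measurable_fun setT (fun x => H (u x)).
  move=> dH; apply: measurableT_comp => //; apply: continuous_measurable_fun.
  by move=> t; apply: differentiable_continuous; apply/derivable1_diffP; have [] := dH t.
apply: measurable_funD; apply: measurable_funM => //.
- exact: k (sc_H (df_s d)).
- by apply: measurable_funB => //; exact: measurable_cst.
- exact: k (sc_H (dft_s d)).
Qed.
End Meas.
End Functional.

Lemma powR_add_le (R : realType) (r a b : R) : 0 <= r -> 0 <= a -> 0 <= b ->
  (a + b) `^ r <= 2 `^ r * (a `^ r + b `^ r).
Proof.
move=> r0; have k (x y : R) : 0 <= x -> 0 <= y -> x <= y -> (x + y) `^ r <= 2 `^ r * (x `^ r + y `^ r).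
  move=> x0 y0 xy; apply: (@le_trans _ _ ((2 * y) `^ r)).
    by apply: ge0_ler_powR; rewrite ?nnegrE ?addr_ge0 ?mulr_ge0//; lra.
  by rewrite powRM// ler_wpM2l ?powR_ge0// lerDr powR_ge0.
move=> a0 b0; have [ab|ba] := leP a b; first exact: k.
by rewrite addrC [X in _ * X]addrC; apply: k => //; exact: ltW.
Qed.

Section Energy.
Variables (R : realType) (d : pdata R).
Notation RR := (measurableTypeR R).
Notation T3 := (RR * RR * RR)%type.
Notation m3 := (mu3 R).
Notation m6 := (mu3 R \x mu3 R)%E.
Notation s := (ds d).
Notation p := (dp d).
Notation inH := (inH (ds d)).
Notation hform := (hform (ds d)).
Variables (W : weight (dV d)) (O : set T3).
Hypothesis mO : measurable O.
Implicit Types u v : pt R -> R.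

Definition NN u : R := hform W u u.
Definition Psi u : R := Int m3 (fun x : T3 => GO d O x (u x)).
Definition psi u v : R := Int m3 (fun x : T3 => gO d O x (u x) * v x).
Definition JJ u : R := dMh d (NN u) / 2 - Psi u.
Definition PP u : R := dM d (NN u) * NN u - psi u u.
(** What remains of [dm d] once the linear growth [dk d * t] allowed outside [O] has been absorbed
    by the norm. *)
Definition cc : R := dm d - dk d / dV d.

Lemma cc_gt0 : 0 < cc.
Proof.
rewrite subr_gt0 ltr_pdivrMr; last exact: dV0.
have := dkm d; have := dk0 d; lra.
Qed.

Lemma dk_NN u : inH W u -> dk d * Int m3 (fun x : T3 => u x ^+ 2) <= dk d / dV d * NN u.
Proof.
move=> Hu; rewrite -mulrA ler_pM2l; last exact: dk0.
by rewrite mulrC ler_pdivlMr; [rewrite mulrC; exact: L2_le_form|exact: dV0].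
Qed.

(** [v] is divided by a positive bound [nu] of its norm, so the integral of [EE] is at most a
    constant depending on the bound of [u] only, and estimates linear in [v] appear as [nu * EE]. *)
Definition EE u v (nu : R) (x : T3) : R :=
  u x ^+ 2 + (nu^-1 * v x) ^+ 2 + `|u x| `^ p + `|nu^-1 * v x| `^ p.

Lemma EE_ge0 u v nu x : 0 <= EE u v nu x.
Proof. by rewrite !addr_ge0 ?sqr_ge0 ?powR_ge0. Qed.

Definition KE (rho : R) : R := (rho ^+ 2 + 1) / dV d + `|dA d| * (rho `^ p + 1).

Lemma KE_ge0 rho : 0 <= KE rho.
Proof.
apply: addr_ge0; last by rewrite mulr_ge0// addr_ge0// powR_ge0.
by apply: divr_ge0; [rewrite addr_ge0// sqr_ge0|exact: ltW (dV0 d)].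
Qed.

Lemma EE_L1 u v (rho nu : R) : 0 < rho -> 0 < nu -> inH W u -> inH W v ->
  NN u <= rho ^+ 2 -> NN v <= nu ^+ 2 -> L1 m3 (EE u v nu) /\ Int m3 (EE u v nu) <= KE rho.
Proof.
move=> rho0 nu0 Hu Hv Nu Nv; have V0 := dV0 d.
have Hw := inHZ nu^-1 Hv.
have Nw : hform W (fun x => nu^-1 * v x) (fun x => nu^-1 * v x) <= 1.
  rewrite hformZ// hformC hformZ// mulrA -invfM ler_pdivrMl ?mulr1 -?expr2//.
  by rewrite exprn_gt0.
have [L3 I3] := Lp_scaled (@dLp R d) rho0 Hu Nu.
have [L4 I4] := @dLp R d W _ Hw Nw.
have h1 : Int m3 (fun x : T3 => u x ^+ 2) <= rho ^+ 2 / dV d.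
  by rewrite ler_pdivlMr// mulrC (le_trans (L2_le_form Hu)).
have h2 : Int m3 (fun x : T3 => (nu^-1 * v x) ^+ 2) <= 1 / dV d.
  by rewrite ler_pdivlMr// mulrC (le_trans (L2_le_form Hw)).
split; first exact: L1D (L1D (L1D (inH_2 Hu) (inH_2 Hw)) L3) L4.
rewrite /EE (IntD (L1D (L1D (inH_2 Hu) (inH_2 Hw)) L3) L4) (IntD (L1D (inH_2 Hu) (inH_2 Hw)) L3) (IntD (inH_2 Hu) (inH_2 Hw)).
have rp := powR_ge0 rho p.
have := ler_wpM2r rp (ler_norm (dA d)); have := ler_norm (dA d).
rewrite /KE; move: h1 h2 I3 I4; set I1 := Int _ _; set I2 := Int _ _; set I3 := Int _ _; set I4 := Int _ _; clear -W mO; lra.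
Qed.

Lemma young_nu (a b nu : R) : 0 <= a -> 0 <= b -> 0 < nu ->
  a * b <= nu * (a ^+ 2 + (nu^-1 * b) ^+ 2) /\ a `^ (p - 1) * b <= nu * (a `^ p + (nu^-1 * b) `^ p).
Proof.
move=> a0 b0 nu0; set c := nu^-1 * b.
have c0 : 0 <= c by rewrite mulr_ge0// invr_ge0 ltW.
have -> : b = nu * c by rewrite mulrA divff ?mul1r// gt_eqF.
have hp := dp2 d; split.
  rewrite mulrCA ler_pM2l//; have [ac|ca] := leP a c.
    have := ler_wpM2r c0 ac; rewrite -expr2; have := sqr_ge0 a; lra.
  have := ler_wpM2l a0 (ltW ca); rewrite -expr2; have := sqr_ge0 c; lra.
rewrite mulrCA ler_pM2l//; have [ac|ca] := leP a c.
  have := ler_wpM2r c0 (ge0_ler_powR (r := p - 1) _ _ _ ac).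
  rewrite (mulrC (c `^ _)) mulr_powRB1//; last by lra.
  rewrite !nnegrE => h; apply: le_trans (h _ _ _) _ => //; first by lra.
  by rewrite lerDr powR_ge0.
have := ler_wpM2l (powR_ge0 a (p - 1)) (ltW ca).
rewrite [X in _ <= X]mulrC mulr_powRB1//; last by lra.
by move=> h; apply: le_trans h _; rewrite lerDl powR_ge0.
Qed.

Lemma ab_EE u v (nu : R) (x : T3) : 0 < nu ->
  (`|u x| + `|u x| `^ (p - 1)) * `|v x| <= nu * EE u v nu x.
Proof.
move=> nu0; have [h1 h2] := young_nu (normr_ge0 (u x)) (normr_ge0 (v x)) nu0.
rewrite mulrDl; apply: le_trans (lerD h1 h2) _; rewrite -mulrDr /EE.
have -> : nu^-1 * `|v x| = `|nu^-1 * v x| by rewrite normrM gtr0_norm ?invr_gt0.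
rewrite !real_normK ?num_real// ler_pM2l//; lra.
Qed.

Lemma v2_EE u v (nu : R) (x : T3) : 0 < nu -> v x ^+ 2 <= nu ^+ 2 * EE u v nu x.
Proof.
move=> nu0; have vE : v x = nu * (nu^-1 * v x) by rewrite mulrA divff ?mul1r// gt_eqF.
rewrite {1}vE exprMn ler_wpM2l ?sqr_ge0// /EE -addrA -addrA addrCA lerDl.
by rewrite addr_ge0 ?sqr_ge0// addr_ge0 ?powR_ge0.
Qed.

Lemma bb_EE u v (nu : R) (x : T3) : 0 < nu -> nu <= 1 ->
  (`|v x| + `|v x| `^ (p - 1)) * `|v x| <= nu * EE u v nu x.
Proof.
move=> nu0 nu1; have hp := dp2 d; have p0 : 0 < p by move: hp; clear -W mO; lra.
have vE : v x = nu * (nu^-1 * v x) by rewrite mulrA divff ?mul1r// gt_eqF.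
rewrite mulrDl -expr2 real_normK ?num_real// [X in _ + X]mulrC mulr_powRB1//.
have -> : `|v x| `^ p = nu `^ p * `|nu^-1 * v x| `^ p.
  by rewrite -powRM ?(ltW nu0)// {1}vE normrM (gtr0_norm nu0).
have -> : v x ^+ 2 = nu ^+ 2 * (nu^-1 * v x) ^+ 2 by rewrite {1}vE exprMn.
have q1 : nu `^ p <= nu by apply: ge1r_powR; [rewrite nu0|move: hp; clear -W mO; lra].
have q2 : nu ^+ 2 <= nu by rewrite expr2 ler_piMl// ltW.
have k1 := ler_wpM2r (powR_ge0 `|nu^-1 * v x| p) q1; have k2 := ler_wpM2r (sqr_ge0 (nu^-1 * v x)) q2.
have k3 := mulr_ge0 (ltW nu0) (sqr_ge0 (u x)); have k4 := mulr_ge0 (ltW nu0) (powR_ge0 `|u x| p).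
move: k1 k2 k3 k4; rewrite /EE; clear -W mO; lra.
Qed.

(** By the mean value theorem the remainder is a difference of values of [gO] times [v]. The almost
    Lipschitz bound [hC] makes it of order [l * nu + C * nu^2]; [l] is fixed first, then the size of
    [nu]. *)
Lemma GO_rem u v (l C nu : R) (x : T3) : 0 < l -> 0 < C -> 0 < nu -> nu <= 1 ->
  (forall O x (a b : R), `|gO d O x a - gO d O x b| <= l * (`|a| + `|b| + `|a| `^ (p - 1) + `|b| `^ (p - 1)) + C * `|a - b|) ->
  `|GO d O x (u x + v x) - GO d O x (u x) - gO d O x (u x) * v x| <=
    (2 * l * (2 `^ (p - 1) + 4) * nu + C * nu ^+ 2) * EE u v nu x.
Proof.
move=> l0 C0 nu0 nu1 hC.
have [xi [x1 _ _ Exi]] := GO_mv d O x (u x) (u x + v x).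
have Eb : u x + v x - u x = v x by rewrite addrAC subrr add0r.
rewrite Eb in x1 Exi; rewrite Exi -mulrBl normrM; clear Eb Exi.
have av := normr_ge0 (v x); have au := normr_ge0 (u x).
have xa : `|xi| <= `|u x| + `|v x|.
  by rewrite -(subrK (u x) xi) (le_trans (ler_normD _ _))// addrC lerD2l.
have hp1 : 0 <= p - 1 by have := dp2 d; clear -W mO; lra.
have xp : `|xi| `^ (p - 1) <= 2 `^ (p - 1) * (`|u x| `^ (p - 1) + `|v x| `^ (p - 1)).
  apply: (@le_trans _ _ ((`|u x| + `|v x|) `^ (p - 1))); last exact: powR_add_le.
  by apply: (ge0_ler_powR hp1) => //; rewrite nnegrE ?normr_ge0//; exact: addr_ge0.
pose X := `|u x| + `|u x| `^ (p - 1); pose Y := `|v x| + `|v x| `^ (p - 1).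
have c0 : 0 < 2 `^ (p - 1) + 4 :> R by rewrite ltr_wpDl// powR_ge0.
have hXY : `|xi| + `|u x| + `|xi| `^ (p - 1) + `|u x| `^ (p - 1) <= (2 `^ (p - 1) + 4) * (X + Y).
  have pu := powR_ge0 `|u x| (p - 1); have pv := powR_ge0 `|v x| (p - 1); have p2 := powR_ge0 2 (p - 1).
  have k1 := mulr_ge0 p2 au; have k2 := mulr_ge0 p2 av; rewrite /X /Y.
  move: xa xp pu pv k1 k2 au av; clear -W mO; lra.
have h1 := ab_EE u v x nu0; have h2 := v2_EE u v x nu0; have h3 := bb_EE u v x nu0 nu1.
have h0 := ler_wpM2r av (hC O x xi (u x)).
have h4 := ler_wpM2r av (ler_wpM2l (ltW l0) hXY).
have h5 := ler_wpM2l (ltW C0) (ler_wpM2r av x1).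
rewrite -expr2 real_normK ?num_real// in h5.
have h6 := ler_wpM2l (ltW C0) h2.
have h7 := ler_wpM2l (ltW (mulr_gt0 l0 c0)) (lerD h1 h3).
rewrite -/X -/Y in h7; apply: (le_trans h0); move: h4 h5 h6 h7; set E := EE _ _ _ _; clear -W mO; lra.
Qed.

Lemma L1_gv u v : inH W u -> inH W v -> L1 m3 (fun x : T3 => gO d O x (u x) * v x).
Proof.
move=> Hu Hv; have [C C0 hC] := gO_bound d.
have e0 w : inH W w -> 0 < NN w + 1 by move=> Hw; rewrite ltr_wpDl// hform_ge0.
have le w : inH W w -> NN w <= (NN w + 1) ^+ 2.
  by move=> Hw; have n0 : 0 <= NN w by [exact: hform_ge0]; rewrite expr2; have := mulr_ge0 n0 n0; lra.
have [L _] := EE_L1 (e0 _ Hu) (e0 _ Hv) Hu Hv (le _ Hu) (le _ Hv).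
apply: L1_dom (L1Z (C * (NN v + 1)) L) _.
  by apply: measurable_funM; [exact: (m_gO d mO (inH_m Hu))|exact: inH_m Hv].
move=> x; rewrite normrM -mulrA; apply: le_trans (ler_wpM2l (ltW C0) (ab_EE u v x (e0 _ Hv))).
by rewrite mulrA ler_wpM2r.
Qed.

Lemma L1_G u : inH W u -> L1 m3 (fun x : T3 => GO d O x (u x)).
Proof.
move=> Hu; apply: L1_dom (L1D (L1_gv Hu Hu) (L1Z (dk d) (inH_2 Hu))) _.
  exact: (m_GO d mO (inH_m Hu)).
by move=> x; rewrite ger0_norm ?GO_ge0// GO_le.
Qed.

Lemma psi_bound u : inH W u -> exists C : R, forall v, inH W v -> `|psi u v| <= C * Num.sqrt (NN v).
Proof.
move=> Hu; have [C C0 hC] := gO_bound d; pose rho := NN u + 1.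
have n0 w : 0 <= NN w by exact: hform_ge0.
have rho0 : 0 < rho by rewrite ltr_wpDl.
have ur : NN u <= rho ^+ 2 by have h := n0 u; rewrite /rho expr2; have := mulr_ge0 h h; lra.
exists (C * KE rho) => v Hv; set nv := Num.sqrt _.
have C1 : 0 <= C * KE rho by rewrite mulr_ge0 ?KE_ge0// ltW.
apply/ler_addgt0Pl => e e0.
pose nu := nv + e / (C * KE rho + 1).
have e1 : 0 < e / (C * KE rho + 1) by rewrite divr_gt0// ltr_wpDl.
have nv0 : 0 <= nv by exact: sqrtr_ge0.
have nu0 : 0 < nu by rewrite ltr_wpDl.
have vr : NN v <= nu ^+ 2.
  by rewrite -(sqr_sqrtr (n0 v)) -/nv ler_pXn2r ?nnegrE ?(ltW nu0)// lerDl ltW.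
have [L I] := EE_L1 rho0 nu0 Hu Hv ur vr.
apply: (@le_trans _ _ (Int m3 (fun x => C * nu * EE u v nu x))).
  apply: Int_abs_le; [exact: L1_gv|exact: L1Z|] => x.
  rewrite normrM -mulrA; apply: le_trans (ler_wpM2l (ltW C0) (ab_EE u v x nu0)).
  by rewrite mulrA ler_wpM2r.
rewrite IntZ//; apply: (@le_trans _ _ (C * nu * KE rho)).
  by rewrite ler_wpM2l// mulr_ge0 ?(ltW C0)// ltW.
have -> : C * nu * KE rho = C * KE rho * nv + C * KE rho / (C * KE rho + 1) * e by rewrite /nu; ring.
by rewrite addrC lerD2r ler_piMl ?(ltW e0)// ler_pdivrMr ?ltr_wpDl// mul1r lerDl.
Qed.

Lemma Psi_diff (rho lam : R) : 0 < rho -> 0 < lam -> exists2 tau : R, 0 < tau &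
  forall u v, inH W u -> inH W v -> NN u <= rho ^+ 2 -> Num.sqrt (NN v) <= tau ->
    `|Psi (fun x => u x + v x) - Psi u - psi u v| <= lam * Num.sqrt (NN v).
Proof.
move=> rho0 lam0; have hp := dp2 d; have K0 := KE_ge0 rho.
have K1 : 0 < KE rho + 1 by rewrite ltr_wpDl.
pose c : R := 2 `^ (p - 1) + 4.
have c0 : 0 < c by rewrite ltr_wpDl// powR_ge0.
pose l := lam / (4 * c * (KE rho + 1)).
have l0 : 0 < l by rewrite divr_gt0// !mulr_gt0.
have [C C0 hC] := gO_lip d l0.
pose tau := Num.min (1 / 2) (lam / (8 * C * (KE rho + 1))).
have tau0 : 0 < tau by rewrite lt_min !divr_gt0// !mulr_gt0.
have [tau1 tau2] : tau <= 1 / 2 /\ tau <= lam / (8 * C * (KE rho + 1)).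
  by rewrite !ge_min !lexx ?orbT.
exists tau => // u v Hu Hv ur; set nv := Num.sqrt _ => vt.
have n0 w : 0 <= NN w by exact: hform_ge0.
have nv0 : 0 <= nv by exact: sqrtr_ge0.
(* The norm [nv] may vanish, so the bound is shown for [nu > nv], and [nu] then decreases to
   [nv]. *)
suff main nu : nv < nu -> nu <= 2 * tau -> `|Psi (fun x => u x + v x) - Psi u - psi u v| <= lam * nu.
  apply/ler_addgt0Pl => e e0.
  pose nu := nv + Num.min tau (e / lam).
  have m0 : 0 < Num.min tau (e / lam) by rewrite lt_min tau0 divr_gt0.
  have hmin (a b : R) : Num.min a b <= a /\ Num.min a b <= b by rewrite !ge_min !lexx ?orbT.
  have [m1 m2] := hmin tau (e / lam).
  apply: le_trans (main nu _ _) _; [by rewrite ltrDl|by rewrite /nu; lra|].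
  rewrite /nu mulrDr addrC lerD2r -ler_pdivlMl// [leRHS]mulrC; exact: m2.
move=> nvnu nut; have nu0 : 0 < nu by exact: le_lt_trans nvnu.
have vr : NN v <= nu ^+ 2.
  by rewrite -(sqr_sqrtr (n0 v)) -/nv ler_pXn2r ?nnegrE ?(ltW nu0)// ltW.
have [L I] := EE_L1 rho0 nu0 Hu Hv ur vr.
have Huv := inHD Hu Hv.
have Ld := L1B (L1B (L1_G Huv) (L1_G Hu)) (L1_gv Hu Hv).
have -> : Psi (fun x => u x + v x) - Psi u - psi u v =
    Int m3 (fun x : T3 => GO d O x (u x + v x) - GO d O x (u x) - gO d O x (u x) * v x).
  by rewrite (IntB (L1B (L1_G Huv) (L1_G Hu)) (L1_gv Hu Hv)) (IntB (L1_G Huv) (L1_G Hu)).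
pose c1 := 2 * l * c * nu + C * nu ^+ 2.
have ptw (x : T3) : `|GO d O x (u x + v x) - GO d O x (u x) - gO d O x (u x) * v x| <= c1 * EE u v nu x.
  by apply: GO_rem => //; move: nut tau1; clear -W mO; lra.
apply: (@le_trans _ _ (Int m3 (fun x => c1 * EE u v nu x))).
  by apply: Int_abs_le => //; exact: L1Z.
have c10 : 0 <= c1.
  apply: addr_ge0; first by rewrite (mulr_ge0 _ (ltW nu0))// (mulr_ge0 _ (ltW c0))// (mulr_ge0 _ (ltW l0)).
  by rewrite (mulr_ge0 (ltW C0))// sqr_ge0.
rewrite IntZ//; apply: le_trans (ler_wpM2l c10 I) _.
have K2 : KE rho <= KE rho + 1 by rewrite lerDl.
apply: le_trans (ler_wpM2l c10 K2) _.
rewrite /c1 mulrDl.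
have -> : 2 * l * c * nu * (KE rho + 1) = lam / 2 * nu by rewrite /l; field; rewrite !gt_eqF.
have h : C * nu * (KE rho + 1) <= lam / 2.
  have : nu <= 2 * (lam / (8 * C * (KE rho + 1))) by move: nut tau2; clear -W mO; lra.
  move=> h; have := ler_wpM2l (ltW (mulr_gt0 C0 K1)) h.
  have -> : C * (KE rho + 1) * (2 * (lam / (8 * C * (KE rho + 1)))) = lam / 4 by field; rewrite !gt_eqF.
  move: lam0; clear -W mO; lra.
have := ler_wpM2r (ltW nu0) h; rewrite expr2; clear -W mO; lra.
Qed.

Lemma NN_ge0 u : 0 <= NN u. Proof. exact: hform_ge0. Qed.

Lemma NNZ (t : R) u : inH W u -> NN (fun x => t * u x) = t ^+ 2 * NN u.
Proof. by move=> Hu; rewrite /NN (hformZ t Hu (inHZ t Hu)) hformC (hformZ t Hu Hu) mulrA. Qed.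

Lemma dMh_mono (a b : R) : 0 <= a -> a <= b -> dm d * (b - a) <= dMh d b - dMh d a /\
  dMh d b - dMh d a <= dM d b * (b - a).
Proof.
move=> a0 ab; have [c [_ h1 h2 ->]] := mean_value (@dMh_d R d) a b.
rewrite min_l// in h1; rewrite max_r// in h2.
have ba : 0 <= b - a by rewrite subr_ge0.
split; apply: ler_wpM2r => //; first exact: dM_ge.
by apply: dM_le => //; exact: le_trans a0 h1.
Qed.

(* (M_3) gives M(tau) >= tau (M(t) - m0) / t + m0 on (0, t], which integrates to
   the bound below. *)
Lemma dMh_lower (t : R) : 0 <= t -> t * (dM d t + dm d) / 2 <= dMh d t.
Proof.
rewrite le_eqVlt => /predU1P[<-|t0]; first by rewrite !mul0r dMh0.
pose c : R := (dM d t - dm d) / t.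
pose h (x : R) := dMh d x - (c * (x ^+ 2 / 2) + dm d * x).
have dh (x : R) : is_derive x 1 h (dM d x - (c * x + dm d)).
  have := dMh_d d x => ?; apply: is_derive_eq; rewrite /GRing.scale /=.
  by rewrite !mulr1 expr2; field.
have [e [_ e1 e2]] := mean_value dh 0 t.
rewrite min_l ?(ltW t0)// in e1; rewrite max_r ?(ltW t0)// in e2.
have q : 0 <= dM d e - (c * e + dm d).
  have [e0|e0] := ltP 0 e; last first.
    have -> : e = 0 by apply/le_anti; rewrite e0 e1.
    by rewrite mulr0 add0r subr_ge0 dM_ge.
  have := dM_3 d e0 e2; rewrite /c => k.
  have : 0 <= e * (dm d * (1 / t - 1 / e) - (dM d t / t - dM d e / e)) by rewrite mulr_ge0 ?(ltW e0)// subr_ge0.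
  have -> : e * (dm d * (1 / t - 1 / e) - (dM d t / t - dM d e / e)) = dM d e - ((dM d t - dm d) / t * e + dm d).
    by field; rewrite !gt_eqF.
  by [].
rewrite /h dMh0 expr0n/= mul0r !mulr0 addr0 !subr0 => E.
have : 0 <= dMh d t - (c * (t ^+ 2 / 2) + dm d * t) by rewrite E mulr_ge0// ltW.
have -> : c * (t ^+ 2 / 2) = (dM d t - dm d) * t / 2 by rewrite /c; field; rewrite gt_eqF.
lra.
Qed.

(** [J - J'(u) u / 4]: [dMh_lower] leaves [dm d / 4] of the squared norm and [GO_4] loses at most
    [dk d / 4] of the [L^2] mass; the difference is [cc / 4]. *)
Lemma coercive u : inH W u -> cc / 4 * NN u + PP u / 4 <= JJ u.
Proof.
move=> Hu; have n0 := NN_ge0 u; rewrite /JJ /PP.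
have h1 := dMh_lower n0.
have LG := L1_G Hu; have Lg := L1_gv Hu Hu.
have h2 : 4 * Psi u <= psi u u + dk d * Int m3 (fun x : T3 => u x ^+ 2).
  rewrite /Psi /psi -(IntZ _ LG) -(IntZ _ (inH_2 Hu)) -(IntD Lg (L1Z _ (inH_2 Hu))).
  apply: Int_le; [exact: L1Z|exact: L1D Lg (L1Z _ (inH_2 Hu))|].
  by move=> x; exact: GO_4.
have h3 := dk_NN Hu; rewrite /cc; lra.
Qed.

End Energy.

Section Small.
Variables (R : realType) (d : pdata R).
Notation m3 := (mu3 R).
Notation RR := (measurableTypeR R).
Notation T3 := (RR * RR * RR)%type.

(** Outside [O] the nonlinearity is at most [dk d * t], so the power [r] is needed only on a set
    containing [O]. With [O'] the whole space this gives positivity near [0]; with [O' = O] it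
    forces concentration inside the domain. *)
Lemma PP_lower (r l : R) : 0 < r -> 0 < l -> exists2 C : R, 0 < C &
  forall (W : weight (dV d)) (O : set T3) (u : pt R -> R), measurable O -> inH (ds d) W u ->
  [/\ L1 m3 (fun x : T3 => `|u x| `^ dp d),
    Int m3 (fun x : T3 => `|u x| `^ dp d) <= `|dA d| * Num.sqrt (NN W u) `^ dp d &
   forall O', measurable O' -> L1 m3 (fun x : T3 => \1_O' x * `|u x| `^ r) ->
     O `<=` O' ->
  dm d * NN W u - l * (Int m3 (fun x : T3 => u x ^+ 2) + Int m3 (fun x : T3 => `|u x| `^ dp d))
    - C * Int m3 (fun x : T3 => \1_O' x * `|u x| `^ r) - dk d / dV d * NN W u <= PP W O u].
Proof.
move=> r0 l0; have [C C0 hC] := gO_pow d r0 l0; exists C => // W O u mO Hu.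
have n0 := NN_ge0 W u; have p0 : dp d != 0 by rewrite gt_eqF//; have := dp2 d; lra.
have [Lp Ip] : L1 m3 (fun x : T3 => `|u x| `^ dp d) /\ Int m3 (fun x : T3 => `|u x| `^ dp d) <= `|dA d| * Num.sqrt (NN W u) `^ dp d.
  have [N0|N0] := eqVneq (NN W u) 0.
    have E := form_eq0_ae Hu N0.
    have mp := m_absp (dp d) (inH_m Hu).
    have [] := @ae_Int_eq _ _ _ m3 (fun=> 0) (fun x : T3 => `|u x| `^ dp d) (L1_0 _) mp.
      by apply: (aeS _ E) => x ->; rewrite normr0 powR0.
    by move=> L ->; split => //; rewrite Int0 mulr_ge0 ?powR_ge0.
  have s0 : 0 < Num.sqrt (NN W u) by rewrite sqrtr_gt0 lt_neqAle eq_sym N0.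
  have [] := Lp_scaled (@dLp R d) s0 Hu; first by rewrite sqr_sqrtr.
  move=> L I; split => //; apply: le_trans I _.
  by rewrite ler_wpM2r ?powR_ge0// ler_norm.
split => // O' mO' Lr OO; have Lg := L1_gv mO Hu Hu.
have Ls := L1Z l (L1D (inH_2 Hu) Lp).
have h : psi d O u u <= l * (Int m3 (fun x : T3 => u x ^+ 2) + Int m3 (fun x : T3 => `|u x| `^ dp d)) +
    C * Int m3 (fun x : T3 => \1_O' x * `|u x| `^ r) + dk d * Int m3 (fun x : T3 => u x ^+ 2).
  rewrite -(IntD (inH_2 Hu) Lp) -(IntZ _ (L1D (inH_2 Hu) Lp)) -(IntZ _ Lr) -(IntD Ls (L1Z _ Lr)) -(IntZ _ (inH_2 Hu)).
  rewrite -(IntD (L1D Ls (L1Z _ Lr)) (L1Z _ (inH_2 Hu))).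
  apply: Int_le => //; first exact: L1D (L1D Ls (L1Z _ Lr)) (L1Z _ (inH_2 Hu)).
  move=> x; have k0 := mulr_ge0 (ltW (dk0 d)) (sqr_ge0 (u x)).
  rewrite [\1_O' x]indicE; have [_|/negP xO] := boolP (x \in O'); first by have := hC O x (u x); rewrite mul1r; move: k0; clear -d; lra.
  have e0 : 0 <= l * (u x ^+ 2 + `|u x| `^ dp d) by rewrite mulr_ge0 ?(ltW l0)// addr_ge0 ?sqr_ge0 ?powR_ge0.
  have [[Ox _]|[_ [-> _]]] := gO_case d O x; first by case: xO; apply/mem_set/OO.
  suff : dft d (u x) * u x <= dk d * u x ^+ 2 by rewrite mul0r mulr0; move: e0; clear -d; lra.
  have [u0|u0] := leP (u x) 0; first by rewrite (sc_neg (dft_s d) u0) mul0r.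
  by rewrite expr2 mulrA ler_wpM2r ?(ltW u0)// dft_k// ltW.
have := dk_NN Hu; have := ler_wpM2r n0 (dM_ge d (NN W u)); move: h; rewrite /PP; clear -d; lra.
Qed.

(** The powers contribute at most a constant times the norm to the power [dp d > 2], which a small
    norm makes negligible against [cc] times its square. *)
Lemma small_pos : exists2 r : R, 0 < r & forall (W : weight (dV d)) (O : set T3) (u : pt R -> R), measurable O ->
  inH (ds d) W u -> 0 < NN W u -> NN W u < r ^+ 2 -> 0 < PP W O u.
Proof.
have hp := dp2 d; have V0 := dV0 d; have c0 := cc_gt0 d.
pose cV := cc d * dV d; have cV0 : 0 < cV by exact: mulr_gt0.
pose l := cV / 4; have l0 : 0 < l by rewrite divr_gt0.
have p0 : 0 < dp d by lra.
have [C C0 hC] := PP_lower p0 l0.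
pose B := (l + C) * `|dA d| + 1.
have B0 : 0 < B by rewrite ltr_wpDl// mulr_ge0// addr_ge0// ltW.
have q0 : 0 < cc d / (4 * B) by rewrite divr_gt0// mulr_gt0.
pose r := (cc d / (4 * B)) `^ ((dp d - 2)^-1).
exists r; first exact: powR_gt0.
move=> W O u mO Hu N0 Nr; have [Lp Ip hP] := hC W O u mO Hu.
have E1 : (fun x : T3 => \1_(setT : set T3) x * `|u x| `^ dp d) = (fun x => `|u x| `^ dp d).
  by apply/funext => x; rewrite indicE mem_set// mul1r.
have := hP setT measurableT; rewrite E1 => /(_ Lp (@subsetT _ _)).
apply: lt_le_trans; set nu := Num.sqrt _ in Ip.
have nu0 : 0 < nu by rewrite sqrtr_gt0.
have r0 : 0 < r by exact: powR_gt0.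
have nr : nu < r by rewrite -(gtr0_norm r0) -sqrtr_sqr ltr_sqrt// exprn_gt0.
have Nn : NN W u = nu ^+ 2 by rewrite sqr_sqrtr// ltW.
have npE : nu `^ dp d = NN W u * nu `^ (dp d - 2).
  rewrite Nn -[nu ^+ 2](@powR_mulrn _ nu 2) ?(ltW nu0)// -powRD; last by rewrite (gt_eqF nu0) implybT.
  by congr (_ `^ _); ring.
have h1 : nu `^ (dp d - 2) <= cc d / (4 * B).
  have -> : cc d / (4 * B) = r `^ (dp d - 2).
    by rewrite /r -powRrM mulVf ?powRr1 ?(ltW q0)// gt_eqF// subr_gt0.
  by apply: ge0_ler_powR; rewrite ?nnegrE ?(ltW nu0) ?(ltW r0) ?(ltW nr)// subr_ge0 ltW.
have I2 : l * Int m3 (fun x : T3 => u x ^+ 2) <= cc d / 4 * NN W u.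
  have -> : l * Int m3 (fun x : T3 => u x ^+ 2) = cc d / 4 * (dV d * Int m3 (fun x : T3 => u x ^+ 2)) by rewrite /l /cV; ring.
  by rewrite ler_wpM2l ?divr_ge0 ?(ltW c0)//; exact: L2_le_form.
have I3 : (l + C) * Int m3 (fun x : T3 => `|u x| `^ dp d) <= cc d / 4 * NN W u.
  have lC : 0 <= l + C by rewrite addr_ge0 ?ltW.
  apply: le_trans (ler_wpM2l lC Ip) _; rewrite mulrA npE.
  have a0 : 0 <= (l + C) * `|dA d| by rewrite mulr_ge0.
  apply: (@le_trans _ _ (B * (NN W u * (cc d / (4 * B))))).
    by apply: ler_pM => //; [rewrite mulr_ge0 ?powR_ge0 ?NN_ge0|rewrite lerDl|rewrite ler_wpM2l ?NN_ge0].
  by rewrite le_eqVlt; apply/orP; left; apply/eqP; field; rewrite gt_eqF.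
have := mulr_gt0 c0 N0.
move: I2 I3; rewrite /cc; set I2 := Int _ _; set I3 := Int _ _; set N := NN W u; set K := dk d / dV d; clear -d; lra.
Qed.
End Small.

(** * Meeting the Nehari set along a ray *)

Section NehariExists.
Variables (R : realType) (H : lmodType R) (B : H -> H -> R) (J : H -> R) (D : H -> H).
Hypothesis BP : psd_form B.
Variables (c r : R).
Hypothesis dJ : unif_diff B J D.
Hypothesis ray : ray_cond B D c.
Hypothesis c0 : 0 < c.
Hypothesis r0 : 0 < r.
Hypothesis small : forall u, 0 < nm B u -> nm B u < r -> 0 < B (D u) u.

Lemma ray_continuous u : continuous (fun t : R => B (D (t *: u)) u).
Proof.
move=> t; apply/cvgrPdist_le => e e0.
have e1 : 0 < e / (nm B u + 1) by rewrite divr_gt0// ltr_wpDl// nm_ge0.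
have [tau tau0 hD] := unif_grad BP dJ (`|t| * nm B u) e1.
have d0 : 0 < tau / (nm B u + 1) by rewrite divr_gt0// ltr_wpDl// nm_ge0.
apply/nbhs_ballP; exists (tau / (nm B u + 1)) => //= t' /= tt.
have n0 := nm_ge0 B u; have n1 : 0 < nm B u + 1 by rewrite ltr_wpDl.
rewrite distrC -(psdB BP); apply: le_trans (psd_CS BP _ _) _.
have -> : t' *: u = t *: u + (t' - t) *: u by rewrite -scalerDl addrC subrK.
have h : nm B (D (t *: u + (t' - t) *: u) - D (t *: u)) <= e / (nm B u + 1).
  apply: hD; rewrite (nmZ BP)// distrC; apply: le_trans (ler_wpM2r n0 (ltW tt)) _.
  by rewrite -mulrA ler_piMr ?(ltW tau0)// mulrC ler_pdivrMr// mul1r lerDl.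
apply: le_trans (ler_wpM2r n0 h) _.
by rewrite -mulrA ler_piMr ?(ltW e0)// mulrC ler_pdivrMr// mul1r lerDl.
Qed.

Lemma nehari_exists u (t0 : R) : 0 < t0 -> 0 < nm B u -> B (D (t0 *: u)) u <= 0 ->
  exists2 t : R, 0 < t <= t0 & nehari B D (t *: u).
Proof.
move=> t00 u0 Pt.
pose a := Num.min t0 (r / (2 * nm B u)).
have a0 : 0 < a by rewrite lt_min t00 divr_gt0// mulr_gt0.
have ha (x y : R) : Num.min x y <= x /\ Num.min x y <= y by rewrite !ge_min !lexx ?orbT.
have [at0 ar] := ha t0 (r / (2 * nm B u)); rewrite -/a in at0 ar.
have Pa : 0 < B (D (a *: u)) u.
  have na : nm B (a *: u) = a * nm B u by rewrite (nmZ BP) gtr0_norm.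
  have : 0 < B (D (a *: u)) (a *: u).
    apply: small; rewrite na ?mulr_gt0//.
    apply: le_lt_trans (ler_wpM2r (ltW u0) ar) _.
    have -> : r / (2 * nm B u) * nm B u = r / 2 by field; rewrite gt_eqF.
    by rewrite ltr_pdivrMr// ltr_pMr// ltr1n.
  by rewrite (psdZr BP) pmulr_rgt0.
have cont : {within `[a, t0], continuous (fun t : R => B (D (t *: u)) u)}.
  by apply: continuous_subspaceT; exact: ray_continuous.
have [|t] := @IVT _ _ a t0 0 at0 cont.
  by rewrite ge_min le_max Pt (ltW Pa) !orbT.
rewrite in_itv/= => /andP[t1 t2] E; have tp : 0 < t by exact: lt_le_trans a0 t1.
exists t; first by rewrite tp.
by split; rewrite ?(nmZ BP) ?gtr0_norm ?mulr_gt0// (psdZr BP) E mulr0.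
Qed.

Lemma ray_null (a b u : H) (x y e z : R) : nm B u = 0 -> B a u / x <= B b u / y - e * B u u * z.
Proof.
move=> u0; have k v : B v u = 0 by rewrite (psdC BP); exact: (nm_eq0 BP).
by rewrite !k !mul0r mulr0 mul0r subr0.
Qed.
End NehariExists.

Section Kirchhoff.
Variables (R : realType) (d : pdata R).

Lemma dm_gt0 : 0 < dm d.
Proof. rewrite -(pmulr_lgt0 _ (dV0 d)); have := dkm d; have := dk0 d; lra. Qed.

Lemma dM_gt0 t : 0 < dM d t.
Proof. exact: lt_le_trans dm_gt0 (dM_ge d t). Qed.

(** [2 * b + nv ^+ 2] is the increment of the squared norm. [M] is uniformly continuous on the
    bounded range involved, and the part with [nv ^+ 2] is of second order. *)
Lemma kirch_rem (r1 lam : R) : 0 < r1 -> 0 < lam -> exists2 tau : R, 0 < tau &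
  forall N N' b nv : R, 0 <= N -> 0 <= N' -> N <= r1 ^+ 2 -> N' - N = 2 * b + nv ^+ 2 -> `|b| <= r1 * nv -> 0 <= nv -> nv <= tau ->
  `|dMh d N' / 2 - dMh d N / 2 - dM d N * b| <= lam * nv.
Proof.
move=> r10 lam0; have l4 : 0 < lam / (4 * r1) by rewrite divr_gt0// mulr_gt0.
have [t2 t20 h2] := unif_cont_compact (@dM_c R d) (@seg_compact R (r1 ^+ 2)) l4.
pose S := dM d ((r1 + 1) ^+ 2); have S0 : 0 < S := dM_gt0 _.
pose tau := Num.min (Num.min 1 (t2 / (2 * r1 + 1))) (lam / (2 * S)).
have r2 : 0 < 2 * r1 + 1 by rewrite ltr_wpDr// mulr_gt0.
exists tau; first by rewrite !lt_min ltr01 !divr_gt0// mulr_gt0.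
move=> N N' b nv N0 N0' Nr EN bn n0; rewrite !le_min => /andP[/andP[v2 v3] v4].
have [xi [x1 x2 x3 E]] := mean_value (@dMh_d R d) N N'.
have nn : nv ^+ 2 <= nv by rewrite expr2 ler_piMl.
have dN : `|N' - N| <= (2 * r1 + 1) * nv.
  rewrite EN; apply: le_trans (ler_normD _ _) _.
  rewrite normrM (ger0_norm (ler0n R 2)) (ger0_norm (sqr_ge0 _)).
  move: bn nn; clear; lra.
have hM : `|dM d xi - dM d N| <= lam / (4 * r1).
  apply: h2; first by rewrite /= ger0_norm.
  apply: le_trans x1 _; apply: le_trans dN _.
  by rewrite mulrC -ler_pdivlMr.
have xiS : dM d xi <= S.
  apply: dM_le; first by apply: le_trans x2; rewrite le_min N0.
  apply: le_trans x3 _; rewrite ge_max; apply/andP; split.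
    by apply: le_trans Nr _; rewrite ler_pXn2r ?nnegrE ?addr_ge0 ?(ltW r10)// lerDl.
  have bb := ler_norm b; have rn := ler_wpM2l (ltW r10) v2.
  rewrite sqrrD expr1n mulr1; move: bb bn Nr EN nn v2 rn; clear; lra.
have -> : dMh d N' / 2 - dMh d N / 2 - dM d N * b = (dM d xi - dM d N) * b + dM d xi * nv ^+ 2 / 2.
  have -> : dMh d N' = dMh d N + dM d xi * (2 * b + nv ^+ 2) by rewrite -EN -E; ring.
  by field.
have a1 : `|(dM d xi - dM d N) * b| <= lam / 4 * nv.
  rewrite normrM; apply: le_trans (ler_pM (normr_ge0 _) (normr_ge0 _) hM bn) _.
  by rewrite le_eqVlt; apply/orP; left; apply/eqP; field; rewrite gt_eqF.
have a2 : `|dM d xi * nv ^+ 2 / 2| <= lam / 4 * nv.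
  rewrite ger0_norm; last by rewrite divr_ge0// mulr_ge0 ?sqr_ge0// ltW// dM_gt0.
  apply: (@le_trans _ _ (S * (lam / (2 * S) * nv) / 2)).
    rewrite ler_wpM2r ?invr_ge0//; apply: ler_pM => //; [exact: ltW (dM_gt0 _)|exact: sqr_ge0|].
    by rewrite expr2 ler_wpM2r.
  by rewrite le_eqVlt; apply/orP; left; apply/eqP; field; rewrite gt_eqF.
apply: le_trans (ler_normD _ _) _; have := mulr_ge0 (ltW lam0) n0; move: a1 a2; clear; lra.
Qed.
End Kirchhoff.

(** * The functional and its gradient on the energy space *)

Section HspEnergy.
Variables (R : realType) (d : pdata R).
Notation RR := (measurableTypeR R).
Notation T3 := (RR * RR * RR)%type.
Notation m3 := (mu3 R).
Variables (W : weight (dV d)) (O : set T3).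
Hypothesis mO : measurable O.
Notation H := (Hsp (ds d) W).
Notation B := (@Hform R (ds d) (dV d) W).
Notation BP := (Hform_psd (ds d) W).
Notation NN := (@NN R d W).

Lemma nm_NN (u : H) : nm B u = Num.sqrt (NN (val u)). Proof. by []. Qed.
Lemma nm_sqr (u : H) : NN (val u) = nm B u ^+ 2.
Proof. by rewrite sqr_sqrtr// hform_ge0. Qed.

Lemma psiDr u v w : inH (ds d) W u -> inH (ds d) W v -> inH (ds d) W w ->
  psi d O u (fun x => v x + w x) = psi d O u v + psi d O u w.
Proof.
move=> Hu Hv Hw; rewrite /psi -(IntD (L1_gv mO Hu Hv) (L1_gv mO Hu Hw)).
by apply: eq_Int => x; rewrite mulrDr.
Qed.

Lemma psiZr (a : R) u v : inH (ds d) W u -> inH (ds d) W v ->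
  psi d O u (fun x => a * v x) = a * psi d O u v.
Proof.
move=> Hu Hv; rewrite /psi -(IntZ _ (L1_gv mO Hu Hv)).
by apply: eq_Int => x; rewrite mulrCA.
Qed.

Lemma valD (u v : H) : val (u + v) = (fun x => val u x + val v x). Proof. by rewrite raddfD. Qed.
Lemma valZ (a : R) (u : H) : val (a *: u) = (fun x => a * val u x). Proof. by rewrite linearZ. Qed.
Lemma valB (u v : H) : val (u - v) = (fun x => val u x - val v x). Proof. by rewrite raddfB. Qed.

(** The derivative of [Psi] is a bounded functional, and completeness of the form turns it into a
    vector, determined up to a vector of norm [0]. *)
Lemma gradP (u : H) : exists g : H, forall v, psi d O (val u) (val v) = B g v.
Proof.
have Hu := HspP u; have [C hC] := psi_bound mO Hu.
apply: (riesz BP (@Hform_complete R (ds d) (dV d) W) (C := C)).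
- by move=> v w; rewrite valD psiDr//; exact: HspP.
- by move=> a v; rewrite valZ psiZr//; exact: HspP.
- by move=> v; exact: hC (HspP v).
Qed.
Definition grad (u : H) : H := projT1 (cid (gradP u)).
Lemma gradE (u v : H) : B (grad u) v = psi d O (val u) (val v).
Proof. by rewrite /grad; case: cid. Qed.

Definition JH (u : H) : R := JJ W O (val u).
Definition DH (u : H) : H := dM d (NN (val u)) *: u - grad u.

Lemma DHE (u v : H) : B (DH u) v = dM d (NN (val u)) * B u v - psi d O (val u) (val v).
Proof. by rewrite (psdB BP) (psdZ BP) gradE. Qed.

Lemma DH_PP (u : H) : B (DH u) u = PP W O (val u).
Proof. by rewrite DHE. Qed.

Lemma DH_unif : unif_diff B JH DH.
Proof.
move=> rho lam lam0; pose r1 := `|rho| + 1.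
have r10 : 0 < r1 by rewrite ltr_wpDl.
have l2 : 0 < lam / 2 by rewrite divr_gt0.
have [t1 t10 h1] := Psi_diff W mO r10 l2.
have [t2 t20 h2] := kirch_rem d r10 l2.
exists (Num.min t1 t2); first by rewrite lt_min t10.
move=> u v ur; rewrite le_min => /andP[v1 v2].
have n0 := nm_ge0 B v.
have ur1 : nm B u <= r1 by rewrite (le_trans ur)// /r1 (le_trans (ler_norm _))// lerDl.
have Nu : NN (val u) <= r1 ^+ 2 by rewrite nm_sqr ler_pXn2r ?nnegrE ?nm_ge0 ?(ltW r10).
have := h1 (val u) (val v) (HspP u) (HspP v) Nu v1; rewrite -nm_NN -valD.
have uv : `|B u v| <= r1 * nm B v by apply: le_trans (psd_CS BP u v) _; rewrite ler_wpM2r.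
have EN : NN (val (u + v)) - NN (val u) = 2 * B u v + nm B v ^+ 2.
  have -> : NN (val (u + v)) = B (u + v) (u + v) by [].
  rewrite (psdD BP) !(psdDr BP) (psdC BP v u) -(nmE BP v).
  have -> : NN (val u) = B u u by [].
  ring.
have := h2 (NN (val u)) (NN (val (u + v))) (B u v) (nm B v) (NN_ge0 W (val u)) (NN_ge0 W (val (u + v))) Nu EN uv n0 v2.
have -> : JH (u + v) - JH u - B (DH u) v =
  (dMh d (NN (val (u + v))) / 2 - dMh d (NN (val u)) / 2 - dM d (NN (val u)) * B u v)
  - (Psi d O (val (u + v)) - Psi d O (val u) - psi d O (val u) (val v)).
  by rewrite DHE /JH /JJ; ring.
set X := _ - dM d _ * _; set Y := _ - psi _ _ _ _.
move=> hX hY; apply: le_trans (ler_normB X Y) _.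
have -> : lam * nm B v = lam / 2 * nm B v + lam / 2 * nm B v by field.
exact: lerD.
Qed.

(** (M_3), scaled by the squared norm, contributes the drop [dm d]; the truncated nonlinearity may
    rise by [dk d] times the [L^2] mass. The balance is [cc d]. *)
Lemma DH_ray : ray_cond B DH (cc d).
Proof.
move=> u t1 t2 t10 t12; have t20 := lt_trans t10 t12.
have Hu := HspP u.
have [u0|u0] := eqVneq (nm B u) 0.
  exact: (ray_null BP _ _ _ _ _ _ u0).
have N0 : 0 < NN (val u) by rewrite nm_sqr exprn_gt0// lt_neqAle eq_sym u0 nm_ge0.
have Ht (t : R) : inH (ds d) W (fun x => t * val u x) by exact: inHZ.
have DE (t : R) : 0 < t -> B (DH (t *: u)) u / t ^+ 3 = dM d (t ^+ 2 * NN (val u)) * NN (val u) / t ^+ 2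
   - psi d O (fun x => t * val u x) (val u) / t ^+ 3.
  move=> t0; rewrite DHE (psdZ BP) valZ NNZ//.
  have -> : B u u = NN (val u) by [].
  by field; rewrite gt_eqF.
suff key X1 X2 : X1 = dM d (t1 ^+ 2 * NN (val u)) * NN (val u) / t1 ^+ 2 - psi d O (fun x => t1 * val u x) (val u) / t1 ^+ 3 ->
    X2 = dM d (t2 ^+ 2 * NN (val u)) * NN (val u) / t2 ^+ 2 - psi d O (fun x => t2 * val u x) (val u) / t2 ^+ 3 ->
    X2 <= X1 - cc d * NN (val u) * ((t1 ^+ 2)^-1 - (t2 ^+ 2)^-1).
  exact: (key _ _ (DE t1 t10) (DE t2 t20)).
move=> -> ->; pose T1 := (t1 ^+ 2)^-1; pose T2 := (t2 ^+ 2)^-1.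
have hM : dM d (t2 ^+ 2 * NN (val u)) * NN (val u) / t2 ^+ 2 - dM d (t1 ^+ 2 * NN (val u)) * NN (val u) / t1 ^+ 2
   <= - dm d * NN (val u) * (T1 - T2).
  have p1 : 0 < t1 ^+ 2 * NN (val u) by rewrite mulr_gt0// exprn_gt0.
  have p2 : t1 ^+ 2 * NN (val u) <= t2 ^+ 2 * NN (val u).
    by rewrite ler_pM2r// ler_pXn2r ?nnegrE ?ltW.
  have := ler_wpM2l (sqr_ge0 (NN (val u))) (dM_3 d p1 p2).
  have -> : NN (val u) ^+ 2 * (dM d (t2 ^+ 2 * NN (val u)) / (t2 ^+ 2 * NN (val u)) - dM d (t1 ^+ 2 * NN (val u)) / (t1 ^+ 2 * NN (val u)))
     = dM d (t2 ^+ 2 * NN (val u)) * NN (val u) / t2 ^+ 2 - dM d (t1 ^+ 2 * NN (val u)) * NN (val u) / t1 ^+ 2.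
    by field; rewrite !gt_eqF.
  have -> : NN (val u) ^+ 2 * (dm d * (1 / (t2 ^+ 2 * NN (val u)) - 1 / (t1 ^+ 2 * NN (val u)))) = - dm d * NN (val u) * (T1 - T2).
    by rewrite /T1 /T2; field; rewrite !gt_eqF.
  by [].
have L1 (t : R) := L1_gv mO (Ht t) Hu.
have hg : psi d O (fun x => t1 * val u x) (val u) / t1 ^+ 3 - dk d * Int m3 (fun x : T3 => val u x ^+ 2) * (T1 - T2)
   <= psi d O (fun x => t2 * val u x) (val u) / t2 ^+ 3.
  have e1 := IntZ (t1 ^+ 3)^-1 (L1 t1); have e2 := IntZ (t2 ^+ 3)^-1 (L1 t2).
  have e3 := IntZ (dk d * (T1 - T2)) (inH_2 Hu).
  have -> : psi d O (fun x => t1 * val u x) (val u) / t1 ^+ 3 - dk d * Int m3 (fun x : T3 => val u x ^+ 2) * (T1 - T2) =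
     Int m3 (fun x : T3 => (t1 ^+ 3)^-1 * (gO d O x (t1 * val u x) * val u x) - dk d * (T1 - T2) * val u x ^+ 2).
    rewrite (IntB (L1Z _ (L1 t1)) (L1Z _ (inH_2 Hu))) e1 e3 /psi; ring.
  rewrite [leRHS]mulrC /psi -e2; apply: Int_le; [exact: L1B (L1Z _ (L1 t1)) (L1Z _ (inH_2 Hu))|exact: L1Z (L1 t2)|].
  move=> x; have := gO_ray d O x (val u x) t10 t12.
  rewrite -/T1 -/T2 (mulrAC (dk d)) (mulrC _ (t1 ^+ 3)^-1) (mulrC _ (t2 ^+ 3)^-1); exact.
have h3 := dk_NN Hu.
have TT : 0 <= T1 - T2.
  by rewrite subr_ge0 /T1 /T2 lef_pV2 ?posrE ?exprn_gt0// ler_pXn2r ?nnegrE ?ltW.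
have h4 := ler_wpM2r TT h3.
rewrite -/T1 -/T2 /cc; move: hM hg h4.
set A1 := _ / t2 ^+ 2; set A2 := _ / t1 ^+ 2; set A3 := _ / t1 ^+ 3; set A4 := _ / t2 ^+ 3; set I := Int _ _; set N := NN (val u).
clear; lra.
Qed.

End HspEnergy.

Section FunNehari.
Variables (R : realType) (d : pdata R).
Notation RR := (measurableTypeR R).
Notation T3 := (RR * RR * RR)%type.
Notation m3 := (mu3 R).
Notation inH := (inH (ds d)).
Notation B W := (@Hform R (ds d) (dV d) W).
Notation BP W := (Hform_psd (ds d) W).
Implicit Types (W : weight (dV d)) (O : set T3) (u v w : pt R -> R).

Definition isN W O u := [/\ inH W u, 0 < NN W u & PP W O u = 0].

(** One radius serves all weights and all domains, hence all scaling parameters and the limit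
    problem. *)
Definition rsm : R := s2val (cid2 (@small_pos R d)).
Lemma rsmP : 0 < rsm /\ forall W O u, measurable O -> inH W u -> 0 < NN W u -> NN W u < rsm ^+ 2 -> 0 < PP W O u.
Proof. by rewrite /rsm; case: cid2 => r r0 hr /=; split => // *; exact: hr. Qed.

Lemma nm_toH_gt0 W u (Hu : inH W u) : 0 < NN W u -> 0 < nm (B W) (toH Hu).
Proof. by move=> N0; rewrite sqrtr_gt0. Qed.

Section Fix.
Variables (W : weight (dV d)) (O : set T3).
Hypothesis mO : measurable O.
Notation D := (DH mO).
Notation J := (JH O).

Lemma DH_small (u : Hsp (ds d) W) : 0 < nm (B W) u -> nm (B W) u < rsm -> 0 < B W (D u) u.
Proof.
move=> u0 ur; rewrite DH_PP; apply: rsmP.2 => //; first exact: HspP.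
  by rewrite nm_sqr exprn_gt0.
by rewrite nm_sqr ltr_pXn2r ?nnegrE ?(ltW u0) ?(ltW rsmP.1).
Qed.

Lemma neh_isN (u : Hsp (ds d) W) : nehari (B W) D u <-> isN W O (val u).
Proof.
split.
  move=> [u0 Du]; split; [exact: HspP|by rewrite nm_sqr exprn_gt0|by rewrite -(DH_PP mO)].
by move=> [_ N0 P0]; split; [rewrite nm_NN sqrtr_gt0|rewrite DH_PP].
Qed.

Lemma nehariZ (t : R) u (Hu : inH W u) : isN W O (fun x => t * u x) <-> nehari (B W) D (t *: toH Hu).
Proof. by rewrite neh_isN valZ. Qed.

Lemma isN_ray u (t : R) : isN W O u -> 0 < t -> JJ W O (fun x => t * u x) <= JJ W O u.
Proof.
move=> Nu t0; have Hu : inH W u by case: Nu.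
have Nh : nehari (B W) D (toH Hu) by apply/neh_isN.
have := nehari_ray_le (BP W) (@DH_unif R d W O mO) (@DH_ray R d W O mO) (cc_gt0 d) Nh t0.
by rewrite /JH valZ.
Qed.

Lemma PPZ u (t : R) (Hu : inH W u) : PP W O (fun x => t * u x) = t * B W (D (t *: toH Hu)) (toH Hu).
Proof.
have := DH_PP mO (t *: toH Hu); rewrite valZ => <-.
exact: (psdZr (BP W)).
Qed.

Lemma isN_exists u (t0 : R) : inH W u -> 0 < NN W u -> 0 < t0 -> PP W O (fun x => t0 * u x) <= 0 ->
  exists2 t : R, 0 < t <= t0 & isN W O (fun x => t * u x).
Proof.
move=> Hu N0 t00; rewrite (PPZ t0 Hu) pmulr_rle0// => h.
have [t tt Nt] := nehari_exists (BP W) (@DH_unif R d W O mO) rsmP.1 DH_small t00 (nm_toH_gt0 Hu N0) h.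
by exists t => //; apply/(nehariZ t Hu).
Qed.

Lemma PP_null u : inH W u -> NN W u = 0 -> PP W O u = 0.
Proof.
move=> Hu N0; have := DH_PP mO (toH Hu) => /= <-.
have n0 : nm (B W) (toH Hu) = 0 by rewrite nm_NN /= N0 sqrtr0.
by rewrite (psdC (BP W)); exact: (nm_eq0 (BP W)).
Qed.

Lemma PP_small u : inH W u -> NN W u < rsm ^+ 2 -> 0 <= PP W O u.
Proof.
move=> Hu Nr; have [N0|N0] := eqVneq (NN W u) 0; first by rewrite PP_null.
by apply/ltW/rsmP.2 => //; rewrite lt_neqAle eq_sym N0 NN_ge0.
Qed.

Lemma isN_small u : isN W O u -> rsm ^+ 2 <= NN W u.
Proof.
move=> [Hu N0 P0]; rewrite leNgt; apply/negP => h.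
by have := rsmP.2 W O u mO Hu N0 h; rewrite P0 ltxx.
Qed.

Lemma isN_J u : isN W O u -> cc d / 4 * NN W u <= JJ W O u.
Proof. by move=> [Hu _ P0]; have := coercive mO Hu; rewrite P0 mul0r addr0. Qed.

Lemma ray_cmp u (t1 t2 : R) : inH W u -> 0 < t1 -> t1 < t2 ->
  PP W O (fun x => t2 * u x) / t2 ^+ 4 <= PP W O (fun x => t1 * u x) / t1 ^+ 4 - cc d * NN W u * ((t1 ^+ 2)^-1 - (t2 ^+ 2)^-1).
Proof.
move=> Hu t10 t12; have t20 := lt_trans t10 t12.
have := @DH_ray R d W O mO (toH Hu) t1 t2 t10 t12.
have -> : B W (toH Hu) (toH Hu) = NN W u by [].
suff E (t : R) : 0 < t -> PP W O (fun x => t * u x) / t ^+ 4 = B W (D (t *: toH Hu)) (toH Hu) / t ^+ 3.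
  by rewrite (E t1 t10) (E t2 t20).
move=> t0; rewrite (PPZ t Hu); set X := B W _ _; field; rewrite gt_eqF//.
Qed.

(** [3 / 4] is [1 - 1 / 2^2]: by the ray condition between the times [1] and [2], the assumed bound
    makes the radial derivative nonpositive at time [2]. *)
Lemma isN_exists2 u : inH W u -> 0 < NN W u -> PP W O u <= 3 / 4 * cc d * NN W u ->
  exists2 t : R, 0 < t <= 2 & isN W O (fun x => t * u x).
Proof.
move=> Hu N0 P0; apply: isN_exists => //.
have := ray_cmp Hu ltr01 (ltr1n R 2).
have -> : (fun x => 1 * u x) = u by apply/funext => x; rewrite mul1r.
rewrite !expr1n !invr1 mulr1 => h.
have : PP W O (fun x => 2 * u x) / 2 ^+ 4 <= 0.
  apply: le_trans h _.
  have -> : (2 ^+ 2)^-1 = 1 / 4 :> R by rewrite expr2; field.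
  move: P0; set A := PP _ _ _; set C := cc d; set N := NN _ _; clear -mO; lra.
by rewrite pmulr_lle0// invr_gt0 exprn_gt0.
Qed.

Lemma PP_below u (t0 t : R) : isN W O (fun x => t0 * u x) -> inH W u -> 0 < t -> t <= t0 -> 0 <= PP W O (fun x => t * u x).
Proof.
move=> Nt0 Hu t_0; rewrite le_eqVlt => /predU1P[->|tt]; first by case: Nt0 => _ _ ->.
have := ray_cmp Hu t_0 tt; case: Nt0 => _ _ ->; rewrite mul0r subr_ge0 => h.
have : 0 <= PP W O (fun x => t * u x) / t ^+ 4.
  apply: le_trans h; apply: mulr_ge0.
    by apply: mulr_ge0; [exact: ltW (cc_gt0 d)|exact: NN_ge0].
  by rewrite subr_ge0 lef_pV2 ?posrE ?exprn_gt0// ?(lt_trans t_0 tt)// ler_pXn2r ?nnegrE ?(ltW t_0) ?(ltW tt)// ltW// (lt_trans t_0).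
by rewrite pmulr_lge0// invr_gt0 exprn_gt0.
Qed.
End Fix.

Definition Wc : weight (dV d) := Weight (measurable_cst (dV d)) (dV0 d) (fun x => lexx (dV d)).

Lemma inH_Wc W u : inH W u -> inH Wc u.
Proof.
move=> Hu; split; [exact: inH_m Hu|exact: inH_2 Hu|exact: inH_g Hu|].
exact: L1Z (inH_2 Hu).
Qed.

Lemma NN_Wc W u : inH W u -> NN Wc u <= NN W u.
Proof.
move=> Hu; rewrite /NN !hformE lerD2l; apply: Int_le; [exact: inH_W (inH_Wc Hu)|exact: inH_W Hu|].
by move=> x; rewrite ler_wpM2r ?sqr_ge0// wt_ge.
Qed.

Lemma dM_mul_le (a b : R) : 0 <= a -> a <= b -> dM d a * a <= dM d b * b.
Proof.
move=> a0 ab; apply: ler_pM => //; first exact: ltW (dM_gt0 d a).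
exact: dM_le.
Qed.

Lemma PP_Wc W O u : measurable O -> inH W u -> PP Wc setT u <= PP W O u.
Proof.
move=> mO Hu; apply: lerB; first by apply: dM_mul_le; [exact: NN_ge0|exact: NN_Wc].
apply: Int_le; [exact: (L1_gv mO Hu Hu)|exact: (L1_gv measurableT Hu Hu)|].
move=> x; have [u0|u0] := leP (u x) 0.
  by rewrite (sc_neg (gO_scal d O x) u0) (sc_neg (gO_scal d setT x) u0).
rewrite ler_wpM2r ?(ltW u0)//; have [[_ [-> _]]|[[]//]] := gO_case d setT x.
exact: gO_f.
Qed.

Lemma JJ_Wc W O u (g : R) : measurable O -> inH W u -> 0 <= g ->
  NN Wc u + g <= NN W u -> JJ Wc setT u + dm d / 2 * g <= JJ W O u.
Proof.
move=> mO Hu g0 Ng; rewrite /JJ.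
have [h1 _] := dMh_mono d (NN_ge0 Wc u) (le_trans (ltac:(by rewrite lerDl) : NN Wc u <= NN Wc u + g) Ng).
have h2 : Psi d O u <= Psi d setT u.
  apply: Int_le; [exact: (L1_G mO Hu)|exact: (L1_G measurableT Hu)|].
  move=> x; have [[_ [_ ->]]|[[]//]] := gO_case d setT x; exact: GO_F.
have h3 : dm d * g <= dm d * (NN W u - NN Wc u) by rewrite ler_wpM2l ?(ltW (dm_gt0 d))// lerBrDl.
move: h1 h2 h3; set A := NN W u; set A' := NN Wc u; set P1 := Psi _ _ _; set P2 := Psi _ _ _; set M1 := dMh d A; set M2 := dMh d A'.
clear -d; lra.
Qed.

Lemma NN_ae0 W u : inH W u -> {ae m3, forall x, u x = 0} -> NN W u = 0.
Proof.
move=> Hu E; rewrite /NN hformE.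
have [_ ->] : L1 m3 (fun x : T3 => W x * u x ^+ 2) /\ Int m3 (fun x : T3 => W x * u x ^+ 2) = Int m3 (fun=> 0).
  apply: ae_Int_eq; [exact: L1_0|exact: L1_meas (inH_W Hu)|].
  by apply: (aeS _ E) => x ->; rewrite expr0n mulr0.
have [_ ->] : L1 (mu3 R \x mu3 R)%E (gq (ds d) u u) /\ Int (mu3 R \x mu3 R)%E (gq (ds d) u u) = Int (mu3 R \x mu3 R)%E (fun=> 0).
  apply: ae_Int_eq; [exact: L1_0|exact: L1_meas (inH_g Hu)|].
  by apply: (aeS _ (ae_prod E)) => z [h1 h2]; rewrite /gq h1 h2 subrr !mul0r.
by rewrite !Int0 addr0.
Qed.

Definition c0set : set R := [set JJ Wc setT u | u in isN Wc setT].
Definition c0 : R := inf c0set.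

Lemma isN_Wc W O u : measurable O -> isN W O u -> exists2 t : R, 0 < t <= 1 & isN Wc setT (fun x => t * u x).
Proof.
move=> mO [Hu N0 P0]; have Hc := inH_Wc Hu.
apply: isN_exists => //.
  rewrite lt_neqAle NN_ge0 andbT eq_sym; apply/eqP => Nc.
  have E := form_eq0_ae Hc Nc.
  by move: N0; rewrite (NN_ae0 Hu E) ltxx.
have -> : (fun x => 1 * u x) = u by apply/funext => x; rewrite mul1r.
by rewrite -P0; exact: PP_Wc.
Qed.

Lemma c0_lb u : isN Wc setT u -> c0 <= JJ Wc setT u.
Proof.
move=> Nu; apply: ge_inf; last by exists u.
exists 0 => _ [v Nv <-]; apply: le_trans (isN_J measurableT Nv).
by apply: mulr_ge0; [rewrite divr_ge0// ltW// cc_gt0|exact: NN_ge0].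
Qed.

(** The limit problem has the smallest weight and the largest nonlinearity, so [u] meets its Nehari
    set at a time [t <= 1]. There its limit energy is at most [JJ W O] at the same point, which is
    at most the value at the maximum of the ray. *)
Lemma c0_le W O u : measurable O -> isN W O u -> c0 <= JJ W O u.
Proof.
move=> mO Nu; have [t /andP[t0 t1] Nt] := isN_Wc mO Nu.
have Hu : inH W u by case: Nu.
apply: le_trans (c0_lb Nt) _; apply: le_trans (isN_ray mO Nu t0).
have Ht := inHZ t Hu.
by have := JJ_Wc mO Ht (lexx 0); rewrite addr0 mulr0 addr0; apply; exact: NN_Wc.
Qed.

(** Superadditivity is the direction that splitting needs: separate pieces have no more Kirchhoff
    energy than one function carrying both norms. *)
Lemma dMh_super (a b : R) : 0 <= a -> 0 <= b -> dMh d a + dMh d b <= dMh d (a + b).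
Proof.
move=> a0 b0; pose h (x : R) := dMh d (a + x) - dMh d x.
have dh (x : R) : is_derive x 1 h (dM d (a + x) - dM d x).
  have h1 := dMh_d d (a + x); have h2 := dMh_d d x.
  have h3 : is_derive x 1 (fun x : R => a + x) 1.
    apply: is_derive_eps => e e0; exists 1 => // k _.
    have -> : a + (x + k) - (a + x) - 1 * k = 0 by ring.
    by rewrite normr0 mulr_ge0// ltW.
  have := is_derive1_comp h1 h3.
  by move=> h4; apply: is_derive_eq; rewrite /GRing.scale /= mulr1.
have [c [_ c1 c2]] := mean_value dh 0 b.
rewrite min_l// in c1; rewrite /h addr0 dMh0 !subr0 => E.
have : 0 <= (dM d (a + c) - dM d c) * b.
  by apply: mulr_ge0 => //; rewrite subr_ge0; apply: dM_le => //; rewrite lerDr.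
by rewrite -E; lra.
Qed.

Lemma dM_super (a b : R) : 0 <= a -> 0 <= b -> dM d a * a + dM d b * b <= dM d (a + b) * (a + b).
Proof.
move=> a0 b0; rewrite mulrDr; apply: lerD; apply: ler_wpM2r => //; apply: dM_le => //.
  by rewrite lerDl.
by rewrite lerDr.
Qed.

(** By (M_3) the quotient [M(t) / t] does not increase, so [M] has at most linear growth and
    increments of [t M(t)] are controlled by [M] at the larger point. *)
Lemma dM_mul_diff (a b : R) : 0 <= a -> a <= b -> dM d b * b - dM d a * a <= 2 * dM d b * (b - a).
Proof.
rewrite le_eqVlt => /predU1P[<-|a0] ab.
  rewrite mulr0 !subr0 -mulrA ler_peMl ?ler1n// mulr_ge0//; exact: ltW (dM_gt0 d b).
have b0 := lt_le_trans a0 ab.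
have := dM_3 d a0 ab => h.
have h2 : dM d b / b <= dM d a / a.
  have : dm d * (1 / b - 1 / a) <= 0.
    rewrite pmulr_rle0 ?dm_gt0// subr_le0 !div1r lef_pV2 ?posrE//.
  by move: h; set X := _ / b; set Y := _ / a; set Z := dm d * _; lra.
have h3 : dM d b * a <= dM d a * b.
  by rewrite -ler_pdivlMr// mulrAC -ler_pdivrMr.
have h4 := ler_wpM2r (_ : 0 <= b - a) (dM_le d (ltW a0) ab).
rewrite subr_ge0 in h4; have := h4 ab; rewrite !mulrBr; lra.
Qed.

End FunNehari.

(** * Low energy states do not split *)

Section CutScalar.
Variables (R : realType) (d : pdata R).

Lemma kir_cut (Lam e N N1 N2 t : R) : 0 <= N -> N <= Lam -> 0 <= N1 -> 0 <= N2 -> `|N1 + N2 - N| <= e -> e <= 1 ->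
  0 <= t -> t <= 2 ->
  dMh d (t ^+ 2 * N1) + dMh d (t ^+ 2 * N2) <= dMh d (t ^+ 2 * N) + 4 * dM d (4 * (Lam + 1)) * e /\
  dM d N1 * N1 + dM d N2 * N2 <= dM d N * N + 2 * dM d (4 * (Lam + 1)) * e.
Proof.
move=> N0 NL N10 N20 Ne e1 t0 t2; have e0 : 0 <= e := le_trans (normr_ge0 _) Ne.
have M0 := dM_gt0 d (4 * (Lam + 1)).
have q0 := sqr_ge0 t; have q4 : t ^+ 2 <= 4.
  by rewrite expr2; have := ler_pM t0 t0 t2 t2; lra.
have [s1 s2] : N1 + N2 - N <= e /\ - e <= N1 + N2 - N by move: Ne; rewrite ler_norml => /andP[? ?].
have Lam0 : 0 <= Lam := le_trans N0 NL.
split.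
  apply: le_trans (dMh_super d (mulr_ge0 q0 N10) (mulr_ge0 q0 N20)) _.
  rewrite -mulrDr; have [h|h] := leP (N1 + N2) N.
    have [h1 _] := dMh_mono d (mulr_ge0 q0 (addr_ge0 N10 N20)) (ler_wpM2l q0 h).
    have : 0 <= dm d * (t ^+ 2 * N - t ^+ 2 * (N1 + N2)).
      by apply: mulr_ge0; [exact: ltW (dm_gt0 d)|rewrite -mulrBr mulr_ge0// subr_ge0].
    have := mulr_ge0 (ltW M0) e0; lra.
  have [_ h1] := dMh_mono d (mulr_ge0 q0 N0) (ler_wpM2l q0 (ltW h)).
  have h2 : t ^+ 2 * (N1 + N2) <= 4 * (Lam + 1).
    by apply: ler_pM => //; [exact: addr_ge0|lra].
  have h3 := dM_le d (mulr_ge0 q0 (addr_ge0 N10 N20)) h2.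
  have h4 : t ^+ 2 * (N1 + N2) - t ^+ 2 * N <= 4 * e.
    by rewrite -mulrBr; apply: ler_pM => //; rewrite subr_ge0 ltW.
  have h5 : dM d (t ^+ 2 * (N1 + N2)) * (t ^+ 2 * (N1 + N2) - t ^+ 2 * N) <= dM d (4 * (Lam + 1)) * (4 * e).
    apply: ler_pM => //; first exact: ltW (dM_gt0 _ _).
    by rewrite -mulrBr mulr_ge0// subr_ge0 ltW.
  lra.
apply: le_trans (dM_super d N10 N20) _.
have [h|h] := leP (N1 + N2) N.
  have := dM_mul_le d (addr_ge0 N10 N20) h; have := mulr_ge0 (ltW M0) e0; lra.
have h1 := dM_mul_diff d N0 (ltW h).
have h2 : dM d (N1 + N2) <= dM d (4 * (Lam + 1)) by apply: dM_le; [exact: addr_ge0|lra].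
have h3 : dM d (N1 + N2) * (N1 + N2 - N) <= dM d (4 * (Lam + 1)) * e.
  apply: ler_pM => //; first exact: ltW (dM_gt0 _ _).
  by rewrite subr_ge0 ltW.
lra.
Qed.

Lemma GO_bd : exists2 C : R, 0 < C & forall O x (t w : R), 0 <= t -> t <= 2 ->
  GO d O x (t * w) <= C * (w ^+ 2 + `|w| `^ dp d) /\ gO d O x w * w <= C * (w ^+ 2 + `|w| `^ dp d).
Proof.
have [C C0 hC] := gO_bound d; have k0 := dk0 d; have hp := dp2 d.
have P1 : 1 <= 2 `^ dp d :> R by rewrite -[leLHS](powRr0 (2 : R)); apply: ler_powR; rewrite ?ler1n//; lra.
have g (O : set (measurableTypeR R * measurableTypeR R * measurableTypeR R)) x (a : R) : gO d O x a * a <= C * (a ^+ 2 + `|a| `^ dp d).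
  apply: le_trans (ler_norm _) _; rewrite normrM; apply: le_trans (ler_wpM2r (normr_ge0 a) (hC O x a)) _.
  rewrite -mulrA ler_pM2l// mulrDl -expr2 real_normK ?num_real// [X in _ + X <= _]mulrC mulr_powRB1//; lra.
have CC : 0 < (C + dk d) * (4 + 2 `^ dp d) by rewrite mulr_gt0 ?addr_gt0// ltr_wpDr// powR_ge0.
exists ((C + dk d) * (4 + 2 `^ dp d)) => // O x t w t0 t2.
have w2 := sqr_ge0 w; have wp := powR_ge0 `|w| (dp d).
have q4 : t ^+ 2 <= 4 by rewrite expr2; have := ler_pM t0 t0 t2 t2; lra.
split.
  apply: le_trans (GO_le d O x (t * w)) _.
  have h1 := g O x (t * w).
  have h2 : (t * w) ^+ 2 <= (4 + 2 `^ dp d) * w ^+ 2 by rewrite exprMn ler_wpM2r//; lra.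
  have h3 : `|t * w| `^ dp d <= (4 + 2 `^ dp d) * `|w| `^ dp d.
    rewrite normrM (ger0_norm t0) powRM// ler_wpM2r//.
    have : t `^ dp d <= 2 `^ dp d by apply: ge0_ler_powR; rewrite ?nnegrE//; lra.
    lra.
  have h4 := ler_wpM2l (ltW C0) (lerD h2 h3); have h5 := ler_wpM2l (ltW k0) h2.
  have h6 : 0 <= dk d * ((4 + 2 `^ dp d) * `|w| `^ dp d).
    by rewrite mulr_ge0 ?(ltW k0)// mulr_ge0//; lra.
  lra.
apply: le_trans (g O x w) _; rewrite ler_wpM2r ?addr_ge0//.
have := mulr_ge0 (addr_ge0 (ltW C0) (ltW k0)) (_ : 0 <= 3 + 2 `^ dp d); lra.
Qed.
End CutScalar.

Section Annuli.
Variables (R : realType).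
Notation RR := (measurableTypeR R).
Notation T3 := (RR * RR * RR)%type.
Notation m3 := (mu3 R).

Definition ann (y : pt R) (r : R) : set T3 := [set x : T3 | r < `|(x : pt R) - y| < 2 * r].

Lemma m_ann y r : measurable (ann y r).
Proof.
have mnorm : measurable_fun setT (fun z : T3 => `|(z : pt R) - y|).
  apply: (@m_continuous R (fun x : pt R => `|x - y|)) => x.
  by apply: cvg_norm; apply: cvgB; [exact: cvg_id|exact: cvg_cst].
have -> : ann y r = setT `&` (fun z : T3 => `|(z : pt R) - y|) @^-1` `]r, 2 * r[.
  by rewrite setTI; apply/seteqP; split => z /=; rewrite in_itv.
by apply: mnorm => //; exact: measurable_itv.
Qed.

(** The radii grow by the factor [3] while each annulus ends at twice its inner radius, so the
    annuli are disjoint. *)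
Lemma ann_sum y (r0 : R) n (x : T3) : 0 < r0 ->
  \sum_(k < n) (\1_(ann y (3 ^+ k * r0)) x : R) <= 1 /\
  (3 ^+ n * r0 <= `|(x : pt R) - y| -> \sum_(k < n) (\1_(ann y (3 ^+ k * r0)) x : R) = 0).
Proof.
move=> r00; elim: n => [|n [IH1 IH2]]; first by rewrite !big_ord0.
have p0 : 0 < 3 ^+ n * r0 by rewrite mulr_gt0// exprn_gt0.
rewrite !big_ord_recr /=; split.
  rewrite indicE; have [/set_mem /= /andP[h _]|_] := boolP (x \in _); last by rewrite addr0.
  by rewrite IH2 ?add0r// ltW.
rewrite exprS => h; rewrite IH2 ?add0r; last by move: p0 h; lra.
rewrite indicE memNset// => /= /andP[_ h2]; move: p0 h h2; lra.
Qed.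

Lemma annulus_pigeonhole (y : pt R) (r0 B : R) n (h : T3 -> R) : 0 < r0 -> L1 m3 h -> (forall x, 0 <= h x) ->
  Int m3 h <= B -> exists2 k, (k <= n)%N & Int m3 (fun x => \1_(ann y (3 ^+ k * r0)) x * h x) <= B / n.+1%:R.
Proof.
move=> r00 Lh h0 hB; apply: contrapT => hk.
have Lk k : L1 m3 (fun x => \1_(ann y (3 ^+ k * r0)) x * h x) by apply: L1_indicM => //; exact: m_ann.
have : \sum_(k < n.+1) Int m3 (fun x => \1_(ann y (3 ^+ k * r0)) x * h x) <= B.
  rewrite -Int_sum//; apply: le_trans hB; apply: Int_le => //; first exact: L1_sum.
  by move=> x; rewrite -mulr_suml ler_piMl//; have [] := ann_sum y n.+1 x r00.
apply/negP; rewrite -ltNge.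
have -> : B = \sum_(k < n.+1) (B / n.+1%:R).
  by rewrite sumr_const card_ord -[RHS]mulr_natr divfK// pnatr_eq0.
have lt k : (k <= n)%N -> B / n.+1%:R < Int m3 (fun x => \1_(ann y (3 ^+ k * r0)) x * h x).
  by move=> kn; rewrite ltNge; apply/negP => hk2; apply: hk; exists k.
rewrite big_ord_recl [ltRHS]big_ord_recl; apply: ltr_leD; first exact: lt.
by apply: ler_sum => k _; apply/ltW/lt; rewrite -ltnS ltn_ord.
Qed.
End Annuli.

Section CutEnergy.
Variables (R : realType) (d : pdata R).
Notation RR := (measurableTypeR R).
Notation T3 := (RR * RR * RR)%type.
Notation m3 := (mu3 R).
Notation inH := (inH (ds d)).
Implicit Types (W : weight (dV d)) (O : set T3) (u v w : pt R -> R).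

Definition hw w (x : T3) : R := w x ^+ 2 + `|w x| `^ dp d.

Lemma hw_ge0 w x : 0 <= hw w x. Proof. by rewrite addr_ge0 ?sqr_ge0 ?powR_ge0. Qed.

Lemma hw_L1 (Lam : R) : exists2 C : R, 0 < C & forall W w, inH W w -> NN W w <= Lam ->
  L1 m3 (hw w) /\ Int m3 (hw w) <= C.
Proof.
have [C1 _ hC] := @PP_lower R d 1 1 ltr01 ltr01.
exists (`|Lam| / dV d + `|dA d| * Num.sqrt `|Lam| `^ dp d + 1).
  rewrite ltr_wpDl// addr_ge0//; first by rewrite divr_ge0// ltW// dV0.
move=> W w Hw Nw; have [Lp Ip _] := hC W setT w measurableT Hw.
split; first exact: L1D (inH_2 Hw) Lp.
rewrite /hw (IntD (inH_2 Hw) Lp).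
have h1 : Int m3 (fun x : T3 => w x ^+ 2) <= `|Lam| / dV d.
  rewrite ler_pdivlMr ?dV0// mulrC; apply: le_trans (L2_le_form Hw) _.
  exact: le_trans Nw (ler_norm _).
have h2 : `|dA d| * Num.sqrt (NN W w) `^ dp d <= `|dA d| * Num.sqrt `|Lam| `^ dp d.
  rewrite ler_wpM2l//; apply: ge0_ler_powR; rewrite ?nnegrE ?sqrtr_ge0//; first by rewrite ltW// (lt_trans _ (dp2 d)).
  by rewrite ler_wsqrtr// (le_trans Nw)// ler_norm.
move: h1 h2 Ip; set I1 := Int _ _; set I2 := Int _ _; lra.
Qed.

Section Cut.
Variables (W : weight (dV d)) (O : set T3) (y : pt R) (r : R) (w : pt R -> R).
Hypotheses (mO : measurable O) (r0 : 0 < r) (Hw : inH W w).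
Let u1 (x : pt R) := xic y r x * w x.
Let u2 (x : pt R) := etac y r x * w x.

Lemma cut_inH : inH W u1 /\ inH W u2.
Proof. by have [] := ims (ds0 d) (ds1 d) y r0 Hw. Qed.

Lemma cut_ptw (h : R -> R) (x : T3) (t : R) : h 0 = 0 -> (forall a, 0 <= h a) ->
  h (t * w x) <= h (t * u1 x) + h (t * u2 x) + \1_(ann y r) x * h (t * w x).
Proof.
move=> h00 h0; rewrite indicE; have [_|/negP xA] := boolP (x \in ann y r).
  by rewrite mul1r lerDr addr_ge0.
rewrite mul0r addr0 /u1 /u2.
have [xr|xr] := leP `|(x : pt R) - y| r.
  by have [-> ->] := xic_in r0 xr; rewrite mul1r mul0r mulr0 h00 addr0.
have [xr2|xr2] := leP (2 * r) `|(x : pt R) - y|.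
  by have [-> ->] := xic_out r0 xr2; rewrite mul1r mul0r mulr0 h00 add0r.
by case: xA; apply/mem_set; rewrite /ann /= xr.
Qed.

Lemma cut_Psi (C eta t : R) : 0 < C -> 0 <= t -> t <= 2 -> L1 m3 (hw w) ->
  (forall x, GO d O x (t * w x) <= C * hw w x /\ gO d O x (w x) * w x <= C * hw w x) ->
  Int m3 (fun x => \1_(ann y r) x * hw w x) <= eta ->
  Psi d O (fun x => t * w x) <= Psi d O (fun x => t * u1 x) + Psi d O (fun x => t * u2 x) + C * eta /\
  psi d O w w <= psi d O u1 u1 + psi d O u2 u2 + C * eta.
Proof.
move=> C0 t0 t2 Lh hG he; have [H1 H2] := cut_inH.
have mA := m_ann y r.
have LA : L1 m3 (fun x => \1_(ann y r) x * hw w x) by exact: L1_indicM.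
have i0 x : 0 <= \1_(ann y r) x :> R by rewrite indicE.
split.
  have L1' := L1_G mO (inHZ t H1); have L2' := L1_G mO (inHZ t H2).
  apply: (@le_trans _ _ (Int m3 (fun x : T3 => (GO d O x (t * u1 x) + GO d O x (t * u2 x)) + C * (\1_(ann y r) x * hw w x)))).
    apply: Int_le; [exact: (L1_G mO (inHZ t Hw))|exact: L1D (L1D L1' L2') (L1Z C LA)|].
    move=> x; apply: le_trans (cut_ptw x t (GO_0 d O x) (GO_ge0 d O x)) _.
    by rewrite lerD2l [leRHS]mulrCA; apply: ler_wpM2l; [exact: i0|have [] := hG x].
  rewrite (IntD (L1D L1' L2') (L1Z C LA)) (IntD L1' L2') (IntZ C LA).
  by rewrite lerD2l ler_wpM2l// ltW.
have L1' := L1_gv mO H1 H1; have L2' := L1_gv mO H2 H2.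
apply: (@le_trans _ _ (Int m3 (fun x : T3 => (gO d O x (u1 x) * u1 x + gO d O x (u2 x) * u2 x) + C * (\1_(ann y r) x * hw w x)))).
  apply: Int_le; [exact: (L1_gv mO Hw Hw)|exact: L1D (L1D L1' L2') (L1Z C LA)|].
  move=> x; have := @cut_ptw (fun a => gO d O x a * a) x 1; rewrite !mul1r => h.
  apply: le_trans (h _ _) _; [by rewrite mulr0| |].
    move=> a; have [a0|a0] := leP a 0; first by rewrite (sc_neg (gO_scal d O x) a0) mul0r.
    by rewrite mulr_ge0 ?(ltW a0)// (sc_pos (gO_scal d O x)).
  by rewrite lerD2l [leRHS]mulrCA; apply: ler_wpM2l; [exact: i0|have [] := hG x].
rewrite (IntD (L1D L1' L2') (L1Z C LA)) (IntD L1' L2') (IntZ C LA).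
by rewrite lerD2l ler_wpM2l// ltW.
Qed.

Lemma cut_JP (C Lam e eta : R) : NN W w <= Lam -> 0 < C -> L1 m3 (hw w) ->
  (forall O x (t w : R), 0 <= t -> t <= 2 ->
    GO d O x (t * w) <= C * (w ^+ 2 + `|w| `^ dp d) /\ gO d O x w * w <= C * (w ^+ 2 + `|w| `^ dp d)) ->
  Int m3 (fun x => \1_(ann y r) x * hw w x) <= eta ->
  4 * kap (ds d) r * Int m3 (fun x : T3 => w x ^+ 2) <= e -> e <= 1 ->
  [/\ `|NN W u1 + NN W u2 - NN W w| <= e,
      forall t : R, 0 <= t -> t <= 2 -> JJ W O (fun x => t * u1 x) + JJ W O (fun x => t * u2 x) <=
        JJ W O (fun x => t * w x) + 2 * dM d (4 * (Lam + 1)) * e + C * eta &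
      PP W O u1 + PP W O u2 <= PP W O w + 2 * dM d (4 * (Lam + 1)) * e + C * eta].
Proof.
move=> NL C0 Lh hG he ke e1; have [H1 H2 hims] := ims (ds0 d) (ds1 d) y r0 Hw.
have Ne : `|NN W u1 + NN W u2 - NN W w| <= e := le_trans hims ke.
have n0 := NN_ge0 W w; have n1 := NN_ge0 W u1; have n2 := NN_ge0 W u2.
split => //.
  move=> t t0 t2; have [k1 _] := kir_cut d n0 NL n1 n2 Ne e1 t0 t2.
  have [k2 _] := cut_Psi C0 t0 t2 Lh (fun x => hG O x t (w x) t0 t2) he.
  rewrite /JJ !NNZ//; move: k1 k2.
  set a1 := dMh _ _; set a2 := dMh _ _; set a3 := dMh _ _; set b1 := Psi _ _ _; set b2 := Psi _ _ _; set b3 := Psi _ _ _.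
  set c := dM _ _; set ce := C * eta; clear -mO r0 Hw; lra.
have [_ k1] := kir_cut d n0 NL n1 n2 Ne e1 (ler0n R 2) (lexx 2).
have [_ k2] := cut_Psi C0 (ler0n R 2) (lexx 2) Lh (fun x => hG O x 2 (w x) (ler0n R 2) (lexx 2)) he.
rewrite /PP; move: k1 k2.
set a1 := dM _ _ * _; set a2 := dM _ _ * _; set a3 := dM _ _ * _; set b1 := psi _ _ _ _; set b2 := psi _ _ _ _; set b3 := psi _ _ _ _.
set c := dM _ _; set ce := C * eta; clear -mO r0 Hw; lra.
Qed.
End Cut.
End CutEnergy.

Section CutLemma.
Variables (R : realType) (d : pdata R).
Notation RR := (measurableTypeR R).
Notation T3 := (RR * RR * RR)%type.
Notation m3 := (mu3 R).
Notation inH := (inH (ds d)).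
Implicit Types (W : weight (dV d)) (O : set T3) (u v w : pt R -> R).

(** If every unit cube with corner in [O] had small mass, [lions] would make the subcritical term on
    [O] negligible; as the nonlinearity off [O] is already absorbed, [PP] would be positive on the
    Nehari set. *)
Lemma nonvanish (Lam : R) : 0 < Lam -> exists2 kappa : R, 0 < kappa &
  forall W O w, measurable O -> isN W O w -> NN W w <= Lam ->
    exists2 y : pt R, O y & kappa <= Int m3 (fun x : T3 => \1_(QB y 1) x * w x ^+ 2).
Proof.
move=> Lam0; pose p0 := 2 + 2 * ds d * 2 / 3.
have s0 := ds0 d; have s1 := ds1 d; have hp := dp2 d; have c0 := cc_gt0 d; have V0 := dV0 d.
have p00 : 0 < p0 by rewrite /p0; lra.
pose q := 1 / dV d + `|dA d| * Num.sqrt Lam `^ (dp d - 2) + 1.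
have q0 : 0 < q by rewrite ltr_wpDl// addr_ge0 ?divr_ge0 ?(ltW V0)// mulr_ge0// powR_ge0.
have l0 : 0 < cc d / (4 * q) by rewrite divr_gt0// mulr_gt0.
have [C C0 hC] := @PP_lower R d p0 _ p00 l0.
pose C1 := C * (4 `^ p0 * 32 * (1 + (dV d)^-1)) + 1.
have C10 : 0 < C1.
  rewrite ltr_wpDl// mulr_ge0 ?(ltW C0)// mulr_ge0 ?mulr_ge0 ?powR_ge0//.
  by rewrite addr_ge0// invr_ge0 ltW.
(* Solves [sig^(2 s / 3) = cc / (4 C1)], which bounds the term from [lions] by [cc / 4] of the
   squared norm. *)
pose sig := (cc d / (4 * C1)) `^ (3 / (2 * ds d)).
have sig0 : 0 < sig by rewrite powR_gt0// divr_gt0// mulr_gt0.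
have sigE : sig `^ (2 * ds d / 3) = cc d / (4 * C1).
  rewrite /sig -powRrM.
  have -> : 3 / (2 * ds d) * (2 * ds d / 3) = 1 by field; rewrite gt_eqF.
  by rewrite powRr1// divr_ge0 ?(ltW c0)// mulr_ge0// ltW.
exists sig => // W O w mO Nw NL; have [Hw N0 P0] := Nw.
apply: contrapT => hn.
have hO x : O x -> Int m3 (fun y : T3 => \1_(QB x 1) y * w y ^+ 2) <= sig.
  by move=> Ox; rewrite leNgt; apply/negP => h; apply: hn; exists x => //; exact: ltW.
have [Lr Ir] := lions s0 (ltW s1) sig0 mO Hw hO.
have [Lp Ip hP] := hC W O w mO Hw.
have := hP O mO Lr (@subset_refl _ _); rewrite P0; apply/negP; rewrite -ltNge.
have N1 : NN W w = Num.sqrt (NN W w) ^+ 2 by rewrite sqr_sqrtr// ltW.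
have sp : 0 < Num.sqrt (NN W w) by rewrite sqrtr_gt0.
have hNp : Num.sqrt (NN W w) `^ dp d <= NN W w * Num.sqrt Lam `^ (dp d - 2).
  have -> : Num.sqrt (NN W w) `^ dp d = NN W w * Num.sqrt (NN W w) `^ (dp d - 2).
    rewrite {2}N1 -[Num.sqrt (NN W w) ^+ 2](@powR_mulrn _ _ 2) ?sqrtr_ge0// -powRD; last by rewrite (gt_eqF sp) implybT.
    by congr (_ `^ _); ring.
  rewrite ler_wpM2l ?(ltW N0)//; apply: ge0_ler_powR; rewrite ?nnegrE ?sqrtr_ge0//; first by rewrite subr_ge0 ltW.
  exact: ler_wsqrtr.
have h2 : Int m3 (fun x : T3 => w x ^+ 2) <= NN W w / dV d.
  by rewrite ler_pdivlMr// mulrC; exact: L2_le_form.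
have hA := le_trans Ip (ler_wpM2l (normr_ge0 (dA d)) hNp).
have h3 : Int m3 (fun x : T3 => w x ^+ 2) + Int m3 (fun x : T3 => `|w x| `^ dp d) <= q * NN W w.
  have -> : q * NN W w = NN W w / dV d + `|dA d| * (NN W w * Num.sqrt Lam `^ (dp d - 2)) + NN W w by rewrite /q; ring.
  by apply: le_trans (lerD h2 hA) _; rewrite lerDl ltW.
have h4 : cc d / (4 * q) * (Int m3 (fun x : T3 => w x ^+ 2) + Int m3 (fun x : T3 => `|w x| `^ dp d)) <= cc d / 4 * NN W w.
  apply: le_trans (ler_wpM2l (ltW l0) h3) _.
  by rewrite le_eqVlt; apply/orP; left; apply/eqP; field; rewrite gt_eqF.
have h5 : C * Int m3 (fun x : T3 => \1_O x * `|w x| `^ p0) <= cc d / 4 * NN W w.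
  apply: le_trans (ler_wpM2l (ltW C0) Ir) _; rewrite sigE.
  rewrite -/p0 -/(NN W w).
  have E (c1 N : R) : c1 != 0 -> C * (4 `^ p0 * 32 * (cc d / (4 * c1)) * (1 + (dV d)^-1) * N) =
     (C * (4 `^ p0 * 32 * (1 + (dV d)^-1))) / c1 * (cc d / 4 * N).
    by move=> c10; field; rewrite c10 gt_eqF.
  rewrite E ?gt_eqF// ler_piMl ?mulr_ge0 ?divr_ge0 ?(ltW c0) ?(ltW N0)// ler_pdivrMr// mul1r /C1 lerDl//.
have := mulr_gt0 c0 N0; move: h4 h5; rewrite /cc.
set I1 := _ * (_ + _); set I2 := C * _; set N := NN W w; set K := dk d / dV d; clear -d; lra.
Qed.

(** Two errors compete. The cutoff error decays with the radius and fixes the smallest radius [R0];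
    the mass in the transition annulus is not small at any prescribed radius, so the radius is
    selected among [3^k R0] with [k <= n], and [n] depends on [Lam] and [e] only. *)
Lemma cut_choose (Lam e : R) : 0 < Lam -> 0 < e -> exists2 Rm : R, 1 <= Rm &
  forall W O w (y : pt R), measurable O -> inH W w -> NN W w <= Lam ->
  exists2 r : R, 1 <= r <= Rm &
   let u1 x := xic y r x * w x in let u2 x := etac y r x * w x in
   [/\ inH W u1, inH W u2, `|NN W u1 + NN W u2 - NN W w| <= e,
      (forall t : R, 0 <= t -> t <= 2 -> JJ W O (fun x => t * u1 x) + JJ W O (fun x => t * u2 x) <=
        JJ W O (fun x => t * w x) + e) &
      PP W O u1 + PP W O u2 <= PP W O w + e].
Proof.
move=> Lam0 e0; have [C C0 hC] := GO_bd d; have [B B0 hB] := @hw_L1 R d Lam.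
pose M := dM d (4 * (Lam + 1)); have M0 : 0 < M by exact: dM_gt0.
pose e1 := Num.min (Num.min 1 e) (e / (4 * M)).
have e10 : 0 < e1 by rewrite !lt_min ltr01 e0 divr_gt0// mulr_gt0.
have hmin (a b : R) : Num.min a b <= a /\ Num.min a b <= b by rewrite !ge_min !lexx ?orbT.
have [ea eb] := hmin (Num.min 1 e) (e / (4 * M)); have [ec ed] := hmin 1 e.
have e11 : e1 <= 1 := le_trans ea ec.
have e1e : e1 <= e := le_trans ea ed.
have e1M : 2 * M * e1 <= e / 2.
  have := ler_wpM2l (ltW (mulr_gt0 (ltr0n R 2 : (0:R) < 2) M0)) eb.
  have -> : 2 * M * (e / (4 * M)) = e / 2 by field; rewrite gt_eqF.
  by [].
pose eta := e / (2 * C); have eta0 : 0 < eta by rewrite divr_gt0// mulr_gt0.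
have CE : C * eta = e / 2 by rewrite /eta; field; rewrite gt_eqF.
have [n hn] : exists n, B / n.+1%:R <= eta.
  have [N NP] := small_inv (divr_gt0 eta0 B0); exists N.
  have := NP N (leqnn _); rewrite ler_pdivlMr// mulrC//.
pose R0 := Num.max 1 (4 * `|Ckap (ds d)| * Lam / (dV d * e1)).
have R01 : 1 <= R0 by rewrite le_max lexx.
have R00 : 0 < R0 by exact: lt_le_trans R01.
have p3 k : 1 <= 3 ^+ k :> R by rewrite exprn_ege1// ler1n.
exists (3 ^+ n * R0); first by rewrite (le_trans R01)// ler_peMl// ltW.
move=> W O w y mO Hw NL; have [Lh Ih] := hB W w Hw NL.
have [k kn hk] := annulus_pigeonhole y n R00 Lh (hw_ge0 d w) Ih.
pose r := 3 ^+ k * R0.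
have r1 : 1 <= r by rewrite (le_trans R01)// ler_peMl// ltW.
have r0 : 0 < r by exact: lt_le_trans r1.
have rR : R0 <= r by rewrite ler_peMl// ltW.
exists r; first by rewrite r1 ler_pM2r// ler_weXn2l// ler1n.
have [H1 H2] := cut_inH y r0 Hw.
have ke : 4 * kap (ds d) r * Int m3 (fun x : T3 => w x ^+ 2) <= e1.
  have [_ kb] := kap_bound (ds0 d) (ds1 d) r0.
  have I0 : 0 <= Int m3 (fun x : T3 => w x ^+ 2) by apply: Int_ge0 => x; exact: sqr_ge0.
  have I1 : Int m3 (fun x : T3 => w x ^+ 2) <= Lam / dV d.
    by rewrite ler_pdivlMr ?dV0// mulrC; apply: le_trans (L2_le_form Hw) NL.
  have k1 : kap (ds d) r <= `|Ckap (ds d)| / R0.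
    apply: le_trans kb _; apply: (@le_trans _ _ (`|Ckap (ds d)| * r `^ (- (2 * ds d)))).
      by rewrite ler_wpM2r ?powR_ge0// ler_norm.
    rewrite ler_wpM2l// powRN lef_pV2 ?posrE ?powR_gt0//.
    by apply: le_trans rR _; apply: le1r_powR => //; exact: ds2.
  have k0 : 0 <= `|Ckap (ds d)| / R0 by rewrite divr_ge0// ltW.
  rewrite -mulrA; apply: (@le_trans _ _ (4 * (`|Ckap (ds d)| / R0 * (Lam / dV d)))).
    rewrite ler_wpM2l//; apply: (@le_trans _ _ (`|Ckap (ds d)| / R0 * Int m3 (fun x : T3 => w x ^+ 2))).
      by rewrite ler_wpM2r.
    by rewrite ler_wpM2l.
  have : 4 * `|Ckap (ds d)| * Lam / (dV d * e1) <= R0 by rewrite le_max lexx orbT.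
  have V0 := dV0 d; rewrite ler_pdivrMr ?mulr_gt0// => h.
  have -> : 4 * (`|Ckap (ds d)| / R0 * (Lam / dV d)) = 4 * `|Ckap (ds d)| * Lam / (R0 * dV d) by field; rewrite !gt_eqF.
  rewrite ler_pdivrMr ?mulr_gt0//; have -> : e1 * (R0 * dV d) = R0 * (dV d * e1) by ring.
  exact: h.
have [h1 h2 h3] := cut_JP mO r0 Hw NL C0 Lh hC (le_trans hk hn) ke e11.
split => //; first exact: le_trans h1 e1e.
  by move=> t t0 t2; have := h2 t t0 t2; rewrite -/M CE; move: e1M; clear; lra.
by move: h3; rewrite -/M CE; move: e1M; clear; lra.
Qed.

Section Dicho.
Variables (W : weight (dV d)) (O : set T3).
Hypothesis mO : measurable O.

(** At the time [t] that puts [a] on the Nehari set, [a] costs at least [c0 d], and [b] a fixed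
    amount by coercivity. Their sum is at most the energy of [w] up to [e], because [w] is the
    maximum of its own ray. The smallest Nehari norm bounds [t] below. *)
Lemma two_bumps (w a b : pt R -> R) (Lam m h e t : R) : isN W O w -> inH W a -> inH W b ->
  isN W O (fun x => t * a x) -> 0 < t -> t <= 2 -> 0 <= PP W O (fun x => t * b x) ->
  0 < Lam -> NN W a <= Lam -> 0 < m -> m <= NN W b -> JJ W O w <= c0 d + h ->
  JJ W O (fun x => t * a x) + JJ W O (fun x => t * b x) <= JJ W O (fun x => t * w x) + e ->
  cc d / 4 * (rsm d ^+ 2 / Lam * m) <= h + e.
Proof.
move=> Nw Ha Hb Nta t0 t2 Pb Lam0 NaL m0 mb Jw Jsum.
have h1 := c0_le mO Nta.
have h2 := isN_ray mO Nw t0.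
have h3 : cc d / 4 * NN W (fun x => t * b x) <= JJ W O (fun x => t * b x).
  apply: le_trans (coercive mO (inHZ t Hb)); rewrite lerDl divr_ge0//.
have h4 := isN_small mO Nta; rewrite (NNZ t Ha) in h4; rewrite (NNZ t Hb) in h3.
have t2r : rsm d ^+ 2 / Lam <= t ^+ 2.
  rewrite ler_pdivrMr//; apply: le_trans h4 _; rewrite ler_wpM2l ?sqr_ge0//.
have h5 : cc d / 4 * (rsm d ^+ 2 / Lam * m) <= cc d / 4 * (t ^+ 2 * NN W b).
  rewrite ler_wpM2l ?divr_ge0 ?(ltW (cc_gt0 d))//; apply: ler_pM => //.
    by rewrite divr_ge0 ?sqr_ge0// ltW.
  exact: ltW.
move: h1 h2 h3 h5 Jw Jsum; set X := cc d / 4 * (rsm d ^+ 2 / Lam * m); set Y := cc d / 4 * (t ^+ 2 * NN W b); clear -mO; lra.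
Qed.

(** If [b] is already past its own Nehari time when [a] reaches its, the roles are exchanged: at the
    earlier time of [b], the radial derivative of [a] is still nonnegative. *)
Lemma no_two_bumps (w a b : pt R -> R) (Lam m h e : R) : isN W O w -> inH W a -> inH W b ->
  0 < Lam -> NN W a <= Lam -> NN W b <= Lam -> 0 < m -> m <= NN W a -> m <= NN W b -> JJ W O w <= c0 d + h ->
  (forall t : R, 0 <= t -> t <= 2 -> JJ W O (fun x => t * a x) + JJ W O (fun x => t * b x) <= JJ W O (fun x => t * w x) + e) ->
  PP W O a <= 3 / 4 * cc d * m ->
  cc d / 4 * (rsm d ^+ 2 / Lam * m) <= h + e.
Proof.
move=> Nw Ha Hb Lam0 NaL NbL m0 ma mb Jw Jsum Pa.
have [||t /andP[t0 t2] Nta] := @isN_exists2 _ d W O mO a Ha.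
- exact: lt_le_trans m0 ma.
- by apply: le_trans Pa _; rewrite ler_wpM2l// mulr_ge0 ?divr_ge0// ltW// cc_gt0.
have [Pb|Pb] := leP 0 (PP W O (fun x => t * b x)).
  exact: two_bumps Nw Ha Hb Nta t0 t2 Pb Lam0 NaL m0 mb Jw (Jsum t (ltW t0) t2).
have [|t' /andP[t'0 t't] Ntb] := isN_exists mO Hb (lt_le_trans m0 mb) t0; first exact: ltW.
have Pa' := PP_below mO Nta Ha t'0 t't.
have t'2 := le_trans t't t2.
apply: (two_bumps Nw Hb Ha Ntb t'0 t'2 Pa' Lam0 NbL m0 ma Jw).
by rewrite addrC; apply: Jsum => //; exact: ltW.
Qed.
End Dicho.

(* If both pieces of a split carried norm, each would cost at least [c0 d]; the
   annulus separating them comes from a pigeonhole argument on the mass of [w]. *)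
Lemma cut_lemma : exists kappa Lam : R, [/\ 0 < kappa, 0 < Lam & forall rho : R, 0 < rho -> exists h Rm : R,
  [/\ 0 < h, h <= 1, 1 <= Rm & forall W O w, measurable O -> isN W O w -> JJ W O w <= c0 d + h ->
   exists (y : pt R) (r t : R), let u1 x := xic y r x * w x in let u2 x := etac y r x * w x in
   [/\ O y, 1 <= r <= Rm, inH W u1 /\ inH W u2, kappa <= Int m3 (fun x : T3 => u1 x ^+ 2) /\ NN W u1 <= Lam &
      NN W u2 <= rho /\ [/\ 0 < t, t <= 2, isN W O (fun x => t * u1 x) & JJ W O (fun x => t * u1 x) <= c0 d + rho]]]].
Proof.
have c0' := cc_gt0 d; have V0 := dV0 d; have [rs0 _] := @rsmP R d.
pose L := `|4 * (c0 d + 1) / cc d| + 1.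
have L0 : 0 < L by rewrite ltr_wpDl.
have [kap0 kap00 hkap] := nonvanish L0.
exists kap0, (L + 1); split => //; first by rewrite addr_gt0.
move=> rho0 rho00.
(* Multiplication by [t <= 2] enlarges the squared norm of the remainder by at most [4]; the
   denominator [8] keeps it below [rsm ^+ 2], where [PP] is nonnegative. *)
pose rho := Num.min rho0 (rsm d ^+ 2 / 8).
have rho_0 : 0 < rho by rewrite lt_min rho00 divr_gt0// exprn_gt0.
have hmin (a b : R) : Num.min a b <= a /\ Num.min a b <= b by rewrite !ge_min !lexx ?orbT.
have [ra rb] := hmin rho0 (rsm d ^+ 2 / 8); rewrite -/rho in ra rb.
pose m := Num.min rho (dV d * kap0).
have m0 : 0 < m by rewrite lt_min rho_0 mulr_gt0.
have [ma mb] := hmin rho (dV d * kap0); rewrite -/m in ma mb.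
pose K := cc d / 4 * (rsm d ^+ 2 / (L + 1) * m).
have L10 : 0 < L + 1 by rewrite addr_gt0.
have K0 : 0 < K.
  apply: mulr_gt0; first by rewrite divr_gt0.
  by apply: mulr_gt0 => //; apply: divr_gt0 => //; exact: exprn_gt0.
pose e := Num.min (Num.min 1 (rho / 2)) (Num.min (K / 4) (3 / 4 * cc d * m)).
have e0 : 0 < e by rewrite !lt_min ltr01 !divr_gt0//= !mulr_gt0// divr_gt0.
have [e1 [e2 [e3 e4]]] : e <= 1 /\ e <= rho / 2 /\ e <= K / 4 /\ e <= 3 / 4 * cc d * m.
  by rewrite /e !ge_min !lexx ?orbT.
have [Rm Rm1 hRm] := cut_choose L0 e0.
exists e, Rm; split => // W O w mO Nw Jw.
have [Hw N0 P0] := Nw.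
have NL : NN W w <= L.
  have := isN_J mO Nw => h; have h2 : cc d / 4 * NN W w <= c0 d + 1 by move: h Jw e1; move: (JJ W O w) => X; clear; lra.
  have : NN W w <= 4 * (c0 d + 1) / cc d by rewrite ler_pdivlMr// mulrC; move: h2; clear; lra.
  move=> h3; apply: le_trans h3 _; rewrite /L (le_trans (ler_norm _))// lerDl//.
have [y Oy hy] := hkap W O w mO Nw NL.
have [r /andP[r1 rR]] := hRm W O w y mO Hw NL; have r0 : 0 < r by exact: lt_le_trans r1.
set u1 := (fun x => xic y r x * w x); set u2 := (fun x => etac y r x * w x); cbv zeta.
have u1E x : u1 x = xic y r x * w x by [].
move=> [H1 H2 hN hJ hP].
have k1 : kap0 <= Int m3 (fun x : T3 => u1 x ^+ 2).
  apply: le_trans hy _; apply: Int_le; [exact: L1_indicM (mQB _ _) (inH_2 Hw)|exact: inH_2 H1|].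
  move=> x; rewrite indicE; have [/set_mem Qx|_] := boolP (x \in QB y 1); last by rewrite mul0r sqr_ge0.
  rewrite mul1r u1E; have [|-> _] := @xic_in _ y r r0 x; last by rewrite mul1r.
  apply: le_trans r1; rewrite norm_pt_le.
  case: Qx => -[] /=; rewrite !in_itv/= => /andP[q1 q2] /andP[q3 q4] /andP[q5 q6].
  by rewrite !ger0_norm ?subr_ge0// !lerBlDl !(ltW q2, ltW q4, ltW q6).
have N1 : dV d * kap0 <= NN W u1.
  by apply: le_trans (L2_le_form H1); rewrite ler_wpM2l// ltW.
have n1 := NN_ge0 W u1; have n2 := NN_ge0 W u2.
have Nsum : NN W u1 + NN W u2 <= L + 1.
  move: hN; rewrite ler_norml => /andP[_ h]; move: h NL e1; clear; lra.
have N1L : NN W u1 <= L + 1 by move: Nsum n2; clear; lra.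
have N2L : NN W u2 <= L + 1 by move: Nsum n1; clear; lra.
rewrite P0 add0r in hP.
have m1 : m <= NN W u1 := le_trans mb N1.
have N2r : NN W u2 <= rho.
  rewrite leNgt; apply/negP => h.
  have m2 : m <= NN W u2 := le_trans ma (ltW h).
  have hh : K <= e + e.
    (* [PP W O u1 + PP W O u2 <= e] and [e <= 3 / 4 * cc d * m], so at least one of the two pieces
       satisfies the bound required by [no_two_bumps]. *)
    have [Pa|Pa] := leP (PP W O u1) (3 / 4 * cc d * m).
      exact: (no_two_bumps mO Nw H1 H2 L10 N1L N2L m0 m1 m2 Jw hJ Pa).
    have Pb : PP W O u2 <= 3 / 4 * cc d * m.
      have := mulr_gt0 (mulr_gt0 (divr_gt0 (ltr0n R 3 : (0 : R) < 3) (ltr0n R 4 : (0 : R) < 4)) c0') m0.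
      move: Pa hP e4; set X := 3 / 4 * cc d * m; clear; lra.
    apply: (no_two_bumps mO Nw H2 H1 L10 N2L N1L m0 m2 m1 Jw _ Pb) => t t0 t2.
    by rewrite addrC; exact: hJ.
  by move: hh e3 K0; clear; lra.
have P2 : 0 <= PP W O u2.
  apply: PP_small => //; apply: le_lt_trans N2r _; apply: le_lt_trans rb _.
  by rewrite ltr_pdivrMr// ltr_pMr ?exprn_gt0// ltr1n.
have [||t /andP[t0 t2] Nt] := @isN_exists2 _ d W O mO u1 H1.
- exact: lt_le_trans m0 m1.
- have h5 : 3 / 4 * cc d * m <= 3 / 4 * cc d * NN W u1 by rewrite ler_wpM2l// mulr_ge0 ?divr_ge0// ltW.
  by move: h5 hP e4 P2; clear; lra.
exists y, r, t; cbv zeta; rewrite -/u1 -/u2; split => //; first by rewrite r1.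
split; first exact: le_trans N2r ra.
split => //.
have J2 : 0 <= JJ W O (fun x => t * u2 x).
  apply: le_trans (coercive mO (inHZ t H2)); apply: addr_ge0.
    by rewrite mulr_ge0 ?NN_ge0// divr_ge0// ltW.
  rewrite divr_ge0//; apply: PP_small => //; first exact: inHZ.
  rewrite NNZ//; apply: (@le_lt_trans _ _ (4 * rho)).
    by apply: ler_pM => //; rewrite ?sqr_ge0// expr2; have := ler_pM (ltW t0) (ltW t0) t2 t2; clear; lra.
  have : 0 < rsm d ^+ 2 by exact: exprn_gt0.
  by move: rb; clear; lra.
have := hJ t (ltW t0) t2; have := isN_ray mO Nw t0.
move: J2 Jw e2 ra rho_0; clear; lra.
Qed.
End CutLemma.

(** * The limit problem and the barycenter *)

Section LimitProblem.
Variables (R : realType) (d : pdata R).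
Notation RR := (measurableTypeR R).
Notation T3 := (RR * RR * RR)%type.
Notation m3 := (mu3 R).
Notation inH := (inH (ds d)).
Implicit Types (W : weight (dV d)) (O : set T3) (u v w : pt R -> R).

Definition cutoff (r : R) (x : pt R) : R := 1 - zeta 0 r x.

Lemma cutoff01 r x : 0 <= cutoff r x <= 1.
Proof. by have /andP[h1 h2] := clamp01P ((`|x - 0| - r) / r); rewrite /cutoff /zeta subr_ge0 h2 gerBl h1. Qed.

Lemma cutoff_in r x : 0 < r -> `|x| <= r -> cutoff r x = 1.
Proof.
move=> r0 h; rewrite /cutoff /zeta clamp01_0 ?subr0//.
by rewrite pmulr_lle0 ?invr_gt0// subr_le0.
Qed.

Lemma cutoff_out r x : 0 < r -> 2 * r <= `|x| -> cutoff r x = 0.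
Proof.
move=> r0 h; rewrite /cutoff /zeta clamp01_1 ?subrr// subr0 ler_pdivlMr//; move: h; clear; lra.
Qed.

Lemma inH_cutoff W r (C : R) : 0 < r -> (forall x : pt R, `|x| <= 2 * r -> W x <= C) -> inH W (cutoff r).
Proof.
move=> r0 WC; have C1 : 1 <= Num.max 1 C by rewrite le_max lexx.
have C0 : 0 <= Num.max 1 C by rewrite (le_trans ler01).
have r20 : 0 <= 2 * r by rewrite mulr_ge0// ltW.
have [L1c _] := @L1_cb R (2 * r) r20.
have cbN (x : pt R) : ~ cb (2 * r) x -> cutoff r x = 0.
  move=> h; apply: cutoff_out => //; rewrite leNgt; apply/negP => h2; apply: h; exact: cb_norm.
have ge0 (x : pt R) : 0 <= \1_(cb (2 * r)) x :> R by rewrite indicE.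
apply: (@inH_bump R (ds d) (ds0 d) (ds1 d) _ W (cutoff r) (cb (2 * r)) (Num.max 1 C) r) => //.
- by apply: measurable_funB; [exact: measurable_cst|exact: m_zeta].
- exact: mQB.
- move=> x y; have E : (cutoff r x - cutoff r y) ^+ 2 = (zeta 0 r x - zeta 0 r y) ^+ 2 by rewrite /cutoff; ring.
  have m0 : 0 <= Num.min 1 (`|x - y| ^+ 2 / r ^+ 2) by rewrite le_min ler01 divr_ge0// sqr_ge0.
  have big : 1 <= \1_(cb (2 * r)) x + \1_(cb (2 * r)) y :> R ->
      (cutoff r x - cutoff r y) ^+ 2 <= Num.max 1 C * (\1_(cb (2 * r)) x + \1_(cb (2 * r)) y) * Num.min 1 (`|x - y| ^+ 2 / r ^+ 2).
    move=> h; rewrite E; apply: le_trans (zeta_lip 0 r0 x y) _; rewrite ler_peMl//.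
    by apply: (@le_trans _ _ (1 * 1)); [rewrite mulr1|exact: ler_pM].
  have [xA|xA] := pselect (cb (2 * r) x).
    by apply: big; rewrite {1}indicE mem_set// lerDl.
  have [yA|yA] := pselect (cb (2 * r) y).
    by apply: big; rewrite addrC {1}indicE mem_set// lerDl.
  rewrite (cbN x xA) (cbN y yA) subrr expr0n /= mulr_ge0// mulr_ge0// addr_ge0//.
- move=> x; have [xA|xA] := pselect (cb (2 * r) x).
    rewrite indicE mem_set// mulr1; have /andP[h1 h2] := cutoff01 r x.
    by apply: le_trans C1; rewrite expr_le1.
  by rewrite (cbN x xA) expr0n mulr_ge0.
- move=> x [[]] /=; rewrite !in_itv/= => /andP[a1 a2] /andP[b1 b2] /andP[c1 c2].
  rewrite le_max WC ?orbT// norm_pt_le; rewrite !ler_norml.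
  by apply/and3P; split; apply/andP; split; move: a1 a2 b1 b2 c1 c2; clear; lra.
Qed.

(** [M] grows at most linearly, so [M(t^2 N) t^2 N] is [O(t^4)], whereas by [df_oo] the nonlinear
    term along the ray of a cutoff exceeds any multiple of [t^4] on the unit cube where the cutoff
    is [1]. *)
Lemma c0set_ne : c0set d !=set0.
Proof.
have H1 : inH (Wc d) (cutoff 1) by apply: (@inH_cutoff _ _ (dV d)).
have V0 := dV0 d; have V1 := inH_2 H1.
have [LQ IQ] := L1_QB (0 : pt R) (r := 1) ler01.
have Qle (x : T3) : QB (0 : pt R) 1 x -> cutoff 1 x = 1.
  move=> Qx; apply: cutoff_in => //; rewrite norm_pt_le.
  case: Qx => -[] /=; rewrite !in_itv/= !add0r => /andP[q1 q2] /andP[q3 q4] /andP[q5 q6].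
  by rewrite !ger0_norm// !ltW.
have I1 : 1 <= Int m3 (fun x : T3 => cutoff 1 x ^+ 2).
  apply: (@le_trans _ _ (Int m3 (\1_(QB (0 : pt R) 1) : T3 -> R))); first by rewrite IQ expr1n.
  apply: Int_le => // x; rewrite indicE; have [/set_mem Qx|_] := boolP (x \in _); last exact: sqr_ge0.
  by rewrite Qle// expr1n.
have N0 : 0 < NN (Wc d) (cutoff 1).
  apply: lt_le_trans (L2_le_form H1); rewrite pmulr_rgt0//; exact: lt_le_trans I1.
set N := NN _ _ in N0.
pose C := dM d 1 * N ^+ 2; have [T T0 hT] := @df_oo R d C.
pose t := Num.max (Num.max 1 T) (1 / N).
have [t1 [tT tN]] : 1 <= t /\ T <= t /\ 1 / N <= t by rewrite /t !le_max !lexx !orbT.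
have t0 : 0 < t by exact: lt_le_trans t1.
have [tau /andP[tau0 _] Nt] : exists2 tau : R, 0 < tau <= t & isN (Wc d) setT (fun x => tau * cutoff 1 x).
  apply: isN_exists => //; rewrite /PP NNZ// -/N.
  have tn1 : 1 <= t ^+ 2 * N.
    have : 1 <= t * N by rewrite -ler_pdivrMr.
    move=> h; apply: le_trans h _; rewrite ler_pM2r// expr2 ler_peMl// ltW//.
  have tn0 : 0 < t ^+ 2 * N by exact: lt_le_trans tn1.
  have hM : dM d (t ^+ 2 * N) * (t ^+ 2 * N) <= dM d 1 * (t ^+ 2 * N) ^+ 2.
    have := dM_3 d ltr01 tn1; rewrite invr1 !mulr1 => h.
    have h2 : dm d * ((t ^+ 2 * N)^-1 - 1) <= 0.
      by rewrite pmulr_rle0 ?dm_gt0// subr_le0 invf_le1.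
    have h3 : dM d (t ^+ 2 * N) / (t ^+ 2 * N) <= dM d 1 by move: h h2; rewrite !mul1r; clear; lra.
    move: (t ^+ 2 * N) tn0 h3 => Y Y0; rewrite ler_pdivrMr// => h3; rewrite expr2 mulrA.
    by apply: ler_wpM2r => //; exact: ltW.
  rewrite subr_le0; apply: le_trans hM _.
  have Ht := inHZ t H1.
  have -> : dM d 1 * (t ^+ 2 * N) ^+ 2 = (C * t ^+ 4) * Int m3 (\1_(QB (0 : pt R) 1) : T3 -> R).
    by rewrite IQ /C; ring.
  rewrite -(IntZ _ LQ); apply: Int_le; [exact: L1Z|exact: (L1_gv measurableT Ht Ht)|].
  move=> x; rewrite indicE; have [/set_mem Qx|_] := boolP (x \in _); last first.
    rewrite mulr0 mulr_ge0//; last by rewrite mulr_ge0 ?(ltW t0)//; have /andP[] := cutoff01 1 x.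
    by apply: (sc_pos (gO_scal d setT x)); rewrite mulr_ge0 ?(ltW t0)//; have /andP[] := cutoff01 1 x.
  rewrite Qle// !mulr1; have [[_ [-> _]]|[[]//]] := gO_case d setT x.
  by have := ler_wpM2r (ltW t0) (hT t tT); rewrite -mulrA -exprSr.
by exists (JJ (Wc d) setT (fun x => tau * cutoff 1 x)); exists (fun x => tau * cutoff 1 x).
Qed.

(** A compactly supported near-minimizer is the rescaled first piece of an arbitrary one:
    [cut_lemma] is applied to the limit problem, whose domain is the whole space. *)
Lemma near_min (e : R) : 0 < e -> exists u (S : R),
  [/\ isN (Wc d) setT u, forall x : pt R, S <= `|x| -> u x = 0 & JJ (Wc d) setT u <= c0 d + e].
Proof.
move=> e0; have [kap [Lam [_ _ /(_ e e0) [h [Rm [h0 _ _ hcut]]]]]] := cut_lemma d.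
have lb : has_lbound (c0set d).
  by exists (c0 d) => _ [v Nv <-]; exact: c0_lb.
have [_ [w Nw <-] Jw] := inf_adherent h0 (conj c0set_ne lb).
have [y [r [t [_ /andP[r1 _] [H1 _] _ [_ [t0 _ Nt Jt]]]]]] := hcut (Wc d) setT w measurableT Nw (ltW Jw).
exists (fun x => t * (xic y r x * w x)), (`|y| + 2 * r); split => // x xS.
have [|-> _] := @xic_out R y r (lt_le_trans ltr01 r1) x; last by rewrite mul0r mulr0.
have := ler_normD (x - y) y; rewrite subrK; move: xS; clear; lra.
Qed.

(* [v] plays a translate of the near-minimizer [u] of the limit problem. *)
Lemma ray_transfer u (e : R) : isN (Wc d) setT u -> 0 < e -> exists2 g : R, 0 < g &
  forall W O v, measurable O -> inH W v -> 0 < NN W v -> NN W v <= NN (Wc d) u + g ->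
  (forall t : R, Psi d O (fun x => t * v x) = Psi d setT (fun x => t * u x)) ->
  (forall t : R, psi d O (fun x => t * v x) (fun x => t * v x) = psi d setT (fun x => t * u x) (fun x => t * u x)) ->
  exists2 t : R, 0 < t & isN W O (fun x => t * v x) /\ JJ W O (fun x => t * v x) <= JJ (Wc d) setT u + e.
Proof.
move=> Nu e0; have [Hu N0 P0] := Nu; set N := NN _ _ in N0 *.
have c0 := cc_gt0 d.
pose S := dM d (4 * (N + 1)); have S0 : 0 < S := dM_gt0 d _.
(* [S] bounds [M] on the squared norms met at times up to [2]. The second bound keeps [PP]
   nonpositive at time [2]; the third limits the rise of the Kirchhoff energy to [e]. *)
pose g := Num.min 1 (Num.min (cc d * N / S) (e / (2 * S))).
have g0 : 0 < g by rewrite !lt_min ltr01 !divr_gt0 ?mulr_gt0.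
have [g1 [g2 g3]] : g <= 1 /\ g <= cc d * N / S /\ g <= e / (2 * S) by rewrite /g !ge_min !lexx !orbT.
rewrite ler_pdivlMr// in g2; rewrite ler_pdivlMr ?mulr_gt0// in g3.
exists g => // W O v mO Hv Nv0 Nv EPsi Epsi.
have n1 := NN_ge0 W v; set N' := NN W v in n1 Nv Nv0.
have Nt4 (t : R) : 0 <= t -> t <= 2 -> t ^+ 2 * N' <= t ^+ 2 * (N + g) /\ t ^+ 2 * (N + g) <= 4 * (N + 1) /\ t ^+ 2 <= 4.
  move=> t0 t2; have q4 : t ^+ 2 <= 4 by rewrite expr2; have := ler_pM t0 t0 t2 t2; clear -t2; lra.
  split; first by rewrite ler_wpM2l// sqr_ge0.
  by split => //; apply: ler_pM; [exact: sqr_ge0|exact: addr_ge0 (ltW N0) (ltW g0)|exact: q4|rewrite lerD2l].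
have hP : PP W O (fun x => 2 * v x) <= 0.
  rewrite /PP NNZ// Epsi.
  have P2 : PP (Wc d) setT (fun x => 2 * u x) <= - (12 * cc d * N).
    have := ray_cmp measurableT Hu ltr01 (ltr1n R 2).
    have -> : (fun x => 1 * u x) = u by apply/funext => x; rewrite mul1r.
    rewrite P0 mul0r !expr1n invr1 sub0r ler_pdivrMr ?exprn_gt0//.
    have -> : (2 ^+ 2)^-1 = 1 / 4 :> R by rewrite expr2; field.
    have -> : 2 ^+ 4 = 16 :> R by rewrite !exprS expr0; ring.
    rewrite -/N; move: (PP _ _ _) => X; clear -N; lra.
  move: P2; rewrite /PP NNZ// -/N -/N'; move: (psi _ _ _ _) => X P2.
  have [h1 [h2 _]] := Nt4 2 (ler0n R 2) (lexx 2).
  have h3 := dM_mul_le d (mulr_ge0 (sqr_ge0 2) n1) h1.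
  have h4 := @dM_mul_diff _ d (2 ^+ 2 * N) (2 ^+ 2 * (N + g)) (mulr_ge0 (sqr_ge0 2) (ltW N0)).
  have h5 : 2 ^+ 2 * N <= 2 ^+ 2 * (N + g) by rewrite ler_pM2l ?exprn_gt0// lerDl ltW.
  have h6 : dM d (2 ^+ 2 * (N + g)) <= S.
    by apply: dM_le h2; apply: mulr_ge0 (sqr_ge0 2) (addr_ge0 (ltW N0) (ltW g0)).
  have h7 : dM d (2 ^+ 2 * (N + g)) * g <= S * g by rewrite ler_pM2r.
  have := h4 h5.
  have -> : 2 ^+ 2 * (N + g) - 2 ^+ 2 * N = 4 * g by rewrite expr2; ring.
  move: (dM d (2 ^+ 2 * N)) (dM d (2 ^+ 2 * N')) h3 P2 h7 g2 => a1 a2; move: (dM d _) => a3.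
  have -> : 2 ^+ 2 = 4 :> R by rewrite expr2; ring.
  have cN := mulr_gt0 c0 N0.
  move: cN; clear; lra.
have [t /andP[t0 t2] Nt] := isN_exists mO Hv Nv0 (ltr0n R 2 : (0 : R) < 2) hP.
exists t => //; split => //.
apply: le_trans (lerD (isN_ray measurableT Nu t0) (lexx e)).
rewrite /JJ !NNZ// EPsi -/N -/N'.
have [h1 [h2 h3]] := Nt4 t (ltW t0) t2.
have [h4 _] := dMh_mono d (mulr_ge0 (sqr_ge0 t) n1) h1.
have h5 : t ^+ 2 * N <= t ^+ 2 * (N + g) by rewrite ler_wpM2l ?sqr_ge0// lerDl ltW.
have [_ h6] := dMh_mono d (mulr_ge0 (sqr_ge0 t) (ltW N0)) h5.
have h7 : dM d (t ^+ 2 * (N + g)) * (t ^+ 2 * (N + g) - t ^+ 2 * N) <= S * (4 * g).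
  have -> : t ^+ 2 * (N + g) - t ^+ 2 * N = t ^+ 2 * g by ring.
  apply: ler_pM; [exact: ltW (dM_gt0 d _)|by rewrite mulr_ge0 ?sqr_ge0// ltW| |by rewrite ler_pM2r].
  by apply: dM_le => //; rewrite mulr_ge0 ?sqr_ge0// addr_ge0// ltW.
have h8 : 0 <= dm d * (t ^+ 2 * (N + g) - t ^+ 2 * N').
  by rewrite mulr_ge0 ?subr_ge0// ltW// dm_gt0.
move: h4 h6 h7 h8 g3; move: (dMh d _) (dMh d _) (dMh d _) (Psi _ _ _) (dM d _ * _) (dm d * _).
move=> A1 A2 A3 A4 A5 A6; clear; lra.
Qed.
End LimitProblem.

Section Scaling.
Variable R : realType.
Notation RR := (measurableTypeR R).
Notation T3 := (RR * RR * RR)%type.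

Lemma pscaleB (e : R) (x y : pt R) : pscale e x - pscale e y = pscale e (x - y).
Proof. by rewrite /pscale -!psubE /psub /= -!mulrBr. Qed.

Lemma norm_pscale (e : R) (x : pt R) : `|pscale e x| = `|e| * `|x|.
Proof. by rewrite !norm_ptE /= !normrM !maxr_pMr. Qed.

Lemma pscale_cont (e : R) : continuous (pscale e).
Proof.
move=> x; apply/cvgrPdist_le => e0 e00.
have e1 : 0 < e0 / (`|e| + 1) by rewrite divr_gt0// ltr_wpDl.
have hb : nbhs (x : pt R) (ball (x : pt R) (e0 / (`|e| + 1))) by exact: nbhsx_ballx e1.
apply: filterS hb => y; rewrite -ball_normE /= => xy.
rewrite pscaleB norm_pscale; apply: le_trans (ler_wpM2l (normr_ge0 e) (ltW xy)) _.
by rewrite mulrCA ler_piMr ?(ltW e00)// ler_pdivrMr ?ltr_wpDl// mul1r lerDl.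
Qed.

Lemma box_compact (r : R) : compact [set x : pt R | `|x| <= r].
Proof.
have -> : [set x : pt R | `|x| <= r] = (`[- r, r]%classic `*` `[- r, r]%classic) `*` `[- r, r]%classic.
  apply/seteqP; split => x /=; rewrite norm_pt_le !in_itv/= -!ler_norml.
    by case/and3P.
  by case=> -[-> ->] ->.
by apply: compact_setX; [apply: compact_setX|]; exact: segment_compact.
Qed.

Lemma compact_gap (V : pt R -> R) (K : set (pt R)) (m : R) : continuous V -> compact K ->
  (forall x, K x -> m < V x) ->
  exists2 g : R, 0 < g & forall z x, K z -> `|x - z| <= g -> m + g <= V x.
Proof.
move=> cV /compact_near_coveringP cK mV.
pose P (d : R) (z : pt R) := forall x, `|x - z| <= d -> m + d <= V x.
have : \forall d \near (0 : R)^'+, K `<=` P d.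
  apply: cK => z Kz; have a0 : 0 < (V z - m) / 2 by rewrite divr_gt0// subr_gt0 mV.
  have /cvgrPdist_le /(_ _ a0) /nbhs_ballP[r /= r0 hr] := cV z.
  have r2 : 0 < r / 2 by rewrite divr_gt0.
  exists (ball z (r / 2), [set d : R | d < Num.min (r / 2) ((V z - m) / 2)]).
    split => /=; first by apply/nbhs_ballP; exists (r / 2).
    by apply: nbhs_right_lt; rewrite lt_min r2.
  move=> [z' d] /= [zz']; rewrite lt_min => /andP[d1 d2] x xz.
  have : `|V z - V x| <= (V z - m) / 2.
    apply: hr; rewrite -ball_normE /=; rewrite -ball_normE /= in zz'.
    have -> : z - x = (z - z') - (x - z') by rewrite opprB addrA subrK.
    apply: le_lt_trans (ler_normB _ _) _; move: zz' xz d1; clear; lra.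
  rewrite ler_norml => /andP[_]; move: d2; clear; lra.
move=> [r /= r0 hr]; exists (r / 2); first by rewrite divr_gt0.
have r2 : 0 < r / 2 by rewrite divr_gt0.
have h1 : ball_ [eta Num.Def.normr] 0 r (r / 2) by rewrite /= sub0r normrN gtr0_norm//; move: r0; clear; lra.
by move=> z x Kz xz; exact: hr h1 r2 z Kz x xz.
Qed.
End Scaling.

Section Average.
Context dd (T : measurableType dd) (R : realType) (mu : {measure set T -> \bar R}).
Variable h : T -> R.
Hypotheses (Lh : L1 mu h) (h0 : forall x, 0 <= h x) (I0 : 0 < Int mu h).

Lemma L1_bdd (a : T -> R) (C : R) : measurable_fun setT a -> (forall x, `|a x| <= C) -> L1 mu (fun x => a x * h x).
Proof.
move=> ma aC; apply: (L1_dom (g := fun x => C * h x)); [|exact: L1Z|].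
  by apply: measurable_funM => //; exact: L1_meas Lh.
by move=> x; rewrite normrM (ger0_norm (h0 x)) ler_wpM2r.
Qed.

Lemma avg_close (a : T -> R) (C z : R) (k : T -> R) (c : R) : measurable_fun setT a -> (forall x, `|a x| <= C) ->
  L1 mu k -> (forall x, `|a x - z| * h x <= k x) -> Int mu k <= c * Int mu h ->
  `|Int mu (fun x => a x * h x) / Int mu h - z| <= c.
Proof.
move=> ma aC Lk ak kc; have La := L1_bdd ma aC.
have -> : Int mu (fun x => a x * h x) / Int mu h - z = Int mu (fun x => a x * h x - z * h x) / Int mu h.
  by rewrite (IntB La (L1Z z Lh)) (IntZ z Lh); field; rewrite gt_eqF.
rewrite normrM normfV (gtr0_norm I0) ler_pdivrMr//; apply: le_trans kc.
apply: Int_abs_le => //; first exact: L1B La (L1Z z Lh).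
by move=> x; rewrite -mulrBl normrM (ger0_norm (h0 x)).
Qed.
End Average.

(** * Low energy states concentrate near the minimum set of the potential *)

Section Localization.
Variables (R : realType) (d : pdata R).
Notation RR := (measurableTypeR R).
Notation T3 := (RR * RR * RR)%type.
Notation m3 := (mu3 R).
Notation inH := (inH (ds d)).
Variables (V : pt R -> R) (Om : set (pt R)) (Rb : R).
Hypotheses (cV : continuous V) (VdV : forall x, dV d <= V x) (oOm : open Om).
Hypotheses (Rb0 : 0 < Rb) (OmR : forall x, Om x -> `|x| <= Rb).
Hypothesis bdV : forall x, closure Om x -> V x = dV d -> Om x.
Let Lm : set (pt R) := [set x | Om x /\ V x = dV d].

Lemma WV_m (eps : R) : measurable_fun setT ((fun x : pt R => V (pscale eps x)) : T3 -> R).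
Proof.
apply: (@m_continuous R) => x; apply: continuous_comp; [exact: pscale_cont|exact: cV].
Qed.
Definition WV (eps : R) : weight (dV d) := Weight (WV_m eps) (dV0 d) (fun x => VdV (pscale eps x)).
Definition OV (eps : R) : set T3 := [set x : T3 | Om (pscale eps x)].

Lemma m_OV eps : measurable (OV eps).
Proof.
apply: open_m3; have /continuousP := @pscale_cont R eps; apply; exact: oOm.
Qed.

(** The gap is needed on a neighbourhood of [z], which may leave [Om]: the first piece of a cut
    function is centred in the domain but may spread across its boundary. *)
Lemma Lm_far (eta : R) : 0 < eta -> exists2 g : R, 0 < g & forall z x, Om z ->
  (forall l, Lm l -> eta <= `|z - l|) -> `|x - z| <= g -> dV d + g <= V x.
Proof.
move=> eta0; pose K := closure Om `&` [set z | forall l, Lm l -> eta <= `|z - l|].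
have cbox : closed [set x : pt R | `|x| <= Rb] by apply: compact_closed; [exact: norm_hausdorff|exact: box_compact].
have KR : K `<=` [set x | `|x| <= Rb].
  by move=> z [cz _]; have := closure_subset OmR cz; rewrite -(iffLR (closure_id _) cbox).
have cK : compact K.
  apply: subclosed_compact KR; last exact: box_compact.
  apply: closedI; first exact: closed_closure.
  have -> : [set z | forall l, Lm l -> eta <= `|z - l|] = \bigcap_(l in Lm) [set z | eta <= `|z - l|].
    by apply/seteqP; split => z h l Ll; exact: h.
  apply: closed_bigI => l Ll.
  have -> : [set z | eta <= `|z - l|] = (fun z : pt R => `|z - l|) @^-1` [set t | eta <= t] by [].
  apply: preimage_closed; last exact: closed_ge.
  by move=> z _; apply: cvg_norm; apply: cvgB; [exact: cvg_id|exact: cvg_cst].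
have [|g g0 hg] := @compact_gap R V K (dV d) cV cK.
  move=> z [cz hz]; rewrite lt_neqAle VdV andbT; apply/eqP => Vz.
  have Lz : Lm z by split => //; apply: bdV.
  by have := hz z Lz; rewrite subrr normr0 leNgt eta0.
by exists g => // z x Oz hz xz; apply: hg xz; split => //; exact: subset_closure.
Qed.

(* Clamping makes the moments of [w ^ 2] finite. *)
Definition clampR (t : R) : R := Num.max (- Rb) (Num.min Rb t).

Lemma clampR_abs t : `|clampR t| <= Rb.
Proof.
rewrite /clampR ler_norml le_max lexx ge_max ge_min lexx /=.
by have h := Rb0; rewrite andbT; lra.
Qed.

Lemma clampR_lip t t' : `|t'| <= Rb -> `|clampR t - t'| <= `|t - t'|.
Proof.
rewrite ler_norml => /andP[h1 h2]; have a1 := ler_norm (t - t'); have a2 := ler_norm (t' - t); rewrite (distrC t' t) in a2.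
have h := Rb0.
rewrite /clampR; case: (leP Rb t) => h3; [case: (leP (- Rb) Rb)|case: (leP (- Rb) t)] => h4;
  by rewrite ler_norml; apply/andP; split; lra.
Qed.

Definition chi (i : pt R -> R) (eps : R) (x : T3) : R := clampR (eps * i x).
Definition bary1 (i : pt R -> R) (eps : R) (w : pt R -> R) : R :=
  Int m3 (fun x : T3 => chi i eps x * w x ^+ 2) / Int m3 (fun x : T3 => w x ^+ 2).
Definition bary (eps : R) (w : pt R -> R) : pt R :=
  (bary1 (fun x => x.1.1) eps w, bary1 (fun x => x.1.2) eps w, bary1 (fun x => x.2) eps w).

Lemma m_chi (i : pt R -> R) eps : measurable_fun setT (i : T3 -> R) -> measurable_fun setT (chi i eps).
Proof.
move=> mi; apply: measurable_maxr; first exact: measurable_cst.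
apply: measurable_minr; first exact: measurable_cst.
by apply: measurable_funM => //; exact: measurable_cst.
Qed.

Lemma bary_dist eps w (z : pt R) (c : R) :
  (forall i : pt R -> R, measurable_fun setT (i : T3 -> R) -> (forall x y, i (x - y) = i x - i y) -> (forall x, `|i x| <= `|x|) ->
     (forall x, i (pscale eps x) = eps * i x) -> `|bary1 i eps w - i z| <= c) -> `|bary eps w - z| <= c.
Proof.
move=> h; rewrite norm_pt_le; apply/and3P; split.
- by apply: (h (fun x => x.1.1)) => //; [exact: m_c1|move=> x; have [] := norm_pt_c x].
- by apply: (h (fun x => x.1.2)) => //; [exact: m_c2|move=> x; have [] := norm_pt_c x].
- by apply: (h (fun x => x.2)) => //; [exact: m_c3|move=> x; have [] := norm_pt_c x].
Qed.

Lemma L2_pos (W : weight (dV d)) O w : measurable O -> isN W O w -> 0 < Int m3 (fun x : T3 => w x ^+ 2).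
Proof.
move=> mO [Hw N0 _]; rewrite lt_neqAle Int_ge0 ?andbT; last by move=> x; exact: sqr_ge0.
apply/eqP => /esym I0; have := Int_eq0 (inH_2 Hw) (fun x => sqr_ge0 _) I0 => E.
have E0 : {ae m3, forall x, w x = 0} by apply: aeS E => x /eqP; rewrite sqrf_eq0 => /eqP.
by move: N0; rewrite (NN_ae0 Hw E0) ltxx.
Qed.

(** In the variable [pscale eps x] the first piece lies within [2 eps Rm] of the centre
    [pscale eps y]. If the centre were far from [Lm], the potential would exceed [V_0 + g] on the
    piece, and projecting to the limit Nehari set would give a level below [c0 d]. The remainder has
    too little mass to move the clamped barycenter away from the centre. *)
Lemma localize (eta : R) : 0 < eta -> exists h epsb : R, [/\ 0 < h, h <= 1, 0 < epsb &
  forall eps w, 0 < eps -> eps < epsb -> isN (WV eps) (OV eps) w -> JJ (WV eps) (OV eps) w <= c0 d + h ->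
  exists2 l, Lm l & `|bary eps w - l| <= eta].
Proof.
move=> eta0; have e2 : 0 < eta / 2 by rewrite divr_gt0.
have e4 : 0 < eta / 4 by rewrite divr_gt0.
have V0 := dV0 d; have m0 := dm_gt0 d; have [rs0 _] := @rsmP R d.
have [g g0 hfar] := Lm_far e2.
have [kap [Lam [kap0 Lam0 hcut]]] := cut_lemma d.
(* The gain in level caused by the excess [g] of the potential on a piece of mass at least [kap];
   [rsm^2 / Lam] bounds below the square of the time that puts this piece on the limit Nehari
   set. *)
pose G := dm d / 2 * (g * (rsm d ^+ 2 / Lam) * kap).
have G0 : 0 < G by apply: mulr_gt0; [exact: divr_gt0|apply: mulr_gt0 => //; apply: mulr_gt0 => //; apply: divr_gt0 => //; exact: exprn_gt0].
(* The first bound is beaten by the gain [G]. With the second, the mass of the remainder, displaced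
   by at most [2 * Rb], moves the barycenter by at most [eta / 4]. *)
pose rho := Num.min (G / 2) (eta / 4 * (dV d * kap) / (2 * Rb)).
have rho0 : 0 < rho.
  by rewrite lt_min; apply/andP; split; apply: divr_gt0 => //; apply: mulr_gt0 => //; exact: mulr_gt0.
have [rho1 rho2] : rho <= G / 2 /\ rho <= eta / 4 * (dV d * kap) / (2 * Rb) by rewrite /rho !ge_min !lexx ?orbT.
rewrite ler_pdivlMr ?mulr_gt0// in rho2.
have [h [Rm [h0 h1 Rm1 hh]]] := hcut rho rho0.
have Rm0 : 0 < Rm by exact: lt_le_trans Rm1.
pose epsb := Num.min (eta / 4) g / (2 * Rm).
have epsb0 : 0 < epsb by rewrite divr_gt0 ?mulr_gt0// lt_min e4.
exists h, epsb; split => // eps w eps0 epsb1 Nw Jw.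
have mO := m_OV eps.
have er : eps * (2 * Rm) <= Num.min (eta / 4) g by rewrite -ler_pdivlMr ?mulr_gt0// ltW.
move: er; rewrite le_min => /andP[er1 er2].
have [y [r [t [Oy /andP[r1 rR] [H1 H2] [k1 N1] [N2 [t0 t2 Nt Jt]]]]]] := hh (WV eps) (OV eps) w mO Nw Jw.
set u1 := (fun x => xic y r x * w x) in H1 k1 N1 Nt Jt; set u2 := (fun x => etac y r x * w x) in H2 N2.
have r0 : 0 < r by exact: lt_le_trans r1.
have Hw : inH (WV eps) w by case: Nw.
have xr (x : pt R) : `|x - y| <= 2 * r -> `|pscale eps x - pscale eps y| <= eps * (2 * Rm).
  move=> h2; rewrite pscaleB norm_pscale (gtr0_norm eps0) ler_pM2l//; move: h2 rR; clear -cV VdV oOm Rb0 OmR bdV; lra.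
have [l Ll yl] : exists2 l, Lm l & `|pscale eps y - l| < eta / 2.
  apply: contrapT => hn.
  have far l : Lm l -> eta / 2 <= `|pscale eps y - l|.
    by move=> Ll; rewrite leNgt; apply/negP => h2; apply: hn; exists l.
  have Nc : NN (Wc d) (fun x => t * u1 x) + t ^+ 2 * (g * Int m3 (fun x : T3 => u1 x ^+ 2)) <= NN (WV eps) (fun x => t * u1 x).
    rewrite (NNZ t H1) (NNZ t (inH_Wc H1)) -mulrDr ler_wpM2l ?sqr_ge0//.
    rewrite /NN !hformE -addrA lerD2l -(IntZ g (inH_2 H1)) -(IntD (inH_W (inH_Wc H1)) (L1Z g (inH_2 H1))).
    apply: Int_le; [exact: L1D (inH_W (inH_Wc H1)) (L1Z g (inH_2 H1))|exact: inH_W H1|].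
    move=> x; rewrite -mulrDl; have [h2|h2] := leP (2 * r) `|(x : pt R) - y|.
      by have [E _] := xic_out r0 h2; rewrite /u1 E mul0r expr0n !mulr0.
    rewrite ler_wpM2r ?sqr_ge0//; apply: hfar Oy far _.
    by apply: le_trans er2; apply: xr; exact: ltW.
  have Ht := inHZ t H1.
  have [tau /andP[tau0 tau1] Ntau] := isN_Wc mO Nt.
  have E0 (a : R) : (fun x => a * (t * u1 x)) = (fun x => (a * t) * u1 x) by apply/funext => x; rewrite mulrA.
  have I0 : 0 <= Int m3 (fun x : T3 => u1 x ^+ 2) by apply: Int_ge0 => x; exact: sqr_ge0.
  have gt0 : 0 <= tau ^+ 2 * (t ^+ 2 * (g * Int m3 (fun x : T3 => u1 x ^+ 2))).
    by apply: mulr_ge0 (sqr_ge0 _) (mulr_ge0 (sqr_ge0 _) (mulr_ge0 (ltW g0) I0)).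
  have := @JJ_Wc R d (WV eps) (OV eps) (fun x => tau * (t * u1 x)) _ mO (inHZ tau Ht) gt0.
  rewrite (NNZ tau Ht) (NNZ tau (inH_Wc Ht)) -mulrDr => /(_ (ler_wpM2l (sqr_ge0 tau) Nc)).
  have := c0_lb Ntau; have := isN_ray mO Nt tau0.
  have hs : rsm d ^+ 2 / Lam <= (tau * t) ^+ 2.
    rewrite ler_pdivrMr//; have := isN_small measurableT Ntau; rewrite E0 (NNZ _ (inH_Wc H1)) => /le_trans; apply.
    by rewrite ler_wpM2l ?sqr_ge0//; apply: le_trans (NN_Wc H1) N1.
  have hG : 2 * rho <= dm d / 2 * (tau ^+ 2 * (t ^+ 2 * (g * Int m3 (fun x : T3 => u1 x ^+ 2)))).
    apply: (@le_trans _ _ G); first by move: rho1; clear -cV VdV oOm Rb0 OmR bdV; lra.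
    rewrite /G ler_pM2l ?divr_gt0//.
    have -> : tau ^+ 2 * (t ^+ 2 * (g * Int m3 (fun x : T3 => u1 x ^+ 2))) = g * (tau * t) ^+ 2 * Int m3 (fun x : T3 => u1 x ^+ 2).
      by move: (Int _ _) => I; rewrite exprMn; ring.
    apply: ler_pM => //; [by apply: mulr_ge0; [exact: ltW|apply: divr_ge0; [exact: sqr_ge0|exact: ltW]]|exact: ltW|].
    by rewrite ler_pM2l.
  move: hG Jt rho0; move: (JJ _ _ _) (JJ _ _ _) (JJ _ _ _) (dm d / 2 * _) => A1 A2 A3 A4; clear -cV VdV oOm Rb0 OmR bdV; lra.
exists l => //.
have -> : bary eps w - l = (bary eps w - pscale eps y) + (pscale eps y - l) by rewrite addrA subrK.
apply: le_trans (ler_normD _ _) _; rewrite [leRHS](splitr eta); apply: lerD; last exact: ltW.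
have I0 := L2_pos mO Nw.
have yR : `|pscale eps y| <= Rb by exact: OmR.
apply: bary_dist => i mi iB iN iS.
have Lk : L1 m3 (fun x : T3 => eta / 4 * w x ^+ 2 + 2 * Rb * u2 x ^+ 2) := L1D (L1Z _ (inH_2 Hw)) (L1Z _ (inH_2 H2)).
have izR : `|i (pscale eps y)| <= Rb := le_trans (iN _) yR.
apply: (avg_close (inH_2 Hw) (fun x => sqr_ge0 _) I0 (m_chi eps mi) (fun x => clampR_abs _) Lk).
  move=> x; have [h2|h2] := leP (2 * r) `|(x : pt R) - y|.
    have [_ E] := xic_out r0 h2; rewrite /u2 E mul1r.
    apply: (@le_trans _ _ (2 * Rb * w x ^+ 2)); last by rewrite lerDr mulr_ge0 ?sqr_ge0// ltW.
    rewrite ler_wpM2r ?sqr_ge0//; apply: le_trans (ler_normB _ _) _.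
    by have := clampR_abs (eps * i x); rewrite /chi; move: izR; clear -cV VdV oOm Rb0 OmR bdV; lra.
  apply: (@le_trans _ _ (eta / 4 * w x ^+ 2)); last by rewrite lerDl mulr_ge0 ?sqr_ge0// mulr_ge0// ltW.
  rewrite ler_wpM2r ?sqr_ge0//; apply: le_trans er1; apply: le_trans (xr x (ltW h2)).
  apply: le_trans (clampR_lip _ izR) _; rewrite -iS -iB; exact: iN.
rewrite (IntD (L1Z _ (inH_2 Hw)) (L1Z _ (inH_2 H2))) (IntZ _ (inH_2 Hw)) (IntZ _ (inH_2 H2)).
have k2 : kap <= Int m3 (fun x : T3 => w x ^+ 2).
  apply: le_trans k1 _; apply: Int_le; [exact: inH_2 H1|exact: inH_2 Hw|].
  move=> x; rewrite /u1 exprMn ler_piMl ?sqr_ge0//.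
  by have /andP[x0 x1] := xic_le y r x; rewrite expr_le1.
have k3 : dV d * Int m3 (fun x : T3 => u2 x ^+ 2) <= rho := le_trans (L2_le_form H2) N2.
have k4 : dV d * (2 * Rb * Int m3 (fun x : T3 => u2 x ^+ 2)) <= dV d * (eta / 4 * kap).
  have := ler_wpM2r (ltW (mulr_gt0 (ltr0n R 2 : (0 : R) < 2) Rb0)) k3; move: rho2.
  move: (Int _ _) => I; clear -cV VdV oOm Rb0 OmR bdV; lra.
rewrite ler_pM2l// in k4; have k5 := ler_wpM2l (ltW e4) k2.
have E (I : R) : eta / 2 * I = eta / 4 * I + eta / 4 * I by field.
by rewrite E lerD2l; exact: le_trans k4 k5.
Qed.
End Localization.

Lemma Int_young dd (T : measurableType dd) (R : realType) (mu : {measure set T -> \bar R}) (f k : T -> R) (nu : R) :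
  measurable_fun setT f -> measurable_fun setT k -> L1 mu (fun x => f x ^+ 2) -> L1 mu (fun x => k x ^+ 2) -> 0 < nu ->
  `|Int mu (fun x => f x * k x)| <= nu^-1 / 2 * Int mu (fun x => f x ^+ 2) + nu / 2 * Int mu (fun x => k x ^+ 2).
Proof.
move=> mf mk Lf Lk nu0; have Lb := L1D (L1Z (nu^-1 / 2) Lf) (L1Z (nu / 2) Lk).
rewrite -(IntZ _ Lf) -(IntZ _ Lk) -(IntD (L1Z (nu^-1 / 2) Lf) (L1Z (nu / 2) Lk)).
apply: Int_abs_le => //; first exact: L1_mul.
move=> x; rewrite -ler_sqr ?nnegrE ?normr_ge0//.
  rewrite real_normK ?num_real// -subr_ge0.
  have -> : (nu^-1 / 2 * f x ^+ 2 + nu / 2 * k x ^+ 2) ^+ 2 - (f x * k x) ^+ 2 =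
    (nu^-1 / 2 * f x ^+ 2 - nu / 2 * k x ^+ 2) ^+ 2 by field; rewrite gt_eqF.
  exact: sqr_ge0.
by apply: addr_ge0; rewrite mulr_ge0 ?sqr_ge0// divr_ge0// ?invr_ge0 ltW.
Qed.

Section Riesz2.
Variables (R : realType) (s V0 : R) (W : weight V0).
Notation RR := (measurableTypeR R).
Notation T3 := (RR * RR * RR)%type.
Notation m3 := (mu3 R).
Notation B := (@Hform R s V0 W).

(** Makes integration against an [L^2] function a test vector for weak convergence, so that weak
    limits can be compared with [L^2] limits and with averages over cubes. *)
Lemma riesz_L2 (k : T3 -> R) : measurable_fun setT k -> L1 m3 (fun x => k x ^+ 2) ->
  exists g : Hsp s W, forall v : Hsp s W, Int m3 (fun x : T3 => val v x * k x) = B g v.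
Proof.
move=> mk Lk; have BP := Hform_psd s W; have V00 := wt_V0 W.
have Lv (v : Hsp s W) : L1 m3 (fun x : T3 => val v x * k x).
  by apply: L1_mul => //; [exact: inH_m (HspP v)|exact: inH_2 (HspP v)].
pose I := Int m3 (fun x => k x ^+ 2); pose C := (V0^-1 + I) / 2.
have I0 : 0 <= I by apply: Int_ge0 => x; exact: sqr_ge0.
have iV : 0 < V0^-1 by rewrite invr_gt0.
have C0 : 0 < C by rewrite divr_gt0// ltr_wpDr.
apply: (riesz BP (@Hform_complete R s V0 W) (C := C)).
- move=> u v; rewrite -(IntD (Lv u) (Lv v)); apply: eq_Int => x.
  by have -> : val (u + v) x = val u x + val v x; [rewrite raddfD|rewrite mulrDl].
- move=> a u; rewrite -(IntZ a (Lv u)); apply: eq_Int => x.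
  by have -> : val (a *: u) x = a * val u x; [rewrite linearZ|rewrite mulrA].
move=> v; apply/ler_addgt0Pl => e e0; pose nu := nm B v + e / C.
have nu0 : 0 < nu by rewrite ltr_wpDl ?nm_ge0// divr_gt0.
have -> : e + C * nm B v = C * nu by rewrite /nu mulrDr [C * (e / C)]mulrC divfK ?gt_eqF// addrC.
apply: le_trans (Int_young (inH_m (HspP v)) mk (inH_2 (HspP v)) Lk nu0) _; rewrite -/I.
have h : Int m3 (fun x : T3 => val v x ^+ 2) <= nu ^+ 2 / V0.
  rewrite ler_pdivlMr// mulrC; apply: le_trans (L2_le_form (HspP v)) _.
  have -> : hform s W (val v) (val v) = nm B v ^+ 2 by rewrite sqr_sqrtr// hform_ge0.
  by rewrite ler_sqr ?nnegrE ?nm_ge0 ?(ltW nu0)// lerDl ltW// divr_gt0.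
have n2 : 0 <= nu^-1 / 2 by rewrite divr_ge0// invr_ge0 ltW.
have := ler_wpM2l n2 h.
have -> : nu^-1 / 2 * (nu ^+ 2 / V0) = nu / 2 * V0^-1 by field; rewrite !gt_eqF.
by rewrite /C; move: (nu^-1 / 2 * _) => X; clear; lra.
Qed.
End Riesz2.

(** * Translations and their continuity *)

Section Translate.
Variables (R : realType) (d : pdata R).
Notation RR := (measurableTypeR R).
Notation T3 := (RR * RR * RR)%type.
Notation m3 := (mu3 R).
Notation m6 := (mu3 R \x mu3 R)%E.
Notation s := (ds d).
Notation inH := (inH (ds d)).
Notation BW := (@Hform R (ds d) (dV d) (Wc d)).
Implicit Types (W : weight (dV d)) (O : set T3) (u v w : pt R -> R).

Definition tr (a : pt R) u (x : pt R) : R := u (x - a).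

Lemma tr_Int (a : pt R) (f : pt R -> R) : L1 m3 (f : T3 -> R) ->
  L1 m3 (fun x : T3 => f ((x : pt R) - a)) /\ Int m3 (fun x : T3 => f ((x : pt R) - a)) = Int m3 (f : T3 -> R).
Proof. by move=> Lf; have := preserves_L1 (preserves_shift (- a)) Lf. Qed.

Lemma gq_tr a u (z : T3 * T3) : gq s (tr a u) (tr a u) z = gq s u u ((z.1 : pt R) + (- a), (z.2 : pt R) + (- a)).
Proof.
rewrite /gq /tr /= /gag_kernel !psubE; congr (_ / (enorm _ `^ _)).
by rewrite opprD addrACA subrr addr0.
Qed.

Lemma tr_gq a u : L1 m6 (gq s u u) -> L1 m6 (gq s (tr a u) (tr a u)) /\ Int m6 (gq s (tr a u) (tr a u)) = Int m6 (gq s u u).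
Proof.
move=> Lg; have [L E] := preserves_L1 (preserves_shift6 (- a)) Lg.
split; first by apply: eq_L1 L => z; rewrite gq_tr.
by rewrite -E; apply: eq_Int => z; rewrite gq_tr.
Qed.

Lemma m_tr a u : measurable_fun setT (u : T3 -> R) -> measurable_fun setT (tr a u : T3 -> R).
Proof. by move=> mu; apply: (measurableT_comp mu); exact: (preserves_shift (- a)).1. Qed.

Lemma tr_Wc a u : inH (Wc d) u -> inH (Wc d) (tr a u) /\ NN (Wc d) (tr a u) = NN (Wc d) u.
Proof.
move=> Hu; have [L2 I2] := tr_Int a (inH_2 Hu); have [Lg Ig] := tr_gq a (inH_g Hu).
split; first by split; [exact: m_tr (inH_m Hu)|exact: L2|exact: Lg|exact: (L1Z (dV d) L2)].
by rewrite /NN !hformE Ig (IntZ _ (inH_2 Hu)) -I2 -(IntZ _ L2).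
Qed.

Variables (u : pt R -> R) (S : R).
Hypotheses (Hu : inH (Wc d) u) (uS : forall x : pt R, S <= `|x| -> u x = 0).

Let trS a x : S <= `|x - a| -> tr a u x = 0. Proof. exact: uS. Qed.

Lemma tr_W W a (C : R) : (forall x, `|x - a| <= S -> W x <= C) ->
  inH W (tr a u) /\ Int m3 (fun x : T3 => W x * tr a u x ^+ 2) <= C * Int m3 (fun x : T3 => u x ^+ 2).
Proof.
move=> WC; have [L2 I2] := tr_Int a (inH_2 Hu).
have mt := m_tr a (inH_m Hu).
have le (x : T3) : W x * tr a u x ^+ 2 <= C * tr a u x ^+ 2.
  have [h|h] := leP S `|(x : pt R) - a|; first by rewrite trS// expr0n !mulr0.
  by rewrite ler_wpM2r ?sqr_ge0// WC// ltW.
have L3 : L1 m3 (fun x : T3 => W x * tr a u x ^+ 2).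
  apply: (L1_dom (g := fun x : T3 => C * tr a u x ^+ 2)); [|exact: (L1Z C L2)|].
    by apply: measurable_funM; [exact: wt_m|apply: measurable_funX].
  by move=> x; rewrite ger0_norm// mulr_ge0 ?sqr_ge0// wt_ge0.
split; first by split; [exact: mt|exact: L2|exact: (tr_gq a (inH_g Hu)).1|exact: L3].
by rewrite -I2 -(IntZ C L2); apply: Int_le => //; exact: (L1Z C L2).
Qed.

Lemma tr_NN W a (g : R) : (forall x, `|x - a| <= S -> W x <= dV d + g) ->
  NN W (tr a u) <= NN (Wc d) u + g * Int m3 (fun x : T3 => u x ^+ 2).
Proof.
move=> Wg; have [Ht It] := tr_W Wg; rewrite /NN !hformE (tr_gq a (inH_g Hu)).2 -addrA lerD2l.
by rewrite (IntZ _ (inH_2 Hu)) -mulrDl.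
Qed.

Lemma free_ultra : exists2 U : set_system nat, UltraFilter U & \oo `<=` U.
Proof. by have [U [? ?]] := ultraFilterLemma (@eventually_filter); exists U. Qed.

(* Translates of [u] converge to [u] weakly because they converge in [L^2];
   as they all have the norm of [u], they converge strongly. *)
Lemma tr_cont0 (e : R) : 0 < e -> exists2 eta : R, 0 < eta & forall a : pt R, `|a| <= eta ->
  NN (Wc d) (fun x => tr a u x - u x) <= e.
Proof.
move=> e0; apply: contrapT => hn.
have hs0 := ds0 d; have hs1 := ds1 d; have V0 := dV0 d.
have /choice[a ha] n : exists a : pt R, `|a| <= n.+1%:R^-1 /\ e < NN (Wc d) (fun x => tr a u x - u x).
  apply: contrapT => h; apply: hn; exists n.+1%:R^-1; first by rewrite invr_gt0.
  by move=> a an; rewrite leNgt; apply/negP => h2; apply: h; exists a.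
have [U UU Uoo] := free_ultra.
pose BP := Hform_psd s (Wc d).
pose v n : Hsp s (Wc d) := toH (tr_Wc (a n) Hu).1.
have nv n : nm BW (v n) = Num.sqrt (NN (Wc d) u) by rewrite -(tr_Wc (a n) Hu).2.
have [l hl] := @weak_lim R _ BW BP (@Hform_complete R s (dV d) (Wc d)) U UU v (Num.sqrt (NN (Wc d) u)) (fun n => ltac:(by rewrite nv)).
pose U0 := toH Hu : Hsp s (Wc d).
have L2 n : Int m3 (fun x : T3 => (val (v n) x - u x) ^+ 2) <= 128 * (3 * n.+1%:R^-1) `^ (2 * s) * Int m6 (gq s u u).
  have [an _] := ha n.
  have r0 : 0 < 3 * n.+1%:R^-1 :> R by rewrite mulr_gt0.
  have ra : 3 * `|- a n| <= 3 * n.+1%:R^-1 by rewrite normrN ler_pM2l.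
  by have [_ h] := shift_L2 hs0 (ltW hs1) r0 ra Hu.
have lU : nm BW (l - U0) = 0.
  have Lz n : L1 m3 (fun x : T3 => (val (v n) x - u x) ^+ 2).
    exact: inH_2 (inHB (tr_Wc (a n) Hu).1 Hu).
  have Hz := inHB (HspP l) Hu.
  have [g hg] := riesz_L2 s (Wc d) (inH_m Hz) (inH_2 Hz).
  have E0 : Int m3 (fun x : T3 => (val l x - u x) ^+ 2) = 0.
    have E1 : BW (v n - U0) g @[n --> U] --> BW (l - U0) g.
      have -> : (fun n => BW (v n - U0) g) = (fun n => BW (v n) g - BW U0 g) by apply/funext => n; rewrite (psdB BP).
      by rewrite (psdB BP); apply: cvgB; [exact: hl|exact: cvg_cst].
    have E2 : BW (v n - U0) g @[n --> U] --> (0 : R).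
      apply/cvgrPdist_le => e1 e10.
      pose I := Int m3 (fun x : T3 => (val l x - u x) ^+ 2).
      have I0 : 0 <= I by apply: Int_ge0 => x; exact: sqr_ge0.
      pose th := e1 / (I + 1); have I1 : 0 < I + 1 by rewrite ltr_wpDl.
      have th0 : 0 < th by rewrite divr_gt0.
      pose G := Int m6 (gq s u u); have G0 : 0 <= G by apply: Int_ge0 => z; exact: gq_ge0.
      have q0 : 0 < Num.min (1 / 3) (th * e1 / (384 * (G + 1))).
        have G1 : 0 < G + 1 by rewrite ltr_wpDl.
        rewrite lt_min; apply/andP; split; first exact: divr_gt0.
        by apply: divr_gt0; [exact: mulr_gt0|apply: mulr_gt0 G1; rewrite ltr0n].
      have [N hN] := small_inv q0; apply: Uoo; exists N => // n /= /hN; rewrite le_min => /andP[n1 n2].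
      rewrite sub0r normrN (psdC BP) -hg valB.
      have Hn := inHB (tr_Wc (a n) Hu).1 Hu.
      apply: le_trans (Int_young (inH_m Hn) (inH_m Hz) (inH_2 Hn) (inH_2 Hz) th0) _; rewrite -/I.
      have r0 : 0 < n.+1%:R^-1 :> R by rewrite invr_gt0.
      have p1 : (3 * n.+1%:R^-1) `^ (2 * s) <= 3 * n.+1%:R^-1.
        have x0 : 0 < 3 * n.+1%:R^-1 :> R by apply: mulr_gt0 r0.
        have x1 : 0 < (3 * n.+1%:R^-1 : R) <= 1.
          by rewrite x0 /=; move: n1; move: (n.+1%:R^-1) => X; clear -Hu uS; lra.
        by have := ger_powR x1 (ds2 d); rewrite (powRr1 (ltW x0)).
      have h1 : Int m3 (fun x : T3 => (val (v n) x - u x) ^+ 2) <= th * e1.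
        apply: le_trans (L2 n) _; rewrite -/G.
        apply: (@le_trans _ _ (128 * (3 * n.+1%:R^-1) * (G + 1))).
          apply: ler_pM; [by rewrite mulr_ge0 ?ler0n// powR_ge0|exact: G0|by rewrite ler_pM2l ?ltr0n|by rewrite lerDl].
        have G1 : 0 < 384 * (G + 1) by rewrite mulr_gt0 ?ltr0n// ltr_wpDl.
        rewrite (ler_pdivlMr _ _ G1) in n2; move: n2; move: (n.+1%:R^-1) => X; clear -Hu uS; lra.
      have h2 : th^-1 / 2 * Int m3 (fun x : T3 => (val (v n) x - u x) ^+ 2) <= e1 / 2.
        have -> : e1 / 2 = th^-1 / 2 * (th * e1) by field; rewrite gt_eqF.
        by rewrite ler_wpM2l// divr_ge0// invr_ge0 ltW.
      have h3 : th / 2 * I <= e1 / 2.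
        have -> : e1 / 2 = th / 2 * (I + 1) by rewrite /th; field; rewrite gt_eqF.
        by apply: ler_wpM2l; [rewrite divr_ge0// ltW|rewrite lerDl].
      by move: h2 h3; move: (th^-1 / 2 * _) (th / 2 * _) => X Y; clear -Hu uS; lra.
    have E12 : BW (l - U0) g = 0 by exact: (cvg_unique _ E1 E2).
    rewrite -E12 (psdC BP) -hg.
    by apply: eq_Int => x; rewrite valB expr2.
  have ae0 := Int_eq0 (inH_2 Hz) (fun x => sqr_ge0 _) E0.
  rewrite nm_NN valB (NN_ae0 Hz) ?sqrtr0//.
  by apply: aeS ae0 => x /eqP; rewrite sqrf_eq0 => /eqP.
have E3 : BW (v n) U0 @[n --> U] --> BW U0 U0.
  have -> : BW U0 U0 = BW l U0.
    by apply/eqP; rewrite eq_sym -subr_eq0 -(psdB BP); apply/eqP; exact: nm_eq0.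
  exact: hl.
have e2 : 0 < e / 2 by rewrite divr_gt0.
have /cvgrPdist_le /(_ _ e2) hU := E3.
have [n hn2] := filter_ex hU.
have [_] := ha n; apply/negP; rewrite -leNgt.
have -> : NN (Wc d) (fun x => tr (a n) u x - u x) = BW (v n - U0) (v n - U0) by [].
rewrite (psdB BP) !(psdBr BP) (psdC BP U0 (v n)).
have -> : BW (v n) (v n) = BW U0 U0 by exact: (tr_Wc (a n) Hu).2.
move: hn2 => /(le_trans (ler_norm _)); move: (BW _ _) (BW _ _) => X Y; clear -Hu uS; lra.
Qed.
End Translate.

Section BaryCont.
Variables (R : realType) (d : pdata R).
Notation RR := (measurableTypeR R).
Notation T3 := (RR * RR * RR)%type.
Notation m3 := (mu3 R).
Notation inH := (inH (ds d)).
Variables (Rb : R) (W : weight (dV d)).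
Hypothesis Rb0 : 0 < Rb.

Lemma sq_diff (a b th : R) : 0 < th -> `|a ^+ 2 - b ^+ 2| <= th * b ^+ 2 + (1 + th^-1) * (a - b) ^+ 2.
Proof.
move=> th0; have -> : a ^+ 2 - b ^+ 2 = (a - b) ^+ 2 + 2 * (b * (a - b)) by ring.
have h : 2 * (`|b| * `|a - b|) <= th * b ^+ 2 + th^-1 * (a - b) ^+ 2.
  rewrite -(real_normK (num_real b)) -(real_normK (num_real (a - b))) -subr_ge0.
  move: `|b| `|a - b| => x y.
  have -> : th * x ^+ 2 + th^-1 * y ^+ 2 - 2 * (x * y) = th * (x - th^-1 * y) ^+ 2 by field; rewrite gt_eqF.
  by rewrite mulr_ge0 ?sqr_ge0// ltW.
apply: le_trans (ler_normD _ _) _; rewrite (ger0_norm (sqr_ge0 _)) normrM (ger0_norm (ler0n R 2)) normrM.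
move: h; move: ((a - b) ^+ 2) (2 * (_ * _)) => X Y h; rewrite mulrDl mul1r; lra.
Qed.

Lemma bary_cont eps (w : pt R -> R) (e : R) : inH W w -> 0 < Int m3 (fun x : T3 => w x ^+ 2) -> 0 < e ->
  exists2 eta : R, 0 < eta & forall w', inH W w' -> NN W (fun x => w' x - w x) <= eta ->
    `|bary Rb eps w' - bary Rb eps w| <= e.
Proof.
move=> Hw I0 e0; set I := Int _ _ in I0; have V0 := dV0 d.
pose k := Num.min (1 / 2) (e / (4 * Rb)).
have k0 : 0 < k by rewrite lt_min !divr_gt0// mulr_gt0.
have [k1 k2] : k <= 1 / 2 /\ k <= e / (4 * Rb) by rewrite /k !ge_min !lexx orbT.
rewrite ler_pdivlMr ?mulr_gt0// in k2.
pose th := k / 2; have th0 : 0 < th by exact: divr_gt0.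
pose C := 1 + th^-1; have C0 : 0 < C by rewrite addr_gt0// invr_gt0.
exists (dV d * (k * I / 2) / C) => [|w' Hw' Nw].
  by rewrite divr_gt0// mulr_gt0// divr_gt0// mulr_gt0.
have Hd := inHB Hw' Hw.
have Lq := L1D (L1Z th (inH_2 Hw)) (L1Z C (inH_2 Hd)).
pose q (x : T3) := th * w x ^+ 2 + C * (w' x - w x) ^+ 2.
have q0 x : 0 <= q x by apply: addr_ge0; rewrite mulr_ge0 ?sqr_ge0// ltW.
have Iq : Int m3 q <= k * I.
  rewrite /q (IntD (L1Z th (inH_2 Hw)) (L1Z C (inH_2 Hd))) (IntZ _ (inH_2 Hw)) (IntZ _ (inH_2 Hd)) -/I.
  have h1 := le_trans (L2_le_form Hd) Nw.
  have h2 : C * Int m3 (fun x : T3 => (w' x - w x) ^+ 2) <= k * I / 2.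
    rewrite -(ler_pM2l V0) mulrCA -ler_pdivlMl//; move: h1; rewrite [C^-1 * _]mulrC; exact.
  move: h2; rewrite /th; move: (C * _) => X; clear -Rb0; lra.
pose I' := Int m3 (fun x : T3 => w' x ^+ 2).
have qd x : `|w' x ^+ 2 - w x ^+ 2| <= q x by exact: sq_diff.
have I'I : I / 2 <= I'.
  have : I <= I' + k * I.
    apply: (@le_trans _ _ (I' + Int m3 q)); last by rewrite lerD2l.
    rewrite -(IntD (inH_2 Hw') Lq); apply: Int_le; [exact: inH_2 Hw|exact: L1D (inH_2 Hw') Lq|].
    by move=> x; have := qd x; rewrite ler_norml -/(q x) => /andP[]; move: (q x) => Q; clear -Rb0; lra.
  move: (ler_wpM2r (ltW I0) k1); clear -Rb0; lra.
have I'0 : 0 < I' by apply: lt_le_trans I'I; exact: divr_gt0.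
suff main (i : pt R -> R) : measurable_fun setT (i : T3 -> R) -> `|bary1 Rb i eps w' - bary1 Rb i eps w| <= e.
  by rewrite norm_pt_le; apply/and3P; split; apply: main; [exact: m_c1|exact: m_c2|exact: m_c3].
move=> mi; set z := bary1 Rb i eps w.
have ma := @m_chi R Rb i eps mi; have aC (x : T3) : `|chi Rb i eps x| <= Rb by exact: clampR_abs.
have La := L1_bdd (inH_2 Hw) (fun x => sqr_ge0 _) ma aC.
have La' := L1_bdd (inH_2 Hw') (fun x => sqr_ge0 _) ma aC.
have zI : z * I = Int m3 (fun x : T3 => chi Rb i eps x * w x ^+ 2) by rewrite /z /bary1 -/I divfK// gt_eqF.
have zR : `|z| <= Rb.
  rewrite -(ler_pM2r I0) -{1}(gtr0_norm I0) -normrM zI -(IntZ Rb (inH_2 Hw)).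
  apply: Int_abs_le => //; first exact: (L1Z Rb (inH_2 Hw)).
  by move=> x; rewrite normrM (ger0_norm (sqr_ge0 _)) ler_wpM2r// sqr_ge0.
have -> : bary1 Rb i eps w' - z = (Int m3 (fun x : T3 => chi Rb i eps x * w' x ^+ 2) - z * I') / I'.
  by rewrite /bary1 -/I' mulrBl mulfK// gt_eqF.
rewrite normrM normfV (gtr0_norm I'0) ler_pdivrMr//.
have -> : Int m3 (fun x : T3 => chi Rb i eps x * w' x ^+ 2) - z * I' =
  Int m3 (fun x : T3 => (chi Rb i eps x * w' x ^+ 2 - z * w' x ^+ 2) - (chi Rb i eps x * w x ^+ 2 - z * w x ^+ 2)).
  rewrite (IntB (L1B La' (L1Z z (inH_2 Hw'))) (L1B La (L1Z z (inH_2 Hw)))) (IntB La' (L1Z z (inH_2 Hw'))) (IntB La (L1Z z (inH_2 Hw))).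
  by rewrite (IntZ _ (inH_2 Hw')) (IntZ _ (inH_2 Hw)) -/I -zI subrr subr0.
apply: (@le_trans _ _ (Int m3 (fun x : T3 => 2 * Rb * q x))).
  apply: Int_abs_le; [exact: L1B (L1B La' (L1Z z (inH_2 Hw'))) (L1B La (L1Z z (inH_2 Hw)))|exact: (L1Z (2 * Rb) Lq)|].
  move=> x; have -> : chi Rb i eps x * w' x ^+ 2 - z * w' x ^+ 2 - (chi Rb i eps x * w x ^+ 2 - z * w x ^+ 2) =
    (chi Rb i eps x - z) * (w' x ^+ 2 - w x ^+ 2) by ring.
  rewrite normrM; apply: ler_pM => //.
  by apply: le_trans (ler_normB _ _) _; have := aC x; move: zR; clear -Rb0; lra.
rewrite (IntZ _ Lq); apply: (@le_trans _ _ (e * (I / 2))); last by rewrite ler_pM2l.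
have := ler_wpM2r (ltW I0) k2; have := ler_wpM2l (ltW (mulr_gt0 (ltr0n R 2 : (0 : R) < 2) Rb0)) Iq.
move: (Int m3 q) => Q; clear -Rb0; lra.
Qed.
End BaryCont.

(** * From the minimum set of the potential to a low sublevel *)

Section PhiMap.
Variables (R : realType) (d : pdata R).
Notation RR := (measurableTypeR R).
Notation T3 := (RR * RR * RR)%type.
Notation m3 := (mu3 R).
Notation inH := (inH (ds d)).
Variables (V : pt R -> R) (Om : set (pt R)) (Rb delta0 : R).
Hypotheses (cV : continuous V) (VdV : forall x, dV d <= V x) (oOm : open Om).
Hypotheses (Rb0 : 0 < Rb) (OmR : forall x, Om x -> `|x| <= Rb).
Let Lm : set (pt R) := [set x | Om x /\ V x = dV d].
Hypotheses (delta00 : 0 < delta0) (LmO : forall l z, Lm l -> `|z - l| <= delta0 -> Om z) (cLm : compact Lm).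
Notation W eps := (WV cV VdV eps).
Notation B eps := (@Hform R (ds d) (dV d) (W eps)).
Notation D eps := (DH (W := W eps) (m_OV oOm eps)).

Lemma pscaleK (eps : R) (y : pt R) : 0 < eps -> pscale eps (pscale eps^-1 y) = y.
Proof.
move=> e0; case: y => [[a b] c]; rewrite /pscale /=.
by rewrite !mulrA divff ?gt_eqF// !mul1r.
Qed.

Lemma phi_exists (h eta : R) : 0 < h -> 0 < eta -> exists2 epsb : R, 0 < epsb &
  forall eps : R, 0 < eps -> eps < epsb -> exists phi : pt R -> Hsp (ds d) (W eps),
  [/\ cont_on (B eps) Lm phi,
      forall y, Lm y -> nehari (B eps) (D eps) (phi y) /\ JH (OV Om eps) (phi y) <= c0 d + h &
      forall y, Lm y -> `|bary Rb eps (val (phi y)) - y| <= eta].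
Proof.
move=> h0 eta0; have h2 : 0 < h / 2 by exact: divr_gt0.
have V0 := dV0 d.
have [u [S0 [Nu uS0 Ju]]] := near_min d h2.
pose S := Num.max S0 1; have S1 : 0 < S by rewrite lt_max ltr01 orbT.
have uS (x : pt R) : S <= `|x| -> u x = 0 by rewrite ge_max => /andP[? _]; exact: uS0.
have [Hu N0 _] := Nu.
have [g g0 hg] := ray_transfer Nu h2.
have I0 : 0 <= Int m3 (fun x : T3 => u x ^+ 2) by apply: Int_ge0 => x; exact: sqr_ge0.
set I := Int _ _ in I0; have I1 : 0 < I + 1 by rewrite ltr_wpDl.
pose gam := g / (I + 1); have gam0 : 0 < gam by exact: divr_gt0.
have gI : gam * I <= g by rewrite /gam mulrAC ler_pdivrMr// ler_wpM2l ?(ltW g0)// lerDl.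
have [d1 d10 hd1] := unif_cont_compact cV cLm gam0.
(* In the variable [pscale eps x] the translate centred at [y] has radius [eps * S]. The three
   bounds keep the potential below [V_0 + gam] on it, keep it inside [Om], and place its barycenter
   within [eta] of [y]. *)
pose m := Num.min (Num.min d1 delta0) eta.
have m0 : 0 < m by rewrite !lt_min d10 delta00.
exists (m / S); first exact: divr_gt0.
move=> eps eps0; rewrite ltr_pdivlMr// => /ltW; rewrite !le_min => /andP[/andP[es1 es2] es3].
pose mO := m_OV oOm eps.
pose a y := pscale eps^-1 y.
have xa (x y : pt R) : `|x - a y| <= S -> `|pscale eps x - y| <= eps * S.
  by move=> xS; rewrite -{1}(pscaleK y eps0) pscaleB norm_pscale (gtr0_norm eps0) ler_pM2l.
have WC y : Lm y -> forall x : pt R, `|x - a y| <= S -> W eps x <= dV d + gam.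
  move=> Ly x /xa xS; have := hd1 y (pscale eps x) Ly (le_trans xS es1).
  by have [_ ->] := Ly; rewrite ler_norml => /andP[_]; rewrite /= lerBlDl.
have xO y : Lm y -> forall x : pt R, `|x - a y| <= S -> Om (pscale eps x).
  by move=> Ly x /xa xS; apply: LmO Ly _; exact: le_trans xS es2.
have Ht y : Lm y -> inH (W eps) (tr (a y) u).
  by move=> Ly; have [] := tr_W Hu uS (WC y Ly).
(* Off [Lm] the translate need not lie in the energy space, so the value there is left free. *)
have /choice[phi0 E0] y : exists v : Hsp (ds d) (W eps), Lm y -> val v = tr (a y) u.
  by have [Ly|Ly] := pselect (Lm y); [exists (toH (Ht y Ly))|exists 0].
have tE (y : pt R) (x : pt R) : ~ `|x - a y| <= S -> tr (a y) u x = 0.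
  by move=> h1; apply: uS; apply/ltW; rewrite ltNge; apply/negP.
(* The translate is supported where [pscale eps x] is in [Om], so the truncation is inactive and the
   limit nonlinearity reappears. *)
have gOE y (t : R) : Lm y -> forall x : T3, gO d (OV Om eps) x (t * tr (a y) u x) = gO d setT ((x : pt R) - a y) (t * u ((x : pt R) - a y)) /\
    GO d (OV Om eps) x (t * tr (a y) u x) = GO d setT ((x : pt R) - a y) (t * u ((x : pt R) - a y)).
  move=> Ly x; rewrite /tr; have [h1|h1] := pselect (`|(x : pt R) - a y| <= S).
    have [[_ [-> ->]]|[]] := gO_case d (OV Om eps) x; last by case; exact: xO h1.
    by have [[_ [-> ->]]|[[]//]] := gO_case d setT ((x : pt R) - a y).
  by have := tE y x h1; rewrite /tr => ->; rewrite mulr0 !gO_0 !GO_0.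
have trans y : Lm y -> exists2 t : R, 0 < t & isN (W eps) (OV Om eps) (fun x => t * tr (a y) u x) /\
    JJ (W eps) (OV Om eps) (fun x => t * tr (a y) u x) <= JJ (Wc d) setT u + h / 2.
  move=> Ly; apply: hg => //; first exact: Ht.
  - by apply: lt_le_trans (NN_Wc (Ht y Ly)); rewrite (tr_Wc (a y) Hu).2.
  - by apply: le_trans (tr_NN Hu uS (WC y Ly)) _; rewrite lerD2l.
  - move=> t; rewrite /Psi.
    have [_ <-] := tr_Int (a y) (L1_G measurableT (inHZ t Hu)).
    by apply: eq_Int => x; have [_ ->] := gOE y t Ly x.
  - move=> t; rewrite /psi.
    have [_ <-] := tr_Int (a y) (L1_gv measurableT (inHZ t Hu) (inHZ t Hu)).
    by apply: eq_Int => x; have [-> _] := gOE y t Ly x.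
have projE y : Lm y -> exists2 t : R, 0 < t & [/\ nehari (B eps) (D eps) (t *: phi0 y),
    nehari_proj (B eps) (D eps) (phi0 y) = t *: phi0 y & JH (OV Om eps) (t *: phi0 y) <= c0 d + h].
  move=> Ly; have [t t0 [Nt Jt]] := trans y Ly; exists t => //.
  have Nh : nehari (B eps) (D eps) (t *: phi0 y) by apply/neh_isN; rewrite valZ (E0 y Ly).
  split; [exact: Nh|exact: (nehari_projE (Hform_psd _ _) (@DH_ray R d (W eps) _ mO) (cc_gt0 d) t0 Nh)|].
  rewrite /JH valZ (E0 y Ly); apply: le_trans Jt _; move: Ju; move: (JJ _ _ _) => X; lra.
exists (fun y => nehari_proj (B eps) (D eps) (phi0 y)); split.
- apply: (cont_on_proj (Hform_psd _ _) (@DH_unif R d (W eps) _ mO) (@DH_ray R d (W eps) _ mO) (cc_gt0 d) (rsmP d).1); last first.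
  + by move=> y Ly; have [t t0 [Nt E _]] := projE y Ly; rewrite E; split => //; exists t.
  + move=> y Ly e e0; pose C := dV d + gam; have C0 : 0 < C by exact: addr_gt0.
    have CV : dV d <= C by rewrite lerDl ltW.
    have e1 : 0 < e ^+ 2 * dV d / C by rewrite divr_gt0// mulr_gt0// exprn_gt0.
    have [et et0 het] := tr_cont0 Hu e1.
    have ee : 0 < eps * et by exact: mulr_gt0.
    have hb : nbhs (y : pt R) (ball (y : pt R) (eps * et)) by exact: nbhsx_ballx ee.
    apply: filterS hb => z; rewrite -ball_normE /= => yz Lz.
    apply: nm_le; first exact: ltW.
    have -> : B eps (phi0 z - phi0 y) (phi0 z - phi0 y) = NN (W eps) (fun x => tr (a z) u x - tr (a y) u x).
      by rewrite -(E0 z Lz) -(E0 y Ly) -valB.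
    pose b := a z - a y.
    pose w0 x := tr b u x - u x.
    have Hw0 : inH (Wc d) w0 by exact: inHB (tr_Wc b Hu).1 Hu.
    have wE : (fun x => tr (a z) u x - tr (a y) u x) = tr (a y) w0.
      apply/funext => x; rewrite /tr /w0 /tr /b; congr (u _ - _).
      by rewrite opprB addrA subrK.
    have Hw : inH (W eps) (tr (a y) w0) by rewrite -wE; exact: inHB (Ht z Lz) (Ht y Ly).
    have Hwc := inH_Wc Hw.
    have nb : `|b| <= et.
      rewrite /b /a pscaleB norm_pscale normfV (gtr0_norm eps0) ler_pdivrMl// distrC; exact: ltW.
    have h3 := het b nb.
    have h4 : NN (W eps) (tr (a y) w0) <= C / dV d * NN (Wc d) (tr (a y) w0).
      have r1 : 1 <= C / dV d by rewrite ler_pdivlMr// mul1r.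
      rewrite /NN !hformE mulrDr; apply: lerD.
        by rewrite ler_peMl// Int_ge0// => q; exact: gq_ge0.
      rewrite -(IntZ _ (inH_W Hwc)); apply: Int_le; [exact: inH_W Hw|exact: (L1Z (C / dV d) (inH_W Hwc))|].
      move=> x; rewrite mulrA divfK ?gt_eqF//.
      have [q1|q1] := pselect (`|(x : pt R) - a y| <= S); first by rewrite ler_wpM2r ?sqr_ge0//; exact: WC Ly _ q1.
      have [q2|q2] := pselect (`|(x : pt R) - a z| <= S); first by rewrite ler_wpM2r ?sqr_ge0//; exact: WC Lz _ q2.
      have -> : tr (a y) w0 x = 0 by rewrite -wE (tE z x q2) (tE y x q1) subrr.
      by rewrite expr0n /= !mulr0.
    rewrite wE; apply: le_trans h4 _; rewrite (tr_Wc (a y) Hw0).2.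
    have c1 : 0 < C / dV d by exact: divr_gt0.
    apply: le_trans (ler_wpM2l (ltW c1) h3) _.
    by rewrite le_eqVlt; apply/orP; left; apply/eqP; field; rewrite !gt_eqF.
  + by move=> w /neh_isN Nw; have := isN_small mO Nw; rewrite nm_sqr ler_sqr ?nnegrE ?nm_ge0// ltW// (rsmP d).1.
- by move=> y Ly; have [t t0 [Nt E Jt]] := projE y Ly; rewrite E.
- move=> y Ly; have [t t0 [Nt E Jt]] := projE y Ly; rewrite E valZ (E0 y Ly).
  have yR : `|y| <= Rb by apply: OmR; case: Ly.
  have Htt := inHZ t (Ht y Ly).
  have It : 0 < Int m3 (fun x : T3 => (t * tr (a y) u x) ^+ 2).
    have Nt' : isN (W eps) (OV Om eps) (fun x => t * tr (a y) u x) by have := (neh_isN mO _).1 Nt; rewrite valZ (E0 y Ly).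
    exact: L2_pos mO Nt'.
  apply: bary_dist => i mi iB iN iS.
  apply: (avg_close (inH_2 Htt) (fun x => sqr_ge0 _) It (m_chi Rb eps mi) (fun x => clampR_abs Rb0 _) (L1Z eta (inH_2 Htt))).
    move=> x; have [q1|q1] := pselect (`|(x : pt R) - a y| <= S); last by rewrite (tE y x q1) mulr0 expr0n !mulr0.
    rewrite ler_wpM2r ?sqr_ge0//; apply: le_trans es3; apply: le_trans (xa x y q1).
    apply: le_trans (clampR_lip Rb0 _ (le_trans (iN y) yR)) _.
    by rewrite -iS -iB; exact: iN.
  by rewrite (IntZ _ (inH_2 Htt)).
Qed.
End PhiMap.

(** * The Palais-Smale condition *)

Section Tail.
Variable R : realType.
Notation RR := (measurableTypeR R).
Notation T3 := (RR * RR * RR)%type.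
Notation m3 := (mu3 R).

Lemma L1_tail (f : T3 -> R) (r0 e : R) : L1 m3 f -> (forall x, 0 <= f x) -> 0 < e ->
  exists2 r : R, r0 < r & Int m3 (fun x => \1_(~` cb r) x * f x) <= e.
Proof.
move=> Lf f0 e0; apply: contrapT => hn.
pose r n : R := `|r0| + n.+1%:R.
have rr n : r0 < r n by apply: le_lt_trans (ler_norm r0) _; rewrite ltrDl.
have mc t : measurable (cb t : set T3) by exact: mQB.
have Lc n : L1 m3 (fun x => \1_(cb (r n)) x * f x) by exact: L1_indicM.
have Ln n : L1 m3 (fun x => \1_(~` cb (r n)) x * f x) by apply: L1_indicM => //; exact: measurableC.
have sumE (A : set T3) (x : T3) : \1_A x * f x + \1_(~` A) x * f x = f x.
  by rewrite -mulrDl !indicE in_setC; case: (x \in A); rewrite /= ?addr0 ?add0r mul1r.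
have Ib n : Int m3 (fun x => \1_(cb (r n)) x * f x) <= Int m3 f - e.
  have : e < Int m3 (fun x => \1_(~` cb (r n)) x * f x).
    by rewrite ltNge; apply/negP => h; apply: hn; exists (r n).
  have <- : Int m3 (fun x => \1_(cb (r n)) x * f x) + Int m3 (fun x => \1_(~` cb (r n)) x * f x) = Int m3 f.
    by rewrite -(IntD (Lc n) (Ln n)); apply: eq_Int => x; exact: sumE.
  move: (Int _ _) (Int _ _) => X Y; clear; lra.
have [] := fatou_bound Lc (fun n x => mulr_ge0 _ (f0 x)) Ib (L1_meas Lf) _ f0.
- by move=> n x; rewrite indicE.
- apply: aeW => x; have [N hN] : exists N, forall n, (N <= n)%N -> `|x : pt R| < r n.
    exists (Num.bound `|x : pt R|) => n nN; apply: lt_le_trans (archi_boundP (normr_ge0 _)) _.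
    rewrite /r; apply: ler_wpDl => //; rewrite ler_nat; exact: leqW.
  apply/cvgrPdist_le => e1 e10; exists N => // n /= nN.
  by rewrite indicE mem_set ?mul1r ?subrr ?normr0 ?(ltW e10)//; apply: cb_norm; exact: hN.
- by move=> _; rewrite leNgt ltrBlDr ltrDl e0.
Qed.

End Tail.

Section PalaisSmale.
Variables (R : realType) (d : pdata R).
Notation RR := (measurableTypeR R).
Notation T3 := (RR * RR * RR)%type.
Notation m3 := (mu3 R).
Notation inH := (inH (ds d)).
Variables (W : weight (dV d)) (O : set T3) (Rw : R).
Hypotheses (mO : measurable O) (OR : forall x : pt R, O x -> `|x| <= Rw).
Notation H := (Hsp (ds d) W).
Notation B := (@Hform R (ds d) (dV d) W).
Notation D := (DH mO).
Notation J := (JH O).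
Notation nmH := (nm B).
Let BP := Hform_psd (ds d) W.

Lemma ps_bound b w : nehari_le B J D b w -> nmH w <= Num.sqrt (4 * `|b| / cc d) + 1.
Proof.
move=> [/neh_isN Nw Jw]; have c0 := cc_gt0 d.
apply: (@le_trans _ _ (Num.sqrt (4 * `|b| / cc d))); last by rewrite lerDl.
rewrite nm_NN ler_wsqrtr// ler_pdivlMr// mulrC.
have := isN_J mO Nw; have := le_trans Jw (ler_norm b); rewrite /JH.
move: (JJ _ _ _) (NN _ _) => X Y; clear -mO OR; lra.
Qed.

Section Seq.
Variables (U : set_system nat) (v : nat -> H) (nu : R).
Hypotheses (UU : UltraFilter U) (nu0 : 0 < nu) (vn : forall n, nmH (v n) <= nu).
Hypothesis v0 : forall z, B (v n) z @[n --> U] --> (0 : R).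

Lemma weak_cell (c : pt R) (h e : R) : 0 < h -> 0 < e ->
  \forall n \near U, `|Int m3 (fun x : T3 => \1_(QB c h) x * val (v n) x)| <= e.
Proof.
move=> h0 e0; have [LQ _] := L1_QB c (ltW h0).
have [|g hg] := @riesz_L2 R (ds d) (dV d) W (\1_(QB c h) : T3 -> R) (L1_meas LQ).
  by apply: eq_L1 LQ => x; rewrite indicE; case: (x \in _); rewrite ?expr1n ?expr0n.
have /cvgrPdist_le /(_ _ e0) := v0 g; apply: filterS => n.
rewrite sub0r normrN (psdC BP) -hg => hle; apply: le_trans hle.
by rewrite le_eqVlt; apply/orP; left; apply/eqP; congr `|_|; apply: eq_Int => x; rewrite mulrC.
Qed.

(** Local compactness: the box is divided into cells so small that the Poincare remainder is below
    [e / 2]; then the finitely many cell integrals tend to [0] by weak convergence. *)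
Lemma weak_local (r e : R) : 0 < r -> 0 < e ->
  \forall n \near U, Int m3 (fun x : T3 => \1_(cb r) x * val (v n) x ^+ 2) <= e.
Proof.
move=> r0 e0; have s0 := ds0 d.
pose q := e / 2 / (16 * (nu ^+ 2 + 1)).
have nu1 : 0 < nu ^+ 2 + 1 by rewrite ltr_wpDl ?sqr_ge0.
have q0 : 0 < q by apply: divr_gt0; [exact: divr_gt0|rewrite mulr_gt0 ?ltr0n].
have m0 : 0 < Num.min 1 q / (2 * r) by rewrite divr_gt0 ?mulr_gt0// lt_min ltr01.
have [N hN] := small_inv m0.
pose n := N.+1; pose h := 2 * r / n%:R.
have n0 : 0 < n%:R :> R by rewrite ltr0n.
have h0 : 0 < h by rewrite divr_gt0// mulr_gt0.
have hq : h <= Num.min 1 q.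
  by have := hN N (leqnn _); rewrite ler_pdivlMr ?mulr_gt0// mulrC.
move: hq; rewrite le_min => /andP[h1 hq].
have nh : n%:R * h = 2 * r by rewrite /h mulrC divfK// gt_eqF.
have h2 : 16 * h `^ (2 * ds d) * nu ^+ 2 <= e / 2.
  have p1 : h `^ (2 * ds d) <= h.
    have hh : 0 < h <= 1 by rewrite h0.
    by have := ger_powR hh (ds2 d); rewrite (powRr1 (ltW h0)).
  have h3 : h `^ (2 * ds d) * nu ^+ 2 <= q * (nu ^+ 2 + 1).
    by apply: ler_pM; rewrite ?powR_ge0 ?sqr_ge0//; [exact: le_trans hq|rewrite lerDl].
  have -> : e / 2 = 16 * (q * (nu ^+ 2 + 1)) by rewrite /q; field; rewrite gt_eqF.
  by rewrite -mulrA ler_wpM2l// ler0n.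
pose I := ('I_n * 'I_n * 'I_n)%type.
pose K : R := (#|{: I}|)%:R + 1; have K0 : 0 < K by rewrite ltr_wpDl.
pose k := Num.min 1 (e / 2 * h ^+ 3 / K).
have hk3 : 0 < h ^+ 3 by exact: exprn_gt0.
have k0 : 0 < k by rewrite lt_min ltr01 divr_gt0// mulr_gt0// divr_gt0.
have [k1 k2] : k <= 1 /\ k <= e / 2 * h ^+ 3 / K by rewrite /k !ge_min !lexx ?orbT.
rewrite ler_pdivlMr// in k2.
have all : \forall m \near U, forall i : I, `|Int m3 (fun x : T3 => \1_(QB (corner (- r, - r, - r) h i) h) x * val (v m) x)| <= k.
  apply: filter_forall => i; exact: weak_cell.
apply: filterS all => m hm.
have := @grid_L2 R (ds d) s0 (ltW (ds1 d)) (dV d) W (val (v m)) (- r, - r, - r) h n h0 (HspP (v m)).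
rewrite nh => hle; apply: le_trans hle _; rewrite [leRHS](splitr e); apply: lerD.
  rewrite ler_pdivrMl//; apply: (@le_trans _ _ (\sum_(i : I) k)).
    apply: ler_sum => i _; have hi := hm i; rewrite -real_normK ?num_real// expr2.
    by apply: le_trans (ler_wpM2r (normr_ge0 _) (le_trans hi k1)) _; rewrite mul1r.
  rewrite sumr_const -[leLHS]mulr_natr [leRHS]mulrC; apply: le_trans k2.
  by apply: ler_wpM2l; [exact: ltW|rewrite lerDl].
apply: le_trans h2; apply: ler_wpM2l; first by rewrite mulr_ge0 ?powR_ge0 ?ler0n.
have -> : hform (ds d) W (val (v m)) (val (v m)) = nmH (v m) ^+ 2 by rewrite -nm_sqr.
by rewrite ler_sqr ?nnegrE ?nm_ge0 ?(ltW nu0).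
Qed.
End Seq.

(* On the box the nonlinearity is subcritical and [v n] converges in [L^2];
   off the box [gO] is at most [dk d * t], which [dm d] absorbs. *)
Lemma psi_bound_ps (l : H) (rho nu e : R) : 0 < rho -> 0 < nu -> 0 < e -> exists (r C : R),
  [/\ 0 < r, 0 < C & forall w : H, nmH w <= rho -> nmH (w - l) <= nu ->
    psi d O (val w) (val (w - l)) <= e + C * Int m3 (fun x : T3 => \1_(cb r) x * val (w - l) x ^+ 2) +
      3 / 4 * dm d * nmH (w - l) ^+ 2].
Proof.
move=> rho0 nu0 e0; have k0 := dk0 d; have V0 := dV0 d; have hp := dp2 d.
have e3 : 0 < e / 3 by exact: divr_gt0.
have Ll := inH_2 (HspP l).
have [r hr htail] := @L1_tail R (fun x : T3 => val l x ^+ 2) (Num.max Rw 1) (2 / dk d * (e / 3)) Ll (fun x => sqr_ge0 _) (mulr_gt0 (divr_gt0 (ltr0n R 2) k0) e3).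
move: hr; rewrite gt_max => /andP[rR r1]; have r0 : 0 < r by exact: lt_trans r1.
have KE0 := KE_ge0 d rho.
pose lam := e / 3 / (nu * (KE d rho + 1)).
have K1 : 0 < KE d rho + 1 by rewrite ltr_wpDl.
have lam0 : 0 < lam by apply: divr_gt0 => //; exact: mulr_gt0.
have [C C0 hC] := gO_lip d lam0.
pose th := e / 3 * 2 * dV d / (C * (rho ^+ 2 + 1)).
have rh1 : 0 < rho ^+ 2 + 1 by rewrite ltr_wpDl ?sqr_ge0.
have th0 : 0 < th by apply: divr_gt0; [apply: mulr_gt0 => //; exact: mulr_gt0|exact: mulr_gt0].
exists r, (C / 2 * th^-1); split => //; first by rewrite mulr_gt0 ?divr_gt0// invr_gt0.
move=> w wr; set v := w - l => vn.
have Hw := HspP w; have Hv := HspP v.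
have Nw : NN W (val w) <= rho ^+ 2 by rewrite nm_sqr ler_sqr ?nnegrE ?nm_ge0 ?(ltW rho0).
have Nv : NN W (val v) <= nu ^+ 2 by rewrite nm_sqr ler_sqr ?nnegrE ?nm_ge0 ?(ltW nu0).
have [LE IE] := EE_L1 rho0 nu0 Hw Hv Nw Nv.
have mc : measurable (cb r : set T3) by exact: mQB.
have Lc := L1_indicM mc (inH_2 Hv).
have Lt := L1_indicM (measurableC mc) Ll.
have A1 := L1Z (lam * nu) LE.
have A2 := L1Z (C / 2 * th) (inH_2 Hw).
have A3 := L1Z (C / 2 * th^-1) Lc.
have A4 := L1Z (3 / 2 * dk d) (inH_2 Hv).
have A5 := L1Z (dk d / 2) Lt.
have vE x : val w x = val v x + val l x by rewrite /v valB subrK.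
have ptw (x : T3) : gO d O x (val w x) * val v x <= lam * nu * EE d (val w) (val v) nu x + C / 2 * th * val w x ^+ 2 +
    C / 2 * th^-1 * (\1_(cb r) x * val v x ^+ 2) + 3 / 2 * dk d * val v x ^+ 2 + dk d / 2 * (\1_(~` cb r) x * val l x ^+ 2).
  have e1 : 0 <= lam * nu * EE d (val w) (val v) nu x by rewrite mulr_ge0 ?EE_ge0// mulr_ge0// ltW.
  have e2 : 0 <= C / 2 * th * val w x ^+ 2 by exact: mulr_ge0 (mulr_ge0 (divr_ge0 (ltW C0) (ler0n R 2)) (ltW th0)) (sqr_ge0 _).
  have e3' : 0 <= 3 / 2 * dk d * val v x ^+ 2 by rewrite mulr_ge0 ?sqr_ge0// mulr_ge0// ltW.
  apply: le_trans (ler_norm _) _; rewrite normrM.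
  have [xQ|xQ] := pselect (cb r x).
    have -> : \1_(cb r) x = 1 :> R by rewrite indicE mem_set.
    have -> : \1_(~` cb r) x = 0 :> R by rewrite indicE memNset//; apply.
    rewrite mul0r mul1r mulr0 addr0.
    have h1 : `|gO d O x (val w x)| <= lam * (`|val w x| + `|val w x| `^ (dp d - 1)) + C * `|val w x|.
      have := hC O x (val w x) 0; rewrite gO_0 !subr0 normr0 powR0; last by rewrite gt_eqF// subr_gt0; apply: lt_trans hp; rewrite ltr1n.
      by rewrite !addr0.
    apply: le_trans (ler_wpM2r (normr_ge0 _) h1) _; rewrite mulrDl.
    have h2 : lam * (`|val w x| + `|val w x| `^ (dp d - 1)) * `|val v x| <= lam * nu * EE d (val w) (val v) nu x.
      by rewrite -[leLHS]mulrA -[leRHS]mulrA; apply: ler_wpM2l; [exact: ltW|exact: ab_EE].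
    have h3 : C * `|val w x| * `|val v x| <= C / 2 * th * val w x ^+ 2 + C / 2 * th^-1 * val v x ^+ 2.
      rewrite -(real_normK (num_real (val w x))) -(real_normK (num_real (val v x))).
      move: `|val w x| `|val v x| => X Y; rewrite -subr_ge0.
      have -> : C / 2 * th * X ^+ 2 + C / 2 * th^-1 * Y ^+ 2 - C * X * Y = C / 2 * (th * (X - th^-1 * Y) ^+ 2) by field; rewrite gt_eqF.
      apply: mulr_ge0; first by rewrite divr_ge0// ltW.
      by apply: mulr_ge0; [exact: ltW|exact: sqr_ge0].
    move: h2 h3 e3'; move: (lam * _ * _) (lam * nu * _) (C * _ * _) (C / 2 * th * _) (C / 2 * th^-1 * _) (3 / 2 * _ * _).
    by move=> a1 a2 a3 a4 a5 a6; clear -mO OR; lra.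
  have -> : \1_(cb r) x = 0 :> R by rewrite indicE memNset.
  have -> : \1_(~` cb r) x = 1 :> R by rewrite indicE mem_set.
  rewrite mul0r mulr0 addr0 mul1r.
  have Ox : ~ O x by move=> /OR xr; apply: xQ; apply: cb_norm; exact: le_lt_trans rR.
  have h1 : `|gO d O x (val w x)| <= dk d * (`|val v x| + `|val l x|).
    have [[//]|[_ [gE _]]] := gO_case d O x.
    have a0 : 0 <= dk d * (`|val v x| + `|val l x|) by rewrite mulr_ge0 ?addr_ge0// ltW.
    have [w0|w0] := leP (val w x) 0; first by rewrite (sc_neg (gO_scal d O x) w0) normr0.
    rewrite ger0_norm ?(sc_pos (gO_scal d O x))// ?(ltW w0)// gE; apply: le_trans (dft_k d (ltW w0)) _.
    rewrite ler_pM2l// vE; apply: le_trans (ler_norm _) _; exact: ler_normD.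
  apply: le_trans (ler_wpM2r (normr_ge0 _) h1) _.
  have h2 : dk d * (`|val v x| + `|val l x|) * `|val v x| <= 3 / 2 * dk d * val v x ^+ 2 + dk d / 2 * val l x ^+ 2.
    rewrite -(real_normK (num_real (val v x))) -(real_normK (num_real (val l x))).
    move: `|val v x| `|val l x| => X Y; rewrite -subr_ge0.
    have -> : 3 / 2 * dk d * X ^+ 2 + dk d / 2 * Y ^+ 2 - dk d * (X + Y) * X = dk d / 2 * (X - Y) ^+ 2 by field.
    by rewrite mulr_ge0 ?sqr_ge0// divr_ge0// ltW.
  move: h2 e1 e2; move: (dk d * _ * _) (lam * nu * _) (C / 2 * th * _) (3 / 2 * _ * _) (dk d / 2 * _).
  by move=> a1 a2 a3 a4 a5; clear -mO OR; lra.
apply: le_trans (Int_le (L1_gv mO Hw Hv) (L1D (L1D (L1D (L1D A1 A2) A3) A4) A5) ptw) _.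
rewrite (IntD (L1D (L1D (L1D A1 A2) A3) A4) A5) (IntD (L1D (L1D A1 A2) A3) A4) (IntD (L1D A1 A2) A3) (IntD A1 A2).
rewrite (IntZ _ LE) (IntZ _ (inH_2 Hw)) (IntZ _ Lc) (IntZ _ (inH_2 Hv)) (IntZ _ Lt).
have b1 : lam * nu * Int m3 (EE d (val w) (val v) nu) <= e / 3.
  have -> : e / 3 = lam * nu * (KE d rho + 1) by rewrite /lam; field; rewrite !gt_eqF.
  apply: ler_wpM2l; first by rewrite mulr_ge0// ltW.
  by apply: le_trans IE _; rewrite lerDl.
have b2 : C / 2 * th * Int m3 (fun x : T3 => val w x ^+ 2) <= e / 3.
  have -> : e / 3 = C / 2 * th * ((rho ^+ 2 + 1) / dV d) by rewrite /th; field; rewrite !gt_eqF.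
  apply: ler_wpM2l; first exact: mulr_ge0 (divr_ge0 (ltW C0) (ler0n R 2)) (ltW th0).
  rewrite ler_pdivlMr// mulrC; apply: le_trans (L2_le_form Hw) _; apply: le_trans Nw _; by rewrite lerDl.
have b4 : 3 / 2 * dk d * Int m3 (fun x : T3 => val v x ^+ 2) <= 3 / 4 * dm d * nmH v ^+ 2.
  have h1 := L2_le_form Hv; have h2 := dkm d.
  have i0 : 0 <= Int m3 (fun x : T3 => val v x ^+ 2) by apply: Int_ge0 => x; exact: sqr_ge0.
  have h3 : hform (ds d) W (val v) (val v) = nmH v ^+ 2 by rewrite -nm_sqr.
  rewrite h3 in h1; have h4 := ler_wpM2l (ltW (dm_gt0 d)) h1; have h5 := ler_wpM2r i0 (ltW h2).
  move: h4 h5; move: (Int _ _) (nmH v ^+ 2) => X Y; clear -mO OR; lra.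
have b5 : dk d / 2 * Int m3 (fun x : T3 => \1_(~` cb r) x * val l x ^+ 2) <= e / 3.
  have -> : e / 3 = dk d / 2 * (2 / dk d * (e / 3)) by field; rewrite gt_eqF.
  by apply: ler_wpM2l => //; rewrite divr_ge0// ltW.
move: b1 b2 b4 b5; move: (lam * nu * _) (C / 2 * th * _) (C / 2 * th^-1 * _) (3 / 2 * _ * _) (dk d / 2 * _) (3 / 4 * _ * _).
by move=> a1 a2 a3 a4 a5 a6; clear -mO OR; lra.
Qed.

Lemma palais_smale b (w : nat -> H) : (forall n, nehari_le B J D b (w n)) ->
  (forall n, nmH (D (w n)) <= n.+1%:R^-1) -> exists l, [/\ nehari B D l, nmH (D l) = 0 &
    forall e : R, 0 < e -> forall N, exists2 n, (N <= n)%N & nmH (w n - l) <= e].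
Proof.
move=> Nw Dw; pose rho := Num.sqrt (4 * `|b| / cc d) + 1.
have rho0 : 0 < rho by rewrite ltr_wpDl// sqrtr_ge0.
have wr n : nmH (w n) <= rho by exact: ps_bound.
have [U UU Uoo] := free_ultra.
have [l hl] := weak_lim BP (@Hform_complete R (ds d) (dV d) W) UU wr.
exists l; pose nu := rho + nmH l; have l0 := nm_ge0 B l.
have nu0 : 0 < nu by rewrite ltr_wpDr.
have vn n : nmH (w n - l) <= nu by apply: le_trans (nmB BP _ _) _; rewrite lerD2r.
have v0 z : B (w n - l) z @[n --> U] --> (0 : R).
  have -> : (fun n => B (w n - l) z) = (fun n => B (w n) z - B l z) by apply/funext => n; rewrite (psdB BP).
  by rewrite -(subrr (B l z)); apply: cvgB; [exact: hl|exact: cvg_cst].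
have m0 := dm_gt0 d.
(* The gradient is tested with [w n - l]. The Kirchhoff coefficient enters only through the bounds
   [dm d] and [S], so its limit need not be identified with the coefficient at [l] beforehand. *)
have strong (e : R) : 0 < e -> \forall n \near U, nmH (w n - l) <= e.
  move=> e0; pose E := dm d / 4 * e ^+ 2.
  have E0 : 0 < E by rewrite mulr_gt0 ?divr_gt0// exprn_gt0.
  have E4 : 0 < E / 4 by exact: divr_gt0.
  have [r [C [r0 C0 hpsi]]] := psi_bound_ps l rho0 nu0 E4.
  pose S := dM d (rho ^+ 2); have S0 : 0 < S := dM_gt0 d _.
  have q1 : 0 < E / 4 / S by exact: divr_gt0.
  have q2 : 0 < E / 4 / nu by exact: divr_gt0.
  have q3 : 0 < E / 4 / C by exact: divr_gt0.
  have f1 : \forall n \near U, `|B l (w n - l)| <= E / 4 / S.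
    have /cvgrPdist_le /(_ _ q1) := v0 l; apply: filterS => n.
    by rewrite sub0r normrN (psdC BP).
  have f2 : \forall n \near U, n.+1%:R^-1 <= E / 4 / nu.
    by have [N hN] := small_inv q2; apply: Uoo; exists N => // n /= /hN.
  have f3 := weak_local UU nu0 vn v0 r0 q3.
  apply: filterS (filterI f1 (filterI f2 f3)) => n [h1 [h2 h3]].
  rewrite ler_pdivlMr// in h1; rewrite ler_pdivlMr// in h2; rewrite ler_pdivlMr// in h3.
  have h4 := hpsi (w n) (wr n) (vn n).
  have E1 := DHE mO (w n) (w n - l).
  have h5 : `|B (D (w n)) (w n - l)| <= E / 4.
    apply: le_trans (psd_CS BP _ _) _; apply: le_trans h2; apply: ler_pM; rewrite ?nm_ge0//.
  pose M := dM d (NN W (val (w n))).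
  have MS : M <= S.
    by apply: dM_le; [exact: NN_ge0|rewrite nm_sqr ler_sqr ?nnegrE ?nm_ge0 ?(ltW rho0)].
  have h6 : `|M * B l (w n - l)| <= E / 4.
    rewrite normrM (gtr0_norm (dM_gt0 d _)) mulrC; apply: le_trans h1; apply: ler_pM => //.
    exact: ltW (dM_gt0 d _).
  have E2 : B (w n) (w n - l) = nmH (w n - l) ^+ 2 + B l (w n - l).
    by rewrite -(nmE BP) -(psdD BP) subrK.
  rewrite E2 -/M [M * (_ + _)]mulrDr in E1.
  have h7 : dm d * nmH (w n - l) ^+ 2 <= M * nmH (w n - l) ^+ 2 by rewrite ler_wpM2r ?sqr_ge0//; exact: dM_ge.
  have h8 : dm d / 4 * nmH (w n - l) ^+ 2 <= E.
    move: h3 h4 h5 h6 h7 E1; rewrite !ler_norml [C * _]mulrC => h3 h4 /andP[_ h5] /andP[h6 _] h7 E1.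
    move: h3 h4 h5 h6 h7 E1.
    set a1 := Int _ _ * C; set a2 := psi _ _ _ _; set a3 := B (D (w n)) _; set a4 := M * B l _.
    set a5 := M * _; set a6 := nmH _ ^+ 2; clearbody a1 a2 a3 a4 a5 a6; clear -mO OR; lra.
  rewrite /E ler_pM2l ?divr_gt0// in h8.
  by rewrite -ler_sqr ?nnegrE ?nm_ge0 ?(ltW e0).
have conv (e : R) : 0 < e -> forall N, exists2 n, (N <= n)%N & nmH (w n - l) <= e.
  move=> e0 N; have hN : U [set n | (N <= n)%N] by apply: Uoo; exists N.
  by have [n [n1 n2]] := filter_ex (filterI hN (strong e e0)); exists n.
have Dl : nmH (D l) = 0.
  apply/eqP; rewrite eq_le nm_ge0 andbT; apply/ler_addgt0Pl => e e0; rewrite addr0.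
  have e2 : 0 < e / 2 by exact: divr_gt0.
  have [tau tau0 htau] := unif_grad BP (@DH_unif R d W O mO) (nmH l) e2.
  have [N hN] := small_inv e2; have [n Nn wn] := conv tau tau0 N.
  have := htau l (w n - l) (lexx _) wn; rewrite (addrC l) subrK => h1.
  have h2 := le_trans (Dw n) (hN n Nn).
  have := nm_dist BP (D l) (D (w n)); rewrite (nmBC BP (D l)).
  by move: h1 h2; move: (nmH _) (nmH _) (nmH _) => a1 a2 a3; clear -mO OR; lra.
have r0 := (rsmP d).1.
split => //; split; last by exact: nm_eq0.
have [n _ wn] := conv (rsm d / 2) (divr_gt0 r0 (ltr0n R 2)) 0%N.
have [/neh_isN Nn _] := Nw n.
have h1 : rsm d <= nmH (w n).
  by have := isN_small mO Nn; rewrite nm_sqr ler_sqr ?nnegrE ?nm_ge0// ltW.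
have := nm_dist BP (w n) l; move: h1 wn r0; move: (nmH _) (nmH _) (nmH _) => a1 a2 a3; clear -mO OR; lra.
Qed.
End PalaisSmale.

(** * Positivity *)

Section Positivity.
Variables (R : realType) (s : R).
Hypotheses (s0 : 0 < s) (s1 : s < 1).
Notation RR := (measurableTypeR R).
Notation T3 := (RR * RR * RR)%type.
Notation m3 := (mu3 R).
Notation m6 := (mu3 R \x mu3 R)%E.
Variables (V0 : R) (W : weight V0) (u eta : pt R -> R).
Hypotheses (Hu : inH s W u) (u0 : forall x, 0 <= u x) (He : inH s W eta) (e0 : forall x, 0 <= eta x).
Hypothesis super : forall phi, inH s W phi -> (forall x, 0 <= phi x) -> 0 <= hform s W u phi.

Let phi (k : nat) (x : pt R) : R := Num.max 0 (eta x - k.+1%:R * u x).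
Let phio (x : pt R) : R := if u x == 0 then eta x else 0.

Let phi_ge0 k x : 0 <= phi k x. Proof. by rewrite le_max lexx. Qed.

Let phi_eta k x : phi k x <= eta x.
Proof. by rewrite ge_max e0 gerBl mulr_ge0. Qed.

Let phi_inH k : inH s W (phi k).
Proof.
have K1 : 1 <= k.+1%:R :> R by rewrite ler1n.
have K2 : 1 <= k.+1%:R ^+ 2 :> R by rewrite exprn_ege1.
apply: (inH_dom (C := 2 * k.+1%:R ^+ 2) _ He Hu).
- apply: measurable_maxr; first exact: measurable_cst.
  by apply: measurable_funB; [exact: inH_m He|apply: measurable_funM; [exact: measurable_cst|exact: inH_m Hu]].
- move=> x; apply: (@le_trans _ _ (eta x ^+ 2)); first by rewrite ler_sqr ?nnegrE.
  have := sqr_ge0 (eta x); have := sqr_ge0 (u x); move: (eta x ^+ 2) (u x ^+ 2) => a b a0 b0.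
  apply: (@le_trans _ _ (1 * (a + b))); first by lra.
  by apply: ler_wpM2r; [exact: addr_ge0|lra].
- move=> x y; apply: (@le_trans _ _ (((eta x - eta y) - k.+1%:R * (u x - u y)) ^+ 2)).
    rewrite -[leLHS]real_normK ?num_real// -[leRHS]real_normK ?num_real// ler_sqr ?nnegrE//.
    have -> : eta x - eta y - k.+1%:R * (u x - u y) = (eta x - k.+1%:R * u x) - (eta y - k.+1%:R * u y) by ring.
    have := max_lip (- (eta x - k.+1%:R * u x)) (- (eta y - k.+1%:R * u y)) 0.
    rewrite /phi; move: (eta x - _) (eta y - _) => a b _.
    have := ler_norm (a - b); have := ler_norm (b - a); rewrite (distrC b a).
    by have [h1|h1] := leP 0 a; have [h2|h2] := leP 0 b; rewrite ler_norml => *; apply/andP; split; lra.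
  move: (eta x - eta y) (u x - u y) (k.+1%:R : R) K1 K2 => a b K K1 K2.
  have h1 := sqr_ge0 (a + K * b); have h2 : a ^+ 2 <= K ^+ 2 * a ^+ 2 by rewrite ler_peMl ?sqr_ge0.
  have -> : (a - K * b) ^+ 2 = 2 * (a ^+ 2 + K ^+ 2 * b ^+ 2) - (a + K * b) ^+ 2 by ring.
  by rewrite -mulrA mulrDr; move: h1 h2; clear -s0 s1 Hu u0 He e0 super; lra.
Qed.

(** Subtracting an increasing multiple of [u] inside the positive part can only lower the product
    with the increment of [u]. This gives a majorant independent of [k]. *)
Let gq_phi k z : gq s u (phi k) z <= `|gq s u eta z|.
Proof.
have k0 : 0 <= (gag_kernel s z.1 z.2)^-1 by rewrite invr_ge0 gag_ge0.
rewrite /gq normrM (ger0_norm k0) ler_wpM2r// normrM /phi.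
have h (K a b c e : R) : 0 <= K -> b <= a ->
    (a - b) * (Num.max 0 (c - K * a) - Num.max 0 (e - K * b)) <= `|a - b| * `|c - e|.
  move=> K0 ba; have d0 : 0 <= a - b by rewrite subr_ge0.
  rewrite (ger0_norm d0); apply: ler_wpM2l => //.
  have h1 := ler_wpM2l K0 ba.
  have h2 := ler_norm (c - e); have h3 := normr_ge0 (c - e).
  move: h1 h2 h3; move: (K * a) (K * b) `|_| => a' b' f h1 h2 h3.
  by have [q1|q1] := leP 0 (c - a'); have [q2|q2] := leP 0 (e - b'); lra.
have K0 : 0 <= k.+1%:R :> R by [].
have [uu|/ltW uu] := leP (u z.2) (u z.1); first exact: h.
have := h _ _ _ (eta z.2) (eta z.1) K0 uu; rewrite (distrC (u z.2)) (distrC (eta z.2)) => h2.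
by apply: le_trans h2; rewrite -opprB -[X in _ * X <= _]opprB mulrNN.
Qed.

Let phi_lim x : phi k x @[k --> \oo] --> phio x.
Proof.
rewrite /phio; have [ux|ux] := eqVneq (u x) 0.
  rewrite /phi ux; under eq_fun do rewrite mulr0 subr0 (max_r (e0 x)).
  exact: cvg_cst.
have up : 0 < u x by rewrite lt_neqAle eq_sym ux u0.
apply/cvgrPdist_le => e e00; exists (Num.bound (eta x / u x)) => // k /= kN.
suff -> : phi k x = 0 by rewrite subrr normr0 ltW.
rewrite /phi max_l// subr_le0 -ler_pdivrMr//.
apply: le_trans (ltW (archi_boundP (divr_ge0 (e0 x) (ltW up)))) _; rewrite ler_nat; exact: leqW.
Qed.

(** [phio] lives where [u] attains its minimum [0], so when only one of the two points is a zero of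
    [u] the two increments have opposite signs. *)
Let gq_phio z : gq s u phio z <= 0.
Proof.
have k0 : 0 <= (gag_kernel s z.1 z.2)^-1 by rewrite invr_ge0 gag_ge0.
rewrite /gq mulr_le0_ge0// /phio.
have := u0 z.1; have := u0 z.2; have := e0 z.1; have := e0 z.2.
move: (u z.1) (u z.2) (eta z.1) (eta z.2) => a b c e e1 c1 b0 a0.
have [->|an] := eqVneq a 0; have [->|bn] := eqVneq b 0; rewrite ?subrr ?mul0r ?mulr0// ?subr0 ?sub0r.
  by rewrite mulNr oppr_le0 mulr_ge0.
by rewrite mulrN oppr_le0 mulr_ge0.
Qed.

(* Test with [(eta - (k + 1) u)^+] and let [k] tend to infinity; on the set
   [u = 0] only the nonlocal interaction with [u > 0] survives. *)
Lemma super_null : {ae m6, forall z, gq s u phio z = 0}.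
Proof.
have Ld : L1 m6 (fun z => `|gq s u eta z|) by apply: L1_abs; exact: L1_gq Hu He.
pose f k z := `|gq s u eta z| - gq s u (phi k) z.
have Lf k : L1 m6 (f k) := L1B Ld (L1_gq Hu (phi_inH k)).
have f0 k z : 0 <= f k z by rewrite /f subr_ge0; exact: gq_phi.
set I := Int m6 (fun z => `|gq s u eta z|); pose A := Int m3 (fun x : T3 => W x * eta x ^+ 2).
have If k : Int m6 (f k) <= I + A / k.+1%:R.
  rewrite (IntB Ld (L1_gq Hu (phi_inH k))) lerD2l lerNl.
  have := super (phi_inH k) (phi_ge0 k); rewrite /hform.
  have : Int m3 (fun x : T3 => W x * u x * phi k x) <= A / k.+1%:R.
    rewrite mulrC -(IntZ _ (inH_W He)); apply: Int_le; [exact: (L1_W Hu (phi_inH k))|exact: (L1Z _ (inH_W He))|].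
    move=> x; rewrite mulrCA -mulrA; apply: ler_wpM2l; first exact: wt_ge0.
    rewrite ler_pdivlMl// mulrA /phi.
    have := u0 x; have := e0 x; move: (u x) (eta x) (k.+1%:R : R) (ltr0n R k.+1) => a b K; rewrite ltnS leq0n => K0 b0 a0.
    have [h|h] := leP (b - K * a) 0; first by rewrite mulr0 sqr_ge0.
    have Ka : 0 <= K * a by rewrite mulr_ge0// ltW.
    rewrite expr2; apply: ler_pM => //; [exact: ltW|by rewrite ltW// -subr_gt0|by rewrite gerBl].
  by move=> h1 h2; rewrite lerNl; apply: le_trans h1; rewrite -subr_ge0 opprK addrC.
have mf : measurable_fun setT (fun z => `|gq s u eta z| - gq s u phio z).
  apply: measurable_funB; first exact: L1_meas Ld.
  apply: m_gq; first exact: inH_m Hu.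
  apply: measurable_fun_if => //; [|by apply: measurable_funTS; exact: inH_m He].
  by apply: measurable_fun_eqr; [exact: inH_m Hu|exact: measurable_cst].
have lim z : f k z @[k --> \oo] --> `|gq s u eta z| - gq s u phio z.
  apply: cvgB; first exact: cvg_cst.
  rewrite /gq; apply: cvgMl; apply: cvgMr; apply: cvgB; exact: phi_lim.
have f1 z : 0 <= `|gq s u eta z| - gq s u phio z.
  by rewrite subr_ge0; apply: le_trans (gq_phio z) _.
have key n : L1 m6 (fun z => `|gq s u eta z| - gq s u phio z) /\ Int m6 (fun z => `|gq s u eta z| - gq s u phio z) <= I + A / n.+1%:R.
  apply: (fatou_bound (f_ := fun k => f (k + n)%N)) => //.
    move=> k; apply: le_trans (If _) _; rewrite lerD2l ler_wpM2l//.
      by apply: Int_ge0 => x; rewrite mulr_ge0 ?sqr_ge0// wt_ge0.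
    by rewrite lef_pV2 ?posrE// ler_nat ltnS leq_addl.
  by apply: aeW => z; have := lim z; rewrite -(cvg_shiftn n).
have [L _] := key 0%N.
have Lo : L1 m6 (fun z => - gq s u phio z).
  apply: eq_L1 (L1B L Ld) => z; ring.
have Io : Int m6 (fun z => - gq s u phio z) = 0.
  apply/eqP; rewrite eq_le Int_ge0 ?andbT; last by move=> z; rewrite oppr_ge0.
  apply/ler_addgt0Pl => e e00; rewrite addr0.
  have A0 : 0 <= A by apply: Int_ge0 => x; rewrite mulr_ge0 ?sqr_ge0// wt_ge0.
  have q0 : 0 < e / (A + 1) by rewrite divr_gt0// ltr_wpDl.
  have [N hN] := small_inv q0; have [_ h] := key N.
  have E : Int m6 (fun z => `|gq s u eta z| - gq s u phio z) = I + Int m6 (fun z => - gq s u phio z) by rewrite -(IntD Ld Lo).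
  rewrite E lerD2l in h; apply: le_trans h _; have := hN N (leqnn _).
  move=> h2; apply: le_trans (ler_wpM2l A0 h2) _.
  by rewrite mulrCA ler_piMr ?(ltW e00)// ler_pdivrMr ?ltr_wpDl// mul1r lerDl.
apply: aeS (Int_eq0 Lo _ Io) => z; last by rewrite oppr_ge0.
by move=> /eqP; rewrite oppr_eq0 => /eqP.
Qed.

(** [super_null] forces [u x * phio y = 0] for almost every pair, and the integral of the squares
    factorizes; as [u] has positive mass, [phio] vanishes almost everywhere. *)
Lemma super_pos_on : 0 < Int m3 (fun x : T3 => u x ^+ 2) -> {ae m3, forall x, u x = 0 -> eta x = 0}.
Proof.
move=> I0.
pose h2 (y : T3) : R := phio y ^+ 2.
have mphio : measurable_fun setT (phio : T3 -> R).
  apply: measurable_fun_if => //; [|by apply: measurable_funTS; exact: inH_m He].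
  by apply: measurable_fun_eqr; [exact: inH_m Hu|exact: measurable_cst].
have L2 : L1 m3 h2.
  apply: (L1_dom (g := fun x : T3 => eta x ^+ 2)); [exact: measurable_funX|exact: inH_2 He|].
  by move=> x; rewrite /h2 /phio; case: ifP => _; rewrite ger0_norm ?sqr_ge0// expr0n sqr_ge0.
pose F (z : T3 * T3) : R := u z.1 ^+ 2 * h2 z.2.
have F0 : {ae m6, forall z, (fun=> 0) z = F z}.
  apply: aeS super_null => z; rewrite /gq /F /h2 /phio.
  have [->|ux] := eqVneq (u z.1) 0; first by rewrite expr0n mul0r.
  have [uy|uy] := eqVneq (u z.2) 0; last by rewrite expr0n mulr0.
  rewrite uy subr0 sub0r => /eqP; rewrite mulf_eq0 invr_eq0 => /orP[|/eqP g0].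
    by rewrite mulf_eq0 (negbTE ux) oppr_eq0 /= => /eqP ->; rewrite expr0n mulr0.
  have := @gag_gt0 R s z.1 z.2; rewrite g0 ltxx => h; exfalso.
  by have := h (fun E => ltac:(by rewrite E uy eqxx in ux)).
have mF : measurable_fun setT F.
  apply: measurable_funM; first by apply: measurable_funX; exact: m_fst (inH_m Hu).
  exact: m_snd (L1_meas L2).
have [LF IF] := ae_Int_eq (L1_0 _) mF F0.
have [_ EF _] := L1_fubini LF.
have E2 : Int m3 (fun x : T3 => Int m3 (fun y : T3 => F (x, y))) = Int m3 h2 * Int m3 (fun x : T3 => u x ^+ 2).
  rewrite -(IntZ _ (inH_2 Hu)); apply: eq_Int => x; rewrite /F /= (IntZ _ L2) mulrC//.
have Ih : Int m3 h2 = 0.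
  by apply/eqP; rewrite -(mulIr_eq0 _ (mulIf (lt0r_neq0 I0))) -E2 EF IF Int0.
apply: aeS (Int_eq0 L2 (fun x => sqr_ge0 _) Ih) => x; rewrite /h2 /phio => h ux.
by move: h; rewrite ux eqxx => /eqP; rewrite sqrf_eq0 => /eqP.
Qed.
End Positivity.

Section CriticalPoint.
Variables (R : realType) (d : pdata R).
Notation RR := (measurableTypeR R).
Notation T3 := (RR * RR * RR)%type.
Notation m3 := (mu3 R).
Notation s := (ds d).
Variables (W : weight (dV d)) (O : set T3).
Hypotheses (mO : measurable O) (WB : forall r : R, exists C : R, forall x : pt R, `|x| <= r -> W x <= C).

(** Testing with the negative part [n] shows that it has norm [0], since [f] vanishes on negative
    arguments. The form does not see [n], so [v = u - n], nonnegative at every point, is a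
    supersolution to which [super_pos_on] applies. *)
Lemma crit_pos u : inH s W u -> 0 < NN W u ->
  (forall phi, inH s W phi -> dM d (NN W u) * hform s W u phi = psi d O u phi) -> {ae m3, forall x, 0 < u x}.
Proof.
move=> Hu N0 crit; have M0 := dM_gt0 d (NN W u).
pose n x : R := Num.min 0 (u x).
have n2 x : n x ^+ 2 = u x * n x.
  by rewrite /n; have [h|h] := leP 0 (u x); rewrite ?expr0n ?mulr0// expr2.
have Hn : inH s W n.
  apply: (inH_dom (C := 1) _ Hu Hu).
  - by apply: measurable_minr; [exact: measurable_cst|exact: inH_m Hu].
  - move=> x; rewrite n2 /n; have [h|h] := leP 0 (u x); rewrite ?mulr0 ?mul1r ?addr_ge0 ?sqr_ge0//.
    by rewrite -expr2 lerDl sqr_ge0.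
  - move=> x y; rewrite mul1r; apply: (@le_trans _ _ ((u x - u y) ^+ 2)); last by rewrite lerDl sqr_ge0.
    rewrite -[leLHS]real_normK ?num_real// -[leRHS]real_normK ?num_real// ler_sqr ?nnegrE//.
    rewrite /n; move: (u x) (u y) => a b.
    have := ler_norm (a - b); have := ler_norm (b - a); rewrite (distrC b a).
    by have [h1|h1] := leP 0 a; have [h2|h2] := leP 0 b; rewrite ler_norml => *; apply/andP; split; lra.
have hn : hform s W u n = 0.
  have := crit n Hn; have -> : psi d O u n = 0.
    rewrite /psi -(Int0 m3); apply: eq_Int => x; rewrite /n; have [h|h] := leP 0 (u x); first by rewrite mulr0.
    by rewrite (sc_neg (gO_scal d O x) (ltW h)) mul0r.
  by move/eqP; rewrite mulf_eq0 (gt_eqF M0) => /eqP.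
have Nn : NN W n = 0.
  apply/eqP; rewrite eq_le NN_ge0 andbT -hn /NN /hform; apply: lerD.
    apply: Int_le; [exact: inH_g Hn|exact: L1_gq Hu Hn|].
    move=> z; rewrite /gq ler_wpM2r ?invr_ge0 ?gag_ge0//.
    rewrite /n; move: (u z.1) (u z.2) => a b.
    have [h1|h1] := leP 0 a; have [h2|h2] := leP 0 b; rewrite ?subrr ?mulr0// ?sub0r ?subr0.
      by have := mulr_ge0 h1 (ltac:(by rewrite oppr_ge0 ltW) : 0 <= - b); lra.
    by have := mulr_ge0 h2 (ltac:(by rewrite oppr_ge0 ltW) : 0 <= - a); lra.
  apply: Int_le; [exact: (L1_W Hn Hn)|exact: (L1_W Hu Hn)|] => x.
  by rewrite -!mulrA -n2 -expr2.
have nz (phi : pt R -> R) : inH s W phi -> hform s W n phi = 0.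
  by move=> Hp; exact: (psd_eq0 (Hform_psd s W) (u := toH Hn) (toH Hp)).
pose v x := u x - n x.
have Hv : inH s W v := inHB Hu Hn.
have v0 x : 0 <= v x by rewrite /v /n; have [h|h] := leP 0 (u x); rewrite ?subr0// subrr.
have uv : u = (fun x => v x + n x) by apply/funext => x; rewrite /v subrK.
have hv phi : inH s W phi -> hform s W u phi = hform s W v phi.
  by move=> Hp; rewrite {1}uv (hformD Hv Hn Hp) nz// addr0.
have super phi : inH s W phi -> (forall x, 0 <= phi x) -> 0 <= hform s W v phi.
  move=> Hp p0; rewrite -hv// -(pmulr_rge0 _ M0) crit//; apply: Int_ge0 => x.
  apply: mulr_ge0; last exact: p0.
  have [h|h] := leP 0 (u x); first by apply: (sc_pos (gO_scal d O x)).
  by rewrite (sc_neg (gO_scal d O x) (ltW h)).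
have I0 : 0 < Int m3 (fun x : T3 => v x ^+ 2).
  rewrite lt_neqAle Int_ge0 ?andbT; last by move=> x; exact: sqr_ge0.
  apply/eqP => /esym E; have E2 := Int_eq0 (inH_2 Hv) (fun x => sqr_ge0 _) E.
  have E3 := form_eq0_ae Hn Nn.
  have E4 : {ae m3, forall x, u x = 0}.
    apply: aeS (aeI E2 E3) => x [/eqP]; rewrite sqrf_eq0 => /eqP h1 h2.
    by rewrite uv h1 h2 addr0.
  by move: N0; rewrite (NN_ae0 Hu E4) ltxx.
(* Cutoffs of integer radius exhaust the space, so countably many null sets suffice. *)
have E k : {ae m3, forall x, v x = 0 -> @cutoff R k.+1%:R x = 0}.
  have k0 : 0 < k.+1%:R :> R by [].
  have [C hC] := WB (2 * k.+1%:R).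
  apply: (@super_pos_on R s (dV d) W v (cutoff k.+1%:R)) => //; first exact: inH_cutoff k0 hC.
  by move=> x; have /andP[] := cutoff01 k.+1%:R x.
have E3 := form_eq0_ae Hn Nn.
apply: aeS (aeI (ae_foralln E) E3) => x [h h3].
have vx : v x != 0.
  apply/eqP => vx; have := h (Num.bound `|x|) vx; rewrite cutoff_in//.
    by move/eqP; rewrite oner_eq0.
  apply: le_trans (ltW (archi_boundP (normr_ge0 _))) _; rewrite ler_nat; exact: leqnSn.
by rewrite uv h3 addr0 lt_neqAle eq_sym vx v0.
Qed.
End CriticalPoint.

(** * The nonlinearity and the Kirchhoff function *)

Section Primitive.
Variables (R : realType) (f : R -> R).
Hypotheses (cf : continuous f) (fneg : forall t, t <= 0 -> f t = 0).
Notation F := (primitive f).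

Lemma primitive_le0 t : t <= 0 -> F t = 0.
Proof.
rewrite le_eqVlt => /predU1P[->|t0]; rewrite /primitive.
  by rewrite set_itv1 Rintegral_set1.
by rewrite set_itv_ge ?Rintegral_set0// bnd_simp -ltNge.
Qed.

Lemma itv_integrable (a b : R) : (@lebesgue_measure R).-integrable `[a, b] (EFin \o f).
Proof.
apply: continuous_compact_integrable; first exact: segment_compact.
by apply: continuous_subspaceT => x; exact: (@cf x).
Qed.

Lemma primitive_derive_gt0 (t : R) : 0 < t -> is_derive t 1 F (f t).
Proof.
move=> t0; have [dF EF] := @continuous_FTC1_closed R f 0 t (t + 1) (ltac:(by rewrite ltrDl)) (itv_integrable 0 (t + 1)) t0 (@cf t).
exact: (DeriveDef dF (etrans (esym (derive1E _ _)) EF)).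
Qed.

(** The interval [[0, t]] is empty for negative [t], so the two sides of [0] are treated separately.
    At [0] the derivative comes from the mean value theorem and the continuity of [f]. *)
Lemma primitive_derive (t : R) : is_derive t 1 F (f t).
Proof.
have [t0|t0|t0] := ltgtP t 0; last first.
- rewrite t0 fneg//; apply: is_derive_eps => e e0.
  have /cvgrPdist_le /(_ _ e0) /nbhs_ballP[r /= r0 hr] := @cf 0.
  exists (r / 2); first by rewrite divr_gt0.
  move=> h hr2; rewrite add0r (primitive_le0 (lexx 0)) mul0r !subr0.
  have [h0|h0] := leP h 0; first by rewrite primitive_le0// normr0 mulr_ge0// ltW.
  have cF : {within `[0, h], continuous F} by apply: parameterized_integral_continuous; [exact: ltW|exact: itv_integrable].
  have [|c] := MVT h0 _ cF (df := f); first by move=> x; rewrite in_itv/= => /andP[x0 _]; exact: primitive_derive_gt0.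
  rewrite in_itv/= => /andP[c0 ch]; rewrite (primitive_le0 (lexx 0)) !subr0 => ->.
  rewrite normrM ler_wpM2r//; have := hr c; rewrite fneg// sub0r normrN; apply.
  rewrite /ball /= sub0r normrN (gtr0_norm c0); rewrite (gtr0_norm h0) in hr2; lra.
- exact: primitive_derive_gt0.
- rewrite fneg; last exact: ltW.
  apply: is_derive_eps => e e0; exists (- t / 2); first by rewrite divr_gt0// oppr_gt0.
  move=> h; rewrite ler_norml => /andP[_ h1]; rewrite !primitive_le0; [|exact: ltW|lra].
  by rewrite subrr mul0r subrr normr0 mulr_ge0// ltW.
Qed.
End Primitive.

Section Nonlinearity.
Variables (R : realType) (q p th V0 K a : R) (f : R -> R).
Hypotheses (cf : continuous f) (fneg : forall t, t < 0 -> f t = 0).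
Hypotheses (f1 : f t / t ^+ 3 @[t --> 0^'+] --> 0) (q4 : 4 < q) (qp : q <= p).
Hypothesis f2 : f t / t `^ (q - 1) @[t --> +oo] --> 0.
Hypotheses (th4 : 4 < th) (f3 : forall t, 0 < t -> 0 < th * primitive f t /\ th * primitive f t <= f t * t).
Hypothesis f4 : forall t1 t2, 0 < t1 -> t1 <= t2 -> f t1 / t1 ^+ 3 <= f t2 / t2 ^+ 3.
Hypotheses (V00 : 0 < V0) (K0 : 0 < K) (a0 : 0 < a) (fa : f a = V0 * a / K).
Notation ft := (ftilde f V0 K a).
Let k := V0 / K.

Lemma f_0 : f 0 = 0.
Proof.
apply/eqP; rewrite -normr_le0; apply/ler_addgt0Pl => e e0; rewrite addr0.
have /cvgrPdist_le /(_ _ e0) /nbhs_ballP[r /= r0 hr] := @cf 0.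
have E : f (- (r / 2)) = 0 by rewrite fneg// oppr_lt0 divr_gt0.
have := hr (- (r / 2)); rewrite E subr0; apply.
by rewrite /ball /= sub0r opprK gtr0_norm ?divr_gt0//; move: r0; clear -cf fneg f1 q4 qp f2 th4 f3 f4 V00 K0 a0 fa; lra.
Qed.

Lemma f_neg t : t <= 0 -> f t = 0.
Proof. by rewrite le_eqVlt => /predU1P[->|]; [exact: f_0|exact: fneg]. Qed.

Lemma f_pos t : 0 < t -> 0 < f t.
Proof.
move=> t0; have [h1 h2] := f3 t0; have := lt_le_trans h1 h2.
by rewrite pmulr_lgt0.
Qed.

Lemma k_gt0 : 0 < k. Proof. exact: divr_gt0. Qed.
Lemma faE : f a = k * a. Proof. by rewrite fa /k mulrAC. Qed.

Lemma f_le_a t : 0 < t -> t <= a -> f t <= k * t.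
Proof.
move=> t0 ta; have := f4 t0 ta; rewrite faE ler_pdivrMr ?exprn_gt0// => /le_trans; apply.
have -> : k * a / a ^+ 3 * t ^+ 3 = k * t * (t / a) ^+ 2 by field; rewrite gt_eqF.
have kt : 0 <= k * t := mulr_ge0 (ltW k_gt0) (ltW t0).
have r0 : 0 <= t / a := divr_ge0 (ltW t0) (ltW a0).
by apply: ler_piMr => //; rewrite expr_le1// ler_pdivrMr// mul1r.
Qed.

Lemma f_ge_a t : a <= t -> k * t <= f t.
Proof.
move=> ta; have t0 := lt_le_trans a0 ta; have := f4 a0 ta.
rewrite faE ler_pdivlMr ?exprn_gt0//; apply: le_trans.
have -> : k * a / a ^+ 3 * t ^+ 3 = k * t * (t / a) ^+ 2 by field; rewrite gt_eqF.
have kt : 0 <= k * t := mulr_ge0 (ltW k_gt0) (ltW t0).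
by apply: ler_peMr => //; rewrite exprn_ege1// ler_pdivlMr// mul1r.
Qed.

Lemma ftE t : ft t = f (Num.min t a) + k * Num.max 0 (t - a).
Proof.
rewrite /ftilde; have [ta|ta] := leP t a.
  by rewrite max_l ?subr_le0// mulr0 addr0.
rewrite max_r ?subr_ge0 ?(ltW ta)// faE /k; field; exact: lt0r_neq0.
Qed.

Lemma ft_c : continuous ft.
Proof.
have -> : ft = (fun t => f (Num.min t a) + k * Num.max 0 (t - a)) by apply/funext => t; exact: ftE.
move=> t; apply: cvgD.
  have cm : continuous (fun t : R => Num.min t a).
    by move=> x; apply: continuous_min; [exact: cvg_id|exact: cst_continuous].
  by apply: continuous_comp; [exact: cm|exact: cf].
apply: cvgMr; apply: (continuous_max (f := fun=> 0 : R^o) (g := fun t : R => t - a : R^o)); first exact: cst_continuous.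
by apply: cvgB; [exact: cvg_id|exact: cvg_cst].
Qed.

Lemma scal_small (h : R -> R) : (forall t, t <= a -> h t = f t) ->
  forall l : R, 0 < l -> exists2 d : R, 0 < d & forall t, `|t| <= d -> `|h t| <= l * `|t|.
Proof.
move=> hf l l0; have /cvgrPdist_le /(_ _ l0) [r /= r0 hr] := f1.
pose d := Num.min (Num.min (r / 2) 1) a.
have d0 : 0 < d by rewrite !lt_min divr_gt0// ltr01.
exists d => // t td; have td2 : `|t| <= a by apply: le_trans td _; rewrite ge_min lexx orbT.
rewrite hf; last exact: le_trans (ler_norm t) td2.
have [t0|t0] := leP t 0; first by rewrite f_neg// normr0 mulr_ge0// ltW.
rewrite (gtr0_norm t0) in td *; move: td; rewrite !le_min => /andP[/andP[t1 t2] _].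
have := hr t; rewrite /= sub0r normrN (gtr0_norm t0) sub0r normrN => /(_ (ltac:(lra)) t0).
rewrite normrM normfV (gtr0_norm (exprn_gt0 3 t0)) ler_pdivrMr ?exprn_gt0// => /le_trans; apply.
rewrite ler_pM2l// exprS ler_piMr ?(ltW t0)// expr_le1// ltW//.
Qed.

Lemma scal_f : scal p f (primitive f).
Proof.
split.
- exact: cf.
- exact: scal_small.
- move=> l l0; have /cvgrPdist_le /(_ _ l0) [T [_ hT]] := f2.
  exists (`|T| + 1); first by rewrite ltr_wpDl.
  move=> t tT; have [t0|t0] := leP t 0; first by rewrite f_neg// normr0 mulr_ge0 ?powR_ge0// ltW.
  rewrite (gtr0_norm t0) in tT *.
  have Tt : T < t by apply: le_lt_trans (ler_norm T) _; apply: lt_le_trans tT; rewrite ltrDl.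
  have t1 : 1 <= t by apply: le_trans tT; rewrite lerDr.
  have := hT t Tt; rewrite sub0r normrN normrM normfV (ger0_norm (powR_ge0 _ _)) ler_pdivrMr ?powR_gt0// => /le_trans; apply.
  by rewrite ler_pM2l//; apply: ler_powR => //; rewrite lerD2r.
- exact: f_neg.
- by move=> t; have [t0|t0] := leP t 0; [rewrite f_neg|exact: ltW (f_pos t0)].
- by move=> t; apply: primitive_derive => // x; exact: f_neg.
- by move=> t; exact: primitive_le0.
Qed.

Lemma ft_neg t : t <= 0 -> ft t = 0.
Proof. by move=> t0; rewrite /ftilde (le_trans t0 (ltW a0)) f_neg. Qed.

Lemma ft_k t : 0 <= t -> ft t <= k * t.
Proof.
rewrite le_eqVlt => /predU1P[<-|t0]; first by rewrite ft_neg// mulr0.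
by rewrite /ftilde; have [ta|ta] := leP t a; [exact: f_le_a|rewrite /k mulrAC].
Qed.

Lemma ft_ge0 t : 0 <= ft t.
Proof.
have [t0|t0] := leP t 0; first by rewrite ft_neg.
rewrite /ftilde; case: ifP => _; first exact: ltW (f_pos t0).
by rewrite divr_ge0 ?mulr_ge0// ltW.
Qed.

Lemma ft_f t : ft t <= f t.
Proof.
rewrite /ftilde; have [ta|ta] := leP t a => //.
by have := f_ge_a (ltW ta); rewrite /k mulrAC.
Qed.

Lemma scal_ft : scal p ft (primitive ft).
Proof.
have kk := k_gt0.
split.
- exact: ft_c.
- by apply: scal_small => t ta; rewrite /ftilde ta.
- move=> l l0; pose T := Num.max 1 (k / l).
  have T1 : 1 <= T by rewrite le_max lexx.
  exists T; first exact: lt_le_trans T1.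
  move=> t tT; have [t0|t0] := leP t 0; first by rewrite ft_neg// normr0 mulr_ge0 ?powR_ge0// ltW.
  rewrite (gtr0_norm t0) in tT *; rewrite ger0_norm ?ft_ge0//.
  apply: le_trans (ft_k (ltW t0)) _.
  have t1 : 1 <= t := le_trans T1 tT.
  have kt : k <= l * t by rewrite mulrC -ler_pdivrMr//; apply: le_trans tT; rewrite le_max lexx orbT.
  apply: (@le_trans _ _ (l * t * t)); first by rewrite ler_pM2r.
  rewrite -mulrA ler_pM2l// -expr2 -powR_mulrn ?(ltW t0)//.
  by apply: ler_powR => //; have := q4; have := qp; lra.
- exact: ft_neg.
- exact: ft_ge0.
- by move=> t; apply: primitive_derive; [exact: ft_c|exact: ft_neg].
- by move=> t; exact: primitive_le0.
Qed.

(** Past [a] the quotient is [k / t^2] and decreases. The correction on the left is exactly its drop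
    between [t1] and [t2], and [ft t <= k * t] handles a [t1] below [a]. *)
Lemma ft_4 (t1 t2 : R) : 0 < t1 -> t1 <= t2 -> ft t1 / t1 ^+ 3 - k * ((t1 ^+ 2)^-1 - (t2 ^+ 2)^-1) <= ft t2 / t2 ^+ 3.
Proof.
move=> t10 t12; have t20 := lt_le_trans t10 t12; have kk := k_gt0.
have tt : 0 <= (t1 ^+ 2)^-1 - (t2 ^+ 2)^-1.
  by rewrite subr_ge0 lef_pV2 ?posrE ?exprn_gt0// ler_sqr ?nnegrE ?(ltW t10) ?(ltW t20).
rewrite {2}/ftilde; have [ta|ta] := leP t2 a.
  rewrite /ftilde (le_trans t12 ta); have := f4 t10 t12; have := mulr_ge0 (ltW kk) tt; lra.
have -> : V0 * t2 / K / t2 ^+ 3 = k * (t2 ^+ 2)^-1 by rewrite /k; field; rewrite !gt_eqF.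
rewrite mulrBr opprB addrCA gerDl subr_le0 ler_pdivrMr ?exprn_gt0//.
have -> : k / t1 ^+ 2 * t1 ^+ 3 = k * t1 by field; rewrite gt_eqF.
exact: ft_k (ltW t10).
Qed.

Lemma prim_le (h g : R -> R) (x y : R) (H G : R -> R) : (forall t : R, is_derive t 1 H (h t)) -> (forall t : R, is_derive t 1 G (g t)) ->
  x <= y -> (forall t, x <= t -> h t <= g t) -> H y - H x <= G y - G x.
Proof.
move=> dH dG xy hg; have dD (t : R) : is_derive t 1 (fun t => G t - H t) (g t - h t).
  exact: is_deriveB (dG t) (dH t).
have [c [_ c1 _]] := mean_value dD x y; rewrite min_l// in c1.
have : 0 <= (g c - h c) * (y - x) by rewrite mulr_ge0 ?subr_ge0//; exact: hg.
by move=> h1 h2; rewrite -subr_ge0; move: h1; rewrite -h2; lra.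
Qed.

Lemma F_4 t : 4 * primitive f t <= f t * t.
Proof.
have [t0|t0] := leP t 0; first by rewrite primitive_le0// f_neg// mul0r mulr0.
have [h1 h2] := f3 t0; apply: le_trans h2; rewrite ler_wpM2r//; last exact: ltW.
by move: h1; rewrite pmulr_rgt0 ?(lt_trans _ th4)// => /ltW.
Qed.

Lemma Ft_F t : primitive ft t <= primitive f t.
Proof.
have [t0|t0] := leP t 0; first by rewrite !primitive_le0.
have := prim_le (sc_H scal_ft) (sc_H scal_f) (ltW t0) (fun t _ => ft_f t).
by rewrite !(@primitive_le0 _ _ 0)// !subr0.
Qed.

Lemma is_derive_sqr (c t : R) : is_derive t 1 (fun t : R => c * t ^+ 2) (c * 2 * t).
Proof.
apply: is_derive_eps => e e0; pose r := e / (`|c| + 1).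
have r0 : 0 < r by rewrite divr_gt0// ltr_wpDl.
exists r => // h hr; have -> : c * (t + h) ^+ 2 - c * t ^+ 2 - c * 2 * t * h = c * h * h by ring.
rewrite !normrM ler_wpM2r//; apply: (@le_trans _ _ (`|c| * r)); first by rewrite ler_wpM2l.
by rewrite /r mulrCA ler_piMr ?(ltW e0)// ler_pdivrMr ?ltr_wpDl// mul1r lerDl.
Qed.

(** Past [a] the primitive grows at most like [k t^2 / 2], so four times its value exceeds
    [ft t * t] by no more than [k t^2]; the definition of [cc] accounts for this loss. *)
Lemma Ft_4 t : 4 * primitive ft t <= ft t * t + k * t ^+ 2.
Proof.
have kk := k_gt0; have [t0|t0] := leP t 0.
  by rewrite primitive_le0// ft_neg// mul0r mulr0 add0r mulr_ge0 ?sqr_ge0// ltW.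
rewrite {2}/ftilde; have [ta|ta] := leP t a.
  have := F_4 t; have := Ft_F t; have := mulr_ge0 (ltW kk) (sqr_ge0 t); lra.
have dk' (x : R) : is_derive x 1 (fun t : R => k / 2 * t ^+ 2) (k * x).
  by have := is_derive_sqr (k / 2) x; rewrite divfK.
have h1 := prim_le (sc_H scal_ft) dk' (ltW ta) (fun t at_ => ft_k (le_trans (ltW a0) at_)).
have h2 := F_4 a; have h3 := Ft_F a; rewrite faE in h2.
have -> : V0 * t / K * t = k * t ^+ 2 by rewrite /k; field; rewrite gt_eqF.
move: h1 h2 h3; rewrite expr2 => h1 h2 h3; have := mulr_ge0 (ltW kk) (sqr_ge0 a); rewrite expr2; lra.
Qed.

(** A cubic lower bound is integrated and fed into (f_3), which improves the constant by the factor
    [th / 4 > 1]. Half of the gain is given up to absorb the contribution of the lower end [T]. *)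
Lemma f_growth (c T : R) : 0 < c -> 0 < T -> (forall t, T <= t -> c * t ^+ 3 <= f t) ->
  exists2 T' : R, 0 < T' & forall t, T' <= t -> c * ((1 + th / 4) / 2) * t ^+ 3 <= f t.
Proof.
move=> c0 T0 hT; have th0 : 0 < th by apply: lt_trans th4.
(* From [S * T] on, the given half of the gain outweighs [th * T^4], as [2 th <= S (th - 4)]. *)
pose S := Num.max 1 (2 * th / (th - 4)); have S1 : 1 <= S by rewrite le_max lexx.
have thS : 2 * th <= S * (th - 4) by rewrite -ler_pdivrMr ?subr_gt0// le_max lexx orbT.
have S0 : 0 < S by exact: lt_le_trans S1.
exists (S * T) => [|t St]; first exact: mulr_gt0.
have Tt : T <= t by apply: le_trans St; rewrite ler_peMl// ltW.
have t0 := lt_le_trans T0 Tt.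
have dc (x : R) : is_derive x 1 (fun t : R => c / 4 * t ^+ 4) (c * x ^+ 3).
  have h1 := is_derive_sqr (c / 4) (1 * x ^+ 2); have h2 := is_derive_sqr 1 x.
  have -> : (fun t : R => c / 4 * t ^+ 4) = (fun t : R => c / 4 * t ^+ 2) \o (fun t : R => 1 * t ^+ 2).
    by apply/funext => y /=; ring.
  have h3 := @is_derive1_comp R (fun t : R => c / 4 * t ^+ 2) (fun t : R => 1 * t ^+ 2) x _ _ h1 h2.
  by apply: is_derive_eq; rewrite /GRing.scale /=; field.
have h1 := prim_le dc (sc_H scal_f) Tt hT.
have [_ h2] := f3 t0.
have FT : 0 < primitive f T by have [+ _] := f3 T0; rewrite pmulr_rgt0.
have h4 : S * T ^+ 4 <= t ^+ 4.
  have : (S * T) ^+ 4 <= t ^+ 4 by rewrite ler_pXn2r ?nnegrE ?(ltW t0)// mulr_ge0// ltW.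
  apply: le_trans; rewrite exprMn ler_pM2r ?exprn_gt0// exprS ler_peMr ?(ltW S0)// exprn_ege1//.
have h5 : th * (c / 4 * t ^+ 4 - c / 4 * T ^+ 4) <= f t * t.
  apply: le_trans h2; rewrite ler_pM2l//; apply: le_trans h1 _; rewrite gerBl ltW//.
rewrite -(ler_pM2r t0); apply: le_trans h5.
have -> : c * ((1 + th / 4) / 2) * t ^+ 3 * t = c * (1 / 2 + th / 8) * t ^+ 4 by field.
have h6 : th * T ^+ 4 * 2 <= (th - 4) * t ^+ 4.
  rewrite -(ler_pM2l S0); have := ler_wpM2r (exprn_ge0 4 (ltW t0)) thS.
  have := ler_wpM2l (mulr_ge0 (ltW th0) (ler0n R 2)) h4.
  move: (T ^+ 4) (t ^+ 4) => X Y; clear -cf fneg f1 q4 qp f2 th4 f3 f4 V00 K0 a0 fa; lra.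
have := ler_wpM2l (ltW c0) h6; move: (T ^+ 4) (t ^+ 4) => X Y; clear -cf fneg f1 q4 qp f2 th4 f3 f4 V00 K0 a0 fa; lra.
Qed.

(** The improvement of [f_growth] is iterated from the constant [f 1] given by (f_4); Bernoulli's
    inequality shows that the constants are unbounded. *)
Lemma f_oo (C : R) : exists2 T : R, 0 < T & forall t, T <= t -> C * t ^+ 3 <= f t.
Proof.
have c0 : 0 < f 1 by exact: f_pos.
have l1 : 0 < (1 + th / 4) / 2 - 1 by move: th4; clear -cf fneg f1 q4 qp f2 th4 f3 f4 V00 K0 a0 fa; lra.
set lam := (1 + th / 4) / 2 in l1.
have gr n : exists2 T : R, 0 < T & forall t, T <= t -> f 1 * lam ^+ n * t ^+ 3 <= f t.
  elim: n => [|n [T T0 hT]].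
    exists 1 => // t t1; rewrite expr0 mulr1; have t0 := lt_le_trans ltr01 t1.
    by rewrite -ler_pdivlMr ?exprn_gt0//; have := f4 ltr01 t1; rewrite expr1n divr1.
  have ln0 : 0 < f 1 * lam ^+ n by rewrite mulr_gt0// exprn_gt0//; move: l1; clear -cf fneg f1 q4 qp f2 th4 f3 f4 V00 K0 a0 fa; lra.
  by have [T' T'0 h] := f_growth ln0 T0 hT; exists T' => // t tT; rewrite exprSr (mulrA (f 1)); exact: (h t tT).
have bern n : 1 + n%:R * (lam - 1) <= lam ^+ n.
  elim: n => [|n IH]; first by rewrite mul0r addr0.
  have l0 : 0 <= lam by move: l1; clear -cf fneg f1 q4 qp f2 th4 f3 f4 V00 K0 a0 fa; lra.
  have := ler_wpM2l l0 IH; rewrite -exprS; apply: le_trans.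
  have := mulr_ge0 (ler0n R n) (sqr_ge0 (lam - 1)); rewrite expr2 -natr1; move: (n%:R : R) => N; clear -cf fneg f1 q4 qp f2 th4 f3 f4 V00 K0 a0 fa; lra.
have [N hN] : exists N, C <= f 1 * (1 + N%:R * (lam - 1)).
  exists (Num.bound (`|C| / (f 1 * (lam - 1)))).
  have fl : 0 < f 1 * (lam - 1) by exact: mulr_gt0.
  have := archi_boundP (divr_ge0 (normr_ge0 C) (ltW fl)); rewrite ltr_pdivrMr// => /ltW h.
  apply: le_trans (ler_norm C) _; apply: le_trans h _.
  have E (N l F : R) : 0 < F -> N * (F * l) <= F * (1 + N * l).
    by move=> F0; have -> : F * (1 + N * l) = F + N * (F * l); [ring|rewrite lerDr ltW].
  exact: E.
have [T T0 hT] := gr N; exists T => // t tT; apply: le_trans (hT t tT).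
rewrite ler_wpM2r ?exprn_ge0 ?(ltW (lt_le_trans T0 tT))//; apply: le_trans hN _.
by rewrite ler_pM2l//; exact: bern.
Qed.
End Nonlinearity.

Section Data.
Variables (R : realType) (s m0 q th K a V0 : R) (M f : R -> R).

Lemma build_pdata : 3 / 4 < s -> s < 1 ->
  {within `[0, +oo[, continuous M} -> 0 < m0 -> (forall t, 0 <= t -> m0 <= M t) ->
  (forall t1 t2, 0 <= t2 -> t2 < t1 -> M t2 < M t1) ->
  (forall t1 t2, 0 < t2 -> t2 <= t1 -> M t1 / t1 - M t2 / t2 <= m0 * (1 / t1 - 1 / t2)) ->
  0 < V0 -> continuous f -> (forall t, t < 0 -> f t = 0) ->
  (f t / t ^+ 3 @[t --> 0^'+] --> 0) -> 4 < q -> q < 6 / (3 - 2 * s) ->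
  (f t / t `^ (q - 1) @[t --> +oo] --> 0) -> 4 < th ->
  (forall t, 0 < t -> 0 < th * primitive f t /\ th * primitive f t <= f t * t) ->
  (forall t1 t2, 0 < t1 -> t1 <= t2 -> f t1 / t1 ^+ 3 <= f t2 / t2 ^+ 3) ->
  2 / m0 < K -> 0 < a -> f a = V0 * a / K ->
  exists d : pdata R, [/\ ds d = s, dV d = V0, forall t, 0 <= t -> dM d t = M t, df d = f & dft d = ftilde f V0 K a].
Proof.
move=> s34 s1 cM m00 Mm Mi M3 V00 cf fneg f1 q4 q6 f2 th4 f3 f4 mK a0 fa.
have s0 : 0 < s by apply: lt_trans s34.
have K0 : 0 < K by apply: lt_trans mK; exact: divr_gt0.
have [p [A [qp LpA]]] := sobolev_exponent s0 (ltW s1) V00 s1 q6.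
pose Mx (t : R) := M (Num.max 0 t).
have mx0 (t : R) : 0 <= Num.max 0 t by rewrite le_max lexx.
have Mx_c : continuous Mx.
  move=> t; apply/cvgrPdist_le => e e0.
  have /subspace_continuousP cM' := cM.
  have t0 : `[0, +oo[%classic (Num.max 0 t) by rewrite /= in_itv/= mx0.
  have /cvgrPdist_le /(_ _ e0) := cM' _ t0; rewrite /= => h.
  have cm : continuous (fun x : R => Num.max 0 x).
    by move=> x; apply: (continuous_max (f := fun=> 0 : R^o) (g := fun t : R => t : R^o)); [exact: cst_continuous|exact: cvg_id].
  have h2 : nbhs t (fun x : R => `[0, +oo[%classic (Num.max 0 x) -> `|M (Num.max 0 t) - M (Num.max 0 x)| <= e).
    exact: cm t _ h.
  by apply: filterS h2 => x; apply; rewrite /= in_itv/= mx0.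
(* [primitive_derive] asks for a function vanishing on the nonpositive half-line; the constant [M 0]
   is integrated separately in [Mh]. *)
pose h (t : R) := Mx t - M 0.
have h_c : continuous h by move=> t; apply: cvgB; [exact: Mx_c|exact: cvg_cst].
have h_0 (t : R) : t <= 0 -> h t = 0 by move=> t0; rewrite /h /Mx max_l// subrr.
have MxE (t : R) : 0 <= t -> Mx t = M t by move=> t0; rewrite /Mx max_r.
pose Mh (t : R) := primitive h t + M 0 * t.
have Mh0 : Mh 0 = 0 by rewrite /Mh primitive_le0// mulr0 addr0.
have Mh_d (t : R) : is_derive t 1 Mh (Mx t).
  have h1 := primitive_derive h_c h_0 t.
  have h2 : is_derive t 1 (fun t : R => M 0 * t) (M 0).
    apply: is_derive_eps => e e0; exists 1 => // k _.
    have -> : M 0 * (t + k) - M 0 * t - M 0 * k = 0 by ring.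
    by rewrite normr0 mulr_ge0// ltW.
  have -> : Mx t = h t + M 0 by rewrite /h subrK.
  exact: is_deriveD.
have kk : 0 < V0 / K by exact: divr_gt0.
have km : 2 * (V0 / K) < m0 * V0.
  rewrite ltr_pdivrMr// in mK.
  have -> : 2 * (V0 / K) = 2 * V0 / K by rewrite mulrA.
  by rewrite ltr_pdivrMr// mulrAC mulrC [ltRHS]mulrC ltr_pM2l// mulrC.
have s2 : 1 <= 2 * s by lra.
have p2 : 2 < p by apply: lt_le_trans qp; apply: lt_trans q4; rewrite ltr_nat.
have Mge (t : R) : m0 <= Mx t by exact: Mm.
have Mle (t1 t2 : R) : 0 <= t1 -> t1 <= t2 -> Mx t1 <= Mx t2.
  move=> t10; rewrite le_eqVlt => /predU1P[->//|t12].
  by rewrite !MxE// ?(le_trans t10 (ltW t12))// ltW// Mi.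
have M3' (t1 t2 : R) : 0 < t2 -> t2 <= t1 -> Mx t1 / t1 - Mx t2 / t2 <= m0 * (1 / t1 - 1 / t2).
  by move=> t20 t21; rewrite !MxE ?(ltW t20)// ?(le_trans (ltW t20) t21)//; exact: M3.
have S1 := scal_f cf fneg f1 qp f2 f3 a0.
have S2 := scal_ft cf fneg f1 q4 qp f3 f4 V00 K0 a0 fa.
exists (@Pdata R s V0 m0 (V0 / K) p A Mx Mh f (primitive f) (ftilde f V0 K a) (primitive (ftilde f V0 K a))
  s0 s1 s2 V00 kk km p2 LpA Mx_c Mge Mle M3' Mh0 Mh_d S1 S2 f4
  (f_oo cf fneg f1 qp f2 th4 f3 f4 a0) (ft_4 cf fneg f4 V00 K0 a0 fa)
  (ft_k cf fneg f4 V00 K0 a0 fa) (ft_f f4 V00 K0 a0 fa)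
  (Ft_F cf fneg f1 q4 qp f2 f3 f4 V00 K0 a0 fa)
  (F_4 cf fneg th4 f3) (Ft_4 cf fneg f1 q4 qp f2 th4 f3 f4 V00 K0 a0 fa)).
by split => // t t0; exact: MxE.
Qed.
End Data.

(** * Multiplicity *)

Section Bridge.
Variables (R : realType) (d : pdata R) (V : pt R -> R) (Om : set (pt R)) (eps K a V0 : R) (M f : R -> R).
Notation RR := (measurableTypeR R).
Notation T3 := (RR * RR * RR)%type.
Notation m3 := (mu3 R).
Notation m6 := (mu3 R \x mu3 R)%E.
Notation s := (ds d).
Hypotheses (cV : continuous V) (VdV : forall x, dV d <= V x) (oOm : open Om).
Hypotheses (ME : forall t, 0 <= t -> dM d t = M t) (fE : df d = f) (ftE' : dft d = ftilde f V0 K a).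
Notation W := (WV cV VdV eps).

Lemma in_Heps_inH u : in_Heps s eps V u -> inH s W u.
Proof.
move=> [mu [u2 [ug uV]]]; split.
- exact: mu.
- by apply: L1_fin u2 => [|x]; [exact: measurable_funX|exact: sqr_ge0].
- apply: L1_tonelli; [exact: m_gq|exact: gq_ge0|].
  suff -> : (\int[m3]_x \int[m3]_y (gq s u u (x, y))%:E = \int[@leb3 R]_x \int[@leb3 R]_y ((u x - u y) ^+ 2 / gag_kernel s x y)%:E)%E by [].
  by apply: eq_integral => x _; apply: eq_integral => y _; rewrite gqE.
- apply: L1_fin uV => [|x]; last by rewrite mulr_ge0 ?sqr_ge0// (wt_ge0 W).
  by apply: measurable_funM; [exact: (wt_m W)|exact: measurable_funX].
Qed.

Lemma inH_in_Heps u : inH s W u -> in_Heps s eps V u.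
Proof.
move=> [mu u2 ug uV]; split; first exact: mu.
split; first by apply: (@L1_finP _ _ _ m3) u2 => x; exact: sqr_ge0.
split; last first.
  by apply: (@L1_finP _ _ _ m3) uV => x; rewrite mulr_ge0 ?sqr_ge0// (wt_ge0 W).
have := L1_finP (@gq_ge0 R s u) ug.
rewrite fubini_tonelli1//; last 2 first.
- by apply: mEFin; exact: L1_meas ug.
- by move=> z; rewrite lee_fin gq_ge0.
Qed.

Lemma bilinE u phi : inH s W u -> inH s W phi -> bilin s eps V u phi = hform s W u phi.
Proof.
by move=> Hu Hp; rewrite /bilin /hform; have [_ <- _] := L1_fubini (L1_gq Hu Hp).
Qed.

Lemma energyE u : inH s W u -> energy s eps V u = NN W u.
Proof.
move=> Hu; rewrite /NN hformE /energy; have [_ <- _] := L1_fubini (inH_g Hu); congr (_ + _).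
Qed.

Lemma gtruncE x t : gtrunc Om f V0 K a (pscale eps x) t = gO d (OV Om eps) x t.
Proof.
rewrite /gtrunc /gO fE ftE'; suff -> : \1_Om (pscale eps x) = \1_(OV Om eps) x :> R by [].
by rewrite !indicE; congr (_%:R); congr nat_of_bool; apply/idP/idP; rewrite !inE.
Qed.

Lemma crit_weak (v : Hsp s W) : nm (@Hform R s (dV d) W) (DH (W := W) (m_OV oOm eps) v) = 0 ->
  (forall phi, inH s W phi -> dM d (NN W (val v)) * hform s W (val v) phi = psi d (OV Om eps) (val v) phi) /\
  weak_solution s eps M V (gtrunc Om f V0 K a) (val v).
Proof.
move=> Dv; have Hv := HspP v.
have E phi : inH s W phi -> dM d (NN W (val v)) * hform s W (val v) phi = psi d (OV Om eps) (val v) phi.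
  move=> Hp; apply/eqP; rewrite -subr_eq0; have := DHE (m_OV oOm eps) v (toH Hp).
  by rewrite (nm_eq0 (Hform_psd _ _) _ Dv) => <-.
split => //; split; first exact: inH_in_Heps.
move=> phi /in_Heps_inH Hp; rewrite (bilinE Hv Hp) (energyE Hv) -(ME (NN_ge0 W (val v))) (E phi Hp).
by apply: eq_Int => x; rewrite gtruncE.
Qed.

Lemma WV_bounded (r : R) : exists C : R, forall x : pt R, `|x| <= r -> W x <= C.
Proof.
have cW : continuous (fun x : pt R => V (pscale eps x)).
  by move=> x; apply: continuous_comp; [exact: pscale_cont|exact: (@cV _)].
have /compact_bounded[C [_ hC]] := continuous_compact (continuous_subspaceT cW) (@box_compact R r).
exists (C + 1) => x xr; apply: le_trans (ler_norm _) _.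
by apply: (hC (C + 1)); [rewrite ltrDl|exists x].
Qed.
End Bridge.

Section Counting.
Variables (R : realType) (d : pdata R) (V : pt R -> R) (Om : set (pt R)) (Rb delta : R).
Hypotheses (cV : continuous V) (VdV : forall x, dV d <= V x) (oOm : open Om).
Hypotheses (Rb0 : 0 < Rb) (OmR : forall x, Om x -> `|x| <= Rb) (bdV : forall x, closure Om x -> V x = dV d -> Om x).
Let Lm : set (pt R) := [set x | Om x /\ V x = dV d].
Variable X : set (pt R).
Hypotheses (delta0 : 0 < delta) (LmX : forall l z, Lm l -> `|z - l| <= delta -> X z).
Hypotheses (XOm : X `<=` Om) (Lm0 : Lm !=set0).
Notation W eps := (WV cV VdV eps).
Notation B eps := (@Hform R (ds d) (dV d) (W eps)).
Notation D eps := (DH (W := W eps) (m_OV oOm eps)).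

Lemma Lm_closed : closed Lm.
Proof.
have -> : Lm = closure Om `&` [set x | V x = dV d].
  by apply/seteqP; split => x [h1 h2]; split => //; [exact: subset_closure|exact: bdV].
apply: closedI; first exact: closed_closure.
have -> : [set x | V x = dV d] = V @^-1` [set dV d] by [].
by apply: preimage_closed; [move=> x _; exact: (@cV x)|exact: closed_eq].
Qed.

Lemma Lm_compact : compact Lm.
Proof.
apply: (subclosed_compact Lm_closed (@box_compact R Rb)) => x [Ox _]; exact: OmR.
Qed.

(** Critical points are collected one at a time. A list of fewer than [n] inequivalent ones that
    could not be extended would contain, up to null vectors, all those of the sublevel. Then
    [ls_cover] would cover [Lm] by as many sets as the list has elements at most, against the
    category bound. *)
Lemma multiplicity : exists2 epsb : R, 0 < epsb & forall eps : R, 0 < eps -> eps < epsb ->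
  forall n, cat_ge X Lm n -> exists vs : seq (Hsp (ds d) (W eps)),
  [/\ size vs = n, forall v, v \in vs -> isN (W eps) (OV Om eps) (val v) /\ nm (B eps) (D eps v) = 0 &
      pairwise (fun v w => nm (B eps) (v - w) != 0) vs].
Proof.
have [h [e1 [h0 _ e10 hloc]]] := localize cV VdV oOm Rb0 OmR bdV delta0.
have LmO l z : Lm l -> `|z - l| <= delta -> Om z by move=> Ll zl; apply: XOm; exact: LmX zl.
have h2 : 0 < h / 2 by exact: divr_gt0.
have [e2 e20 hphi] := phi_exists cV VdV oOm Rb0 OmR delta0 LmO Lm_compact h2 delta0.
exists (Num.min e1 e2); first by rewrite lt_min e10.
move=> eps eps0; rewrite lt_min => /andP[ee1 ee2] n hcat.
have [phi [cphi Nphi bphi]] := hphi eps eps0 ee2.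
pose mO := m_OV oOm eps; pose BP := Hform_psd (ds d) (W eps).
pose b := c0 d + h; pose beta (w : Hsp (ds d) (W eps)) := bary Rb eps (val w).
pose NL := nehari_le (B eps) (JH (OV Om eps)) (D eps) b.
have r0 := (rsmP d).1.
have Nr w : nehari (B eps) (D eps) w -> rsm d <= nm (B eps) w.
  by move=> /neh_isN Nw; have := isN_small mO Nw; rewrite nm_sqr ler_sqr ?nnegrE ?nm_ge0// ltW.
have Nb w : nehari (B eps) (D eps) w -> JH (OV Om eps) w <= b -> nm (B eps) w <= Num.sqrt (4 * `|b| / cc d) + 1.
  by move=> Nw Jw; exact: (ps_bound (mO := mO) (conj Nw Jw)).
have Jpos w : nehari (B eps) (D eps) w -> 0 < JH (OV Om eps) w.
  move=> /neh_isN Nw; apply: lt_le_trans (isN_J mO Nw).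
  by case: Nw => _ N0 _; rewrite mulr_gt0// divr_gt0// cc_gt0.
have OR (x : pt R) : OV Om eps x -> `|x| <= Rb / eps.
  by move=> /OmR; rewrite norm_pscale (gtr0_norm eps0) ler_pdivlMr// mulrC.
have PS := @palais_smale R d (W eps) _ _ mO OR b.
have betaX w : NL w -> X (beta w).
  move=> [/neh_isN Nw Jw]; have [l Ll bl] := hloc eps (val w) eps0 ee1 Nw Jw.
  exact: LmX Ll bl.
have bc w : NL w -> forall e : R, 0 < e -> exists2 eta : R, 0 < eta &
    forall w', nm (B eps) (w' - w) <= eta -> `|beta w' - beta w| <= e.
  move=> [/neh_isN Nw _] e e0.
  have [eta eta0 het] := bary_cont Rb0 eps (HspP w) (L2_pos mO Nw) e0.
  exists (Num.sqrt eta); first by rewrite sqrtr_gt0.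
  move=> w' ww; apply: het; first exact: HspP.
  have -> : NN (W eps) (fun x => val w' x - val w x) = nm (B eps) (w' - w) ^+ 2 by rewrite -nm_sqr valB.
  by rewrite -(sqr_sqrtr (ltW eta0)) ler_sqr ?nnegrE ?nm_ge0 ?sqrtr_ge0.
have beta_cont w : NL w -> forall e : R, 0 < e -> exists2 eta : R, 0 < eta &
    forall w', NL w' -> nm (B eps) (w' - w) <= eta -> `|beta w' - beta w| <= e.
  by move=> Nw e e0; have [eta eta0 het] := bc w Nw e e0; exists eta => // w' _; exact: het.
have lb : c0 d + h / 2 < b by rewrite ltrD2l ltr_pdivrMr// ltr_pMr// ltr1n.
have X0 : X !=set0 by have [l Ll] := Lm0; exists l; apply: LmX Ll _; rewrite subrr normr0 ltW.
have LX : Lm `<=` X by move=> l Ll; apply: LmX Ll _; rewrite subrr normr0 ltW.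
have Nphi' y : Lm y -> NL (phi y) /\ JH (OV Om eps) (phi y) <= c0 d + h / 2.
  by move=> /Nphi[N1 J1]; split => //; split => //; apply: le_trans J1 (ltW lb).
have hom : homotopic_in X Lm id (beta \o phi).
  pose g y := beta (phi y).
  have cg y : Lm y -> g @ within Lm (nbhs y) --> g y.
    move=> Ly; apply/cvgrPdist_le => e e0.
    have [eta eta0 het] := bc (phi y) (Nphi' y Ly).1 e e0.
    have hn : nbhs (y : pt R) (fun z => Lm z -> nm (B eps) (phi z - phi y) <= eta) := cphi y Ly eta eta0.
    by apply: filterS hn => z hz Lz; rewrite distrC; apply: het; exact: hz.
  (* Straight segments: the barycenter of [phi y] is within [delta] of [y], so by [LmX] they stay in
     [X]. *)
  exists (fun z => z.2 + z.1 *: (g z.2 - z.2)); split.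
  - apply/subspace_continuousP => -[t y] [It Ly] /=.
    have c1 : (fst : R * pt R -> R) @ within (`[0, 1]%classic `*` Lm) (nbhs (t, y)) --> t.
      by apply: cvg_within_filter; exact: cvg_fst.
    have c2 : (snd : R * pt R -> pt R) @ within (`[0, 1]%classic `*` Lm) (nbhs (t, y)) --> y.
      by apply: cvg_within_filter; exact: cvg_snd.
    have c3 : (g \o snd) @ within (`[0, 1]%classic `*` Lm) (nbhs (t, y)) --> g y.
      move=> P /(cg y Ly) hP; exists (setT, [set z | Lm z -> P (g z)]); first by split; [exact: filterT|exact: hP].
      by move=> [t' y'] [_ hz] [_ Lz]; exact: hz.
    apply: cvgD; [exact: c2|apply: cvgZ; [exact: c1|apply: cvgB; [exact: c3|exact: c2]]].
  - by move=> y Ly /=; rewrite scale0r addr0 scale1r addrC subrK.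
  - move=> t y; rewrite /= in_itv/= => /andP[t0 t1] Ly.
    apply: (LmX Ly); rewrite addrC addKr normrZ (ger0_norm t0).
    by apply: le_trans (bphi y Ly); rewrite ler_piMl.
pose good (vs : seq (Hsp (ds d) (W eps))) := (forall v, v \in vs -> NL v /\ nm (B eps) (D eps v) = 0) /\
  pairwise (fun v w => nm (B eps) (v - w) != 0) vs.
have step m : (m < n)%N -> (exists vs, size vs = m /\ good vs) -> exists vs, size vs = m.+1 /\ good vs.
  move=> mn [vs [sz [vsP vsd]]]; apply: contrapT => hn.
  have vs_crit w : NL w -> nm (B eps) (D eps w) = 0 -> exists2 v, v \in vs & nm (B eps) (w - v) = 0.
    move=> Nw Dw; apply: contrapT => hv; apply: hn; exists (w :: vs); split; first by rewrite /= sz.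
    split; first by move=> v; rewrite inE => /predU1P[->//|/vsP].
    rewrite /= vsd andbT; apply/allP => v vv; apply/eqP => E; by apply: hv; exists v.
  have := ls_cover BP (@DH_unif R d (W eps) _ mO) (@DH_ray R d (W eps) _ mO) (cc_gt0 d) r0 Nr Nb Jpos PS
    betaX beta_cont vsP vs_crit lb X0 Lm_closed LX cphi Nphi' hom.
  move=> /coverable_cat /(_ hcat); rewrite leqNgt => /negP; apply.
  by apply: leq_ltn_trans (count_size _ _) _; rewrite sz.
have all m : (m <= n)%N -> exists vs, size vs = m /\ good vs.
  elim: m => [|m IH] mn; first by exists [::]; split => //; split.
  by apply: step => //; apply: IH; exact: ltnW.
have [vs [sz [vsP vsd]]] := all n (leqnn n); exists vs; split => //.
by move=> v /vsP[[/neh_isN Nv _] Dv].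
Qed.
End Counting.

Lemma ae_imp d (T : measurableType d) (R : realType) (mu : {measure set T -> \bar R}) (P Q : T -> Prop) :
  (forall x, P x -> Q x) -> {ae mu, forall x, P x} -> {ae mu, forall x, Q x}.
Proof. by move=> PQ; apply: filterS. Qed.

(** The infimum of a set without lower bound is [0] by convention, so a positive [Vinf V] already
    forces [V] to be bounded below. *)
Lemma Vinf_le (R : realType) (V : pt R -> R) : 0 < Vinf V -> forall x, Vinf V <= V x.
Proof.
move=> V0 x; apply: ge_inf; last by exists x.
by apply: contrapT => h; move: V0; rewrite /Vinf inf_out ?ltxx// => -[].
Qed.

Lemma V2_domain_bd (R : realType) (V : pt R -> R) (delta : R) (Om : set (pt R)) x :
  V2_domain V delta Om -> closure Om x -> V x = Vinf V -> Om x.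
Proof.
move=> [[oOm _] [bd _]] cx Vx; apply: contrapT => Ox.
suff /bd : boundary Om x by rewrite Vx ltxx.
by split => //; apply: contra_not Ox; exact: interior_subset.
Qed.

(** The norm of [pt R] is the maximum norm, while [dist_to] uses the Euclidean one, which is at most
    twice as large; hence [delta / 2]. *)
Lemma Lam_delta_near (R : realType) (V : pt R -> R) (delta : R) (Om : set (pt R)) l z :
  Lam V Om l -> `|z - l| <= delta / 2 -> Lam_delta V Om delta z.
Proof.
move=> Ll zl; apply: (@le_trans _ _ (enorm (psub z l))); last first.
  by rewrite psubE; apply: le_trans (enorm_le _) _; rewrite mulrC -ler_pdivlMr.
apply: ge_inf; last by exists l.
by exists 0 => _ [y _ <-]; exact: enorm_ge0.
Qed.

(** Quantifying over every [n] with [cat_ge] expresses the count without naming the category and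
    makes sense even if no finite cover exists. The solutions are distinct modulo null sets. *)
Theorem theorem5p6 (R : realType) (s m0 q th K a delta : R) (M : R -> R)
    (V : pt R -> R) (f : R -> R) (Om : set (pt R)) :
  3 / 4 < s < 1 ->
  (* M *)
  {within `[0, +oo[, continuous M} ->
  (forall t, 0 <= t -> 0 <= M t) ->
  0 < m0 -> (forall t, 0 <= t -> m0 <= M t) ->
  (forall t1 t2, 0 <= t2 -> t2 < t1 -> M t2 < M t1) ->
  (forall t1 t2, 0 < t2 -> t2 <= t1 ->
     M t1 / t1 - M t2 / t2 <= m0 * (1 / t1 - 1 / t2)) ->
  (* V *)
  continuous V ->
  0 < Vinf V ->
  (forall d, 0 < d -> exists O, V2_domain V d O) ->
  (* f *)
  continuous f ->
  (forall t, t < 0 -> f t = 0) ->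
  (f t / t ^+ 3 @[t --> 0^'+] --> 0) ->
  4 < q < 6 / (3 - 2 * s) ->
  (f t / t `^ (q - 1) @[t --> +oo] --> 0) ->
  4 < th < 6 / (3 - 2 * s) ->
  (forall t, 0 < t -> 0 < th * primitive f t /\ th * primitive f t <= f t * t) ->
  (forall t1 t2, 0 < t1 -> t1 <= t2 -> f t1 / t1 ^+ 3 <= f t2 / t2 ^+ 3) ->
  (* truncation *)
  2 / m0 < K -> 0 < a -> f a = Vinf V * a / K ->
  (* the domain given by (V_2) for delta *)
  0 < delta -> V2_domain V delta Om ->
  exists epsb : R, 0 < epsb /\
    forall eps, 0 < eps < epsb ->
    forall n : nat, cat_ge (Lam_delta V Om delta) (Lam V Om) n ->
    exists us : 'I_n -> pt R -> R,
      (forall i, weak_solution s eps M V (gtrunc Om f (Vinf V) K a) (us i) /\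
                 {ae @leb3 R, forall x, 0 < us i x}) /\
      (forall i j, i <> j -> ~ {ae @leb3 R, forall x, us i x = us j x}).
Proof.
move=> /andP[s34 s1] cM _ m00 Mm Mi M3 cV V0 _ cf fneg f1 /andP[q4 q6] f2 /andP[th4 _] f3 f4 mK a0 fa delta0 hOm.
have [d [dsE dVE ME fE ftE]] :=
  build_pdata s34 s1 cM m00 Mm Mi M3 V0 cf fneg f1 q4 q6 f2 th4 f3 f4 mK a0 fa.
have VdV x : dV d <= V x by rewrite dVE; exact: Vinf_le.
have [[oOm [_ [_ [[r OmR] _]]]] [_ [Lm0 XOm]]] := hOm.
have Rb0 : 0 < `|r| + 1 by rewrite ltr_pwDr.
have OmR' x : Om x -> `|x| <= `|r| + 1.
  move=> /OmR xr; apply: le_trans (le_enorm x) (le_trans xr _).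
  by apply: le_trans (ler_norm r) _; rewrite lerDl.
have bdV x : closure Om x -> V x = dV d -> Om x by rewrite dVE; exact: V2_domain_bd hOm.
have LmE : [set x | Om x /\ V x = dV d] = Lam V Om by rewrite dVE.
have LmX l z : [set x | Om x /\ V x = dV d] l -> `|z - l| <= delta / 2 -> Lam_delta V Om delta z.
  by rewrite LmE; exact: Lam_delta_near.
have Lm0' : [set x | Om x /\ V x = dV d] !=set0 by rewrite LmE.
have d2 : 0 < delta / 2 by exact: divr_gt0.
have [epsb epsb0 hm] := multiplicity cV VdV oOm Rb0 OmR' bdV d2 LmX XOm Lm0'.
exists epsb; split => // eps /andP[e0 e1] n; rewrite -LmE => /(hm eps e0 e1)[vs [sz vsP vsd]].
have lt_sz (i : 'I_n) : (i < size vs)%N by rewrite sz.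
exists (fun i => val (nth 0 vs i)); split => [i|i j].
  have [[Hv Nv _] Dv] := vsP _ (mem_nth 0 (lt_sz i)).
  have [E wsol] := crit_weak ME fE ftE Dv.
  split; first by rewrite -dsE.
  have pos := crit_pos (WV_bounded eps cV VdV) Hv Nv E.
  exact: (ae_leb3 pos).
move=> ij E.
suff key (k l : 'I_n) : (k < l)%N -> {ae mu3 R, forall x, val (nth 0 vs k) x = val (nth 0 vs l) x} -> False.
  have [kl|kl|/val_inj//] := ltngtP i j; first exact: key kl E.
  have E3 : {ae mu3 R, forall x, val (nth 0 vs i) x = val (nth 0 vs j) x} := E.
  by apply: (key j i kl); apply: ae_imp E3 => x ->.
move=> kl Ekl; have /(pairwiseP 0) /(_ k l (lt_sz k) (lt_sz l) kl) := vsd.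
rewrite nm_NN NN_ae0 ?sqrtr0 ?eqxx//; first exact: HspP.
by apply: ae_imp Ekl => x xE; rewrite valB xE subrr.
Qed.
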